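(* Let $X$ be a smooth projective geometrically irreducible curve over $\mathbb{F}_q$ with function field $F$ and genus $g_X$, let $x$ be a place of $F$ (closed point of $X$) of degree $d_x$, let $h_X=\#\mathrm{Cl}^0X$ be the class number and $m_X=\max\{2g_X-2,0\}$. Let $\mathcal{G}_x$, its nucleus $\mathcal{N}_x$ and its cusps $\mathcal{C}_x(D)$ be as defined in the context. Then: (1) $\mathcal{G}_x$ has $h_Xd_x$ cusps and $$\mathcal{G}_x=\mathcal{N}_x\cup\coprod_{[D]\in\mathrm{Cl}\,\mathcal{O}_F^x}\mathcal{C}_x(D),$$ where $\mathrm{Vert}\,\mathcal{N}_x\cap\mathrm{Vert}\,\mathcal{C}_x(D)=\{c_D\}$ if $m_X<\deg D\le m_X+d_x$. The union of the edges is disjoint. Different cusps are disjoint subgraphs. (2) $\mathcal{N}_x$ is finite and has $\#\bigl(\mathrm{Cl}\,\mathcal{O}_F^x/2\,\mathrm{Cl}\,\mathcal{O}_F^x\bigr)$ components. Each vertex of $\mathcal{N}_x$ is at distance $\le(2g_X+m_X+d_x)/d_x$ from some cusp. The associated CW-complexes of $\mathcal{N}_x$ and $\mathcal{G}_x$ are homotopy equivalent. (3) If $[D]\in\mathrm{Cl}\,\mathcal{O}_F^x$, then $\mathrm{Vert}\,\mathcal{C}_x(D)\subset\mathbb{P}\mathrm{Bun}_2^{\rm dec}X$. Furthermore $$\mathbb{P}\mathrm{Bun}_2^{\rm dec}X\subset\{v\in\mathrm{Vert}\,\mathcal{G}_x\mid\delta(v)\ge0\},$$ $$\mathbb{P}\mathrm{Bun}_2^{\rm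 gi}X\subset\{v\in\mathrm{Vert}\,\mathcal{G}_x\mid\delta(v)\le2g_X-2\},$$ $$\mathbb{P}\mathrm{Bun}_2^{\rm tr}X\subset\{v\in\mathrm{Vert}\,\mathcal{G}_x\mid\delta(v)<0\text{ and }\delta(v)\text{ even}\}.$$
   Context: $\mathrm{Bun}_2X$ is the set of isomorphism classes of rank $2$ vector bundles on $X$; $\mathrm{Pic}\,X$ acts on it by tensor product, and $\mathbb{P}\mathrm{Bun}_2X=\mathrm{Bun}_2X/\mathrm{Pic}\,X$. Write $\mathcal{M}\sim\mathcal{M}'$ if $\mathcal{M}'\simeq\mathcal{M}\otimes\mathcal{L}$ for some line bundle $\mathcal{L}$, and $[\mathcal{M}]$ for the class of $\mathcal{M}$. $\mathrm{Cl}\,X$ is the divisor class group, $\mathrm{Cl}^0X$ its degree $0$ part, $\mathcal{L}_D$ the line bundle associated to a divisor $D$, and $c_D=[\mathcal{L}_D\oplus\mathcal{O}_X]$. $\mathrm{Cl}\,\mathcal{O}_F^x=\mathrm{Cl}\,X/\langle x\rangle$ is the class group of the ring $\mathcal{O}_F^x$ of elements of $F$ that are regular away from $x$. Let $\mathcal{K}_x$ be the torsion sheaf supported at $x$ whose stalk at $x$ is the residue field of $x$. The graph $\mathcal{G}_x$ (the graph of the unramified Hecke operator $\Phi_x$ on $\mathrm{PGL}_2$, in its geometric description) has vertex set $\mathrm{Vert}\,\mathcal{G}_x=\mathbb{P}\mathrm{Bun}_2X$ and weighted oriented edges the triples $([\mathcal{M}],[\mathcal{M}'],m)$ with $m=m_x([\mathcal{M}],[\mathcal{M}'])\neq0$,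 where $m_x([\mathcal{M}],[\mathcal{M}'])$ is the number of subsheaves $\mathcal{M}''\subset\mathcal{M}$ with $\mathcal{M}/\mathcal{M}''\simeq\mathcal{K}_x$ and $\mathcal{M}''\sim\mathcal{M}'$ (this is independent of the representative $\mathcal{M}$). If there is an edge from $v$ to $w$, there is also one from $w$ to $v$. The associated CW-complex is that of the underlying graph with weights suppressed, an edge and its inverse edge giving one $1$-cell; components and distance refer to this underlying graph. A line subbundle of $\mathcal{M}$ is an injective morphism $\mathcal{L}\to\mathcal{M}$ from a line bundle whose cokernel is locally free. For a line subbundle of a rank $2$ bundle, $\delta(\mathcal{L},\mathcal{M})=2\deg\mathcal{L}-\deg\mathcal{M}$, and $\delta(\mathcal{M})=\sup\delta(\mathcal{L},\mathcal{M})$ over all line subbundles; $\delta([\mathcal{M}])=\delta(\mathcal{M})$ is well defined. The nucleus $\mathcal{N}_x$ is the full subgraph of $\mathcal{G}_x$ with vertices $\{[\mathcal{M}]\in\mathbb{P}\mathrm{Bun}_2X\mid\delta(\mathcal{M})\le m_X+d_x\}$. For a divisor $D$ representing a class $[D]\in\mathrm{Cl}\,\mathcal{O}_F^x$, the cusp $\mathcal{C}_x(D)$ is the full subgraph of $\mathcal{G}_x$ with vertices $\{c_{D'}\mid [D']\equiv[D]\bmod\langle x\rangle,\ \deg D'>m_X\}$. $\mathbb{P}\mathrm{Bun}_2^{\rm dec}X$ is the set of classes of bundles that are direct sums of two line bundles; $\mathbb{P}\mathrm{Bun}_2^{\rm gi}X$ the set of classes of geometrically indecomposable bundles (indecomposable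 after pullback to $X\otimes\overline{\mathbb{F}}_q$); $\mathbb{P}\mathrm{Bun}_2^{\rm tr}X$ the set of classes of bundles that are indecomposable but not geometrically indecomposable.
   Formalization: ''The union of the edges is disjoint'' is proved up to loops: edge sets of different cusps are disjoint, and an edge common to the nucleus and a cusp is a loop at their common vertex; such loops occur, e.g. at the class of O(1)+O on the projective line with d_x = 2, so the literal claim fails there. *)

(* Defs.v *)
From HB Require Import structures.
From mathcomp Require Import all_boot all_order all_algebra.
From mathcomp Require Import finmap.
From mathcomp Require Import all_classical all_reals all_analysis.
Set Implicit Arguments.
Unset Strict Implicit.
Unset Printing Implicit Defensive.
Import Order.TTheory GRing.Theory Num.Theory.
Import numFieldNormedType.Exports.
Local Open Scope classical_set_scope.
Local Open Scope ring_scope.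

(** * Curves

    A regular projective integral curve over k is presented as the abstract
    nonsingular curve of its function field (Hartshorne, I.6): its closed points
    are the discrete valuation rings of the function field over k, its nonempty
    open sets are the sets with finite complement (always understood to contain
    the generic point), and O_X(U) is the intersection of the valuation rings of
    the points of U. *)

(* Finitely generated of transcendence degree 1: finite over some k(t) with t
   transcendental over k. *)
Definition function_field (k F : fieldType) (i : {rmorphism k -> F}) : Prop :=
  exists t : F, ~ algebraicOver i t /\
  exists (n : nat) (b : 'I_n -> F), forall f : F, exists c : 'I_n -> F,
    (forall j, exists p q : {poly k},
       q != 0 /\ c j = (map_poly i p).[t] / (map_poly i q).[t]) /\
    f = \sum_j c j * b j.

Record curve (k : fieldType) := Curve {
  funfield : fieldType;
  const : {rmorphism k -> funfield};
  curveP : function_field const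
}.

(* Normalized discrete valuations of the function field that are trivial on k.
   The value at 0 is the convention ord 0 = 0, so that [0 <= ord f] says that f
   lies in the valuation ring, for every f. *)
Record place (k : fieldType) (X : curve k) := Place {
  ord : funfield X -> int;
  ord0 : ord 0 = 0;
  ordM : forall f g, f != 0 -> g != 0 -> ord (f * g) = ord f + ord g;
  ordD : forall f g, f != 0 -> g != 0 -> f + g != 0 ->
    Num.min (ord f) (ord g) <= ord (f + g);
  ord_const : forall c : k, ord (const X c) = 0;
  ord_surj : exists f, ord f = 1
}.

HB.instance Definition _ k (X : curve k) := gen_eqMixin (place X).
HB.instance Definition _ k (X : curve k) := gen_choiceMixin (place X).

(* [quotient_dim s A B d]: the k-space A / B has dimension d, where s is the
   scalar multiplication of V and B is a subspace of A. *)
Definition quotient_dim (k : fieldType) (V : zmodType) (s : k -> V -> V)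
    (A B : set V) (d : nat) : Prop :=
  exists2 e : 'I_d -> V, (forall i, A (e i)) &
    forall a, A a -> exists! c : {ffun 'I_d -> k}, B (a - \sum_i s (c i) (e i)).

Section Bundles.
Variables (k : fieldType) (X : curve k).
Local Notation F := (funfield X).
Local Notation place := (place X).

Definition regular (v : place) : set F := [set f | 0 <= ord v f].
Definition maximal_ideal (v : place) : set F := [set f | f = 0 \/ 0 < ord v f].

(* [U] is a Zariski neighbourhood of [v]. *)
Definition nbhd (v : place) (U : set place) : Prop := finite_set (~` U) /\ U v.

(* The degree of the residue field over k. *)
Definition pdeg (v : place) : nat :=
  xget 0%N [set d | quotient_dim (fun c f => const X c * f)
                      (regular v) (maximal_ideal v) d].

(* The dimension of H^1(X, O_X), computed by the flasque resolution
   0 -> O_X -> F -> F / O_X -> 0, that is, as the quotient of the ring of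
   repartitions by the sum of F and the ring of integral repartitions. *)
Definition genus : nat :=
  xget 0%N [set g | quotient_dim (V := place -> F)
    (fun c a v => const X c * a v)
    [set a | finite_set [set v | ~ regular v (a v)]]
    [set a | exists f : F, forall v, regular v (a v - f)] g].

(** * Vector bundles

    Every bundle of rank n embeds in the constant sheaf of its generic stalk,
    which is isomorphic to F^n.  So bundles are taken to be locally free
    subsheaves of rank n of the constant sheaf F^n of row vectors.  A subsheaf is
    given by its stalks at the closed points, sections over U being the
    intersection of the stalks at the points of U.  Morphisms of O_X-modules
    between such bundles are the matrices over F that map stalks into stalks. *)
Definition sheaf (n : nat) := place -> set 'rV[F]_n.

(* The O_v-submodule of F^n generated by S. *)
Definition ospan (v : place) n (S : set 'rV[F]_n) : set 'rV[F]_n :=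
  [set z | exists m (a : 'I_m -> F) (u : 'I_m -> 'rV[F]_n),
     [/\ forall i, regular v (a i), forall i, S (u i) & z = \sum_i a i *: u i]].

(* The free O_v-module on the rows of B. *)
Definition lattice (v : place) n (B : 'M[F]_n) : set 'rV[F]_n :=
  [set c *m B | c in [set c : 'rV[F]_n | forall j, regular v (c 0 j)]].

Definition bundle n : set (sheaf n) :=
  [set E | forall v, exists (U : set place) (B : 'M[F]_n),
     [/\ nbhd v U, B \in unitmx & forall w, U w -> E w = lattice w B]].

Definition iso n (E E' : sheaf n) : Prop :=
  exists2 A : 'M[F]_n, A \in unitmx & forall v, E' v = [set u *m A | u in E v].

Definition tensor (L : sheaf 1) n (E : sheaf n) : sheaf n :=
  fun v => ospan v [set z | exists l u, [/\ L v l, E v u & z = l 0 0 *: u]].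

Definition dsum m n (E : sheaf m) (E' : sheaf n) : sheaf (m + n) :=
  fun v => [set z | exists u u', [/\ E v u, E' v u' & z = row_mx u u']].

(* The degree of a bundle is that of its determinant, whose stalk at v is
   generated by the determinant of any basis of the stalk of E.  The sign is
   fixed by deg O(D) = deg D, where the stalk of O(D) at v is generated by an
   element of order - D v. *)
Definition ord_det n (E : sheaf n) (v : place) : int :=
  xget 0 [set a | exists B : 'M[F]_n,
    [/\ B \in unitmx, E v = lattice v B & a = ord v (\det B)]].

Definition deg n (E : sheaf n) : int :=
  - \sum_(v \in setT) (pdeg v)%:Z * ord_det E v.

(* The cokernel of A : L -> M is Zariski-locally free; over a neighbourhood, the
   class of e is a basis of it. *)
Definition line_subbundle (L : sheaf 1) (M : sheaf 2) : Prop :=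
  bundle L /\ exists A : 'M[F]_(1, 2),
  [/\ row_free A,
      forall v l, L v l -> M v (l *m A) &
      forall v, exists (U : set place) (e : 'rV[F]_2), nbhd v U /\
        forall w, U w -> M w e /\
          forall u, M w u -> exists! a : F,
            regular w a /\ exists2 l, L w l & u = l *m A + a *: e].

Definition deltaL (L : sheaf 1) (M : sheaf 2) : int := 2 * deg L - deg M.

Definition delta (M : sheaf 2) : int :=
  supremum 0 [set deltaL L M | L in [set L | line_subbundle L M]].

Definition decomposable (M : sheaf 2) : Prop :=
  exists L L' : sheaf 1, [/\ bundle L, bundle L' & iso (dsum L L') M].

(* N is a subsheaf of E with E / N isomorphic to the skyscraper sheaf K_x; at x
   the isomorphism is induced by the map O_x -> E_x / N_x sending 1 to the class
   of e. *)
Definition skyscraper_quotient (x : place) n (E N : sheaf n) : Prop :=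
  [/\ forall v, N v `<=` E v,
      forall v, v != x -> N v = E v &
      exists2 e, E x e &
        (forall u, E x u -> exists2 a, regular x a & N x (u - a *: e)) /\
        (forall a, regular x a -> (N x (a *: e) <-> maximal_ideal x a))].

(** * Projective classes of rank 2 bundles *)

Definition proj_equiv (M M' : sheaf 2) : Prop :=
  exists2 L : sheaf 1, bundle L & iso (tensor L M) M'.

Definition pclass (M : sheaf 2) : set (sheaf 2) :=
  [set M' | bundle M' /\ proj_equiv M M'].

Definition PBun2_where (P : sheaf 2 -> Prop) : set (set (sheaf 2)) :=
  [set pclass M | M in [set M | bundle M /\ P M]].

Definition PBun2 : set (set (sheaf 2)) := PBun2_where (fun=> True).

Definition PBun2_dec : set (set (sheaf 2)) := PBun2_where decomposable.

(** * Divisors *)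

Definition divisor : set (place -> int) :=
  [set D | finite_set [set v | D v != 0]].

Definition div_deg (D : place -> int) : int :=
  \sum_(v \in setT) (pdeg v)%:Z * D v.

Definition principal (f : F) : place -> int := fun v => ord v f.

Definition point (x : place) : place -> int := fun v => (v == x)%:R.

Definition lin_class (D : place -> int) : set (place -> int) :=
  [set D' | exists2 f, f != 0 & D' = D + principal f].

Definition Cl0 : set (set (place -> int)) :=
  [set lin_class D | D in [set D | divisor D /\ div_deg D = 0]].

Definition class_number : nat := #|` fset_set Cl0|.

(* The class of D in Cl X / <x>. *)
Definition xclass (x : place) (D : place -> int) : set (place -> int) :=
  [set D' | exists f n, f != 0 /\ D' = D + principal f + point x *~ n].

Definition ClO (x : place) : set (set (place -> int)) :=
  [set xclass x D | D in divisor].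

(* The class of D in (Cl X / <x>) / 2 (Cl X / <x>). *)
Definition xclass2 (x : place) (D : place -> int) : set (place -> int) :=
  [set D' | exists2 E, divisor E & xclass x (D + E *+ 2) D'].

Definition ClO_mod2 (x : place) : set (set (place -> int)) :=
  [set xclass2 x D | D in divisor].

Definition line_bundle (D : place -> int) : sheaf 1 :=
  fun v => [set u | u 0 0 = 0 \/ - D v <= ord v (u 0 0)].

(* [line_bundle 0] is the structure sheaf. *)
Definition cvert (D : place -> int) : set (sheaf 2) :=
  pclass (dsum (line_bundle D) (line_bundle 0)).

End Bundles.

Arguments bundle {k X} n.
Arguments divisor {k} X.
Arguments PBun2 {k} X.
Arguments PBun2_dec {k} X.

(** * Base change to the algebraic closure *)

(* An integral model of the base change of X to an algebraic closure of k.  The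
   last two fields say that the natural map from the tensor product over k of
   the function field of X and the algebraic closure to the function field of
   [fibre] is surjective and injective, respectively. *)
Record geometric_fibre (k : fieldType) (X : curve k) := GeometricFibre {
  kbar : closedFieldType;
  kbar_emb : {rmorphism k -> kbar};
  kbar_alg : forall z, algebraicOver kbar_emb z;
  fibre : curve kbar;
  to_fibre : {rmorphism funfield X -> funfield fibre};
  to_fibre_const : forall c, to_fibre (const X c) = const fibre (kbar_emb c);
  fibre_gen : forall z, exists n (a : 'I_n -> funfield X) (b : 'I_n -> kbar),
    z = \sum_i to_fibre (a i) * const fibre (b i);
  fibre_free : forall n (a : 'I_n -> funfield X),
    (forall c : 'I_n -> k, \sum_i a i * const X (c i) = 0 ->
       forall i, c i = 0) ->
    forall b : 'I_n -> kbar, \sum_i to_fibre (a i) * const fibre (b i) = 0 ->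
       forall i, b i = 0
}.

(* The base change of X to the algebraic closure is integral. *)
Definition geometrically_irreducible (k : fieldType) (X : curve k) : Prop :=
  inhabited (geometric_fibre X).

Section Pullback.
Variables (k : fieldType) (X : curve k) (Y : geometric_fibre X).

Definition lies_over (w : place (fibre Y)) (v : place X) : Prop :=
  forall f, regular w (to_fibre Y f) <-> regular v f.

Definition pullback n (E : sheaf X n) : sheaf (fibre Y) n :=
  fun w => [set z | exists2 v, lies_over w v &
              ospan w [set map_mx (to_fibre Y) u | u in E v] z].

End Pullback.

Arguments pullback {k X} Y {n} E.

Definition geom_indecomposable (k : fieldType) (X : curve k) (M : sheaf X 2) :=
  forall Y : geometric_fibre X, ~ decomposable (pullback Y M).

Definition PBun2_gi (k : fieldType) (X : curve k) : set (set (sheaf X 2)) :=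
  PBun2_where (@geom_indecomposable k X).

Definition PBun2_tr (k : fieldType) (X : curve k) : set (set (sheaf X 2)) :=
  PBun2_where (fun M => ~ decomposable M /\ ~ geom_indecomposable M).

Arguments PBun2_gi {k} X.
Arguments PBun2_tr {k} X.

(** * Weighted graphs and their underlying graphs *)

Record graph (T : Type) := Graph {
  vert : set T;
  edge : set (T * T * nat)
}.

Definition full_subgraph T (G : graph T) (V : set T) : graph T :=
  Graph (vert G `&` V) (edge G `&` [set e | V e.1.1 /\ V e.1.2]).

Section UnderlyingGraph.
Variables (T : Type) (G : graph T).

Definition adj (v w : T) : Prop := exists m, edge G (v, w, m) \/ edge G (w, v, m).

Definition walk (n : nat) (v w : T) : Prop :=
  exists p : nat -> T, [/\ p 0%N = v, p n = w, forall i, (i <= n)%N -> vert G (p i) &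
    forall i, (i < n)%N -> adj (p i) (p i.+1)].

Definition component (v : T) : set T := [set w | exists n, walk n v w].

Definition components : set (set T) := [set component v | v in vert G].

End UnderlyingGraph.

(** * Geometric realization *)

Section Realization.
Variables (R : realType) (T : Type) (G : graph T).

Definition vertex := {v : T | vert G v}.

(* A 1-cell for each unordered pair of adjacent vertices, possibly equal. *)
Definition cell := {e : set vertex |
  exists v w, adj G (sval v) (sval w) /\ e = [set v; w]}.

(* The choice of the order of the end points is immaterial. *)
Definition source (c : cell) : vertex := projT1 (cid (svalP c)).
Definition target (c : cell) : vertex := projT1 (cid (projT2 (cid (svalP c)))).

(* The points are the vertices and the points of the open 1-cells. *)
Definition realization : Type := vertex + cell * {t : R | 0 < t < 1}.

(* Only the values of this characteristic map on [0, 1] matter. *)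
Definition attach (c : cell) (t : R) : realization :=
  match pselect (0 < t < 1) with
  | left h => inr (c, exist _ t h)
  | right _ => inl (if t <= 0 then source c else target c)
  end.

(* The CW topology. *)
Definition realization_open (U : set realization) : Prop :=
  forall c, open (attach c @^-1` U : set (subspace `[0%R, 1%R])).

HB.instance Definition _ := gen_eqMixin realization.
HB.instance Definition _ := gen_choiceMixin realization.

Lemma realization_openT : realization_open setT.
Proof. by move=> c; rewrite preimage_setT; exact: openT. Qed.

Lemma realization_openI : setI_closed realization_open.
Proof. by move=> U V oU oV c; rewrite preimage_setI; exact: openI. Qed.

Lemma realization_open_bigU (I : Type) (f : I -> set realization) :
  (forall i, realization_open (f i)) -> realization_open (\bigcup_i f i).
Proof.
by move=> of_ c; rewrite preimage_bigcup; apply: bigcup_open => i _; exact: of_.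
Qed.

HB.instance Definition _ := isOpenTopological.Build realization
  realization_openT realization_openI realization_open_bigU.

End Realization.

Definition homotopic (R : realType) (A B : topologicalType) (f g : A -> B) :=
  exists H : R * A -> B,
    [/\ {within [set z | `[0%R, 1%R]%classic z.1], continuous H},
        forall a, H (0, a) = f a & forall a, H (1, a) = g a].

Definition homotopy_equivalent (R : realType) (A B : topologicalType) : Prop :=
  exists (f : A -> B) (g : B -> A),
    [/\ continuous f, continuous g, homotopic R (g \o f) id & homotopic R (f \o g) id].

(** * The graph of the Hecke operator, its nucleus and its cusps *)

Section HeckeGraph.
Variables (k : fieldType) (X : curve k) (x : place X).

Definition multiplicity (M M' : sheaf X 2) : nat :=
  #|` fset_set [set N | [/\ bundle 2 N, skyscraper_quotient x M N & proj_equiv N M']]|.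

Definition hecke_graph : graph (set (sheaf X 2)) :=
  Graph (PBun2 X)
    [set e | exists M M', [/\ bundle 2 M, bundle 2 M', multiplicity M M' <> 0%N &
                              e = (pclass M, pclass M', multiplicity M M')]].

Definition mX : int := Num.max (2 * (genus X)%:Z - 2) 0.

Definition nucleus : graph (set (sheaf X 2)) :=
  full_subgraph hecke_graph (PBun2_where (fun M => delta M <= mX + (pdeg x)%:Z)).

(* The cusp of the class C in Cl X / <x>. *)
Definition cusp (C : set (place X -> int)) : graph (set (sheaf X 2)) :=
  full_subgraph hecke_graph
    [set cvert D | D in [set D | [/\ divisor X D, C D & mX < div_deg D]]].

Definition cusps : set (graph (set (sheaf X 2))) := [set cusp C | C in ClO x].

End HeckeGraph.

Arguments mX {k} X.

(* Main.v *)
(** A bundle M of rank 2 with a vector e of its generic stalk is an extension of O(D') by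
    O(D), where D records the multiples of e that are sections of M. It splits when
    deg D - deg D' > 2g - 2, since then H^1(X, O(D - D')) = 0 by Riemann-Roch; so a class with
    delta > m_X is some c_D, determined by the class of D. A Hecke modification at x replaces D
    by D or D - x and the determinant by its twist by -x. Hence c_D with deg D > m_X + d_x has
    the two neighbours c_{D + x} and c_{D - x} only, and the cusps are rays attached to the
    nucleus at c_D with m_X < deg D <= m_X + d_x. Lowering D' by x repeatedly leads from any
    bundle to a cusp, and delta >= -2g by Riemann's theorem, whence the bound on the distance
    and, the graph being locally finite, the finiteness of the nucleus.

    The class of the determinant in Cl O_F^x / 2 Cl O_F^x is constant on components. Conversely,
    bundles that differ at x only are connected, because an inclusion of lattices at x is refined
    to a chain of Hecke modifications, and diag(t, 1/t) is a product of elementary matrices, which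
    strong approximation makes global up to poles at x; so c_D and c_{D + 2y} are connected.

    A decomposable pullback carries an idempotent endomorphism. Descending the coefficients of its
    expansion along a k-basis of the algebraic closure gives an endomorphism of M itself with
    nonzero discriminant. Its characteristic polynomial has coefficients in k; if it is reducible
    then M splits, and if not then O(D) + phi O(D) in M forces delta < 0, the index of this
    subsheaf being supported at places of even degree.

    The count of cusps needs a divisor of degree 1 (F. K. Schmidt). If a prime l divides the
    degrees of all places, then each of them splits in the constant field extension of degree l,
    and pairs of effective divisors of X give more effective divisors upstairs than the
    finiteness of the class group permits. *)

Require Import Defs.
From HB Require Import structures.
From mathcomp Require Import all_boot all_order all_algebra.
From mathcomp Require Import finmap finfield pgroup.
From mathcomp Require Import all_classical all_reals all_analysis.
From mathcomp Require Import zify ring lra.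
Set Implicit Arguments.
Unset Strict Implicit.
Unset Printing Implicit Defensive.
Import Order.TTheory GRing.Theory Num.Theory.
Import numFieldNormedType.Exports.
Local Open Scope classical_set_scope.
Local Open Scope card_scope.
Local Open Scope ring_scope.

(** * Dimensions of quotient spaces *)

(** Since a curve is given by its places alone, points must be produced first: a subring maximal
    among those containing k and f but not 1/f is a valuation ring, and it is discrete because
    [F : k(f)] is finite. The same degree controls principal divisors and yields Riemann's theorem.
    Vanishing of H^1 above degree 2g - 2 is reached without a canonical divisor: a nonzero form on
    the adeles killing W(D) + F may be multiplied by all of L(E), and for large E this outgrows
    Riemann-Roch. Geometric irreducibility enters through linear disjointness: it makes k the field
    of constants, and it makes the map 1 (x) Frobenius on the function field of the fibre well
    defined. That automorphism replaces Galois descent, both for endomorphisms and for constant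
    field extensions. An idempotent upstairs is only a combination of endomorphisms of M; the
    discriminant serves to pick a useful one because it is a quadratic form, which remains valid in
    characteristic 2. *)

Definition scaling (k : fieldType) (V : zmodType) (s : k -> V -> V) :=
  [/\ forall u, s 1 u = u, forall a b u, s a (s b u) = s (a * b) u,
      forall a b u, s (a + b) u = s a u + s b u &
      forall a u v, s a (u + v) = s a u + s a v].

Definition subsp (k : fieldType) (V : zmodType) (s : k -> V -> V) (A : set V) :=
  [/\ A 0, forall u v, A u -> A v -> A (u + v) & forall c u, A u -> A (s c u)].

Definition indep (k : fieldType) (V : zmodType) (s : k -> V -> V) (B : set V)
    m (u : 'I_m -> V) :=
  forall c : 'I_m -> k, B (\sum_i s (c i) (u i)) -> forall i, c i = 0.

Section QuotientDim.
Variables (k : fieldType) (V : zmodType) (s : k -> V -> V).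
Hypothesis sc : scaling s.
Implicit Types A B C : set V.

Lemma sc0r a : s a 0 = 0.
Proof. by case: sc => _ _ _ sD; apply: (addrI (s a 0)); rewrite -sD !addr0. Qed.

Lemma sc0l u : s 0 u = 0.
Proof. by case: sc => _ _ sD _; apply: (addrI (s 0 u)); rewrite -sD !addr0. Qed.

Lemma scN1 u : s (-1) u = - u.
Proof.
case: sc => s1 _ sD _; apply: (addrI u).
by rewrite -{1}[u]s1 -sD !subrr sc0l.
Qed.

Lemma scB a u v : s a (u - v) = s a u - s a v.
Proof.
case: sc => s1 sA sD sDr; rewrite sDr; congr (_ + _).
by rewrite -!scN1 !sA mulrN1 mulN1r.
Qed.

Lemma sc_sum a n (f : 'I_n -> V) : s a (\sum_i f i) = \sum_i s a (f i).
Proof.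
case: sc => _ _ _ sDr.
by apply: (big_morph (s a)) => [u v|]; rewrite ?sDr ?sc0r.
Qed.

Lemma sc_suml u n (f : 'I_n -> k) : s (\sum_i f i) u = \sum_i s (f i) u.
Proof.
case: sc => _ _ sD _.
by apply: (big_morph (fun a => s a u)) => [a b|]; rewrite ?sD ?sc0l.
Qed.

Lemma subspN A u : subsp s A -> A u -> A (- u).
Proof. by case=> _ _ As Au; rewrite -scN1; apply: As. Qed.

Lemma subspB A u v : subsp s A -> A u -> A v -> A (u - v).
Proof. by move=> sA Au Av; case: (sA) => _ AD _; apply: AD => //; apply: subspN. Qed.

Lemma subsp_sum A n (f : 'I_n -> V) : subsp s A -> (forall i, A (f i)) -> A (\sum_i f i).
Proof. by case=> A0 AD _ Af; elim/big_ind : _. Qed.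

Lemma lin_sum A n (c : 'I_n -> k) (f : 'I_n -> V) : subsp s A -> (forall i, A (f i)) ->
  A (\sum_i s (c i) (f i)).
Proof. by move=> sA Af; apply: subsp_sum => // i; case: sA => _ _; apply. Qed.

Lemma subsp0 : subsp s [set 0].
Proof. by split=> //= [u v -> ->|c u ->]; rewrite ?addr0 ?sc0r. Qed.

Lemma subspI A B : subsp s A -> subsp s B -> subsp s (A `&` B).
Proof.
move=> [A0 AD As] [B0 BD Bs]; split=> [//|u v [? ?] [? ?]|c u [? ?]].
  by split; [apply: AD|apply: BD].
by split; [apply: As|apply: Bs].
Qed.

Lemma lin_comb m d (c : 'I_m -> k) (M : 'I_m -> 'I_d -> k) (e : 'I_d -> V) :
  \sum_i s (c i) (\sum_j s (M i j) (e j)) = \sum_j s (\sum_i c i * M i j) (e j).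
Proof.
case: sc => _ sA _ _.
under eq_bigr do rewrite sc_sum; rewrite exchange_big.
by apply: eq_bigr => j _; rewrite sc_suml; apply: eq_bigr => i _; rewrite sA.
Qed.

(** Steinitz: if m > d, the m by d matrix of coordinates has a nonzero vector in its left kernel,
    and this vector is a relation between the u i modulo B. *)
Lemma indep_le B m d (u : 'I_m -> V) (e : 'I_d -> V) : subsp s B ->
  (forall i, exists c : 'I_d -> k, B (u i - \sum_j s (c j) (e j))) ->
  indep s B u -> (m <= d)%N.
Proof.
move=> sB /choice[M hM] iu; rewrite leqNgt; apply/negP => lt_dm.
pose C := \matrix_(i < m, j < d) M i j.
have : kermx C != 0.
  rewrite -mxrank_eq0 mxrank_ker subn_eq0 -ltnNge.
  exact: leq_ltn_trans (rank_leq_col C) lt_dm.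
case/rowV0Pn => l /sub_kermxP lC /negP[]; apply/eqP/rowP => i; rewrite mxE.
apply: (iu (fun i => l 0 i)) => {i}.
have -> : \sum_i s (l 0 i) (u i) =
   \sum_i s (l 0 i) (u i - \sum_j s (M i j) (e j)) +
   \sum_j s ((l *m C) 0 j) (e j).
  have -> : \sum_j s ((l *m C) 0 j) (e j) = \sum_i s (l 0 i) (\sum_j s (M i j) (e j)).
    rewrite lin_comb; apply: eq_bigr => j _; congr (s _ _); rewrite mxE.
    by apply: eq_bigr => i _; rewrite mxE.
  by rewrite -big_split /=; apply: eq_bigr => i _; rewrite scB subrK.
rewrite lC [X in _ + X]big1 ?addr0; first exact: (lin_sum _ sB).
by move=> j _; rewrite mxE sc0l.
Qed.

Lemma qdimP A B d : subsp s B -> quotient_dim s A B d <->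
  exists e : 'I_d -> V, [/\ forall i, A (e i), indep s B e &
    forall a, A a -> exists c : 'I_d -> k, B (a - \sum_i s (c i) (e i))].
Proof.
move=> sB; split=> [[e Ae ue]|[e [Ae ie se]]]; exists e => //.
  split=> // [c Bc|a Aa]; last by have [c [Bc _]] := ue a Aa; exists c.
  have key (c' : 'I_d -> k) a : A a -> B (a - \sum_i s (c' i) (e i)) ->
      forall c'' : 'I_d -> k, B (a - \sum_i s (c'' i) (e i)) -> forall i, c' i = c'' i.
    move=> Aa h c'' h'' i; have [c0 [_ uc]] := ue a Aa.
    have h1 : c0 = [ffun i => c' i].
      by apply: uc; under eq_bigr do rewrite ffunE.
    have h2 : c0 = [ffun i => c'' i].
      by apply: uc; under eq_bigr do rewrite ffunE.
    by move: h1; rewrite h2 => /ffunP/(_ i); rewrite !ffunE.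
  (* A relation c turns the coordinates c1 of [e i] into the equally valid c1 - c, so uniqueness
     forces c i = 0. *)
  move=> i; pose c1 : 'I_d -> k := fun j => (j == i)%:R.
  have ei : e i = \sum_j s (c1 j) (e j).
    rewrite (bigD1 i) //= /c1 eqxx big1 ?addr0; first by case: sc => ->.
    by move=> j /negPf ->; rewrite sc0l.
  have := key c1 (e i) (Ae i); rewrite {1}ei subrr.
  move/(_ ltac:(by case: sB) (fun j => c1 j - c j)).
  have -> : \sum_j s (c1 j - c j) (e j) = e i - \sum_j s (c j) (e j).
    rewrite ei -sumrB; apply: eq_bigr => j _; case: sc => _ sA sD _.
    by rewrite sD; congr (_ + _); rewrite -scN1 sA mulN1r.
  rewrite opprB addrC subrK => /(_ Bc i) /eqP.
  by rewrite -subr_eq0 opprB addrC subrK => /eqP.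
move=> a Aa; have [c Bc] := se a Aa.
exists [ffun i => c i]; split=> [|c' Bc'].
  by under eq_bigr do rewrite ffunE.
apply/ffunP => i; rewrite ffunE; apply/eqP; rewrite eq_sym -subr_eq0; apply/eqP.
apply: (ie (fun i => c' i - c i)).
have -> : \sum_j s (c' j - c j) (e j) =
   (a - \sum_j s (c j) (e j)) - (a - \sum_j s (c' j) (e j)).
  rewrite [RHS]addrC opprB addrA subrK -sumrB; apply: eq_bigr => j _; case: sc => _ sA sD _.
  by rewrite sD; congr (_ + _); rewrite -scN1 sA mulN1r.
exact: subspB.
Qed.

Lemma qdim_indep A B d m (u : 'I_m -> V) : subsp s B -> quotient_dim s A B d ->
  (forall i, A (u i)) -> indep s B u -> (m <= d)%N.
Proof.
move=> sB /(qdimP _ _ sB)[e [_ _ se]] Au; apply: indep_le (e) sB _ => i; exact: se.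
Qed.

Lemma qdim_uniq A B d d' : subsp s B -> quotient_dim s A B d -> quotient_dim s A B d' ->
  d = d'.
Proof.
move=> sB h h'; apply/eqP; rewrite eqn_leq.
have [/(qdimP _ _ sB)[e [? ? _]] /(qdimP _ _ sB)[e' [? ? _]]] := (h, h').
by rewrite (@qdim_indep A B d' _ e) ?(@qdim_indep A B d _ e').
Qed.

Lemma indep_cons B m (u : 'I_m -> V) a : subsp s B -> indep s B u ->
  (forall c : 'I_m -> k, ~ B (a - \sum_i s (c i) (u i))) ->
  indep s B (fun i : 'I_m.+1 => if unlift ord0 i is Some j then u j else a).
Proof.
move=> sB iu na c; rewrite big_ord_recl unlift_none /=.
under eq_bigr do rewrite liftK.
have [c0|c0] := eqVneq (c ord0) 0.
  rewrite c0 sc0l add0r => Bc i; case: (unliftP ord0 i) => [j ->|-> //].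
  exact: (iu (fun j => c (lift ord0 j))).
move=> Bc; case: (na (fun j => - (c ord0)^-1 * c (lift ord0 j))).
case: sc => s1 sA _ sDr; have [_ _ Bs] := sB.
have := Bs (c ord0)^-1 _ Bc; rewrite sDr sA mulVf // s1 sc_sum.
rewrite -sumrN; congr (B (_ + _)); apply: eq_bigr => j _.
by rewrite sA mulNr -scN1 sA mulN1r opprK.
Qed.

(** An independent family of maximal size is a basis. Finite dimensions are always obtained in this
    way below, from a bound on independent families. *)
Lemma qdim_bound A B N : subsp s B ->
  (forall m (u : 'I_m -> V), (forall i, A (u i)) -> indep s B u -> (m <= N)%N) ->
  exists d, quotient_dim s A B d.
Proof.
move=> sB bA.
pose P m := `[< exists u : 'I_m -> V, (forall i, A (u i)) /\ indep s B u >].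
have P0 : exists m, P m.
  exists 0%N; apply/asboolP; exists (fun=> 0); split=> [[]//|c _ []//].
have PN m : P m -> (m <= N)%N by move=> /asboolP[u [? ?]]; apply: (bA m u).
case: (ex_maxnP P0 PN) => d /asboolP[u [Au iu]] dmax; exists d.
apply/(qdimP _ _ sB); exists u; split=> // a Aa; apply: contrapT => /forallNP na.
have := @indep_cons B d u a sB iu na => iu'.
have /dmax : P d.+1; last by rewrite ltnn.
apply/asboolP; eexists; split; last exact: iu'.
by move=> i /=; case: (unlift ord0 i).
Qed.

Lemma qdim_add A B C m n : subsp s A -> subsp s B -> subsp s C -> B `<=` C -> C `<=` A ->
  quotient_dim s A C m -> quotient_dim s C B n -> quotient_dim s A B (m + n).
Proof.
move=> sA sB sC BC CA /(qdimP _ _ sC)[e [Ae ie se]] /(qdimP _ _ sB)[f [Cf jf tf]].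
apply/(qdimP _ _ sB).
exists (fun i => match fintype.split i with inl i => e i | inr j => f j end); split.
- by move=> i; case: (fintype.split i) => j //; apply: CA.
- move=> c; rewrite big_split_ord /=.
  under eq_bigr do rewrite (unsplitK (inl _)).
  under [X in _ + X]eq_bigr do rewrite (unsplitK (inr _)).
  move=> Bc.
  have c1 i : c (lshift n i) = 0.
    apply: (ie (fun i => c (lshift n i))).
    rewrite -[X in C X](addrK (\sum_i s (c (rshift m i)) (f i))).
    by apply: subspB => //; [apply: BC|apply: lin_sum].
  move: Bc; rewrite big1 ?add0r => [Bc|i _]; last by rewrite c1 sc0l.
  have c2 := jf _ Bc; move=> i; case: (split_ordP i) => j -> //; exact: c2.
- move=> a Aa; have [c Cc] := se a Aa; have [c' Bc'] := tf _ Cc.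
  exists (fun i => match fintype.split i with inl i => c i | inr j => c' j end).
  rewrite big_split_ord /= opprD addrA.
  under eq_bigr do rewrite (unsplitK (inl _)).
  by under [X in _ - X]eq_bigr do rewrite (unsplitK (inr _)).
Qed.

(** Independent families of either layer are independent in A / B, which bounds their size by d;
    hence both dimensions exist, and they add up. *)
Lemma qdim_split A B C d : subsp s A -> subsp s B -> subsp s C -> B `<=` C -> C `<=` A ->
  quotient_dim s A B d -> exists m n,
  [/\ quotient_dim s A C m, quotient_dim s C B n & d = (m + n)%N].
Proof.
move=> sA sB sC BC CA h.
have [m hm] : exists m, quotient_dim s A C m.
  apply: (@qdim_bound A C d sC) => m u Au iu.
  by apply: (qdim_indep sB h Au) => c /BC; exact: iu.
have [n hn] : exists n, quotient_dim s C B n.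
  apply: (@qdim_bound C B d sB) => n u Cu iu.
  by apply: (qdim_indep sB h _ iu) => i; exact: CA.
exists m, n; split => //; apply: (qdim_uniq sB h); exact: (@qdim_add A B C).
Qed.

Lemma qdim_eq0 A B : subsp s B -> quotient_dim s A B 0 <-> A `<=` B.
Proof.
move=> sB; split=> [/(qdimP _ _ sB)[e [_ _ h]] a /h[c]|AB].
  by rewrite big_ord0 subr0.
apply/(qdimP _ _ sB); exists (fun=> 0); split => [[]//|c _ []//|a /AB Ba].
by exists (fun=> 0); rewrite big_ord0 subr0.
Qed.

End QuotientDim.

(** * Isomorphisms between quotient spaces *)

Section Transport.
Variables (k : fieldType) (V W : zmodType) (s : k -> V -> V) (s' : k -> W -> W).
Hypotheses (sc : scaling s) (sc' : scaling s').
Variables (phi : V -> W) (A B : set V) (A' B' : set W).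
Hypotheses (phiD : forall u v, phi (u + v) = phi u + phi v)
  (phis : forall c u, phi (s c u) = s' c (phi u)).
Hypotheses (sB : subsp s B) (sB' : subsp s' B').
Hypotheses (phiA : forall u, A u -> A' (phi u))
  (phiS : forall w, A' w -> exists2 u, A u & B' (w - phi u)).

Lemma lin_phi n (c : 'I_n -> k) (u : 'I_n -> V) :
  phi (\sum_i s (c i) (u i)) = \sum_i s' (c i) (phi (u i)).
Proof.
rewrite (big_morph phi (id1 := 0) phiD).
  by apply: eq_bigr => i _; rewrite phis.
by rewrite -(sc0l sc 0) phis (sc0l sc').
Qed.

Lemma phiB u v : phi (u - v) = phi u - phi v.
Proof. by rewrite phiD -(scN1 sc) phis (scN1 sc'). Qed.

(** The map phi induces an isomorphism A / B -> A' / B': the last hypothesis gives injectivity and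
    [phiS] gives surjectivity. *)
Lemma qdim_map d : subsp s A ->
  (forall u, A u -> B u <-> B' (phi u)) ->
  quotient_dim s A B d <-> quotient_dim s' A' B' d.
Proof.
move=> sA hB; split.
  move=> /(qdimP sc _ _ sB)[e [Ae ie se]]; apply/(qdimP sc' _ _ sB').
  exists (phi \o e); split=> [i|c|w /phiS[u Au Bu]]; first exact: phiA.
    rewrite /= -lin_phi => h; apply: ie; apply/hB => //; exact: (lin_sum _ sA).
  have [c Bc] := se u Au; exists c; rewrite -lin_phi.
  rewrite -(subrK (phi u) w) -addrA -phiB.
  have [_ BD _] := sB'; apply: BD => //; apply/hB => //.
  by apply: (subspB sc) => //; apply: (lin_sum _ sA).
move=> /(qdimP sc' _ _ sB')[e' [Ae' ie' se']].
have /choice[e he] : forall i, exists u, A u /\ B' (e' i - phi u).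
  by move=> i; have [u ? ?] := phiS (Ae' i); exists u.
have Ae i : A (e i) by case: (he i).
apply/(qdimP sc _ _ sB); exists e; split=> [//|c Bc|u Au].
  apply: ie'; rewrite -[X in B' X](subrK (phi (\sum_i s (c i) (e i)))).
  have [_ BD Bs] := sB'; apply: BD; last by apply/hB => //; apply: (lin_sum _ sA).
  rewrite lin_phi -sumrB; apply: (subsp_sum sB') => i; rewrite -(scB sc').
  by apply: Bs; case: (he i).
have [c Bc] := se' _ (phiA Au); exists c; apply/hB.
  by apply: (subspB sc) => //; apply: (lin_sum _ sA).
rewrite phiB lin_phi.
have -> : phi u - \sum_i s' (c i) (phi (e i)) = (phi u - \sum_i s' (c i) (e' i)) +
  \sum_i s' (c i) (e' i - phi (e i)).
  under [X in _ = _ + X]eq_bigr do rewrite (scB sc').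
  by rewrite sumrB addrA subrK.
have [_ BD Bs] := sB'; apply: BD => //; apply: (lin_sum _ sB') => i.
by case: (he i).
Qed.

End Transport.

(** * Places *)

Section Places.
Variables (k : fieldType) (X : curve k).
Local Notation F := (funfield X).
Local Notation place := (place X).
Implicit Types (v w : place) (f g : F).

Definition ev f (p : {poly k}) : F := (map_poly (const X) p).[f].

Definition transc f := forall p : {poly k}, ev f p = 0 -> p = 0.

Definition vge v (n : int) : set F := [set f | f = 0 \/ n <= ord v f].

Definition kscale (c : k) f : F := const X c * f.

Lemma kscaling : scaling kscale.
Proof.
split=> [u|a b u|a b u|a u v]; rewrite /kscale ?rmorph1 ?mul1r //.
- by rewrite mulrA rmorphM.
- by rewrite rmorphD mulrDl.
- by rewrite mulrDr.
Qed.

Lemma evD f p q : ev f (p + q) = ev f p + ev f q.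
Proof. by rewrite /ev rmorphD hornerD. Qed.

Lemma evB f p q : ev f (p - q) = ev f p - ev f q.
Proof. by rewrite /ev rmorphB hornerD hornerN. Qed.

Lemma evM f p q : ev f (p * q) = ev f p * ev f q.
Proof. by rewrite /ev rmorphM hornerM. Qed.

Lemma ev0 f : ev f 0 = 0. Proof. by rewrite /ev rmorph0 horner0. Qed.

Lemma ev1 f : ev f 1 = 1. Proof. by rewrite /ev rmorph1 hornerC. Qed.

Lemma evXn f p n : ev f (p ^+ n) = ev f p ^+ n.
Proof. by rewrite /ev rmorphXn horner_exp. Qed.

Lemma ev_sum f (I : Type) (r : seq I) (P : pred I) (E : I -> {poly k}) :
  ev f (\sum_(i <- r | P i) E i) = \sum_(i <- r | P i) ev f (E i).
Proof. exact: (big_morph _ (evD f) (ev0 f)). Qed.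

Lemma ev_prod f (I : Type) (r : seq I) (P : pred I) (E : I -> {poly k}) :
  ev f (\prod_(i <- r | P i) E i) = \prod_(i <- r | P i) ev f (E i).
Proof. exact: (big_morph _ (evM f) (ev1 f)). Qed.

Lemma ev_coef f n (p : {poly k}) : (size p <= n)%N ->
  ev f p = \sum_(i < n) const X p`_i * f ^+ i.
Proof.
move=> pn; rewrite /ev (@horner_coef_wide _ n) ?size_map_poly //.
by apply: eq_bigr => i _; rewrite coef_map.
Qed.

Lemma evC f c : ev f c%:P = const X c.
Proof. by rewrite /ev map_polyC hornerC. Qed.

Lemma evX f : ev f 'X = f.
Proof. by rewrite /ev map_polyX hornerX. Qed.

Lemma const_eq0 c : (const X c == 0) = (c == 0). Proof. exact: fmorph_eq0. Qed.

Lemma ord_one v : ord v 1 = 0. Proof. by rewrite -(rmorph1 (const X)) ord_const. Qed.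

Lemma ordN v f : ord v (- f) = ord v f.
Proof.
have [->|f0] := eqVneq f 0; first by rewrite oppr0.
have -> : - f = const X (-1) * f by rewrite rmorphN rmorph1 mulN1r.
by rewrite ordM ?const_eq0 ?oppr_eq0 ?oner_eq0 // ord_const add0r.
Qed.

Lemma ordV v f : ord v f^-1 = - ord v f.
Proof.
have [->|f0] := eqVneq f 0; first by rewrite invr0 Defs.ord0 oppr0.
by apply/eqP; rewrite -subr_eq0 opprK -ordM ?invr_eq0 // mulVf // ord_one.
Qed.

Lemma ordX v f n : ord v (f ^+ n) = ord v f *+ n.
Proof.
have [->|f0] := eqVneq f 0.
  by case: n => [|n]; rewrite ?expr0 ?ord_one ?exprS ?mul0r Defs.ord0 ?mul0rn.
elim: n => [|n IH]; first by rewrite expr0 ord_one.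
by rewrite exprS ordM ?expf_neq0 // IH mulrS.
Qed.

Lemma vge0 v n : vge v n 0. Proof. by left. Qed.

Lemma vgeW v n m f : m <= n -> vge v n f -> vge v m f.
Proof. by move=> mn [->|h]; [left|right; apply: le_trans mn h]. Qed.

Lemma vgeD v n f g : vge v n f -> vge v n g -> vge v n (f + g).
Proof.
have [->|f0] := eqVneq f 0; first by rewrite add0r.
have [->|g0] := eqVneq g 0; first by rewrite addr0.
have [->|fg0] := eqVneq (f + g) 0; first by left.
case=> [/eqP|nf]; first by rewrite (negPf f0).
case=> [/eqP|ng]; first by rewrite (negPf g0).
by right; apply: le_trans (ordD v f0 g0 fg0); rewrite le_min nf.
Qed.

Lemma vgeN v n f : vge v n (- f) <-> vge v n f.
Proof.
by split=> -[/eqP|]; rewrite ?ordN ?oppr_eq0 => h; [left; apply/eqP|right|left; apply/eqP; rewrite oppr_eq0|right; rewrite ordN].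
Qed.

Lemma vgeB v n f g : vge v n f -> vge v n g -> vge v n (f - g).
Proof. by move=> vf vg; apply: vgeD => //; apply/vgeN. Qed.

Lemma vgeM v n m f g : vge v n f -> vge v m g -> vge v (n + m) (f * g).
Proof.
have [->|f0] := eqVneq f 0; first by rewrite mul0r; left.
have [->|g0] := eqVneq g 0; first by rewrite mulr0; left.
case=> [/eqP|nf]; first by rewrite (negPf f0).
case=> [/eqP|ng]; first by rewrite (negPf g0).
by right; rewrite ordM // lerD.
Qed.

Lemma vge_ord v n f : f != 0 -> vge v n f <-> n <= ord v f.
Proof. by move=> /eqP f0; split=> [[]//|]; right. Qed.

Lemma vgeMl v n f g : f != 0 -> vge v n (f * g) <-> vge v (n - ord v f) g.
Proof.
move=> f0; split=> h; last first.
  rewrite -[n](subrK (ord v f)) addrC; apply: vgeM => //; by right.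
rewrite -[g](mulKf f0) addrC; apply: vgeM => //; by right; rewrite ordV.
Qed.

Lemma vge_const v c : vge v 0 (const X c).
Proof. by right; rewrite ord_const. Qed.

Lemma vge_sum v n (I : Type) (r : seq I) (P : pred I) (E : I -> F) :
  (forall i, P i -> vge v n (E i)) -> vge v n (\sum_(i <- r | P i) E i).
Proof. by move=> h; elim/big_ind : _ => //; [left|exact: vgeD]. Qed.

Lemma vge_subsp v n : subsp kscale (vge v n).
Proof.
split=> [|f g|c f h]; [exact: vge0|exact: vgeD|].
by rewrite -[n]add0r; apply: vgeM => //; exact: vge_const.
Qed.

Lemma regularE v : regular v = vge v 0.
Proof.
apply/seteqP; split=> f /=; first by right.
by case=> [->|//]; rewrite /regular /= Defs.ord0.
Qed.

Lemma maximal_idealE v : maximal_ideal v = vge v 1.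
Proof. by apply/seteqP; split=> f /= [->|]; [left|right|left|right]. Qed.

Lemma ord_dominant v f g : f != 0 -> vge v (ord v f + 1) g -> ord v (f + g) = ord v f /\ f + g != 0.
Proof.
move=> f0 hg; have [fg0|fg0] := eqVneq (f + g) 0.
  have : vge v (ord v f + 1) f.
    by rewrite -[X in vge _ _ X](addrK g f) fg0 add0r; apply/vgeN.
  by rewrite vge_ord // gerDl.
split=> //; apply/eqP; rewrite eq_le; apply/andP; split; last first.
  apply/vge_ord => //; apply: vgeD; first by right.
  by apply: vgeW hg; rewrite lerDl.
rewrite leNgt; apply/negP => lt_f.
have : vge v (ord v f + 1) f.
  rewrite -[X in vge _ _ X](addrK g f); apply: vgeB => //; right.
  by rewrite lezD1.
by rewrite vge_ord // gerDl.
Qed.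

Lemma place_eq v w : ord v =1 ord w -> v = w.
Proof.
move=> /funext; case: v => o a b c d e; case: w => o' a' b' c' d' e' /= E.
by case: _ / E a' b' c' d' e' => *; congr Place; exact: Prop_irrelevance.
Qed.

Definition unif v : F := projT1 (cid (ord_surj v)).

Lemma ord_unif v : ord v (unif v) = 1. Proof. exact: projT2 (cid (ord_surj v)). Qed.

Lemma unif_neq0 v : unif v != 0.
Proof. by apply/eqP => h; have := ord_unif v; rewrite h Defs.ord0. Qed.

Lemma unifz_neq0 v (n : int) : unif v ^ n != 0.
Proof. by rewrite expfz_neq0 ?unif_neq0. Qed.

Lemma ordXz v f (n : int) : ord v (f ^ n) = ord v f * n.
Proof.
case: n => n; first by rewrite -exprnP ordX -mulr_natr natz.
by rewrite NegzE -exprnN ordV ordX -mulr_natr natz mulrN.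
Qed.

Lemma ord_unifz v (n : int) : ord v (unif v ^ n) = n.
Proof. by rewrite ordXz ord_unif mul1r. Qed.

(** Units of the smaller ring are units of the larger one, so [ord w] is a multiple of [ord v]. The
    factor is nonnegative on a uniformizer, and as [ord w] takes the value 1 it equals 1. *)
Lemma place_sub v w : (forall f, vge v 0 f -> vge w 0 f) -> v = w.
Proof.
move=> h; have units f : f != 0 -> ord v f = 0 -> ord w f = 0.
  move=> f0 of0; apply/eqP; rewrite eq_le; apply/andP; split.
    rewrite -oppr_ge0 -ordV; apply/(vge_ord w); rewrite ?invr_eq0 //; apply: h.
    by right; rewrite ordV of0 oppr0.
  by apply/(vge_ord w) => //; apply: h; right; rewrite of0.
have E f : f != 0 -> ord w f = ord v f * ord w (unif v).
  move=> f0; rewrite mulrC -ordXz; apply/eqP; rewrite -subr_eq0 -ordV -ordM ?invr_eq0 ?unifz_neq0 //.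
  apply/eqP/units; first by rewrite mulf_neq0 ?invr_eq0 ?unifz_neq0.
  by rewrite ordM ?invr_eq0 ?unifz_neq0 // ordV ord_unifz subrr.
have u1 : ord w (unif v) = 1.
  have [g og] := ord_surj w; have g0 : g != 0 by apply/eqP => g0; rewrite g0 Defs.ord0 in og.
  have : 0 <= ord w (unif v).
    by apply/vge_ord; rewrite ?unif_neq0 //; apply: h; right; rewrite ord_unif.
  move: og; rewrite E //; move: (ord v g) (ord w _) => a b ab b0.
  have : absz (a * b) = 1%N by rewrite ab.
  by rewrite abszM => /eqP; rewrite muln_eq1 => /andP[_ /eqP]; lia.
apply: place_eq => f; have [->|f0] := eqVneq f 0; first by rewrite !Defs.ord0.
by rewrite E // u1 mulr1.
Qed.

Lemma place_sep v w : v <> w -> exists z, [/\ z != 0, 0 < ord v z & ord w z < 0].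
Proof.
have key u u' : u <> u' -> exists f, [/\ f != 0, 0 <= ord u f & ord u' f < 0].
  move=> uu'; apply: contrapT => /forallNP h; apply: uu'; apply: place_sub => f.
  have [->|f0] := eqVneq f 0; first by left.
  rewrite !vge_ord // => uf; rewrite leNgt; apply/negP => u'f.
  by apply: (h f).
move=> vw; have [f [f0 vf wf]] := key _ _ vw.
have [g [g0 wg vg]] := key _ _ (nesym vw).
exists (f / g); split; first by rewrite mulf_neq0 ?invr_eq0.
  by rewrite ordM ?invr_eq0 // ordV; lia.
by rewrite ordM ?invr_eq0 // ordV; lia.
Qed.

Lemma weak_approx_pole v (s : seq place) : v \notin s ->
  exists z, [/\ z != 0, 0 < ord v z & forall w, w \in s -> ord w z < 0].
Proof.
elim: s => [|w s IH]; first by exists (unif v); rewrite unif_neq0 ord_unif.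
rewrite inE negb_or => /andP[/eqP vw /IH[z [z0 vz sz]]].
have [y [y0 vy wy]] := place_sep vw.
(* The exponent exceeds every |ord u z| on the list, so y^r strictly dominates z at each pole of y
   there; where y is regular, z has a pole and dominates. *)
pose r := (\sum_(u <- w :: s) absz (ord u z)).+1%N.
have hr u : u \in w :: s -> ord u y < 0 -> ord u (y ^+ r) + 1 <= ord u z.
  move=> us uy; rewrite ordX -mulr_natr natz.
  have : (absz (ord u z) < r)%N by rewrite ltnS (big_rem u) //= leq_addr.
  by move: (ord u z) (ord u y) r uy => a b r; nia.
have zy : z + y ^+ r != 0 /\ forall u, u \in w :: s -> ord u (z + y ^+ r) < 0.
  have P u : u \in w :: s -> ord u (z + y ^+ r) < 0 /\ z + y ^+ r != 0.
    move=> us; have [uy|uy] := ltP (ord u y) 0.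
      have [|E n0] := @ord_dominant u (y ^+ r) z (expf_neq0 r y0).
        by right; exact: hr.
      by rewrite addrC E n0; split=> //; rewrite ordX /r mulrS; have := mulrn_wle0 (r.-1) (ltW uy); rewrite /r /=; lia.
    have uz : ord u z < 0.
      by move: us; rewrite inE => /orP[/eqP E|/sz//]; move: wy uy; rewrite E; lia.
    have [|-> ->] := @ord_dominant u z (y ^+ r) z0; last by [].
    by right; rewrite ordX; apply: le_trans (mulrn_wge0 _ uy); rewrite lezD1.
  split=> [|u /P[]//]; by case: (P w); rewrite ?inE ?eqxx.
exists (z + y ^+ r); split=> //; [exact: zy.1| |exact: zy.2].
have : vge v 1 (z + y ^+ r).
  apply: vgeD; first by right.
  right; rewrite ordX /r mulrS; have := mulrn_wge0 (r.-1) (ltW vy); rewrite /r /=; lia.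
by case=> // E; move: zy.1; rewrite E eqxx.
Qed.

(** With z small at v and with poles on s, the function 1 / (1 + z^n) is close to 1 at v and close
    to 0 on s. *)
Lemma weak_approx01 v (s : seq place) (N : nat) : v \notin s ->
  exists z, vge v N%:Z (z - 1) /\ forall w, w \in s -> vge w N%:Z z.
Proof.
move=> /weak_approx_pole[z [z0 vz sz]]; exists (1 + z ^+ N.+1)^-1.
have o1 u : 0 < ord u z -> ord u (1 + z ^+ N.+1) = 0 /\ 1 + z ^+ N.+1 != 0.
  move=> uz; have [|-> //] := @ord_dominant u 1 (z ^+ N.+1) (oner_neq0 _).
    by right; rewrite ord_one ordX mulrS; have := mulrn_wge0 N (ltW uz); lia.
  by rewrite ord_one.
split.
  have [ov n0] := o1 v vz.
  have -> : (1 + z ^+ N.+1)^-1 - 1 = - (z ^+ N.+1 / (1 + z ^+ N.+1)).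
    by rewrite -[X in _ - X](mulVf n0) mulrDr mulr1 opprD addrA subrr add0r mulrC.
  apply/vgeN; right; rewrite ordM ?expf_neq0 ?invr_eq0 // ordV ov ordX -mulr_natr natz.
  by move: (ord v z) vz => a; nia.
move=> w /sz wz; right; rewrite ordV addrC.
have [|-> _] := @ord_dominant w (z ^+ N.+1) 1 (expf_neq0 _ z0).
  by right; rewrite ord_one ordX -mulr_natr natz; nia.
by rewrite ordX -mulr_natr natz; nia.
Qed.

Lemma weak_approx (s : seq place) (a : place -> F) (N : nat) : uniq s ->
  exists z, forall v, v \in s -> vge v N%:Z (z - a v).
Proof.
move=> us; pose K := (N + \sum_(v <- s) \sum_(w <- s) absz (ord w (a v)))%N.
have hK v w : v \in s -> w \in s -> N%:Z <= K%:Z + ord w (a v).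
  move=> vs ws; have : (N + absz (ord w (a v)) <= K)%N.
    rewrite leq_add2l (big_rem v) //=; apply: leq_trans (leq_addr _ _).
    by rewrite (big_rem w) //= leq_addr.
  by lia.
have /choice[z hz] : forall v, exists z, v \in s ->
    vge v K%:Z (z - 1) /\ forall w, w \in s -> w != v -> vge w K%:Z z.
  move=> v; have [z [vz sz]] := @weak_approx01 v (rem v s) K (negbT (mem_rem_uniqF v us)).
  exists z => _; split=> // w ws wv; apply: sz.
  by rewrite mem_rem_uniq // inE wv.
exists (\sum_(v <- s) a v * z v) => v vs.
rewrite (big_rem v) //= addrAC.
apply: vgeD; last first.
  rewrite big_seq; apply: vge_sum => w; rewrite mem_rem_uniq // inE => /andP[wv ws].
  have [_ /(_ v vs)] := hz w ws; rewrite eq_sym => /(_ wv) h.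
  have [->|aw] := eqVneq (a w) 0; first by rewrite mul0r; left.
  by apply/vgeMl => //; apply: vgeW h; have := hK w v ws vs; lia.
have [->|av] := eqVneq (a v) 0; first by rewrite mul0r subrr; left.
rewrite -[X in _ - X]mulr1 -mulrBr; apply/vgeMl => //.
by have [h _] := hz v vs; apply: vgeW h; have := hK v v vs vs; lia.
Qed.

Lemma ord_ev v f p : 0 < ord v f -> p.[0] != 0 -> ord v (ev f p) = 0 /\ ev f p != 0.
Proof.
move=> vf p0.
have f0 : f != 0 by apply/eqP => f0; rewrite f0 Defs.ord0 in vf.
have [q Eq] : exists q, p = (p.[0])%:P + q * 'X.
  have : root (p - (p.[0])%:P) 0 by rewrite /root !hornerE subrr.
  move=> /factor_theorem[q]; rewrite subr0 => E; exists q.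
  by rewrite -E addrC subrK.
rewrite Eq evD evM evC evX.
have c0 : const X p.[0] != 0 by rewrite const_eq0.
have := @ord_dominant v (const X p.[0]) (ev f q * f) c0; rewrite ord_const => h.
apply: h; rewrite add0r -[1]add0r; apply: vgeM; last by right.
rewrite (ev_coef f (leqnn _)); apply: vge_sum => i _.
rewrite -[0]addr0; apply: vgeM; first exact: vge_const.
by right; rewrite ordX mulrn_wge0 // ltW.
Qed.

(** When ord f > 0, a polynomial relation stripped of its factors f has a dominant constant term. A
    negative order is reduced to this case by passing to 1/f. *)
Lemma ord_transc v f : ord v f != 0 -> transc f.
Proof.
have key g : 0 < ord v g -> transc g.
  move=> vg p; have g0 : g != 0 by apply/eqP => g0; rewrite g0 Defs.ord0 in vg.
  have [//|p0] := eqVneq p 0.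
  have [n [q] q0 ->] := multiplicity_XsubC p 0.
  move: q0; rewrite p0 /= subr0 => q0; rewrite evM evXn evX => /eqP.
  rewrite mulf_eq0 expf_eq0 (negPf g0) andbF orbF.
  by have [_ /negPf ->] := ord_ev vg q0.
move=> vf p; have [|vf0] := ltP 0 (ord v f); first by move/key; apply.
have f0 : f != 0 by apply: contraNneq vf => ->; rewrite Defs.ord0.
have /key tf : 0 < ord v f^-1 by rewrite ordV; lia.
have [->//|p0 E] := eqVneq p 0.
(* The reciprocal polynomial, which has 1/f as a root. *)
pose q := \poly_(i < size p) p`_((size p).-1 - i).
have sp : (0 < size p)%N by rewrite size_poly_gt0.
have : ev f^-1 q = 0.
  have -> : ev f^-1 q = ev f p * f^-1 ^+ (size p).-1.
    rewrite (ev_coef _ (size_poly _ _)) (ev_coef f (leqnn (size p))) mulr_suml.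
    rewrite (reindex_inj rev_ord_inj); apply: eq_bigr => i _.
    rewrite coef_poly /= ltn_subrL sp /=.
    have -> : ((size p).-1 - (size p - i.+1) = i)%N by have := ltn_ord i; lia.
    rewrite -mulrA; congr (_ * _).
    have -> : (size p).-1 = (size p - i.+1 + i)%N by have := ltn_ord i; lia.
    by rewrite exprD mulrCA exprVn [f^-1 ^+ i]exprVn mulfV ?mulr1 ?expf_neq0 // exprVn.
  by rewrite E mul0r.
move/tf/polyP => q0.
apply/polyP => i; rewrite coef0; have [ip|ip] := ltnP i (size p); last by rewrite nth_default.
have := q0 ((size p).-1 - i)%N; rewrite coef0 coef_poly.
have -> : ((size p).-1 - i < size p)%N by lia.
by have -> : ((size p).-1 - ((size p).-1 - i) = i)%N by lia.
Qed.

Lemma transc_neq0 f : transc f -> f != 0.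
Proof.
move=> tf; apply/eqP => f0; have := tf 'X; rewrite evX => /(_ f0) /eqP.
by rewrite polyX_eq0.
Qed.

Lemma algebraic_ord v f : ~ transc f -> ord v f = 0.
Proof. by move=> af; apply/eqP/negP => /negP /ord_transc. Qed.
End Places.

(** * Finiteness of F over k(f) *)

Section FunctionField.
Variables (k : fieldType) (X : curve k).
Local Notation F := (funfield X).
Local Notation place := (place X).
Implicit Types (v w : place) (f g : F).

(** For transcendental f this is linear independence over k(f) with denominators cleared. For
    algebraic f only the empty family qualifies, so that bounds on such families make sense for
    every f. *)
Definition findep f m (u : 'I_m -> F) :=
  forall p : 'I_m -> {poly k}, \sum_i ev f (p i) * u i = 0 -> forall i, p i = 0.

(** The definition of a function field, rewritten with one common denominator q for a whole finite
    family g. *)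
Lemma function_field_basis : exists t : F, transc t /\ exists n (b : 'I_n -> F),
  forall m (g : 'I_m -> F), exists (q : {poly k}) (P : 'I_m -> 'I_n -> {poly k}),
    q != 0 /\ forall i, ev t q * g i = \sum_j ev t (P i j) * b j.
Proof.
have [t [nt [n [b hb]]]] := curveP X; exists t.
have tt : transc t.
  move=> p E; have [//|p0] := eqVneq p 0; case: nt; exists p => //.
  by apply/rootP.
split=> //; exists n, b => m g.
have ev0P (q : {poly k}) : q != 0 -> ev t q != 0 by apply: contraNneq => /tt ->.
have clear l (q : 'I_l -> {poly k}) : (forall i, q i != 0) ->
   \prod_i q i != 0 by move=> h; apply/prodf_neq0.
have one h : exists (q : {poly k}) (P : 'I_n -> {poly k}), q != 0 /\ ev t q * h = \sum_j ev t (P j) * b j.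
  have [c [hc ->]] := hb h.
  have /choice[pq hpq] : forall j, exists pq : {poly k} * {poly k},
      pq.2 != 0 /\ c j = ev t pq.1 / ev t pq.2.
    by move=> j; have [p [q [? ?]]] := hc j; exists (p, q).
  exists (\prod_j (pq j).2), (fun j => (pq j).1 * \prod_(l | l != j) (pq l).2).
  split; first by apply: clear => i; case: (hpq i).
  rewrite mulr_sumr; apply: eq_bigr => j _; have [q0 ->] := hpq j.
  rewrite (bigD1 j) //= !evM; have := ev0P _ q0; set a := ev t _.2 => a0.
  by field.
have /choice[qP hqP] : forall i, exists qP : {poly k} * ('I_n -> {poly k}),
    qP.1 != 0 /\ ev t qP.1 * g i = \sum_j ev t (qP.2 j) * b j.
  by move=> i; have [q [P ?]] := one (g i); exists (q, P).
exists (\prod_i (qP i).1), (fun i j => (qP i).2 j * \prod_(l | l != i) (qP l).1).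
split=> [|i]; first by apply: clear => i; case: (hqP i).
rewrite (bigD1 i) //= evM mulrAC (hqP i).2 mulr_suml; apply: eq_bigr => j _.
by rewrite evM mulrAC.
Qed.

(* If [q f b = G b] with [q], [G] of degree at most [a] in [t], then the elements
   [f^i u_j], [i < N], span a space of dimension at most [n (a N + O(1))]. *)
Lemma findep_bound f : exists N, forall m (u : 'I_m -> F), findep f u -> (m <= N)%N.
Proof.
have [t [tt [n [b hb]]]] := function_field_basis.
have ev0P (q : {poly k}) : q != 0 -> ev t q != 0 by apply: contraNneq => /tt ->.
have [q [G [q0 hG]]] := hb n (fun i => f * b i).
pose a := (size q + \sum_i \sum_j size (G i j))%N.
have Ga i j : (size (G i j) <= a)%N.
  by rewrite /a (bigD1 i) //= (bigD1 j) //= addnCA -!addnA leq_addr.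
have sM (p1 p2 : {poly k}) a1 a2 : (size p1 <= a1.+1)%N -> (size p2 <= a2.+1)%N ->
    (size (p1 * p2)%R <= (a1 + a2).+1)%N.
  by move=> h1 h2; apply: leq_trans (size_polyMleq _ _) _; lia.
have sS l (P : 'I_l -> {poly k}) c : (forall i, size (P i) <= c)%N -> (size (\sum_i P i)%R <= c)%N.
  by move=> h; apply: leq_trans (size_sum _ _ _) _; apply/bigmax_leqP.
have pow i : exists H : 'I_n -> 'I_n -> {poly k}, (forall s l, size (H s l) <= (a * i).+1)%N /\
    forall s, (ev t q * f) ^+ i * b s = \sum_l ev t (H s l) * b l.
  elim: i => [|i [H [sH hH]]].
    exists (fun s l => (s == l)%:R%:P); split=> [s l|s].
      by rewrite size_polyC; case: (_ != _).
    rewrite expr0 mul1r (bigD1 s) //= eqxx ev1 mul1r big1 ?addr0 // => l /negPf.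
    by rewrite eq_sym => ->; rewrite ev0 mul0r.
  exists (fun s j => \sum_l H s l * G l j); split=> [s l|s].
    by apply: sS => j; rewrite mulnSr; apply: sM => //; exact: leqW.
  rewrite exprS -mulrA hH mulr_sumr.
  under [RHS]eq_bigr do rewrite ev_sum mulr_suml.
  rewrite exchange_big; apply: eq_bigr => l _.
  have -> : ev t q * f * (ev t (H s l) * b l) =
    ev t (H s l) * (ev t q * (f * b l)) by ring.
  rewrite hG mulr_sumr.
  by apply: eq_bigr => j _; rewrite evM mulrA.
exists (n * a)%N => m u iu.
have [qu [U [qu0 hU]]] := hb m u.
pose au := (\sum_i \sum_j size (U i j))%N.
have Ua i j : (size (U i j) <= au)%N.
  by rewrite /au (bigD1 i) //= (bigD1 j) //= -!addnA leq_addr.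
have dim N : (N * m <= (a * N + au).+1 * n)%N.
  pose I := ('I_N * 'I_m)%type; pose J := ('I_(a * N + au).+1 * 'I_n)%type.
  pose w (z : I) := ev t (q ^+ N * qu) * (f ^+ z.1 * u z.2).
  pose e (z : J) := t ^+ z.1 * b z.2.
  have <- : #|{: I}| = (N * m)%N by rewrite card_prod !card_ord.
  have <- : #|{: J}| = ((a * N + au).+1 * n)%N by rewrite card_prod !card_ord.
  apply: (@indep_le _ _ _ (kscaling X) [set 0] _ _ (w \o enum_val) (e \o enum_val) (subsp0 (kscaling X))).
    move=> i0 /=; case: (enum_val i0) => i j /=.
    have [H [sH hH]] := pow i.
    pose P l : {poly k} := \sum_s q ^+ (N - i) * U j s * H s l.
    exists (fun z : 'I_#|{: J}| => (P (enum_val z).2)`_((enum_val z).1)).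
    apply/eqP; rewrite subr_eq0; apply/eqP.
    rewrite -(big_enum_val (A := {: J}) (fun z => kscale (P z.2)`_(z.1) (e z))) /=.
    rewrite -(pair_bigA _ (fun (s : 'I_(a * N + au).+1) l => kscale (P l)`_s (e (s, l)))) /=.
    rewrite exchange_big /=.
    transitivity (\sum_l ev t (P l) * b l); last first.
      apply: eq_bigr => l _; rewrite (@ev_coef _ _ t (a * N + au).+1).
        by rewrite mulr_suml; apply: eq_bigr => s _; rewrite /kscale /e /= mulrA.
      apply: sS => s; have -> : (a * N + au = (a * (N - i) + au) + a * i)%N.
        by have := ltn_ord i; nia.
      apply: (sM) => //; apply: (sM); last exact: leqW.
      have qa : (size q <= a.+1)%N by rewrite /a; lia.
      elim: (N - i)%N => [|c IHc]; first by rewrite expr0 size_poly1.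
      by rewrite exprS mulnS; apply: sM.
    rewrite /w /= evM evXn.
    have -> : ev t q ^+ N * ev t qu * (f ^+ i * u j) =
       ev t q ^+ (N - i) * (ev t q * f) ^+ i * (ev t qu * u j).
      rewrite exprMn -{1}(subnK (ltnW (ltn_ord i))) exprD; ring.
    rewrite hU mulr_sumr.
    under [RHS]eq_bigr do rewrite ev_sum mulr_suml.
    rewrite exchange_big; apply: eq_bigr => s _.
    have -> : ev t q ^+ (N - i) * (ev t q * f) ^+ i * (ev t (U j s) * b s) =
      ev t q ^+ (N - i) * ev t (U j s) * ((ev t q * f) ^+ i * b s) by ring.
    rewrite hH mulr_sumr; apply: eq_bigr => l _.
    by rewrite !evM evXn; ring.
  move=> c hc z.
  have /eqP : \sum_j ev f (\poly_(i < N) (if insub i is Some i then c (enum_rank (i, j)) else 0)) * u j = 0.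
    have qq0 : ev t (q ^+ N * qu) != 0 by rewrite ev0P ?mulf_neq0 ?expf_neq0.
    apply: (mulfI qq0); rewrite mulr0 -[RHS]hc.
    rewrite -[RHS](@eq_bigr _ _ _ _ _ _ (fun z => kscale (c (enum_rank ((enum_val z).1, (enum_val z).2))) (w ((enum_val z).1, (enum_val z).2)))); last first.
      by move=> i _; rewrite -!surjective_pairing enum_valK.
    rewrite -(big_enum_val (A := {: I}) (fun z => kscale (c (enum_rank (z.1, z.2))) (w (z.1, z.2)))) /=.
    rewrite -(pair_bigA _ (fun i j => kscale (c (enum_rank (i, j))) (w (i, j)))) /=.
    rewrite exchange_big mulr_sumr; apply: eq_bigr => j _.
    rewrite (ev_coef _ (size_poly _ _)) mulr_suml mulr_sumr; apply: eq_bigr => i _.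
    rewrite coef_poly ltn_ord valK /kscale /w /=; ring.
  move/eqP/iu => /(_ (enum_val z).2)/polyP/(_ (enum_val z).1).
  by rewrite coef_poly ltn_ord coef0 valK -surjective_pairing enum_valK.
rewrite leqNgt; apply/negP => lt_m.
(* If m > n a, the inequality for N gives N <= n (au + 1), which fails for this N. *)
have := dim (n * au.+1).+1; nia.
Qed.
End FunctionField.

(** Used to divide a relation over k[f] by the largest common power of f, so that setting f = 0
    leaves a nontrivial relation between constants. *)
Lemma poly_strip (k : fieldType) m (p : 'I_m -> {poly k}) (j0 : 'I_m) : p j0 != 0 ->
  exists e (q : 'I_m -> {poly k}), (forall i, p i = q i * 'X^e) /\ exists j, (q j).[0] != 0.
Proof.
move: {2}(size (p j0)) (leqnn (size (p j0))) => n; elim: n p => [|n IH] p.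
  by rewrite leqn0 size_poly_eq0 => ->.
move=> sn p0; have [[j hj]|/forallNP h] := pselect (exists j, (p j).[0] != 0).
  by exists 0%N, p; split=> [i|]; [rewrite expr0 mulr1|exists j].
have /choice[q hq] : forall i, exists q, p i = q * 'X.
  move=> i; have /factor_theorem[q] : root (p i) 0 by rewrite /root; apply/negPn/negP/h.
  by rewrite subr0; exists q.
have q0 : q j0 != 0 by apply: contraNneq p0 => q0; rewrite hq q0 mul0r.
have [|e [q' [hq' hj]]] := IH q _ q0; last first.
  by exists e.+1, q'; split=> // i; rewrite hq hq' exprSr mulrA.
by move: sn; rewrite hq size_mulX.
Qed.

(** * Existence of zeros of transcendental functions *)

Section ExistsPlace.
Variables (k : fieldType) (X : curve k).
Local Notation F := (funfield X).
Local Notation place := (place X).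

Definition subring (O : set F) :=
  [/\ forall c, O (const X c), forall a b, O a -> O b -> O (a + b) &
      forall a b, O a -> O b -> O (a * b)].

Section Valuation.
Variables (O : set F) (f : F).
Hypotheses (rO : subring O) (Of : O f) (tf : transc f) (nOf : ~ O f^-1).
Hypothesis vO : forall z, O z \/ O z^-1.

Lemma O1 : O 1. Proof. by case: rO => Oc _ _; rewrite -(rmorph1 (const X)). Qed.
Lemma O0 : O 0. Proof. by case: rO => Oc _ _; rewrite -(rmorph0 (const X)). Qed.
Lemma ON a : O a -> O (- a).
Proof.
by case: rO => Oc _ OM Oa; rewrite -mulN1r -(rmorph1 (const X)) -rmorphN; apply: OM.
Qed.
Lemma OX a n : O a -> O (a ^+ n).
Proof.
case: rO => _ _ OM Oa; elim: n => [|n IH]; first by rewrite expr0; exact: O1.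
by rewrite exprS; apply: OM.
Qed.
Lemma Oev a p : O a -> O (ev a p).
Proof.
case: rO => Oc OD OM Oa; rewrite (ev_coef _ (leqnn _)).
by elim/big_ind : _ => // [|i _]; [exact: O0|apply: OM => //; exact: OX].
Qed.

Definition nonunit : set F := [set z | O z /\ ~ (z != 0 /\ O z^-1)].

Lemma nonunit0 : nonunit 0. Proof. by split; [exact: O0|rewrite eqxx; case]. Qed.

Lemma nonunitM a z : O a -> nonunit z -> nonunit (a * z).
Proof.
case: rO => _ _ OM Oa [Oz nz]; split; first exact: OM.
rewrite mulf_eq0 negb_or => -[/andP[a0 z0] h]; apply: nz; split=> //.
have -> : z^-1 = a * (a * z)^-1 by rewrite invfM mulVKf.
exact: OM.
Qed.

Lemma nonunitD y z : nonunit y -> nonunit z -> nonunit (y + z).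
Proof.
have [->|y0] := eqVneq y 0; first by rewrite add0r.
have [->|z0] := eqVneq z 0; first by rewrite addr0.
case: (rO) => _ OD _ my mz; have [h|h] := vO (y / z).
  have -> : y + z = (y / z + 1) * z by rewrite mulrDl divfK // mul1r.
  by apply: nonunitM => //; apply: OD => //; exact: O1.
have -> : y + z = (1 + (y / z)^-1) * y by rewrite mulrDl mul1r invf_div divfK.
by apply: nonunitM => //; apply: OD => //; exact: O1.
Qed.

Lemma nonunit_sum n (P : pred 'I_n) (E : 'I_n -> F) :
  (forall i, P i -> nonunit (E i)) -> nonunit (\sum_(i | P i) E i).
Proof. by move=> h; elim/big_ind : _ => //; [exact: nonunit0|exact: nonunitD]. Qed.

Lemma nonunit_const c : nonunit (const X c) -> c = 0.
Proof.
case: rO => Oc _ _ [_ nc]; have [//|c0] := eqVneq c 0; case: nc.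
by rewrite const_eq0 -fmorphV.
Qed.

Lemma ev_nonunit z p : nonunit z -> nonunit (ev z p) -> p.[0] = 0.
Proof.
move=> mz mp; have : root (p - (p.[0])%:P) 0 by rewrite /root !hornerE subrr.
move=> /factor_theorem[q]; rewrite subr0 => E.
have {}E : (p.[0])%:P = p - q * 'X by rewrite -E; ring.
apply: nonunit_const; rewrite -(evC z) E evB evM evX -mulNr addrC; apply: nonunitD => //.
by apply: nonunitM => //; apply/ON/Oev; case: mz.
Qed.

(** In a relation stripped of powers of x 0, let j be the last index whose coefficient has nonzero
    constant term, and divide by x j. The earlier terms are nonunits because x i / x j is one; the
    later ones because their coefficients contain a factor x 0, and x 0 / x j lies in O. So the j-th
    coefficient is a nonunit, contradicting its constant term. *)
Lemma chain_findep n (x : nat -> F) : (forall i, (i < n)%N -> nonunit (x i) /\ x i != 0) ->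
  (forall i, (i.+1 < n)%N -> nonunit (x i / x i.+1)) ->
  findep (x 0%N) (fun i : 'I_n => x i).
Proof.
move=> xm xc p E i0; apply/eqP/negPn/negP => p0.
have n0 : (0 < n)%N by have := ltn_ord i0; lia.
have [x0m x00] := xm _ n0.
have [e [q [hq [j0 qj0]]]] := poly_strip p0.
case: (@arg_maxnP _ j0 (fun j => (q j).[0] != 0) (fun j => val j) qj0) => j qj jmax.
have xc' a b : (a < b)%N -> (b < n)%N -> nonunit (x a / x b).
  elim: b => // b IH; rewrite ltnS leq_eqVlt => /orP[/eqP->|ab] bn; first exact: xc.
  have [_ xb0] := xm b (ltnW bn).
  have -> : x a / x b.+1 = x a / x b * (x b / x b.+1).
    by rewrite mulrA divfK.
  by apply: nonunitM; [case: (IH ab (ltnW bn))|exact: xc].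
have Oc a b : (a <= b)%N -> (b < n)%N -> O (x a / x b).
  rewrite leq_eqVlt => /orP[/eqP->|ab] bn; last by case: (xc' _ _ ab bn).
  by rewrite divff; [exact: O1|case: (xm b bn)].
have [_ xj0] := xm j (ltn_ord j).
have Eq : \sum_i ev (x 0%N) (q i) * x i = 0.
  have /mulfI : x 0%N ^+ e != 0 by rewrite expf_neq0.
  apply; rewrite mulr0 -[RHS]E mulr_sumr; apply: eq_bigr => i _.
  by rewrite hq evM evXn evX; ring.
have : nonunit (ev (x 0%N) (q j)).
  have -> : ev (x 0%N) (q j) = \sum_(i | i != j) - ev (x 0%N) (q i) * (x i / x j).
    move/eqP: Eq; rewrite (bigD1 j) //= addr_eq0 => /eqP Eq.
    apply: (mulIf xj0); rewrite Eq -sumrN mulr_suml.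
    by apply: eq_bigr => i _; rewrite -mulrA divfK // mulNr.
  apply: nonunit_sum => i ij; have [lt_ij|le_ji] := ltnP i j.
    by apply: nonunitM; [apply/ON/Oev; case: x0m|exact: xc'].
  have qi : (q i).[0] = 0.
    apply/eqP/negPn/negP => qi; have := jmax i qi; move: ij.
    by rewrite -val_eqE /=; move: le_ji; lia.
  have : root (q i) 0 by rewrite /root qi.
  move=> /factor_theorem[r]; rewrite subr0 => ->.
  rewrite evM evX.
  have -> : - (ev (x 0%N) r * x 0%N) * (x i / x j) = - ev (x 0%N) r * (x 0%N / x j) * x i by ring.
  case: (rO) => _ _ OM; apply: nonunitM; last by case: (xm i).
  by apply: OM; [apply/ON/Oev; case: x0m|exact: Oc].
by move=> /(ev_nonunit x0m)/eqP; rewrite (negPf qj).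
Qed.

Lemma nonunit_f : nonunit f. Proof. by split=> // -[]. Qed.

(** If no nonunit divided all nonunits, one could go on choosing proper divisors f = x 0, x 1, ...
    forever; by [chain_findep] this violates the bound on families independent over k(f). *)
Lemma uniformizer_exists : exists p, [/\ p != 0, nonunit p & forall z, nonunit z -> O (z / p)].
Proof.
apply: contrapT => /forallNP h.
have /choice[nxt hn] : forall p, exists y, p != 0 /\ nonunit p -> [/\ y != 0, nonunit y & nonunit (p / y)].
  move=> p; have [[p0 mp]|] := pselect (p != 0 /\ nonunit p); last by exists 0.
  have [y /not_implyP[my ny]] : exists y, ~ (nonunit y -> O (y / p)).
    by apply/existsNP => hp; apply: (h p).
  have y0 : y != 0.
    by apply/eqP => y0; apply: ny; rewrite y0 mul0r; exact: O0.
  exists y => _; split=> //; split; last by rewrite invf_div => -[].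
  by have [|] := vO (y / p); rewrite ?invf_div.
pose x i := iter i nxt f.
have hx i : x i != 0 /\ nonunit (x i).
  elim: i => [|i IH]; first by split; [exact: transc_neq0|exact: nonunit_f].
  by have [] := hn _ IH.
have [N hN] := findep_bound f.
have /hN : findep f (fun i : 'I_N.+1 => x i); last by rewrite ltnn.
apply: (@chain_findep N.+1 x) => i _; first by case: (hx i).
by have [] := hn _ (hx i).
Qed.

(** Otherwise z is divisible by every power of p, and z, p^N, ..., p is a chain of N + 1 elements
    independent over k(z), for N larger than allowed. *)
Lemma uniformizer_pow p : p != 0 -> nonunit p -> (forall z, nonunit z -> O (z / p)) ->
  forall z, O z -> z != 0 -> exists n, O (z / p ^+ n) /\ O (z / p ^+ n)^-1.
Proof.
move=> p0 mp hp z Oz z0; apply: contrapT => /forallNP h.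
have zn0 n : z / p ^+ n != 0 by rewrite mulf_neq0 // invr_eq0 expf_neq0.
have mz n : nonunit (z / p ^+ n).
  elim: n => [|n IH].
    by split=> [|[_ h0]]; [|apply: (h 0%N); split]; rewrite expr0 divr1 // -[z]divr1 -(expr0 p).
  have Op : O (z / p ^+ n.+1).
    by rewrite exprSr invfM mulrA; apply: hp.
  by split=> // -[_ ?]; apply: (h n.+1).
have := mz 0%N; rewrite expr0 divr1 => mz0.
have [N hN] := findep_bound z.
pose x i := if i is i.+1 then p ^+ (N - i)%N else z.
have /hN : findep z (fun i : 'I_N.+1 => x i); last by rewrite ltnn.
apply: (@chain_findep N.+1 x) => -[|i] iN //; rewrite /x /=.
- split; last by rewrite expf_neq0.
  have -> : (N - i)%N = (N - i).-1.+1 by lia.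
  by rewrite exprSr; apply: nonunitM => //; apply: OX; case: mp.
- by rewrite ?subn0.
- have -> : (N - i)%N = (N - i.+1).+1 by lia.
  by rewrite exprS mulfK // expf_neq0.
Qed.

Lemma valuation_place : exists v : place, 0 < ord v f.
Proof.
have [p [p0 mp hp]] := uniformizer_exists; have [ Op np] := mp.
case: (rO) => Oc OD OM.
pose U := [set z | [/\ z != 0, O z & O z^-1]].
have UM y z : U y -> U z -> U (y * z).
  by move=> [? ? ?] [? ? ?]; split; [rewrite mulf_neq0|apply: OM|rewrite invfM; apply: OM].
have UV z : U z -> U z^-1 by move=> [? ? ?]; split; rewrite ?invrK ?invr_eq0.
have Opn (n : int) : O (p ^ n) -> 0 <= n.
  case: n => // n; rewrite NegzE => On; case: np; split=> //.
  have -> : p^-1 = p ^+ n * p ^ (- n.+1%:Z).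
    by rewrite -exprnN exprSr invfM mulrA divff ?mul1r ?expf_neq0.
  by apply: OM => //; exact: OX.
have Un0 (n : int) : U (p ^ n) -> n = 0.
  move=> [_ /Opn n0]; rewrite invr_expz => /Opn; lia.
have Oz (n : int) : 0 <= n -> O (p ^ n) by case: n => // n _; rewrite -exprnP; apply: OX.
have ex z : z != 0 -> exists n : int, U (z * p ^ (- n)).
  move=> z0; have [ O_z|O_z] := vO z.
    have [n [h1 h2]] := uniformizer_pow p0 mp hp O_z z0; exists n%:Z.
    by rewrite -exprnN; split=> //; rewrite mulf_neq0 // invr_eq0 expf_neq0.
  have z0' : z^-1 != 0 by rewrite invr_eq0.
  have [n [h1 h2]] := uniformizer_pow p0 mp hp O_z z0'; exists (- n%:Z).
  have E : z * p ^ (- - n%:Z) = (z^-1 / p ^+ n)^-1 by rewrite opprK -exprnP invfM !invrK.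
  by split; rewrite E ?invrK // invr_eq0 mulf_neq0 // invr_eq0 expf_neq0.
pose o z : int := if z == 0 then 0 else xget 0 [set n : int | U (z * p ^ (- n))].
have oU z : z != 0 -> U (z * p ^ (- o z)).
  by move=> z0; rewrite /o (negPf z0); have [n Un] := ex z z0; exact: (@xgetPex _ 0 [set n : int | U _] (ex z z0)).
have o_uniq z (n : int) : z != 0 -> U (z * p ^ (- n)) -> o z = n.
  move=> z0 Un; apply/eqP; rewrite -subr_eq0; apply/eqP/Un0.
  have -> : p ^ (o z - n) = (z * p ^ (- n)) * (z * p ^ (- o z))^-1.
    by rewrite invfM invr_expz opprK expfzDr // mulrACA divff // mul1r mulrC.
  by apply: UM => //; apply/UV/oU.
have O_o z : z != 0 -> O z -> 0 <= o z.
  move=> z0 O_z; apply: Opn; have [_ _ h] := oU z z0.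
  have -> : p ^ o z = z * (z * p ^ (- o z))^-1.
    by rewrite invfM mulrA divff // mul1r invr_expz opprK.
  exact: OM.
have oM y z : y != 0 -> z != 0 -> o (y * z) = o y + o z.
  move=> y0 z0; apply: o_uniq; first by rewrite mulf_neq0.
  by rewrite opprD expfzDr // mulrACA; apply: UM; exact: oU.
have oD y z : y != 0 -> z != 0 -> y + z != 0 -> Num.min (o y) (o z) <= o (y + z).
  move=> y0 z0 yz0; set m := Num.min _ _.
  have pm : p ^ (- m) != 0 by rewrite expfz_neq0.
  have opm : o (p ^ (- m)) = - m.
    apply: o_uniq => //; rewrite -expfzDr // opprK addNr expr0z.
    by split; rewrite ?oner_neq0 ?invr1 //; exact: O1.
  have key w : w != 0 -> m <= o w -> O (w * p ^ (- m)).
    move=> w0 mw; have [_ h _] := oU w w0.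
    have -> : w * p ^ (- m) = (w * p ^ (- o w)) * p ^ (o w - m).
      by rewrite -mulrA -expfzDr // addrA addNr add0r.
    by apply: OM => //; apply: Oz; rewrite subr_ge0.
  have : 0 <= o ((y + z) * p ^ (- m)).
    apply: O_o; first by rewrite mulf_neq0.
    by rewrite mulrDl; apply: OD; apply: key => //; rewrite /m ge_min lexx ?orbT.
  by rewrite oM // opm subr_ge0.
have oc c : o (const X c) = 0.
  have [->|c0] := eqVneq c 0; first by rewrite rmorph0 /o eqxx.
  apply: o_uniq; first by rewrite const_eq0.
  by rewrite oppr0 expr0z mulr1; split; rewrite ?const_eq0 // -fmorphV.
have os : exists z, o z = 1.
  exists p; apply: o_uniq => //; rewrite -[X in X * _]expr1z -expfzDr // subrr expr0z.
  by split; rewrite ?oner_neq0 ?invr1 //; exact: O1.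
have o0 : o 0 = 0 by rewrite /o eqxx.
exists (Place o0 oM oD oc os) => /=; rewrite lt_neqAle O_o ?andbT //; last exact: transc_neq0.
apply/eqP => of0; have := oU f (transc_neq0 tf); rewrite -of0 oppr0 expr0z mulr1.
by case.
Qed.
End Valuation.

(** Chevalley's argument. Let O be maximal among the rings containing k and f but not 1/f. If z and
    1/z were both outside O, adjoining either one would produce 1/f, so 1 would be a polynomial in
    z, and another one in 1/z, with coefficients in f O. Relations of least degree can be played off
    against each other. *)
Lemma exists_zero f : transc f -> exists v : place, 0 < ord v f.
Proof.
move=> tf; have f0 := transc_neq0 tf.
pose good (O : set F) := [/\ subring O, O f & ~ O f^-1].
have [| O [gO maxO]] := @Zorn_bigcup F [set O | O = set0 \/ good O].
  move=> C CP totC.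
  have [[ O [CO gO]]|/forallNP h] := pselect (exists O, C O /\ good O); last first.
    left; apply/seteqP; split=> // z [ O CO Oz].
    by have [ O0|gO] := CP O CO; [rewrite O0 in Oz|case: (h O)].
  right; have dir O1 O2 a b : C O1 -> C O2 -> O1 a -> O2 b ->
      exists O', [/\ C O', good O', O' a & O' b].
    move=> C1 C2 Oa Ob; have gd O' c : C O' -> O' c -> good O'.
      by move=> CO' Oc; have [E|//] := CP O' CO'; rewrite E in Oc.
    have [s|s] := totC _ _ C1 C2.
      by exists O2; split=> //; [exact: gd Ob|exact: s].
    by exists O1; split=> //; [exact: gd Oa|exact: s].
  have [[ Oc OD OM] Of nOf] := gO.
  split; [split| |].
  - by move=> c; exists O.
  - move=> a b [ O1 C1 Oa] [ O2 C2 Ob]; have [ O' [CO' [[_ D _] _ _] ? ?]] := dir _ _ _ _ C1 C2 Oa Ob.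
    by exists O' => //; apply: D.
  - move=> a b [ O1 C1 Oa] [ O2 C2 Ob]; have [ O' [CO' [[_ _ D] _ _] ? ?]] := dir _ _ _ _ C1 C2 Oa Ob.
    by exists O' => //; apply: D.
  - by exists O.
  - move=> [ O1 C1 Oa]; have [ O' [CO' [_ _ n] ? ?]] := dir _ _ _ _ C1 C1 Oa Oa.
    exact: n.
have {gO}[rO Of nOf] : good O.
  (* The maximal set is not empty, since k[f] is good. *)
  case: gO => // O0; exfalso; apply: (maxO (range (ev f))).
    by rewrite O0; split=> // h; apply: (h (ev f 0)); exists 0.
  right; split; [split| |].
  - by move=> c; exists c%:P => //; rewrite evC.
  - by move=> _ _ [p _ <-] [q _ <-]; exists (p + q) => //; rewrite evD.
  - by move=> _ _ [p _ <-] [q _ <-]; exists (p * q) => //; rewrite evM.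
  - by exists 'X => //; rewrite evX.
  - move=> [p _ E]; have /tf : ev f (p * 'X - 1) = 0.
      by rewrite evB evM evX ev1 E mulVf // subrr.
    move=> /(congr1 (fun p => p.[0])); rewrite hornerD hornerN hornerM hornerX !hornerC mulr0 => /eqP.
    by rewrite add0r oppr_eq0 oner_eq0.
apply: (@valuation_place O f) => // z.
case: (rO) => Oc OD OM.
have [//|zO] := pselect (O z); first by left.
have [//|zO'] := pselect (O z^-1); first by right.
exfalso.
have z0 : z != 0 by apply/eqP => z0; apply: zO; rewrite z0 -(rmorph0 (const X)).
have O_0 : O 0 by rewrite -(rmorph0 (const X)).
have O_1 : O 1 by rewrite -(rmorph1 (const X)).
pose I : set F := [set a | O (a / f)].
have IO a : I a -> O a by move=> Ia; rewrite -(divfK f0 a); apply: OM.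
have ID a b : I a -> I b -> I (a + b) by rewrite /I /= => ? ?; rewrite mulrDl; apply: OD.
have IM a b : O a -> I b -> I (a * b) by rewrite /I /= => ? ?; rewrite -mulrA; apply: OM.
have O_N a : O a -> O (- a).
  by move=> ?; rewrite -mulN1r -(rmorph1 (const X)) -rmorphN; apply: OM.
have Osum n (E : 'I_n -> F) : (forall i, O (E i)) -> O (\sum_i E i).
  by move=> h; elim/big_ind : _.
(* [D y n] says that 1 is a polynomial in y of degree less than n with coefficients in the ideal I =
   f O. *)
pose D y n := exists q : {poly F}, [/\ (size q <= n)%N, forall i, I q`_i & q.[y] = 1].
have DP y : ~ O y -> exists n, D y n.
  move=> yO; pose S := [set a | exists q : {poly F}, (forall i, O q`_i) /\ a = q.[y]].
  have OS : O `<` S.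
    split=> [a Oa|h]; last by apply: yO; apply: h; exists 'X; rewrite hornerX; split=> // i; rewrite coefX; case: eqP.
    by exists a%:P; rewrite hornerC; split=> // i; rewrite coefC; case: eqP.
  have [q [qO Ey]] : S f^-1.
    apply: contrapT => nS; apply: (maxO S OS); right.
    split=> //; last by apply: OS.1.
    split=> [c|a b [q [qO ->]] [r [rO' ->]]|a b [q [qO ->]] [r [rO' ->]]].
    - by apply: OS.1.
    - by exists (q + r); rewrite hornerD; split=> // i; rewrite coefD; apply: OD.
    - exists (q * r); rewrite hornerM; split=> // i; rewrite coefM.
      by apply: Osum => j; apply: OM.
  exists (size (f *: q)), (f *: q); split=> // [i|].
    by rewrite /I /= coefZ mulrAC divff // mul1r.
  by rewrite hornerZ -Ey divff.
have Dle y n n' : (n <= n')%N -> D y n -> D y n'.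
  by move=> nn' [q [? ? ?]]; exists q; split=> //; apply: leq_trans nn'.
(* Multiply q(y) = 1 by 1 - r_0 and replace (1 - r_0) y^n by the sum of the r_i y^(n - i), i >= 1,
   which is r(1/y) = 1 times y^n. The degree in y drops. *)
have main y n m : y != 0 -> (m <= n)%N -> D y n.+1 -> D y^-1 m.+1 -> D y n.
  move=> y0 mn [q [sq Iq qy]] [r [sr Ir ry]].
  pose q' := (r`_0)%:P + (1 - r`_0) *: \poly_(i < n) q`_i +
     q`_n *: \poly_(i < n) (if (n - i <= m)%N then r`_(n - i) else 0).
  exists q'; split.
  - rewrite /q'; have [n0|n0] := posnP n.
      subst n; move: mn; rewrite leqn0 => /eqP m0; subst m.
      move: qy; rewrite (horner_coef_wide _ sq) big_ord1 expr0 mulr1 => q1.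
      by case: nOf; have := Iq 0%N; rewrite /I /= q1 mul1r.
    apply: leq_trans (size_polyD _ _) _; rewrite geq_max; apply/andP; split.
      apply: leq_trans (size_polyD _ _) _; rewrite geq_max; apply/andP; split.
        by rewrite size_polyC; case: eqP.
      by apply: leq_trans (size_scale_leq _ _) (size_poly _ _).
    by apply: leq_trans (size_scale_leq _ _) (size_poly _ _).
  - move=> i; rewrite /q' !coefD !coefZ !coef_poly; apply: (ID); first apply: ID.
    + by rewrite coefC; case: eqP => _; [exact: Ir|rewrite /I /= mul0r].
    + apply: IM; last by case: ltnP => _; [exact: Iq|rewrite /I /= mul0r].
      by apply: OD => //; apply/O_N/IO.
    + rewrite mulrC; apply: IM => //; case: ltnP => // _; case: leqP => // _.
      exact/IO.
  - rewrite /q' !hornerD !hornerZ hornerC.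
    have qn : (\poly_(i < n) q`_i).[y] = 1 - q`_n * y ^+ n.
      by rewrite horner_poly -[in RHS]qy (horner_coef_wide _ sq) big_ord_recr /= addrK.
    have rn : (\poly_(i < n) (if (n - i <= m)%N then r`_(n - i) else 0)).[y] = (1 - r`_0) * y ^+ n.
      rewrite horner_poly -ry (horner_coef_wide _ (n := n.+1)); last exact: leq_trans sr _.
      rewrite big_ord_recl expr0 mulr1 addrAC subrr add0r mulr_suml.
      rewrite (reindex_inj rev_ord_inj); apply: eq_bigr => i _ /=.
      rewrite subKn // /bump /= add1n; case: (leqP i.+1 m) => h.
        rewrite -mulrA; congr (_ * _).
        have -> : y ^+ n = y ^+ (n - i.+1) * y ^+ i.+1 by rewrite -exprD subnK.
        by rewrite exprVn mulrCA mulVf ?mulr1 // expf_neq0.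
      by rewrite nth_default ?mul0r // (leq_trans sr).
    rewrite qn rn; ring.
have nD0 y : ~ D y 0%N.
  move=> [q [+ _ qy]]; rewrite leqn0 size_poly_eq0 => /eqP q0.
  by move/eqP: qy; rewrite q0 horner0 eq_sym oner_eq0.
have [n Dn] := DP z zO; have [m Dm] := DP _ zO'.
move: {2}(n + m)%N (leqnn (n + m)) => N; elim: N n m Dn Dm => [|N IH] n m Dn Dm.
  rewrite leqn0 addn_eq0 => /andP[/eqP n0 _]; rewrite n0 in Dn; exact: nD0 Dn.
case: n Dn => [/nD0//|n] Dn; case: m Dm => [/nD0//|m] Dm nmN.
have [mn|nm] := leqP m n.
  by apply: (IH n m.+1 (main _ _ _ z0 mn Dn Dm) Dm); lia.
apply: (IH n.+1 m Dn); last by lia.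
apply: (main _ _ n); rewrite ?invr_eq0 ?invrK //; exact: ltnW.
Qed.

End ExistsPlace.

(** * Divisors *)

Lemma finite_bounded (T : eqType) (A : set T) N :
  (forall s : seq T, uniq s -> (forall a, a \in s -> A a) -> (size s <= N)%N) -> finite_set A.
Proof.
move=> h.
pose P m := `[< exists s : seq T, [/\ uniq s, forall a, a \in s -> A a & size s = m] >].
have P0 : exists m, P m by exists 0%N; apply/asboolP; exists [::].
have PN m : P m -> (m <= N)%N by move=> /asboolP[s [us sA <-]]; exact: h.
case: (ex_maxnP P0 PN) => m /asboolP[s [us sA sm]] smax.
apply: (@sub_finite_set _ _ [set` s]) => // a Aa /=; apply/negPn/negP => as'.
have /smax : P m.+1; last by rewrite ltnn.
apply/asboolP; exists (a :: s); rewrite /= as' us sm; split=> // b.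
by rewrite inE => /orP[/eqP->//|/sA].
Qed.

Section Divisors.
Variables (k : fieldType) (X : curve k).
Local Notation F := (funfield X).
Local Notation place := (place X).
Implicit Types (v w : place) (f g : F) (D E : place -> int).

Lemma divisor0 : divisor X (0 : place -> int).
Proof. by apply: sub_finite_set (finite_set0 place) => v /eqP[]. Qed.

Lemma divisor_sub D E : divisor X D -> divisor X E ->
  forall D', (forall v, D v = 0 -> E v = 0 -> D' v = 0) -> divisor X D'.
Proof.
move=> dD dE D' h; apply: (@sub_finite_set _ _ ([set v | D v != 0] `|` [set v | E v != 0])).
  move=> v /= /eqP D'v; apply: contrapT => /not_orP[/negP/negPn/eqP a /negP/negPn/eqP b].
  exact/D'v/h.
by rewrite finite_setU.
Qed.

Lemma divisorD D E : divisor X D -> divisor X E -> divisor X (D + E).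
Proof. by move=> dD dE; apply: (divisor_sub dD dE) => v; rewrite fctE => -> ->. Qed.

Lemma divisorN D : divisor X D -> divisor X (- D).
Proof. by move=> dD; apply: (divisor_sub dD dD) => v; rewrite fctE => ->. Qed.

Lemma divisorB D E : divisor X D -> divisor X E -> divisor X (D - E).
Proof. by move=> dD dE; apply: divisorD => //; exact: divisorN. Qed.

Lemma divisor_point v : divisor X (Defs.point v).
Proof.
apply: sub_finite_set (finite_set1 v) => w /=; rewrite /Defs.point.
by case: (w =P v) => //= _; rewrite eqxx.
Qed.

Lemma divisorMn D n : divisor X D -> divisor X (D *+ n).
Proof.
move=> dD; elim: n => [|n IH]; first by rewrite mulr0n; exact: divisor0.
by rewrite mulrS; exact: divisorD.
Qed.

Lemma divisorMz D (n : int) : divisor X D -> divisor X (D *~ n).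
Proof.
move=> dD; case: n => n; first exact: divisorMn.
by rewrite NegzE mulrNz; apply/divisorN/divisorMn.
Qed.

Lemma divisor_seq D : divisor X D ->
  exists s : seq place, uniq s /\ forall v, D v != 0 -> v \in s.
Proof.
move=> /finite_seqP[s Es]; exists (undup s); split; first exact: undup_uniq.
move=> v Dv; rewrite mem_undup.
by have : [set v | D v != 0] v by []; rewrite Es.
Qed.

Lemma div_ind (P : (place -> int) -> Prop) : P 0 ->
  (forall D v, divisor X D -> P D -> P (D + Defs.point v)) ->
  (forall D v, divisor X D -> P D -> P (D - Defs.point v)) ->
  forall D, divisor X D -> P D.
Proof.
move=> P0 Pp Pm D dD; have [s [_ hs]] := divisor_seq dD.
elim: s D dD hs => [|v s IH] D dD hs.
  suff -> : D = 0 by [].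
  by apply/funext => v; apply/eqP/negPn/negP => /hs.
pose D0 : place -> int := fun w => if w == v then 0 else D w.
have dD0 : divisor X D0.
  by apply: (divisor_sub dD dD) => w; rewrite /D0; case: eqP.
have PD0 : P D0.
  apply: IH => // w; rewrite /D0; case: (w =P v) => [_|wv /hs]; first by rewrite eqxx.
  by rewrite inE => /orP[/eqP|].
have -> : D = D0 + Defs.point v *~ D v.
  apply/funext => w; rewrite -[RHS]/(D0 w + (Defs.point v *~ D v) w).
  have -> : (Defs.point v *~ D v) w = (w == v)%:R * D v.
    have Pn n : (Defs.point v *+ n) w = (w == v)%:R * n%:Z.
      elim: n => [|n IHn]; first by rewrite mulr0n mulr0.
      by rewrite mulrS fctE IHn /Defs.point intS mulrDr mulr1.
    case: (D v) => n; first by rewrite -pmulrn Pn.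
    by rewrite NegzE mulrNz fctE -pmulrn Pn mulrN.
  by rewrite /D0; case: eqP => [->|]; rewrite ?mul1r ?add0r ?mul0r ?addr0.
elim/int_ind: (D v) => [|n IHn|n IHn].
- by rewrite mulr0z addr0.
- rewrite intS mulrzDr mulr1z [Defs.point v + _]addrC addrA; apply: Pp => //.
  by apply: divisorD => //; apply/divisorMz/divisor_point.
- rewrite intS opprD mulrzDr mulrN1z [- Defs.point v + _]addrC addrA; apply: Pm => //.
  by apply: divisorD => //; apply/divisorMz/divisor_point.
Qed.

Lemma eff_ind (P : (place -> int) -> Prop) : P 0 ->
  (forall D v, divisor X D -> (forall w, 0 <= D w) -> P D -> P (D + Defs.point v)) ->
  forall D, divisor X D -> (forall w, 0 <= D w) -> P D.
Proof.
move=> P0 Pp D dD D0; have [s [us hs]] := divisor_seq dD.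
move: {2}(\sum_(v <- s) absz (D v))%N (leqnn (\sum_(v <- s) absz (D v)))%N => N.
elim: N D dD D0 hs => [|N IH] D dD D0 hs hN.
  suff -> : D = 0 by [].
  apply/funext => v; apply/eqP/negPn/negP => Dv; have vs := hs _ Dv.
  by move: hN; rewrite (big_rem v) //= leqn0 addn_eq0 absz_eq0 (negPf Dv).
have [h|/existsNP[v Dv]] := pselect (forall v, D v = 0).
  by suff -> : D = 0 by []; exact/funext.
have vD : 0 < D v by rewrite lt_neqAle D0 eq_sym andbT; exact/eqP.
have Ew w : (D - Defs.point v) w = D w - (w == v)%:R by [].
rewrite -(subrK (Defs.point v) D); apply: Pp.
- by apply: divisorB => //; exact: divisor_point.
- move=> w; rewrite Ew; case: (w =P v) => [->|_]; last by rewrite subr0.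
  by move: vD; lia.
- apply: IH => //.
  + by apply: divisorB => //; exact: divisor_point.
  + move=> w; rewrite Ew; case: (w =P v) => [->|_]; last by rewrite subr0.
    by move: vD; lia.
  + move=> w; rewrite Ew; case: (w =P v) => [->|_]; last by rewrite subr0 => /hs.
    by move=> _; apply/hs/eqP.
  + have vs : v \in s by apply/hs/eqP.
    have Es : (\sum_(w <- rem v s) absz ((D - Defs.point v)%R w) = \sum_(w <- rem v s) absz (D w))%N.
      apply: eq_big_seq => w; rewrite (mem_rem_uniq v us) inE => /andP[/negPf wv _].
      by rewrite Ew wv subr0.
    move: hN; rewrite !(big_rem v vs) /= Es Ew eqxx.
    set S := (\sum_(w <- _) _)%N; have -> : true%:R = 1 :> int by [].
    by move: vD; lia.
Qed.
End Divisors.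

(** * Degrees of places and of divisors *)

Section Degree.
Variables (k : fieldType) (X : curve k).
Local Notation F := (funfield X).
Local Notation place := (place X).
Implicit Types (v w : place) (f g : F) (D E : place -> int).

Lemma vge_ev0 v (e : int) f p : 0 <= e -> vge v e f -> vge v e (ev f p - const X p.[0]).
Proof.
move=> e0 hf; have f0 : vge v 0 f by apply: vgeW hf.
have : root (p - (p.[0])%:P) 0 by rewrite /root !hornerE subrr.
move=> /factor_theorem[q]; rewrite subr0 => E.
rewrite -(evC f) -evB E evM evX -[e]add0r; apply: vgeM => //.
rewrite (ev_coef _ (leqnn _)); apply: vge_sum => i _.
rewrite -[0]addr0; apply: vgeM; first exact: vge_const.
elim: (nat_of_ord i) => [|n IH]; first by rewrite expr0 -(rmorph1 (const X)); exact: vge_const.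
by rewrite exprS -[0]addr0; apply: vgeM.
Qed.

(** A relation over k[f], divided by the largest common power of f, reduces modulo f to a relation
    between the constant terms. So independence over k modulo an ideal containing f lifts to
    independence over k(f). *)
Lemma local_findep (S : set place) E f m (z : 'I_m -> F) :
  (forall v, S v -> [/\ 0 <= E v, vge v (E v) f & forall i, vge v 0 (z i)]) ->
  (forall c : 'I_m -> k, (forall v, S v -> vge v (E v) (\sum_i kscale (c i) (z i))) ->
     forall i, c i = 0) ->
  f != 0 -> findep f z.
Proof.
move=> hS hz f0 p Ep i0; apply/eqP/negPn/negP => p0.
have [e [q [hq [j qj]]]] := poly_strip p0.
have Eq : \sum_i ev f (q i) * z i = 0.
  have /mulfI : f ^+ e != 0 by rewrite expf_neq0.
  apply; rewrite mulr0 -[RHS]Ep mulr_sumr; apply: eq_bigr => i _.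
  by rewrite hq evM evXn evX; ring.
case/eqP: qj; apply: (hz (fun i => (q i).[0])) => v Sv; have [Ev vf vz] := hS v Sv.
have -> : \sum_i kscale (q i).[0] (z i) = \sum_i - ((ev f (q i) - const X (q i).[0]) * z i).
  rewrite sumrN; apply/eqP; rewrite -addr_eq0 -big_split /=; apply/eqP.
  by rewrite -[RHS]Eq; apply: eq_bigr => i _; rewrite /kscale; ring.
apply: vge_sum => i _; apply/vgeN; rewrite -[E v]addr0; apply: vgeM => //.
exact: vge_ev0.
Qed.

(** Elements whose residues are independent over k are independent over k(pi) for a uniformizer pi,
    and the size of such families is bounded. *)
Lemma residue_dim v : exists d, quotient_dim (@kscale _ X) (regular v) (maximal_ideal v) d.
Proof.
have [N hN] := findep_bound (unif v).
rewrite regularE maximal_idealE; apply: (qdim_bound (kscaling X) (N := N)).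
  exact: vge_subsp.
move=> m u Au iu; apply: (hN m u).
apply: (@local_findep [set v] (fun=> 1)); last exact: unif_neq0.
  by move=> _ ->; split=> //; right; rewrite ord_unif.
by move=> c h; apply: iu; exact: h.
Qed.

Lemma pdegP v : quotient_dim (@kscale _ X) (vge v 0) (vge v 1) (pdeg v).
Proof.
rewrite -regularE -maximal_idealE; exact: (xgetPex 0%N (residue_dim v)).
Qed.

Lemma pdeg_gt0 v : (0 < pdeg v)%N.
Proof.
rewrite lt0n; apply/eqP => d0; have := pdegP v; rewrite d0.
move/(qdim_eq0 (kscaling X) _ (vge_subsp v 1))/(_ 1) => h.
have : vge v 1 1 by apply: h; right; rewrite ord_one.
by rewrite vge_ord ?oner_eq0 // ord_one.
Qed.

Lemma div_deg_seq D (s : seq place) : uniq s -> (forall v, D v != 0 -> v \in s) ->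
  div_deg D = \sum_(v <- s) (pdeg v)%:Z * D v.
Proof.
move=> us hs; rewrite /div_deg (fsbigE s) //.
  by apply: eq_bigl => v; rewrite in_setT.
by move=> v _ vs; apply/eqP; rewrite mulf_eq0; apply/orP; right; apply: contraNT vs => /hs.
Qed.

Lemma div_degD D E : divisor X D -> divisor X E -> div_deg (D + E) = div_deg D + div_deg E.
Proof.
move=> dD dE; have [s [us hs]] := divisor_seq dD; have [r [ur hr]] := divisor_seq dE.
pose q := undup (s ++ r).
have uq : uniq q by exact: undup_uniq.
have h v : D v != 0 \/ E v != 0 -> v \in q.
  by rewrite mem_undup mem_cat => -[/hs|/hr] ->; rewrite ?orbT.
rewrite !(@div_deg_seq _ q) //; first by rewrite -big_split /=; apply: eq_bigr => v _; rewrite fctE mulrDr.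
- by move=> v Ev; apply: h; right.
- by move=> v Ev; apply: h; left.
- move=> v DEv; apply: h; have [D0|D0] := eqVneq (D v) 0; last by left.
  by right; move: DEv; rewrite fctE D0 add0r.
Qed.

Lemma div_deg0 : div_deg (0 : place -> int) = 0.
Proof. by rewrite (@div_deg_seq _ [::]) ?big_nil // => v; rewrite eqxx. Qed.

Lemma div_degN D : divisor X D -> div_deg (- D) = - div_deg D.
Proof.
move=> dD; apply/eqP; rewrite -addr_eq0 -div_degD //; last exact: divisorN.
by rewrite addNr div_deg0.
Qed.

Lemma div_degB D E : divisor X D -> divisor X E -> div_deg (D - E) = div_deg D - div_deg E.
Proof. by move=> dD dE; rewrite div_degD ?div_degN //; exact: divisorN. Qed.

Lemma div_deg_point v : div_deg (Defs.point v) = (pdeg v)%:Z.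
Proof.
rewrite (@div_deg_seq _ [:: v]) //; first by rewrite big_seq1 /Defs.point eqxx mulr1.
by move=> w; rewrite /Defs.point inE; case: (w =P v) => //=; rewrite eqxx.
Qed.

Lemma div_degMn D n : divisor X D -> div_deg (D *+ n) = div_deg D * n%:Z.
Proof.
move=> dD; elim: n => [|n IH]; first by rewrite mulr0n div_deg0 mulr0.
by rewrite mulrS div_degD ?IH //; [rewrite intS mulrDr mulr1|exact: divisorMn].
Qed.

Lemma div_degMz D (n : int) : divisor X D -> div_deg (D *~ n) = div_deg D * n.
Proof.
move=> dD; case: n => n; first exact: div_degMn.
by rewrite NegzE mulrNz div_degN ?div_degMn ?mulrN //; exact: divisorMn.
Qed.

Lemma div_deg_ge0 D : divisor X D -> (forall v, 0 <= D v) -> 0 <= div_deg D.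
Proof.
move=> dD D0; have [s [us hs]] := divisor_seq dD.
by rewrite (div_deg_seq us hs); apply: sumr_ge0 => v _; rewrite mulr_ge0.
Qed.

(** Weil's space of families whose poles are bounded by D at every place. *)
Definition Wsp D : set (place -> F) := [set a | forall v, vge v (- D v) (a v)].

Definition ascale (c : k) (a : place -> F) : place -> F := fun v => const X c * a v.

Lemma ascaling : scaling ascale.
Proof.
split=> [u|a b u|a b u|a u w]; apply/funext => v; rewrite /ascale ?fctE.
- by rewrite rmorph1 mul1r.
- by rewrite mulrA rmorphM.
- by rewrite rmorphD mulrDl.
- by rewrite mulrDr.
Qed.

Lemma ascaleE n (c : 'I_n -> k) (a : 'I_n -> place -> F) v :
  (\sum_i ascale (c i) (a i)) v = \sum_i kscale (c i) (a i v).
Proof. by rewrite fct_sumE. Qed.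

Lemma Wsp_subsp D : subsp ascale (Wsp D).
Proof.
split=> [v|a b ha hb v|c a ha v]; first exact: vge0.
  exact: vgeD.
by have [_ _ h] := vge_subsp v (- D v); exact: h.
Qed.

Lemma vge_step v (n : int) : quotient_dim (@kscale _ X) (vge v n) (vge v (n + 1)) (pdeg v).
Proof.
have u0 := unifz_neq0 v n.
apply/(qdim_map (kscaling X) (kscaling X) (phi := fun f => unif v ^ n * f) (A := vge v 0)
   (B := vge v 1)); last exact: pdegP.
- by move=> f g; rewrite mulrDr.
- by move=> c f; rewrite /kscale mulrCA.
- exact: vge_subsp.
- exact: vge_subsp.
- by move=> f vf; apply/vgeMl => //; rewrite ord_unifz subrr.
- move=> g vg; exists (unif v ^ (- n) * g).
    by apply/vgeMl; rewrite ?unifz_neq0 // ord_unifz opprK add0r.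
  by rewrite mulrA -expfzDr ?unif_neq0 // subrr expr0z mul1r subrr; left.
- exact: vge_subsp.
- by move=> f _; rewrite vgeMl // ord_unifz addrAC subrr add0r.
Qed.

Lemma Wsp_le D E : (forall v, D v <= E v) -> Wsp D `<=` Wsp E.
Proof. by move=> h a ha v; apply: vgeW (ha v); rewrite lerN2. Qed.

Lemma le_point D v w : D w <= (D + Defs.point v) w.
Proof. by rewrite fctE lerDl /Defs.point; case: eqP. Qed.

Lemma Wsp_step D v : quotient_dim ascale (Wsp (D + Defs.point v)) (Wsp D) (pdeg v).
Proof.
apply/(qdim_map ascaling (kscaling X) (phi := fun a => a v) (A' := vge v (- D v - 1))
   (B' := vge v (- D v - 1 + 1))); last exact: vge_step.
- by [].
- by [].
- exact: Wsp_subsp.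
- exact: vge_subsp.
- by move=> a /(_ v); rewrite fctE /Defs.point eqxx opprD.
- move=> f vf; exists (fun w => if w == v then f else 0).
    move=> w; case: (w =P v) => [->|_]; last exact: vge0.
    by rewrite fctE /Defs.point eqxx opprD.
  by rewrite eqxx subrr; exact: vge0.
- exact: Wsp_subsp.
- move=> a ha; rewrite subrK; split=> [|h w]; first exact.
  have [->//|wv] := eqVneq w v.
  by have := ha w; rewrite fctE /Defs.point (negPf wv) addr0.
Qed.

Lemma Wsp_dim D E : divisor X E -> (forall v, 0 <= E v) ->
  exists2 d, quotient_dim ascale (Wsp (D + E)) (Wsp D) d & d%:Z = div_deg E.
Proof.
move=> dE E0; move: E dE E0; apply: eff_ind => [|E v dE E0 [d hd Ed]].
  exists 0%N; last by rewrite div_deg0.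
  by apply/(qdim_eq0 ascaling); [exact: Wsp_subsp|rewrite addr0].
exists (pdeg v + d)%N.
  apply: (qdim_add ascaling (C := Wsp (D + E))) => //; try exact: Wsp_subsp.
  - by apply: Wsp_le => w; rewrite fctE lerDl.
  - by rewrite addrA; apply: Wsp_le => w; exact: le_point.
  - by rewrite addrA; exact: Wsp_step.
by rewrite PoszD Ed (div_degD dE (divisor_point v)) div_deg_point addrC.
Qed.

(** Representatives of a basis of W(0) / W(-E) are approximated on the support of E by functions.
    These are independent modulo the zeros of f, hence over k(f), so the dimension deg E is at most
    N. *)
Lemma zeros_bound f N : f != 0 ->
  (forall m (u : 'I_m -> F), findep f u -> (m <= N)%N) ->
  forall E, divisor X E -> (forall v, 0 <= E v) -> (forall v, 0 < E v -> E v <= ord v f) ->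
  div_deg E <= N%:Z.
Proof.
move=> f0 hN E dE E0 Ef; have [s [us hs]] := divisor_seq dE.
have [d] := @Wsp_dim (- E) E dE E0; rewrite addNr => /(qdimP ascaling _ _ (Wsp_subsp _))[a [aW ia _]] <-.
pose K := (\sum_(v <- s) absz (E v))%N.
have EK v : v \in s -> E v <= K%:Z.
  by move=> vs; have : (absz (E v) <= K)%N; [rewrite /K (big_rem v) //= leq_addr|lia].
have /choice[z hz] : forall i, exists z, forall v, v \in s -> vge v K%:Z (z - a i v).
  by move=> i; exact: weak_approx.
rewrite lez_nat; apply: (hN d z); apply: (@local_findep [set v | 0 < E v] E) => //.
  move=> v /= Ev; split=> // [|i]; first by right; exact: Ef.
  rewrite -(subrK (a i v) (z i)); apply: vgeD; last by have := aW i v; rewrite oppr0.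
  by apply: vgeW (hz i v _); last by apply: hs; rewrite gt_eqF.
move=> c hc; apply: ia => v; rewrite fctE opprK ascaleE.
have [Ev|Ev] := ltP 0 (E v); last first.
  have -> : E v = 0 by apply/eqP; rewrite eq_le Ev E0.
  have [_ _ hs'] := vge_subsp v 0; apply: vge_sum => i _; apply: hs'.
  by have := aW i v; rewrite oppr0.
have vs : v \in s by apply: hs; rewrite gt_eqF.
have -> : \sum_i kscale (c i) (a i v) = \sum_i kscale (c i) (z i) - \sum_i kscale (c i) (z i - a i v).
  by rewrite -sumrB; apply: eq_bigr => i _; rewrite -(scB (kscaling X)) subKr.
apply: vgeB; first exact: hc.
apply: vge_sum => i _; have [_ _ hs'] := vge_subsp v (E v); apply: hs'.
by apply: vgeW (hz i v vs); exact: EK.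
Qed.

End Degree.

(** * Riemann's theorem *)

Section Riemann.
Variables (k : fieldType) (X : curve k).
Local Notation F := (funfield X).
Local Notation place := (place X).
Implicit Types (v w : place) (f g : F) (D E : place -> int).
Local Notation scF := (kscaling X).
Local Notation scA := (ascaling X).

Lemma exists_transc : exists t : F, transc t.
Proof. by have [t [tt _]] := function_field_basis X; exists t. Qed.

Lemma exists_place : exists v : place, True.
Proof. by have [t /exists_zero[v _]] := exists_transc; exists v. Qed.

Lemma transcV f : transc f -> transc f^-1.
Proof.
by move=> /exists_zero[v vf]; apply: (@ord_transc _ _ v); rewrite ordV oppr_eq0 gt_eqF.
Qed.

(** A finite set of zeros, seen as a reduced divisor, has degree at least its size, and
    [zeros_bound] limits that degree. *)
Lemma finite_zeros f : f != 0 -> finite_set [set v | 0 < ord v f].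
Proof.
move=> f0; have [N hN] := findep_bound f.
apply: (@finite_bounded _ _ N) => s us hs.
have ds : divisor X (fun v => (v \in s)%:R).
  apply: (@sub_finite_set _ _ [set` s]) => // v /=; by case: (v \in s) => // /eqP[].
have h := zeros_bound f0 hN ds.
have : div_deg (fun v : place => (v \in s)%:R) <= N%:Z.
  apply: h => v; first by case: (v \in s).
  by case: (boolP (v \in s)) => [/hs /=|_]; rewrite ?ltxx //; lia.
rewrite (div_deg_seq us); last by move=> v; case: (v \in s); rewrite ?eqxx.
have : ((size s)%:Z <= \sum_(v <- s) (pdeg v)%:Z * (v \in s)%:R).
  rewrite -[X in X%:Z <= _]sum1_size -natz natr_sum big_seq [X in _ <= X]big_seq.
  by apply: ler_sum => v ->; rewrite mulr1 lez_nat pdeg_gt0.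
by move=> a b; rewrite -lez_nat; apply: le_trans a b.
Qed.

Lemma divisor_principal f : f != 0 -> divisor X (principal f).
Proof.
move=> f0; apply: (@sub_finite_set _ _ ([set v | 0 < ord v f] `|` [set v | 0 < ord v f^-1])).
  by move=> v /=; rewrite ordV /principal; lia.
by rewrite finite_setU; split; apply: finite_zeros; rewrite ?invr_eq0.
Qed.

Lemma principalM f g : f != 0 -> g != 0 -> principal (f * g) = principal f + principal g :> (place -> int).
Proof. by move=> f0 g0; apply/funext => v; rewrite /principal ordM. Qed.

Lemma principalV f : principal f^-1 = - principal f :> (place -> int).
Proof. by apply/funext => v; rewrite /principal ordV. Qed.

Definition Lsp D : set F := [set f | forall v, vge v (- D v) f].

Lemma Lsp_subsp D : subsp (@kscale _ X) (Lsp D).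
Proof.
split=> [v|f g hf hg v|c f hf v]; [exact: vge0|exact: vgeD|].
by have [_ _ h] := vge_subsp v (- D v); exact: h.
Qed.

Lemma Lsp_le D E : (forall v, D v <= E v) -> Lsp D `<=` Lsp E.
Proof. by move=> h f hf v; apply: vgeW (hf v); rewrite lerN2. Qed.

(** A nonzero f with a zero is transcendental, so 1/f has a zero too and f has a pole. Consequently
    L(0) embeds into a residue field. *)
Lemma Lsp0_zero v f : Lsp 0 f -> vge v 1 f -> f = 0.
Proof.
move=> h [//|vf]; have [//|f0] := eqVneq f 0.
have /transcV/exists_zero[w] : transc f by apply: (@ord_transc _ _ v); lia.
have := h w; rewrite oppr0 vge_ord // ordV; lia.
Qed.

Lemma Lsp0_dim : exists d, quotient_dim (@kscale _ X) (Lsp 0) [set 0] d.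
Proof.
have [v _] := exists_place; apply: (qdim_bound scF (N := pdeg v)); first exact: (subsp0 scF).
move=> m u Lu iu; apply: (qdim_indep scF (vge_subsp v 1) (pdegP v) (u := u)).
  by move=> i; have := Lu i v; rewrite oppr0.
move=> c hc; apply: iu; apply: Lsp0_zero hc.
exact: (lin_sum _ (Lsp_subsp 0)).
Qed.

Lemma kscale_sub0 : subsp (@kscale _ X) [set 0]. Proof. exact: (subsp0 scF). Qed.

Lemma Lsp_step_dim D v d : quotient_dim (@kscale _ X) (Lsp D) [set 0] d ->
  exists2 n, quotient_dim (@kscale _ X) (Lsp (D + Defs.point v)) [set 0] (n + d) &
    quotient_dim (@kscale _ X) (Lsp (D + Defs.point v)) (Lsp D) n.
Proof.
move=> hd; have [n hn] : exists n, quotient_dim (@kscale _ X) (Lsp (D + Defs.point v)) (Lsp D) n.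
  apply: (qdim_bound scF (N := pdeg v)); first exact: Lsp_subsp.
  move=> m u Lu iu; apply: (qdim_indep scF (vge_subsp v (- D v - 1 + 1)) (vge_step v _) (u := u)).
    by move=> i; have := Lu i v; rewrite fctE /Defs.point eqxx opprD.
  move=> c; rewrite subrK => hc; apply: iu => w.
  have [->//|wv] := eqVneq w v.
  have := lin_sum c (Lsp_subsp (D + Defs.point v)) Lu => /(_ w).
  by rewrite fctE /Defs.point (negPf wv) addr0.
exists n => //; apply: (qdim_add scF (C := Lsp D)) => //; try exact: Lsp_subsp.
- exact: kscale_sub0.
- by move=> _ -> v'; left.
- by apply: Lsp_le => w; exact: le_point.
Qed.

Lemma le_pointB D v w : (D - Defs.point v) w <= D w.
Proof. by rewrite -[X in X <= _]/(D w - (w == v)%:R) lerBlDr lerDl; case: eqP. Qed.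

Lemma Lsp_dim D : divisor X D -> exists d, quotient_dim (@kscale _ X) (Lsp D) [set 0] d.
Proof.
move: D; apply: div_ind => [|D v dD [d hd]|D v dD [d hd]].
- exact: Lsp0_dim.
- by have [n h _] := Lsp_step_dim v hd; exists (n + d)%N.
- apply: (qdim_bound scF (N := d)); first exact: kscale_sub0.
  move=> m u Lu; apply: (qdim_indep scF kscale_sub0 hd) => i.
  apply: Lsp_le (Lu i) => w; exact: le_pointB.
Qed.

Definition ldim D : nat := xget 0%N [set d | quotient_dim (@kscale _ X) (Lsp D) [set 0] d].

Lemma ldimP D : divisor X D -> quotient_dim (@kscale _ X) (Lsp D) [set 0] (ldim D).
Proof. by move=> /Lsp_dim; exact: xgetPex. Qed.

Lemma ldimE D d : quotient_dim (@kscale _ X) (Lsp D) [set 0] d -> ldim D = d.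
Proof.
move=> h; apply: (qdim_uniq scF kscale_sub0 _ h).
exact: (@xgetI _ 0%N [set d | quotient_dim (@kscale _ X) (Lsp D) [set 0] d] d h).
Qed.

(* W(D) + F; the quotient of the repartitions by it is H^1(X, O(D)). *)
Definition WFsp D : set (place -> F) := [set a | exists f, forall v, vge v (- D v) (a v - f)].

Lemma WFsp_subsp D : subsp (@ascale _ X) (WFsp D).
Proof.
split=> [|a b [f hf] [g hg]|c a [f hf]].
- by exists 0 => v; rewrite subrr; left.
- exists (f + g) => v; have -> : (a + b) v - (f + g) = (a v - f) + (b v - g).
    by rewrite fctE; ring.
  exact: vgeD.
- exists (const X c * f) => v; rewrite /ascale -mulrBr.
  by have [_ _ h] := vge_subsp v (- D v); exact: h.
Qed.

Lemma WFsp_le D E : (forall v, D v <= E v) -> WFsp D `<=` WFsp E.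
Proof. by move=> h a [f hf]; exists f => v; apply: vgeW (hf v); rewrite lerN2. Qed.

Lemma Wsp_WFsp D : Wsp D `<=` WFsp D.
Proof. by move=> a ha; exists 0 => v; rewrite subr0. Qed.

(** Exactness of 0 -> L(D + v) / L(D) -> W(D + v) / W(D) -> (W(D + v) + F) / (W(D) + F) -> 0, where
    the middle term has dimension [pdeg v]. Modulo W(D), the space C is the image of L(D + v). *)
Lemma WFsp_step D v : divisor X D ->
  exists2 h, quotient_dim (@ascale _ X) (WFsp (D + Defs.point v)) (WFsp D) h &
    (ldim (D + Defs.point v)%R + h = ldim D + pdeg v)%N.
Proof.
move=> dD; pose D' := D + Defs.point v; pose C := Wsp D' `&` WFsp D.
have DD' w : D w <= D' w by exact: le_point.
have sC : subsp (@ascale _ X) C by apply: subspI; [exact: Wsp_subsp|exact: WFsp_subsp].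
have WC : Wsp D `<=` C by move=> a ha; split; [exact: Wsp_le ha|exact: Wsp_WFsp].
have CW : C `<=` Wsp D' by move=> a [].
have [m [n [hm hn Ev]]] := qdim_split scA (Wsp_subsp D') (Wsp_subsp D) sC WC CW (Wsp_step D v).
have [n' hn' hn''] := Lsp_step_dim v (ldimP dD).
have En : n' = n.
  apply: (qdim_uniq scA (Wsp_subsp D)) hn.
  apply/(qdim_map scF scA (phi := fun f (_ : place) => f) (A := Lsp D') (B := Lsp D)) => //.
  - exact: Lsp_subsp.
  - exact: Wsp_subsp.
  - by move=> f hf; split=> //; exists f => w; rewrite subrr; left.
  - move=> a [Wa [f hf]]; exists f => // w.
    have -> : f = a w - (a w - f) by rewrite subKr.
    by apply: vgeB => //; apply: vgeW (hf w); rewrite lerN2.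
  - exact: Lsp_subsp.
exists m; last by rewrite (ldimE hn') En Ev; lia.
apply/(qdim_map scA scA (phi := id) (A := Wsp D') (B := C)) => //.
- exact: WFsp_subsp.
- exact: Wsp_WFsp.
- move=> a [f hf]; exists (fun w => a w - f) => //.
  by exists f => w; rewrite fctE subKr subrr; left.
- exact: Wsp_subsp.
- by move=> a Wa; split=> [[]|].
Qed.

Lemma WFsp_dim D E : divisor X D -> divisor X E -> (forall v, 0 <= E v) ->
  exists2 h, quotient_dim (@ascale _ X) (WFsp (D + E)) (WFsp D) h &
    (ldim (D + E))%:Z + h%:Z = (ldim D)%:Z + div_deg E.
Proof.
move=> dD dE E0; move: E dE E0; apply: eff_ind => [|E v dE E0 [d hd Ed]].
  exists 0%N; last by rewrite div_deg0 !addr0.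
  by apply/(qdim_eq0 scA); [exact: WFsp_subsp|rewrite addr0].
have [h hh Eh] := WFsp_step v (divisorD dD dE).
exists (h + d)%N.
  apply: (qdim_add scA (C := WFsp (D + E))) => //; try exact: WFsp_subsp.
  - by apply: WFsp_le => w; rewrite fctE lerDl.
  - by rewrite addrA; apply: WFsp_le => w; exact: le_point.
  - by rewrite addrA.
rewrite addrA (div_degD dE (divisor_point v)) div_deg_point; move: Ed Eh.
by move: (ldim _) (ldim _) (ldim _) (div_deg _) (pdeg v) => a b c e p; lia.
Qed.

Lemma ldim_le D E : divisor X D -> divisor X E -> (forall v, D v <= E v) ->
  (ldim E)%:Z <= (ldim D)%:Z + (div_deg E - div_deg D).
Proof.
move=> dD dE DE; have [|h _] := WFsp_dim dD (divisorB dE dD).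
  by move=> v; rewrite fctE subr_ge0.
rewrite (_ : D + (E - D) = E); last by rewrite addrC subrK.
rewrite (div_degB dE dD).
by move: (ldim _) (ldim _) (div_deg _) (div_deg _) => a b c d; lia.
Qed.

Lemma ldim_indep D m (u : 'I_m -> F) : divisor X D -> (forall i, Lsp D (u i)) ->
  indep (@kscale _ X) [set 0] u -> (m <= ldim D)%N.
Proof. move=> dD; exact: (qdim_indep scF kscale_sub0 (ldimP dD)). Qed.

Definition pol f : place -> int := fun v => Num.max 0 (- ord v f).

Lemma pol_ge0 f v : 0 <= pol f v. Proof. by rewrite /pol le_max lexx. Qed.

Lemma divisor_pol f : f != 0 -> divisor X (pol f).
Proof.
move=> f0; have := divisor_principal f0 => h; apply: (divisor_sub h h) => v.
by rewrite /principal /pol => ->.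
Qed.

Lemma vge_pol f v : vge v (- pol f v) f.
Proof. by right; rewrite /pol; lia. Qed.

(** Reversing all coefficients in a common degree turns a relation over k[1/f] into one over
    k[f]. *)
Lemma findepV f m (u : 'I_m -> F) : f != 0 -> findep f u -> findep f^-1 u.
Proof.
move=> f0 iu p Ep.
pose N := (\max_i size (p i))%N.
have sp i : (size (p i) <= N)%N by exact: leq_bigmax.
pose q i := \poly_(j < N) (p i)`_(N.-1 - j).
have q0 : forall i, q i = 0.
  apply: iu; rewrite -[RHS](mulr0 (f ^+ N.-1)) -[in RHS]Ep mulr_sumr.
  apply: eq_bigr => i _; rewrite mulrA; congr (_ * _).
  rewrite (ev_coef _ (size_poly _ _)) (ev_coef _ (sp i)) mulr_sumr (reindex_inj rev_ord_inj).
  apply: eq_bigr => j _; rewrite coef_poly /= ltn_subrL (leq_ltn_trans _ (ltn_ord j)) //=.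
  have -> : (N.-1 - (N - j.+1) = j)%N by have := ltn_ord j; lia.
  rewrite mulrCA; congr (_ * _).
  have -> : (N.-1 = N - j.+1 + j)%N by have := ltn_ord j; lia.
  by rewrite exprD exprVn mulfK // expf_neq0.
move=> i; apply/polyP => j; rewrite coef0; have [jN|jN] := ltnP j N; last first.
  by rewrite nth_default // (leq_trans (sp i)).
have := q0 i => /polyP/(_ (N.-1 - j)%N); rewrite coef0 coef_poly.
have -> : (N.-1 - j < N)%N by lia.
by have -> : (N.-1 - (N.-1 - j) = j)%N by lia.
Qed.

(* The pole divisor of a transcendental f has degree [F : k(f)]. *)
Lemma deg_pol_aux f : transc f ->
  exists n (u : 'I_n -> F), [/\ findep f u,
    forall m (w : 'I_m -> F), findep f w -> (m <= n)%N & div_deg (pol f) <= n%:Z].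
Proof.
move=> tf; have f0 := transc_neq0 tf; have [N hN] := findep_bound f.
pose P m := `[< exists u : 'I_m -> F, findep f u >].
have P0 : exists m, P m by exists 0%N; apply/asboolP; exists (fun=> 0) => p _ [].
have PN m : P m -> (m <= N)%N by move=> /asboolP[u /hN].
case: (ex_maxnP P0 PN) => n /asboolP[u iu] nmax; exists n, u; split=> //.
  by move=> m w iw; apply: nmax; apply/asboolP; exists w.
have fV0 : f^-1 != 0 by rewrite invr_eq0.
apply: (zeros_bound fV0 _ (divisor_pol f0)).
- move=> m w iw; apply: nmax; apply/asboolP; exists w.
  by rewrite -[f]invrK; apply: findepV.
- exact: pol_ge0.
- by move=> v; rewrite /pol ordV; lia.
Qed.

(** C bounds the poles of the u i, so the n (l + 1) products f^j u_i with j <= l all lie in the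
    space in question, and independence over k(f) makes them independent over k. This is the source
    both of the exact degree of the pole divisor and of Riemann's theorem. *)
Lemma growth f n (u : 'I_n -> F) : f != 0 -> findep f u ->
  exists C, [/\ divisor X C, forall v, 0 <= C v &
    forall l, (n * l.+1 <= ldim (pol f *+ l + C)%R)%N].
Proof.
move=> f0 iu.
have u0 i : u i != 0.
  apply/eqP => ui; have := iu (fun j => (j == i)%:R%:P); apply: contraPP => _ h.
  have : \sum_j ev f (j == i)%:R%:P * u j = 0.
    rewrite (bigD1 i) //= ui mulr0 add0r big1 // => j /negPf ->.
    by rewrite evC rmorph0 mul0r.
  by move/h/(_ i)/eqP; rewrite eqxx polyC_eq0 oner_eq0.
pose C := \sum_i pol (u i).
have CE v : C v = \sum_i pol (u i) v by rewrite /C fct_sumE.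
have dC : divisor X C.
  rewrite /C; elim/big_ind : _ => //; [exact: divisor0|exact: divisorD|].
  by move=> i _; exact: divisor_pol.
exists C; split=> // [v|l].
  by rewrite CE; apply: sumr_ge0 => i _; exact: pol_ge0.
pose I := ('I_n * 'I_l.+1)%type.
pose w (z : I) := f ^+ z.2 * u z.1.
have <- : #|{: I}| = (n * l.+1)%N by rewrite card_prod !card_ord.
apply: (@ldim_indep _ _ (w \o enum_val)).
- by apply: divisorD => //; apply/divisorMn/divisor_pol.
- move=> i0 /=; case: (enum_val i0) => i j v /=; rewrite /w /=.
  have -> : (pol f *+ l + C) v = pol f v *+ l + C v.
    by rewrite fctE; congr (_ + _); elim: (l) => [|m IH]; rewrite ?mulr0n // !mulrS fctE IH.
  rewrite opprD; apply: vgeM.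
    right; rewrite ordX; have := pol_ge0 f v; have : - pol f v <= ord v f by rewrite /pol; lia.
    have := ltn_ord j; rewrite -(mulr_natr (pol f v) l) -(mulr_natr (ord v f) j) !natz; move: (pol f v) (ord v f) (nat_of_ord j) => a b c.
    by nia.
  apply: vgeW (vge_pol (u i) v); rewrite lerN2 CE (bigD1 i) //= lerDl.
  by apply: sumr_ge0 => i' _; exact: pol_ge0.
- move=> c hc z.
  have /iu/(_ (enum_val z).1)/polyP/(_ (enum_val z).2) :
    \sum_i ev f (\poly_(j < l.+1) (if insub j is Some j then c (enum_rank (i, j)) else 0)) * u i = 0.
    rewrite -[RHS]hc.
    rewrite -[RHS](@eq_bigr _ _ _ _ _ _ (fun z => kscale (c (enum_rank ((enum_val z).1, (enum_val z).2))) (w ((enum_val z).1, (enum_val z).2)))); last first.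
      by move=> i _; rewrite -!surjective_pairing enum_valK.
    rewrite -(big_enum_val (A := {: I}) (fun z => kscale (c (enum_rank (z.1, z.2))) (w (z.1, z.2)))) /=.
    rewrite -(pair_bigA _ (fun i j => kscale (c (enum_rank (i, j))) (w (i, j)))) /=.
    apply: eq_bigr => j _.
    rewrite (ev_coef _ (size_poly _ _)) mulr_suml; apply: eq_bigr => i _.
    by rewrite coef_poly ltn_ord valK /kscale /w /= mulrA.
  by rewrite coef_poly ltn_ord coef0 valK -surjective_pairing enum_valK.
Qed.

Lemma linear_growth (n z c : int) : (forall l : nat, n * l.+1%:Z <= c + z * l%:Z) -> n <= z.
Proof.
move=> h; rewrite leNgt; apply/negP => zn.
by have := h (absz c + absz n).+1; nia.
Qed.

(** The remaining inequality comes from comparing the slopes in l of the lower bound in [growth] and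
    of the upper bound by the degree. *)
Lemma deg_pol f : transc f ->
  exists n (u : 'I_n -> F), [/\ findep f u,
    forall m (w : 'I_m -> F), findep f w -> (m <= n)%N & div_deg (pol f) = n%:Z].
Proof.
move=> tf; have f0 := transc_neq0 tf; have [n [u [iu nmax le_n]]] := deg_pol_aux tf.
exists n, u; split=> //; apply/eqP; rewrite eq_le le_n /=.
have [C [dC C0 hC]] := growth f0 iu.
apply: (@linear_growth _ _ ((ldim 0)%:Z + div_deg C)) => l.
have dl : divisor X (pol f *+ l) by apply/divisorMn/divisor_pol.
have := @ldim_le 0 (pol f *+ l + C) (divisor0 X) (divisorD dl dC).
rewrite (div_degD dl dC) (div_degMn l (divisor_pol f0)) div_deg0.
have := hC l; set a := ldim _; set b := ldim _ => h1 h2.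
have {}h2 : a%:Z <= b%:Z + (div_deg (pol f) * l%:Z + div_deg C - 0).
  apply: h2 => v; rewrite fctE; apply: addr_ge0 => //.
  by elim: l {dl hC a h1} => [|l IH]; rewrite ?mulr0n // mulrS fctE addr_ge0 // pol_ge0.
move: h1 h2; rewrite -lez_nat PoszM; lia.
Qed.

(** Zeros and poles both have degree [F : k(f)], since f and 1/f generate the same field; an
    algebraic f has neither. *)
Lemma div_deg_principal f : f != 0 -> div_deg (principal f : place -> int) = 0.
Proof.
move=> f0; have [tf|af] := pselect (transc f); last first.
  suff -> : principal f = 0 :> (place -> int) by exact: div_deg0.
  by apply/funext => v; rewrite /principal algebraic_ord.
have fV0 : f^-1 != 0 by rewrite invr_eq0.
have -> : principal f = pol f^-1 - pol f :> (place -> int).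
  by apply/funext => v; rewrite -[RHS]/(pol f^-1 v - pol f v) /pol /principal ordV; lia.
rewrite div_degB; [|exact: divisor_pol|exact: divisor_pol].
have [n [u [iu nmax ->]]] := deg_pol tf.
have [m [w [iw mmax ->]]] := deg_pol (transcV tf).
apply/eqP; rewrite subr_eq0 eqz_nat eqn_leq; apply/andP; split.
  by apply: (nmax _ w); rewrite -[f]invrK; apply: findepV.
by apply: (mmax _ u); apply: findepV.
Qed.

Lemma Lsp_mul D f g : f != 0 -> Lsp (D - principal f) (f * g) <-> Lsp D g.
Proof.
move=> f0; split=> h v; have := h v; rewrite vgeMl // -[(D - _) v]/(D v - ord v f); apply: vgeW; lia.
Qed.

Lemma ldim_equiv D f : divisor X D -> f != 0 -> ldim (D + principal f) = ldim D.
Proof.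
move=> dD f0; apply: ldimE.
have fV0 : f^-1 != 0 by rewrite invr_eq0.
apply/(qdim_map scF scF (phi := fun g => f^-1 * g) (A := Lsp D) (B := [set 0])) => //.
- by move=> a b; rewrite mulrDr.
- by move=> c a; rewrite /kscale mulrCA.
- exact: kscale_sub0.
- exact: kscale_sub0.
- by move=> g /(Lsp_mul D g fV0); rewrite principalV opprK.
- move=> g hg; exists (f * g); last by rewrite mulKf // subrr.
  by apply/(Lsp_mul _ _ fV0); rewrite principalV opprK mulKf.
- exact: Lsp_subsp.
- by move=> g _; split=> [->|/eqP]; rewrite ?mulr0 // mulf_eq0 (negPf fV0) => /eqP.
- exact: ldimP.
Qed.

(** The quantity deg - ldim is monotone, invariant under linear equivalence, and at most deg C along
    the divisors L (t)_oo + C. An effective E is pushed below one of these by subtracting the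
    divisor of a polynomial Q in t that vanishes sufficiently on the part of E away from the poles
    of t. *)
Lemma riemann_bound : exists c : int, forall E, divisor X E -> (forall v, 0 <= E v) ->
  div_deg E - (ldim E)%:Z <= c.
Proof.
have [t tt] := exists_transc; have t0 := transc_neq0 tt.
have [n [u [iu nmax En]]] := deg_pol tt.
have [C [dC C0 hC]] := growth t0 iu; have dt := divisor_pol t0.
exists (div_deg C) => E dE E0.
have polE l v : (pol t *+ l) v = pol t v *+ l.
  by elim: l => [|m IH]; rewrite ?mulr0n // !mulrS fctE IH.
have mono D D' : divisor X D -> divisor X D' -> (forall v, D v <= D' v) ->
    div_deg D - (ldim D)%:Z <= div_deg D' - (ldim D')%:Z.
  by move=> dD dD' h; have := ldim_le dD dD' h; lia.
have [s [us hs]] := divisor_seq dE.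
(* The powers 1, t, ..., t^(pdeg v) are dependent in the residue field of v, so some polynomial in t
   vanishes at v. *)
have /choice[p hp] : forall v, exists p : {poly k}, p != 0 /\ (0 <= ord v t -> vge v 1 (ev t p)).
  move=> v; have [vt|vt] := leP 0 (ord v t); last by exists 1; rewrite oner_neq0.
  have [p [p0 hp]] : exists p : {poly k}, p != 0 /\ vge v 1 (ev t p).
    apply: contrapT => /forallNP h.
    have : indep (@kscale _ X) (vge v 1) (fun i : 'I_(pdeg v).+1 => t ^+ i).
      move=> c hc i; have := h (\poly_(i < (pdeg v).+1) (if insub i is Some i then c i else 0)).
      move/not_andP => [/negP/negPn/eqP/polyP/(_ i)|[]]; first by rewrite coef_poly ltn_ord valK coef0.
      rewrite (ev_coef _ (size_poly _ _)); move: hc; congr (vge _ _ _).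
      by apply: eq_bigr => j _; rewrite coef_poly ltn_ord valK.
    move=> it; suff : ((pdeg v).+1 <= pdeg v)%N by rewrite ltnn.
    apply: (qdim_indep scF (vge_subsp v 1) (pdegP v) _ it) => i.
    by right; rewrite ordX mulrn_wge0.
  by exists p.
pose Q := \prod_(v <- s) p v ^+ absz (E v).
have Q0 : Q != 0 by rewrite prodf_seq_neq0; apply/allP => v _ /=; rewrite expf_neq0 //; case: (hp v).
have tQ0 : ev t Q != 0 by apply: contraNneq Q0 => /tt ->.
have regQ v (q : {poly k}) : 0 <= ord v t -> vge v 0 (ev t q).
  move=> vt; rewrite (ev_coef _ (leqnn _)); apply: vge_sum => i _.
  by rewrite -[0]addr0; apply: vgeM; [exact: vge_const|right; rewrite ordX mulrn_wge0].
pose l := (\sum_(v <- s) absz (E v) + \sum_(v <- s) 1 + 1)%N.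
have dQ := divisor_principal tQ0.
have [r [ur hr]] := divisor_seq (divisorB dE dQ).
pose L := (\sum_(v <- r) absz (E v - ord v (ev t Q)))%N.
have le_EQ v : (E - principal (ev t Q)) v <= (pol t *+ L + C) v.
  have -> : (E - principal (ev t Q)) v = E v - ord v (ev t Q) by [].
  have -> : (pol t *+ L + C) v = pol t v *+ L + C v by rewrite fctE polE.
  rewrite -[X in X <= _]addr0; apply: lerD => //.
  have [vt|vt] := leP 0 (ord v t).
    have -> : pol t v = 0 by rewrite /pol; lia.
    rewrite mul0rn subr_le0; have [vs|vs] := boolP (v \in s); last first.
      have -> : E v = 0 by apply/eqP; apply: contraNT vs => /hs.
      by apply/(vge_ord v _ tQ0); exact: regQ.
    apply/(vge_ord v _ tQ0); rewrite /Q (big_rem v) //= evM evXn -[X in vge _ X _]addr0.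
    apply: vgeM; last exact: regQ.
    have h1 : vge v 1 (ev t (p v)) by case: (hp v) => _; apply.
    have : forall m, vge v m%:Z (ev t (p v) ^+ m).
      elim=> [|m IH]; first by rewrite expr0; right; rewrite ord_one.
      by rewrite exprS intS; apply: vgeM.
    by move/(_ (absz (E v))); rewrite gez0_abs.
  have pv : 1 <= pol t v by rewrite /pol; lia.
  have [->|ne0] := eqVneq (E v - ord v (ev t Q)) 0; first by rewrite mulrn_wge0 // pol_ge0.
  have vr : v \in r by apply: hr.
  have : (absz (E v - ord v (ev t Q)) <= L)%N by rewrite /L (big_rem v) //= leq_addr.
  by rewrite -mulr_natr natz; move: (E v - _) (pol t v) pv L => a b pv L'; nia.
have dL : divisor X (pol t *+ L) by exact: divisorMn.
have dEQ := divisorB dE dQ.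
have := mono _ _ dEQ (divisorD dL dC) le_EQ.
rewrite (div_degB dE dQ) (div_deg_principal tQ0) subr0 (div_degD dL dC) (div_degMn L dt) En.
rewrite -principalV (ldim_equiv dE) ?invr_eq0 //.
move=> h2; have := hC L; rewrite -lez_nat PoszM intS mulrDr mulr1 => h1.
have n0 : 0 <= n%:Z by [].
apply: le_trans h2 _; move: h1 n0; move: n%:Z (ldim _) => y b; nia.
Qed.

End Riemann.

(** * The Riemann-Roch theorem *)

Section RiemannRoch.
Variables (k : fieldType) (X : curve k).
Local Notation F := (funfield X).
Local Notation place := (place X).
Implicit Types (v w : place) (f g : F) (D E : place -> int).
Local Notation scF := (kscaling X).
Local Notation scA := (ascaling X).

Definition adele : set (place -> F) := [set a | finite_set [set v | ~ regular v (a v)]].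

Lemma adele_Wsp a : adele a -> exists E, [/\ divisor X E, forall v, 0 <= E v & Wsp E a].
Proof.
move=> ha; exists (fun v => Num.max 0 (- ord v (a v))); split.
- by apply: sub_finite_set ha => v /=; rewrite /regular /=; lia.
- by move=> v; rewrite le_max lexx.
- by move=> v; right; lia.
Qed.

Lemma Wsp_adele D : divisor X D -> Wsp D `<=` adele.
Proof.
move=> dD a ha; apply: sub_finite_set dD => v /= h; apply/eqP => D0; apply: h.
by rewrite regularE; have := ha v; rewrite D0 oppr0.
Qed.

Lemma adele_subsp : subsp (@ascale _ X) adele.
Proof.
split=> [|a b ha hb|c a ha].
- by apply: sub_finite_set (finite_set0 place) => v /=; case; rewrite regularE; left.
- have [E [dE _ hE]] := adele_Wsp ha; have [E' [dE' _ hE']] := adele_Wsp hb.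
  apply: (@sub_finite_set _ _ ([set v | ~ regular v (a v)] `|` [set v | ~ regular v (b v)])).
    move=> v /= h; apply: contrapT => /not_orP[/contrapT h1 /contrapT h2]; apply: h.
    by move: h1 h2; rewrite regularE; exact: vgeD.
  by rewrite finite_setU.
- apply: sub_finite_set ha => v /= h h1; apply: h; move: h1; rewrite regularE.
  by have [_ _ h] := vge_subsp v 0; exact: h.
Qed.

Lemma WFsp_adele D : divisor X D -> WFsp D `<=` adele.
Proof.
move=> dD a [f hf]; have -> : a = (fun v => a v - f) + (fun=> f).
  by apply/funext => v; rewrite fctE subrK.
have [_ AD _] := adele_subsp; apply: AD; first exact: Wsp_adele hf.
have [->|f0] := eqVneq f 0; first by have [A0 _ _] := adele_subsp.
apply: sub_finite_set (divisor_principal f0) => v /= h; apply/eqP => v0; apply: h.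
by rewrite /regular /= -[ord v f]/(principal f v) v0.
Qed.

(** Finitely many repartitions lie in a single W(S), and by [WFsp_dim] the dimension of W(S) + F
    over W(0) + F is deg S - ldim S + ldim 0, which Riemann's theorem bounds. *)
Lemma hdim_ex0 : exists d, quotient_dim (@ascale _ X) adele (WFsp 0) d.
Proof.
have [c hc] := riemann_bound X.
apply: (qdim_bound scA (N := absz (c + (ldim (0 : place -> int))%:Z))); first exact: WFsp_subsp.
move=> m u Au iu; have /choice[E hE] := fun i => adele_Wsp (Au i).
pose S := \sum_i E i.
have SE v : S v = \sum_i E i v by rewrite /S fct_sumE.
have dS : divisor X S.
  rewrite /S; elim/big_ind : _ => //; [exact: divisor0|exact: divisorD|].
  by move=> i _; case: (hE i).
have S0 v : 0 <= S v by rewrite SE; apply: sumr_ge0 => i _; case: (hE i).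
have [h hh Eh] := WFsp_dim (divisor0 X) dS S0.
have := qdim_indep scA (WFsp_subsp 0) hh _ iu; rewrite add0r => hm.
have {}hm : (m <= h)%N.
  apply: hm => i; apply: Wsp_WFsp => v; have [_ E0 W] := hE i.
  apply: vgeW (W v); rewrite lerN2 SE (bigD1 i) //= lerDl; apply: sumr_ge0 => j _.
  by case: (hE j).
have := hc S dS S0; move: Eh hm; rewrite add0r; lia.
Qed.

Lemma genusP : quotient_dim (@ascale _ X) adele (WFsp 0) (genus X).
Proof.
have -> : WFsp 0 = [set a | exists f : F, forall v : place, regular v (a v - f)].
  by apply/seteqP; split=> a [f hf]; exists f => v; have := hf v; rewrite ?regularE oppr0.
apply: (@xgetPex _ 0%N [set g | quotient_dim _ adele [set a | exists f : F, forall v : place, regular v (a v - f)] g]).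
have [g hg] := hdim_ex0; exists g => /=.
rewrite (_ : [set a | _] = WFsp 0) //.
by apply/seteqP; split=> a [f hf]; exists f => v; have := hf v; rewrite ?regularE oppr0.
Qed.

Definition hdim D : nat := xget 0%N [set d | quotient_dim (@ascale _ X) adele (WFsp D) d].

Lemma hdim_uniq D d d' : quotient_dim (@ascale _ X) adele (WFsp D) d ->
  quotient_dim (@ascale _ X) adele (WFsp D) d' -> d = d'.
Proof. exact: (qdim_uniq scA (WFsp_subsp D)). Qed.

(** At D = 0 this is the definition of the genus; adding or removing a point changes both sides
    equally by [WFsp_step]. *)
Lemma RR_aux D : divisor X D -> exists2 h, quotient_dim (@ascale _ X) adele (WFsp D) h &
  (ldim D)%:Z - h%:Z = div_deg D + (ldim (0 : place -> int))%:Z - (genus X)%:Z.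
Proof.
move: D; apply: div_ind => [|D v dD [h hh Eh]|D v dD [h hh Eh]].
- by exists (genus X); [exact: genusP|rewrite div_deg0 add0r].
- have [n hn En] := WFsp_step v dD.
  have dDv := divisorD dD (divisor_point v).
  have [|m [n' [hm hn' E]]] := qdim_split scA adele_subsp (WFsp_subsp D) (WFsp_subsp (D + Defs.point v)) _ (WFsp_adele dDv) hh.
    by apply: WFsp_le => w; exact: le_point.
  exists m => //; rewrite (div_degD dD (divisor_point v)) div_deg_point.
  have En' := qdim_uniq scA (WFsp_subsp D) hn' hn; lia.
- have dDv := divisorB dD (divisor_point v).
  have [n hn En] := WFsp_step v dDv.
  move: hn En; rewrite subrK => hn En.
  exists (h + n)%N.
    apply: (qdim_add scA adele_subsp (WFsp_subsp _) (WFsp_subsp D)) => //; last exact: WFsp_adele.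
    by apply: WFsp_le => w; exact: le_pointB.
  rewrite (div_degB dD (divisor_point v)) div_deg_point; lia.
Qed.

Lemma hdimP D : divisor X D -> quotient_dim (@ascale _ X) adele (WFsp D) (hdim D).
Proof. by move=> /RR_aux[h hh _]; apply: xgetPex; exists h. Qed.

Theorem riemann_roch D : divisor X D ->
  (ldim D)%:Z - (hdim D)%:Z = div_deg D + (ldim (0 : place -> int))%:Z - (genus X)%:Z.
Proof.
move=> dD; have [h hh <-] := RR_aux dD.
by rewrite (hdim_uniq (hdimP dD) hh).
Qed.

Lemma ldim_gt0P D : divisor X D -> (0 < ldim D)%N <-> exists2 f, f != 0 & Lsp D f.
Proof.
move=> dD; split=> [l0|[f f0 Lf]].
  have := ldimP dD; case: (ldim D) l0 => // n _ /(qdimP scF _ _ (kscale_sub0 X))[e [Le ie _]].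
  exists (e fintype.ord0) => //; apply/eqP => e0.
  have h := ie (fun j => (j == fintype.ord0)%:R) _ fintype.ord0.
  have /eqP : (1 : k) = 0; last by rewrite oner_eq0.
  apply: h; rewrite (bigD1 fintype.ord0) //= e0 /kscale mulr0 add0r big1 // => j /negPf ->.
  by rewrite rmorph0 mul0r.
rewrite lt0n; apply/eqP => l0; have := ldimP dD; rewrite l0.
move/(qdim_eq0 scF _ (kscale_sub0 X))/(_ f Lf) => /= f0'.
by rewrite f0' eqxx in f0.
Qed.

Lemma Lsp_eff D f : f != 0 -> Lsp D f <-> forall v, 0 <= (D + principal f) v.
Proof.
move=> f0; have E v : (D + principal f) v = D v + ord v f by [].
by split=> h v; have := h v; rewrite ?E vge_ord //; lia.
Qed.

Lemma Lsp_deg D f : divisor X D -> f != 0 -> Lsp D f -> 0 <= div_deg D.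
Proof.
move=> dD f0 /(Lsp_eff _ f0) h; have dp := divisor_principal f0.
have -> : div_deg D = div_deg (D + principal f).
  by rewrite (div_degD dD dp) (div_deg_principal f0) addr0.
by apply: div_deg_ge0 => //; exact: divisorD.
Qed.

Lemma ldim_lt0 D : divisor X D -> div_deg D < 0 -> ldim D = 0%N.
Proof.
move=> dD dneg; apply/eqP; rewrite -leqn0 leqNgt; apply/negP => /(ldim_gt0P dD)[f f0 Lf].
by have := Lsp_deg dD f0 Lf; rewrite leNgt dneg.
Qed.

Lemma WFsp_mul D f a : f != 0 -> WFsp (D + principal f) a -> WFsp D (fun v => f * a v).
Proof.
move=> f0 [g hg]; exists (f * g) => v; rewrite -mulrBr; apply/vgeMl => //.
by apply: vgeW (hg v); rewrite -[(D + _) v]/(D v + ord v f) opprD.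
Qed.

(* A functional w killing W(D) + F gives an injection f |-> f w of L(E) into the dual
   of the quotient by W(D - E) + F. *)
Lemma ldim_le_hdim D E : divisor X D -> divisor X E -> (0 < hdim D)%N ->
  (ldim E <= hdim (D - E)%R)%N.
Proof.
move=> dD dE h0.
(* [om] is a coordinate on the quotient of the adeles by W(D) + F, read as a linear form on
   adeles. *)
have [om [omD [oms [omW [a0 Aa0 oma0]]]]] : exists om : (place -> F) -> k,
   (forall a b, adele a -> adele b -> om (a + b) = om a + om b) /\
   ((forall c a, adele a -> om (ascale c a) = c * om a) /\
   ((forall a, WFsp D a -> om a = 0) /\ exists2 a, adele a & om a != 0)).
  have := hdimP dD; case: (hdim D) h0 => // n _ /(qdimP scA _ _ (WFsp_subsp D))[e [Ae ie se]].
  have /choice[c hc] : forall a, exists c : 'I_n.+1 -> k, adele a -> WFsp D (a - \sum_i ascale (c i) (e i)).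
    move=> a; have [/se[c hc]|na] := pselect (adele a); first by exists c.
    by exists (fun=> 0).
  have uc a (c1 : 'I_n.+1 -> k) : adele a -> WFsp D (a - \sum_i ascale (c1 i) (e i)) -> forall i, c a i = c1 i.
    move=> Aa h i; apply/eqP; rewrite -subr_eq0; apply/eqP.
    apply: (ie (fun i => c a i - c1 i)).
    have -> : \sum_j ascale (c a j - c1 j) (e j) =
       (a - \sum_j ascale (c1 j) (e j)) - (a - \sum_j ascale (c a j) (e j)).
      rewrite [RHS]addrC opprB addrA subrK -sumrB; apply: eq_bigr => j _.
      by apply/funext => v; rewrite !fctE /ascale rmorphB mulrBl.
    by apply: (subspB scA) => //; [exact: WFsp_subsp|exact: hc].
  have [W0 WD Ws] := WFsp_subsp D.
  exists (fun a => c a fintype.ord0); split; last split; last split.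
  - move=> a b Aa Ab; apply: (uc _ (fun i => c a i + c b i)).
      by have [_ AD _] := adele_subsp; exact: AD.
    have -> : a + b - \sum_i ascale (c a i + c b i) (e i) =
      (a - \sum_i ascale (c a i) (e i)) + (b - \sum_i ascale (c b i) (e i)).
      rewrite addrACA -opprD -big_split /=; congr (_ - _); apply: eq_bigr => j _.
      by apply/funext => v; rewrite !fctE /ascale rmorphD mulrDl.
    by apply: WD; exact: hc.
  - move=> z a Aa; apply: (uc _ (fun i => z * c a i)).
      by have [_ _ As] := adele_subsp; exact: As.
    have -> : ascale z a - \sum_i ascale (z * c a i) (e i) = ascale z (a - \sum_i ascale (c a i) (e i)).
      rewrite (scB scA) (sc_sum scA); congr (_ - _); apply: eq_bigr => j _.
      by case: scA => _ sA _ _; rewrite sA.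
    by apply: Ws; exact: hc.
  - move=> a Wa; apply: (uc _ (fun=> 0)); first exact: WFsp_adele Wa.
    by rewrite big1 ?subr0 // => i _; rewrite (sc0l scA).
  - exists (e fintype.ord0) => //.
    rewrite (uc _ (fun j => (j == fintype.ord0)%:R)) ?eqxx ?oner_eq0 //.
    rewrite (bigD1 fintype.ord0) //= big1 ?addr0.
      by case: scA => s1 _ _ _; rewrite s1 subrr.
    by move=> j /negPf ->; rewrite (sc0l scA).
have dDE := divisorB dD dE.
have /(qdimP scA _ _ (WFsp_subsp _))[e [Ae _ se]] := hdimP dDE.
have /(qdimP scF _ _ (kscale_sub0 X))[u [Lu iu _]] := ldimP dE.
rewrite leqNgt; apply/negP => lt_h.
pose mul f a : place -> F := fun v => f * a v.
have Amul f a : adele a -> adele (mul f a).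
  move=> Aa; have [->|f0] := eqVneq f 0.
    have -> : mul 0 a = 0 by apply/funext => v; rewrite /mul mul0r.
    by have [] := adele_subsp.
  have [G [dG _ hG]] := adele_Wsp Aa.
  apply: (@Wsp_adele (G - principal f)); first exact/divisorB/divisor_principal.
  move=> v; rewrite /mul; apply/vgeMl => //; apply: vgeW (hG v).
  by rewrite -[(G - _) v]/(G v - ord v f); lia.
(* If ldim E were larger than the quotient by W(D - E) + F, some nonzero combination f of the u i
   would satisfy om(f e_j) = 0 on a basis, hence om(f a) = 0 for all adeles a. As multiplication by
   f is bijective, om would vanish. *)
pose M := \matrix_(i < ldim E, j < hdim (D - E)) om (mul (u i) (e j)).
have : kermx M != 0.
  rewrite -mxrank_eq0 mxrank_ker subn_eq0 -ltnNge.
  exact: leq_ltn_trans (rank_leq_col M) lt_h.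
case/rowV0Pn => l /sub_kermxP lM l0.
pose f := \sum_i kscale (l 0 i) (u i).
have f0 : f != 0.
  apply: contraNneq l0 => f0; apply/eqP/rowP => i; rewrite mxE.
  by apply: (iu (fun i => l 0 i)).
have Lf : Lsp E f by exact: (lin_sum _ (Lsp_subsp E)).
have [A0 AD As] := adele_subsp.
have om_sum n (a : 'I_n -> place -> F) : (forall i, adele (a i)) ->
    om (\sum_i a i) = \sum_i om (a i).
  have om0 : om 0 = 0.
    have := oms 0 0 A0; rewrite mul0r => <-; congr om; apply/funext => v.
    by rewrite /ascale rmorph0 mul0r.
  elim: n a => [|n IH] a Aa; first by rewrite !big_ord0.
  by rewrite !big_ord_recr /= omD ?IH //; exact: (subsp_sum adele_subsp).
have omfe j : om (mul f (e j)) = 0.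
  have -> : mul f (e j) = \sum_i ascale (l 0 i) (mul (u i) (e j)).
    apply/funext => v; rewrite ascaleE /mul /f mulr_suml; apply: eq_bigr => i _.
    by rewrite /kscale mulrA.
  rewrite om_sum => [|i]; last exact/As/Amul.
  have /rowP/(_ j) := lM; rewrite !mxE => h; rewrite -[RHS]h.
  by apply: eq_bigr => i _; rewrite mxE oms //; exact: Amul.
have omf a : adele a -> om (mul f a) = 0.
  move=> Aa; have [c hc] := se a Aa.
  have Asum : adele (\sum_i ascale (c i) (e i)) by exact: (lin_sum _ adele_subsp).
  have -> : mul f a = mul f (a - \sum_i ascale (c i) (e i)) + \sum_i ascale (c i) (mul f (e i)).
    apply/funext => v; rewrite -[RHS]/(_ v + _ v) ascaleE /mul -[(a - _) v]/(a v - (\sum_i _) v).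
    rewrite ascaleE mulrBr mulr_sumr -addrA; apply/eqP; rewrite eq_sym -subr_eq0 addrAC subrr add0r addrC subr_eq0.
    by apply/eqP; apply: eq_bigr => i _; rewrite /kscale; ring.
  rewrite omD; last 2 first.
  - apply/Amul; exact: (subspB scA).
  - by apply: (lin_sum _ adele_subsp) => i; exact: Amul.
  rewrite omW ?add0r.
    rewrite om_sum => [|i]; last exact/As/Amul.
    by rewrite big1 // => i _; rewrite oms ?omfe ?mulr0 //; exact: Amul.
  apply: WFsp_mul => //; apply: WFsp_le hc => v.
  rewrite -[(D - E) v]/(D v - E v) -[(D + _) v]/(D v + ord v f).
  by have := Lf v; rewrite vge_ord //; lia.
move/negP: oma0; apply; apply/eqP.
have -> : a0 = mul f (mul f^-1 a0) by apply/funext => v; rewrite /mul mulVKf.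
by rewrite omf //; exact: Amul.
Qed.

Lemma div_pointMn v n : div_deg (Defs.point v *+ n) = (pdeg v)%:Z * n%:Z.
Proof. by rewrite (div_degMn n (divisor_point v)) div_deg_point. Qed.

(** Suppose hdim D > 0 and take deg E > deg D, so that L(D - E) = 0. Then ldim E <= hdim (D - E),
    and Riemann-Roch on both sides turns this into deg D <= 2g - 2 ldim 0. *)
Theorem hdim_vanish D : divisor X D ->
  2 * (genus X)%:Z - 2 * (ldim (0 : place -> int))%:Z < div_deg D -> hdim D = 0%N.
Proof.
move=> dD hD; apply/eqP; rewrite -leqn0 leqNgt; apply/negP => h0.
have [v _] := exists_place X.
pose E := Defs.point v *+ (absz (div_deg D)).+1.
have dE : divisor X E by exact/divisorMn/divisor_point.
have degE : div_deg D < div_deg E by rewrite div_pointMn; have := pdeg_gt0 v; nia.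
have dDE := divisorB dD dE.
have := ldim_le_hdim dD dE h0; have := riemann_roch dE; have := riemann_roch dDE.
rewrite (div_degB dD dE) (@ldim_lt0 (D - E)) //; last by rewrite (div_degB dD dE); lia.
by move: hD; lia.
Qed.

Theorem strong_approx D a : divisor X D -> hdim D = 0%N -> adele a ->
  exists f, forall v, vge v (- D v) (a v - f).
Proof.
move=> dD h0 Aa; have := hdimP dD; rewrite h0.
by move/(qdim_eq0 scA _ (WFsp_subsp D))/(_ a Aa).
Qed.

Lemma ldim_ge D : divisor X D ->
  div_deg D + (ldim (0 : place -> int))%:Z - (genus X)%:Z <= (ldim D)%:Z.
Proof. by move=> /riemann_roch; lia. Qed.

Lemma ldim0_gt0 : (0 < ldim (0%R : place -> int))%N.
Proof.
apply/(ldim_gt0P (divisor0 X)); exists 1; rewrite ?oner_eq0 // => v.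
by rewrite oppr0; right; rewrite ord_one.
Qed.

Lemma place_root t v : 0 <= ord v t ->
  exists p : {poly k}, [/\ p != 0, (size p <= (pdeg v).+1)%N & vge v 1 (ev t p)].
Proof.
move=> vt; apply: contrapT => /forallNP h.
have it : indep (@kscale _ X) (vge v 1) (fun i : 'I_(pdeg v).+1 => t ^+ i).
  move=> c hc i; have := h (\poly_(i < (pdeg v).+1) (if insub i is Some i then c i else 0)).
  move/not_and3P => [/negP/negPn/eqP/polyP/(_ i)|[]|[]]; first by rewrite coef_poly ltn_ord valK coef0.
    exact: size_poly.
  rewrite (ev_coef _ (size_poly _ _)); move: hc; congr (vge _ _ _).
  by apply: eq_bigr => j _; rewrite coef_poly ltn_ord valK.
suff : ((pdeg v).+1 <= pdeg v)%N by rewrite ltnn.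
apply: (qdim_indep scF (vge_subsp v 1) (pdegP v) _ it) => i.
by right; rewrite ordX mulrn_wge0.
Qed.

End RiemannRoch.

(** * Finiteness of the class group *)

Section LinearEquivalence.
Variables (k : fieldType) (X : curve k).
Local Notation place := (place X).
Implicit Types (D E : place -> int).

Lemma principal1 : principal 1 = 0 :> (place -> int).
Proof. by apply/funext => v; rewrite /principal ord_one. Qed.

Lemma lin_classP D E : lin_class D = lin_class E <->
  exists2 f, f != 0 & E = D + principal f.
Proof.
split=> [h|[f f0 ->]].
  have : lin_class E E by exists 1; rewrite ?oner_eq0 // principal1 addr0.
  by rewrite -h.
apply/seteqP; split=> _ [g g0 ->].
  exists (f^-1 * g); first by rewrite mulf_neq0 ?invr_eq0.
  by rewrite principalM ?invr_eq0 // principalV addrA addrK.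
by exists (f * g); rewrite ?mulf_neq0 // principalM // addrA.
Qed.

Lemma eff_le D v : divisor X D -> (forall w, 0 <= D w) -> (pdeg v)%:Z * D v <= div_deg D.
Proof.
move=> dD D0; have [s [us hs]] := divisor_seq dD.
have [->|Dv] := eqVneq (D v) 0; first by rewrite mulr0; exact: div_deg_ge0.
rewrite (div_deg_seq us hs) (big_rem v) /= ?hs // lerDl.
by apply: sumr_ge0 => w _; rewrite mulr_ge0.
Qed.

Lemma eff_deg_le D v : divisor X D -> (forall w, 0 <= D w) -> 0 < D v ->
  (pdeg v)%:Z <= div_deg D /\ D v <= div_deg D.
Proof.
move=> dD D0 Dv; have := eff_le v dD D0; have := pdeg_gt0 v.
by move: (D v) Dv (pdeg v) (div_deg D) => a a0 b c b0 abc; split; nia.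
Qed.
End LinearEquivalence.

Section FiniteField.
Variables (k : finFieldType) (X : curve k).
Local Notation F := (funfield X).
Local Notation place := (place X).
Implicit Types (v w : place) (f g : F) (D E : place -> int).

(** Away from the poles of t, a place of degree at most n is a zero of one of the finitely many
    nonzero polynomials in t of degree at most n. *)
Lemma finite_places n : finite_set [set v : place | (pdeg v <= n)%N].
Proof.
have [t tt] := exists_transc X; have t0 := transc_neq0 tt.
pose S : set {poly k} := [set p : {poly k} | p != 0 /\ (size p <= n.+1)%N].
apply: (@sub_finite_set _ _ ([set v | 0 < ord v t^-1] `|`
   \bigcup_(p in S) [set v | 0 < ord v (ev t p)])).
  move=> v /= vn; have [vt|vt] := leP 0 (ord v t); last by left; rewrite ordV; lia.
  right; have [p [p0 sp hp]] := place_root vt; exists p.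
    by split=> //; apply: leq_trans sp _; rewrite ltnS.
  have tp0 : ev t p != 0 by apply: contraNneq p0 => /tt ->.
  by move: hp => /=; rewrite vge_ord //; lia.
rewrite finite_setU; split; first by apply: finite_zeros; rewrite invr_eq0.
apply: bigcup_finite => [|p [p0 _]]; last first.
  by apply: finite_zeros; apply: contraNneq p0 => /tt ->.
apply: (@sub_finite_set _ _ ((fun c : {ffun 'I_n.+1 -> k} => \poly_(i < n.+1) c (inord i)) @` setT)).
  move=> p [_ sp]; exists [ffun i : 'I_n.+1 => p`_i] => //.
  apply/polyP => i; rewrite coef_poly; case: ltnP => h; last by rewrite nth_default // (leq_trans sp).
  by rewrite ffunE inordK.
exact/finite_image/finite_finset.
Qed.

Lemma finite_eff n : finite_set [set E : place -> int | [/\ divisor X E, forall v, 0 <= E v & div_deg E <= n%:Z]].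
Proof.
have /finite_seqP[s Es] := finite_places n.
apply: (@sub_finite_set _ _ ((fun (g : {ffun 'I_(size s) -> 'I_n.+1}) (v : place) =>
   if insub (index v s) is Some i then (g i : nat)%:Z else 0) @` setT)); last exact/finite_image/finite_finset.
move=> E [dE E0 degE]; exists [ffun i => inord (absz (E (tnth (in_tuple s) i)))] => //.
apply/funext => v; case: insubP => [i ilt iE|].
  have vs : v \in s by rewrite -index_mem.
  rewrite ffunE (tnth_nth v) /= iE nth_index // inordK ?gez0_abs //.
  have [Ev|Ev] := leP (E v) 0; first by move: (E0 v); lia.
  by have [_] := eff_deg_le dE E0 Ev; lia.
rewrite index_mem => vs; apply/eqP; rewrite eq_sym; apply: contraNT vs => Ev.
have vE : 0 < E v by rewrite lt_neqAle eq_sym Ev E0.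
have : [set v | (pdeg v <= n)%N] v by have [h _] := eff_deg_le dE E0 vE => /=; lia.
by rewrite Es.
Qed.

(** After adding a fixed D0 of degree at least g, each class of degree 0 contains an effective
    divisor of the degree of D0, and there are finitely many of those. *)
Lemma Cl0_finite : finite_set (@Cl0 k X).
Proof.
have [v _] := exists_place X.
pose D0 := Defs.point v *+ genus X.
have dD0 : divisor X D0 by exact/divisorMn/divisor_point.
have degD0 : (genus X)%:Z <= div_deg D0.
  by rewrite div_pointMn; have := pdeg_gt0 v; nia.
apply: (@sub_finite_set _ _ ((fun E => lin_class (E - D0)) @` [set E : place -> int | [/\ divisor X E,
   forall v, 0 <= E v & div_deg E <= (absz (div_deg D0))%:Z]])).
  move=> _ [D [dD dD'] <-]; have dDD := divisorD dD dD0.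
  have /(ldim_gt0P dDD)[f f0 Lf] : (0 < ldim (D + D0)%R)%N.
    have := ldim_ge dDD; rewrite (div_degD dD dD0) dD'; have := ldim0_gt0 X.
    by move: degD0; lia.
  exists (D + D0 + principal f).
    split; [exact/divisorD/divisor_principal|exact/Lsp_eff|].
    rewrite (div_degD dDD (divisor_principal f0)) (div_degD dD dD0) dD' div_deg_principal //.
    by move: degD0; lia.
  apply/esym/lin_classP; exists f => //.
  by apply/funext => w; rewrite !fctE; ring.
exact/finite_image/finite_eff.
Qed.

(** Fixing one coordinate to be 1 makes the functions pairwise non-proportional, so that they define
    q^a different effective divisors D + (f). *)
Lemma dim_family a D : divisor X D -> (a < ldim D)%N ->
  exists Phi : {ffun 'I_a -> k} -> F,
  (forall c, Phi c != 0 /\ Lsp D (Phi c)) /\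
  forall c c' z, Phi c = const X z * Phi c' -> c = c'.
Proof.
move=> dD al; have := ldimP dD.
move=> /(qdimP (kscaling X) _ _ (kscale_sub0 X))[e [Le ie _]].
pose e' (i : 'I_a.+1) := e (widen_ord al i).
have ie' : indep (@kscale _ X) [set 0] e'.
  move=> c hc i.
  pose c' (j : 'I_(ldim D)) := if insub (nat_of_ord j) is Some j' then c j' else 0.
  have : c' (widen_ord al i) = 0; last by rewrite /c' valK.
  have {}hc : \sum_i kscale (c i) (e' i) = 0 by exact: hc.
  apply: ie => /=; rewrite -[RHS]hc.
  rewrite (bigID (fun j : 'I_(ldim D) => (j < a.+1)%N)) /= [X in _ + X]big1 ?addr0; last first.
    by move=> j /negPf ja; rewrite /c' insubF // /kscale rmorph0 mul0r.
  rewrite (reindex_onto (widen_ord al) (fun j => inord j)) /=; last first.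
    by move=> j ja; apply/val_inj; rewrite /= inordK.
  apply: eq_big => j; first by rewrite ltn_ord inord_val eqxx.
  by move=> _; rewrite /c' /e' /= valK.
pose ext (c : {ffun 'I_a -> k}) (i : 'I_a.+1) := if unlift fintype.ord0 i is Some j then c j else 1.
exists (fun c => \sum_i kscale (ext c i) (e' i)); split=> [c|c c' z E].
  split; last by apply: (lin_sum _ (Lsp_subsp D)) => i; exact: Le.
  apply/eqP => h; have /eqP := ie' _ h fintype.ord0.
  by rewrite /ext unlift_none oner_eq0.
have h i : ext c i = z * ext c' i.
  apply/eqP; rewrite -subr_eq0; apply/eqP; apply: (ie' (fun i => ext c i - z * ext c' i)) => /=.
  rewrite -[RHS](subrr (const X z * \sum_i kscale (ext c' i) (e' i))) -{1}E mulr_sumr -sumrB.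
  by apply: eq_bigr => j _; rewrite /kscale rmorphB rmorphM mulrBl mulrA.
have := h fintype.ord0; rewrite /ext unlift_none mulr1 => z1.
by apply/ffunP => i; have := h (lift fintype.ord0 i); rewrite /ext liftK -z1 mul1r.
Qed.

(* What matters is that the bound is O(q^M) with the class number as constant. *)
Lemma eff_count M : exists (T : finType) (dec : T -> place -> int),
  (#|T| <= #|` fset_set (@Cl0 k X)| * #|k| ^ (ldim (0%R : place -> int) + M.+1))%N /\
  forall E, divisor X E -> (forall v, 0 <= E v) -> div_deg E <= M%:Z -> exists x, E = dec x.
Proof.
pose l0 := ldim (0 : place -> int); pose q := #|k|.
pose A := enum_fset (fset_set (@Cl0 k X)); pose h := size A.
have hE : h = #|` fset_set (@Cl0 k X)| by [].
(* [B j] is a reference divisor of degree j, and [G j c] an effective one of degree j whose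
   difference with it has class c. The default 0 is harmless: both are only used when some effective
   E provides a witness. *)
pose B (j : nat) : place -> int := xget 0 [set B | divisor X B /\ div_deg B = j%:Z].
pose G (j : nat) (c : 'I_h) : place -> int := xget 0 [set G | [/\ divisor X G, forall v, 0 <= G v,
   div_deg G = j%:Z & lin_class (G - B j) = tnth (in_tuple A) c]].
have /choice[bas hbas] : forall D : place -> int, exists u : nat -> F, divisor X D -> forall f, Lsp D f ->
    exists c : 'I_(ldim D) -> k, f = \sum_i kscale (c i) (u i).
  move=> D; have [dD|nD] := pselect (divisor X D); last by exists (fun=> 0) => /nD.
  have := ldimP dD => /(qdimP (kscaling X) _ _ (kscale_sub0 X))[e [_ _ se]].
  exists (fun i => if insub i is Some i then e i else 0) => _ f /se[c /eqP].
  rewrite subr_eq0 => /eqP ->; exists c; apply: eq_bigr => i _; by rewrite valK.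
(* An effective divisor is coded by its degree, its class and the coordinates of a function in L(G j
   c), whose dimension is at most j + ldim 0. *)
pose T := {j : 'I_M.+1 & ('I_h * {ffun 'I_(j + l0) -> k})%type}.
exists T, (fun x : T => G (tag x) (tagged x).1 +
  principal (\sum_i kscale ((tagged x).2 i) (bas (G (tag x) (tagged x).1) i))); split.
  rewrite card_tagged -hE sumnE big_map big_enum /=.
  under eq_bigr do rewrite card_prod card_ord card_ffun card_ord expnD mulnCA.
  rewrite -big_distrl /= expnD [X in (_ <= X)%N]mulnA [X in (_ <= X)%N]mulnC leq_mul2r; apply/orP; right.
  have q2 : (1 < q)%N by exact: card_finNzRing_gt1.
  elim: (M) => [|m IH]; first by rewrite big_ord_recr big_ord0 /= expn0 expn1 add0n ltnW.
  rewrite big_ord_recr /=; apply: leq_trans (leq_add IH (leqnn _)) _.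
  by rewrite addnn -mul2n [in leqRHS]expnS leq_mul2r q2 orbT.
move=> E dE E0 degE; have degE0 := div_deg_ge0 dE E0.
have jM : (absz (div_deg E) < M.+1)%N by lia.
pose j := Ordinal jM.
have jE : div_deg E = (absz (div_deg E))%:Z by rewrite gez0_abs.
have [dB degB] : divisor X (B j) /\ div_deg (B j) = j%:Z.
  by apply: (@xgetI _ 0 [set B | divisor X B /\ div_deg B = j%:Z] E); split.
have cA : lin_class (E - B j) \in A.
  rewrite /A /= in_fset_set; last exact: Cl0_finite.
  rewrite inE; exists (E - B j) => //; split; first exact: divisorB.
  by rewrite (div_degB dE dB) degB /= -jE subrr.
have ch : (index (lin_class (E - B j)%R) A < size A)%N by rewrite /h index_mem.
pose c := Ordinal ch.
have [dG G0 degG lG] : [/\ divisor X (G j c), forall v, 0 <= G j c v,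
   div_deg (G j c) = j%:Z & lin_class (G j c - B j) = tnth (in_tuple A) c].
  apply: (@xgetI _ 0 [set G | [/\ divisor X G, forall v, 0 <= G v,
   div_deg G = j%:Z & lin_class (G - B j) = tnth (in_tuple A) c]] E); split=> //.
  by rewrite (tnth_nth (lin_class E)) /= nth_index.
have [f f0 Ef] : exists2 f, f != 0 & E = G j c + principal f.
  have /lin_classP[f f0 Ef] : lin_class (G j c - B j) = lin_class (E - B j).
    by rewrite lG (tnth_nth (lin_class E)) /= nth_index.
  by exists f => //; rewrite -[LHS](subrK (B j)) Ef; apply/funext => v; rewrite !fctE; ring.
have Lf : Lsp (G j c) f by apply/Lsp_eff => //; rewrite -Ef.
have lG' : (ldim (G j c) <= j + l0)%N.
  have := ldim_le (divisor0 X) dG G0; rewrite degG div_deg0 subr0 /l0; lia.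
have [x fx] := hbas _ dG _ Lf.
exists (existT _ j (c, [ffun i => if insub (nat_of_ord i) is Some i then x i else 0])) => /=.
rewrite {1}Ef; congr (_ + principal _); rewrite fx.
rewrite [RHS](bigID (fun i : 'I_(j + l0) => (i < ldim (G j c))%N)) /= [X in _ + X]big1 ?addr0; last first.
  by move=> i /negPf il; rewrite ffunE insubF // /kscale rmorph0 mul0r.
have [l1|l1] := posnP (ldim (G j c)).
  rewrite [RHS]big_pred0; last by move=> i; rewrite l1.
  by apply: big1 => -[i il]; exfalso; rewrite l1 in il.
rewrite [RHS](reindex_onto (widen_ord lG') (fun i => insubd (Ordinal l1) (nat_of_ord i))) /=; last first.
  by move=> i il; apply/val_inj; rewrite /= val_insubd il.
apply: eq_big => i; last by move=> _; rewrite ffunE /= valK.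
by rewrite ltn_ord /=; apply/esym/eqP/val_inj; rewrite val_insubd /= ltn_ord.
Qed.
End FiniteField.

(** * Two disjoint lifts of all places cannot exist *)

Section NoSplitCover.
Variables (k : finFieldType) (X X' : curve k).
Variables w1 w2 : place X -> place X'.
Hypotheses (w1_inj : injective w1) (w2_inj : injective w2) (w12 : forall P Q, w1 P <> w2 Q).
Hypotheses (deg1 : forall P, (pdeg (w1 P) <= pdeg P)%N) (deg2 : forall P, (pdeg (w2 P) <= pdeg P)%N).

Lemma push_divisor (E1 E2 : place X -> int) : divisor X E1 -> divisor X E2 ->
  (forall v, 0 <= E1 v) -> (forall v, 0 <= E2 v) -> exists G : place X' -> int,
  [/\ divisor X' G, forall v, 0 <= G v, div_deg G <= div_deg E1 + div_deg E2 &
      (forall v, G (w1 v) = E1 v) /\ (forall v, G (w2 v) = E2 v)].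
Proof.
move=> dE1 dE2 E10 E20.
have /choice[G hG] : forall y, exists n, [/\ forall v, w1 v = y -> n = E1 v, forall v, w2 v = y -> n = E2 v &
    (forall v, w1 v <> y) -> (forall v, w2 v <> y) -> n = 0].
  move=> y; have [[v vy]|h1] := pselect (exists v, w1 v = y).
    exists (E1 v); split=> [u|u|/(_ v)//]; last by rewrite -vy => /esym/w12.
    by rewrite -vy => /w1_inj ->.
  have [[v vy]|h2] := pselect (exists v, w2 v = y).
    exists (E2 v); split=> [u uy|u|_ /(_ v)//]; first by case: h1; exists u.
    by rewrite -vy => /w2_inj ->.
  exists 0; split=> // [u uy|u uy]; [by case: h1; exists u|by case: h2; exists u].
have G1 v : G (w1 v) = E1 v by case: (hG (w1 v)) => h _ _; exact: h.
have G2 v : G (w2 v) = E2 v by case: (hG (w2 v)) => _ h _; exact: h.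
have [s1 [us1 hs1]] := divisor_seq dE1; have [s2 [us2 hs2]] := divisor_seq dE2.
pose s := map w1 s1 ++ map w2 s2.
have us : uniq s.
  rewrite cat_uniq !map_inj_uniq // us1 us2 andbT /=; apply/hasPn => _ /mapP[v _ ->].
  by apply/mapP => -[u _ /esym/w12].
have hs y : G y != 0 -> y \in s.
  move=> Gy; rewrite mem_cat; have [[v vy]|h1] := pselect (exists v, w1 v = y).
    by rewrite -vy map_f // hs1 // -G1 vy.
  have [[v vy]|h2] := pselect (exists v, w2 v = y).
    by rewrite -vy [X in _ || X]map_f ?orbT // hs2 // -G2 vy.
  case/eqP: Gy; case: (hG y) => _ _; apply => v vy; [by case: h1; exists v|by case: h2; exists v].
exists G; split=> // [|y|].
- by apply: (@sub_finite_set _ _ [set` s]) => // y /= /hs.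
- have [->//|/hs] := eqVneq (G y) 0; rewrite mem_cat.
  by case/orP => /mapP[v _ ->]; rewrite ?G1 ?G2.
- rewrite (div_deg_seq us hs) (div_deg_seq us1 hs1) (div_deg_seq us2 hs2) big_cat /= !big_map.
  by apply: lerD; apply: ler_sum => v _; rewrite ?G1 ?G2 ler_wpM2r ?lez_nat.
Qed.

(** For each i <= N there are q^K pairs of effective divisors of degrees d (g + i) and d (g + N - i)
    on X, with K independent of i. Placed along w1 and w2 they give distinct effective divisors of
    degree at most n d on X'. This makes (N + 1) q^K divisors, while [eff_count] permits N q^K. *)
Lemma no_split_cover : (forall f : funfield X, Lsp 0 f -> exists z, f = const X z) -> False.
Proof.
move=> constP; have [y _] := exists_place X.
pose d := pdeg y; have d0 : (0 < d)%N by exact: pdeg_gt0.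
pose q := #|k|; have q2 : (1 < q)%N by exact: card_finNzRing_gt1.
pose g := genus X; pose l0 := ldim (0 : place X' -> int).
pose N := (#|` fset_set (@Cl0 k X')| * q ^ (l0 + (2 * g).+1))%N.
pose D m := Defs.point y *+ m.
have dD m : divisor X (D m) by exact/divisorMn/divisor_point.
pose n := (2 * g + N)%N; pose K := (n * d - 2 * g)%N.
have gd : (g <= g * d)%N by rewrite leq_pmulr.
pose a (i : 'I_N.+1) := ((g + i) * d - g)%N; pose b (i : 'I_N.+1) := ((g + (N - i)) * d - g)%N.
have abK i : (a i + b i = K)%N by have := ltn_ord i; rewrite /a /b /K /n; nia.
have ldimD m : (m * d + 1 <= ldim (D m) + g)%N.
  have := ldim_ge (dD m); rewrite /D div_pointMn -/d -/g; have := ldim0_gt0 X.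
  by move: (ldim _) (ldim _) => u v; lia.
have ex1 i : exists Phi : {ffun 'I_(a i) -> k} -> funfield X,
    (forall c, Phi c != 0 /\ Lsp (D (g + i)%N) (Phi c)) /\
    forall c c' z, Phi c = const X z * Phi c' -> c = c'.
  apply: dim_family => //; have := ldimD (g + i)%N; rewrite /a; nia.
pose P1 i := projT1 (cid (ex1 i)); have hP1 i := projT2 (cid (ex1 i)).
have ex2 i : exists Phi : {ffun 'I_(b i) -> k} -> funfield X,
    (forall c, Phi c != 0 /\ Lsp (D (g + (N - i))%N) (Phi c)) /\
    forall c c' z, Phi c = const X z * Phi c' -> c = c'.
  apply: dim_family => //; have := ldimD (g + (N - i))%N; rewrite /b; nia.
pose P2 i := projT1 (cid (ex2 i)); have hP2 i := projT2 (cid (ex2 i)).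
pose T := {i : 'I_N.+1 & ({ffun 'I_(a i) -> k} * {ffun 'I_(b i) -> k})%type}.
pose E1 (t : T) := D (g + tag t)%N + principal (P1 _ (tagged t).1).
pose E2 (t : T) := D (g + (N - tag t))%N + principal (P2 _ (tagged t).2).
have P10 (t : T) : P1 (tag t) (tagged t).1 != 0 by case: (hP1 (tag t)) => /(_ (tagged t).1)[].
have P20 (t : T) : P2 (tag t) (tagged t).2 != 0 by case: (hP2 (tag t)) => /(_ (tagged t).2)[].
have dE1 t : divisor X (E1 t) by exact/divisorD/divisor_principal.
have dE2 t : divisor X (E2 t) by exact/divisorD/divisor_principal.
have E10 t v : 0 <= E1 t v.
  by case: (hP1 (tag t)) => /(_ (tagged t).1)[f0 Lf] _; apply: (Lsp_eff _ f0).1.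
have E20 t v : 0 <= E2 t v.
  by case: (hP2 (tag t)) => /(_ (tagged t).2)[f0 Lf] _; apply: (Lsp_eff _ f0).1.
have deg1E t : div_deg (E1 t) = (d * (g + tag t))%N%:Z.
  by rewrite (div_degD (dD _) (divisor_principal (P10 t))) div_deg_principal // addr0 div_pointMn.
have deg2E t : div_deg (E2 t) = (d * (g + (N - tag t)))%N%:Z.
  by rewrite (div_degD (dD _) (divisor_principal (P20 t))) div_deg_principal // addr0 div_pointMn.
have /choice[G hG] : forall t, exists G : place X' -> int,
    [/\ divisor X' G, forall v, 0 <= G v, div_deg G <= div_deg (E1 t) + div_deg (E2 t) &
      (forall v, G (w1 v) = E1 t v) /\ (forall v, G (w2 v) = E2 t v)].
  by move=> t; exact: push_divisor.
have [T' [dec [cT' hdec]]] := eff_count X' (n * d)%N.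
have /choice[e he] : forall t, exists x, G t = dec x.
  move=> t; case: (hG t) => dG G0 degG _; apply: hdec => //; apply: le_trans degG _.
  rewrite deg1E deg2E /n -PoszD lez_nat; have := ltn_ord (tag t); nia.
have principal_eq f f' : f != 0 -> f' != 0 -> principal f = principal f' :> (place X -> int) ->
    exists z, f = const X z * f'.
  move=> f0 f0' E; have [z Ez] : exists z, f / f' = const X z.
    apply: constP => v; rewrite oppr0; right.
    rewrite ordM ?invr_eq0 // ordV -[ord v f]/(principal f v) E /principal; lia.
  by exists z; rewrite -Ez divfK.
(* The degree of E1 recovers i, and each divisor recovers its function up to a constant, hence its
   coordinates by the normalization in [dim_family]. *)
have e_inj : injective e.
  move=> t t' ett'; have Gtt' : G t = G t' by rewrite !he ett'.
  have [_ _ _ [G1 G2]] := hG t; have [_ _ _ [G1' G2']] := hG t'.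
  have {G1 G1'}E1E : E1 t = E1 t' by apply/funext => v; rewrite -G1 -G1' Gtt'.
  have {G2 G2'}E2E : E2 t = E2 t' by apply/funext => v; rewrite -G2 -G2' Gtt'.
  have tt' : tag t = tag t'.
    apply/val_inj => /=; have := deg1E t; rewrite E1E deg1E => -[/eqP].
    by rewrite eqn_pmul2l // eqn_add2l => /eqP.
  case: t t' tt' E1E E2E {ett' Gtt'} => i [c1 c2] [i' [c1' c2']] /= ii'; subst i'.
  rewrite /E1 /E2 /= => /addrI h1 /addrI h2.
  have [z1 hz1] := principal_eq _ _ (P10 (existT _ i (c1, c2))) (P10 (existT _ i (c1', c2'))) h1.
  have [z2 hz2] := principal_eq _ _ (P20 (existT _ i (c1, c2))) (P20 (existT _ i (c1', c2'))) h2.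
  by have /= -> := (hP1 i).2 _ _ _ hz1; have /= -> := (hP2 i).2 _ _ _ hz2.
have := leq_trans (leq_card e e_inj) cT'.
rewrite card_tagged sumnE big_map big_enum /=.
under eq_bigr => i _ do rewrite card_prod !card_ffun !card_ord -expnD abK.
rewrite sum_nat_const card_ord -/q -/l0.
have -> : (l0 + (n * d).+1 = (l0 + (2 * g).+1) + K)%N by rewrite /K /n; nia.
rewrite expnD mulnA -/N leq_mul2r => /orP[|]; last by rewrite ltnn.
by rewrite expn_eq0 => /andP[/eqP q0 _]; rewrite q0 in q2.
Qed.
End NoSplitCover.

(** * The geometric fibre *)

Section Constants.
Variables (k : fieldType) (X : curve k).
Implicit Types (v w : place X) (f g : funfield X).

Lemma ev_congr v f c p : vge v 0 f -> vge v 1 (f - const X c) -> vge v 1 (ev f p - const X p.[c]).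
Proof.
move=> hf hc; have : root (p - (p.[c])%:P) c by rewrite /root !hornerE subrr.
move=> /factor_theorem[q] E.
rewrite -(evC f) -evB E evM evB evX evC -[1]add0r; apply: vgeM => //.
rewrite (ev_coef _ (leqnn _)); apply: vge_sum => i _.
rewrite -[0]addr0; apply: vgeM; first exact: vge_const.
elim: (nat_of_ord i) => [|n IH]; first by rewrite expr0 -(rmorph1 (const X)); exact: vge_const.
by rewrite exprS -[0]addr0; apply: vgeM.
Qed.

Lemma vge_const1 v c : vge v 1 (const X c) -> c = 0.
Proof.
by case=> [/eqP|]; rewrite ?ord_const // const_eq0 => /eqP.
Qed.

Lemma vge_unit v f : vge v 0 f -> ~ vge v 1 f -> f != 0 /\ ord v f = 0.
Proof.
move=> h0 h1; have f0 : f != 0 by apply/eqP => f0; apply: h1; rewrite f0; left.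
split=> //; move: h0 h1; rewrite !vge_ord // => h0 h1.
by have [//|h2] := eqVneq (ord v f) 0; case: h1; lia.
Qed.

Lemma vge1_prod v (I : eqType) (r : seq I) (E : I -> funfield X) :
  (forall i, i \in r -> vge v 0 (E i)) -> vge v 1 (\prod_(i <- r) E i) ->
  exists2 i, i \in r & vge v 1 (E i).
Proof.
move=> h0 h1; apply: contrapT => hn.
have hu i : i \in r -> E i != 0 /\ ord v (E i) = 0.
  by move=> ir; apply: vge_unit; [exact: h0|move=> h; apply: hn; exists i].
have : \prod_(i <- r) E i != 0 /\ ord v (\prod_(i <- r) E i) = 0.
  rewrite big_seq; elim/big_ind : _ => [|x y [x0 ox] [y0 oy]|i /hu //].
    by rewrite oner_eq0 ord_one.
  by rewrite mulf_neq0 // ordM // ox oy.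
by case=> n0 o0; move: h1; rewrite vge_ord // o0.
Qed.

End Constants.

(** The residue of f is a root of a polynomial over k, which splits into linear factors; one of the
    factors must vanish at v. *)
Lemma residue_closed (k : closedFieldType) (X : curve k) (v : place X) f :
  vge v 0 f -> exists c, vge v 1 (f - const X c).
Proof.
move=> hf; have [->|f0] := eqVneq f 0; first by exists 0; rewrite rmorph0 subr0; left.
have [p [p0 _ hp]] : exists p : {poly k}, [/\ p != 0, (size p <= (pdeg v).+1)%N & vge v 1 (ev f p)].
  by apply: place_root; apply/(vge_ord v 0 f0).
have [r Er] := closed_field_poly_normal p.
have lp : const X (lead_coef p) != 0 by rewrite const_eq0 lead_coef_eq0.
move: hp; rewrite Er -mul_polyC evM evC vgeMl // ord_const subr0 ev_prod => hp.
have [c _ hc] : exists2 c, c \in r & vge v 1 (ev f ('X - c%:P)).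
  apply: vge1_prod hp => c _; rewrite evB evX evC; apply: vgeB => //; exact: vge_const.
by exists c; move: hc; rewrite evB evX evC.
Qed.

(** The orders at w of elements coming from X form the multiples of their least positive value e,
    the ramification index; dividing by e normalizes the restricted valuation. *)
Lemma place_restrict (k K : fieldType) (X : curve k) (Z : curve K) (io : {rmorphism k -> K})
    (j : {rmorphism funfield X -> funfield Z}) (w : place Z) :
  (forall c, j (const X c) = const Z (io c)) -> (exists f, ord w (j f) != 0) ->
  exists (v : place X) (e : nat), (0 < e)%N /\ forall f, ord w (j f) = e%:Z * ord v f.
Proof.
move=> jc [f0 hf0].
have f00 : f0 != 0 by apply: contraNneq hf0 => ->; rewrite rmorph0 Defs.ord0.
pose P n := `[< (0 < n)%N /\ exists f, ord w (j f) = n%:Z >].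
have P0 : exists n, P n.
  exists (absz (ord w (j f0))); apply/asboolP; split; first by lia.
  have [h|h] := leP 0 (ord w (j f0)); first by exists f0; lia.
  by exists f0^-1; rewrite fmorphV ordV ltz0_abs.
case: (ex_minnP P0) => e /asboolP[e0 [u uE]] emin.
have u0 : u != 0 by apply/eqP => u0; move: uE e0; rewrite u0 rmorph0 Defs.ord0; lia.
have dv f : ord w (j f) = e%:Z * (ord w (j f) %/ e%:Z)%Z.
  have [->|f_0] := eqVneq f 0; first by rewrite rmorph0 Defs.ord0 div0z mulr0.
  have E := divz_eq (ord w (j f)) e%:Z.
  suff r0 : (ord w (j f) %% e%:Z)%Z = 0 by rewrite {1}E r0 addr0 mulrC.
  apply/eqP/negPn/negP => r0.
  have re : (ord w (j f) %% e%:Z)%Z < e%:Z by apply: ltz_pmod; lia.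
  have rp : 0 <= (ord w (j f) %% e%:Z)%Z by apply: modz_ge0; lia.
  have /emin : P (absz (ord w (j f) %% e%:Z)%Z); last by lia.
  apply/asboolP; split; first by lia.
  exists (f * u ^ (- (ord w (j f) %/ e%:Z)%Z)).
  rewrite rmorphM fmorphXz ordM ?fmorph_eq0 ?expfz_neq0 ?fmorph_eq0 // ordXz uE gez0_abs //.
  by rewrite {1}E; ring.
pose o f := (ord w (j f) %/ e%:Z)%Z.
have e0' : e%:Z != 0 by lia.
have o0 : o 0 = 0 by rewrite /o rmorph0 Defs.ord0 div0z.
have oM f g : f != 0 -> g != 0 -> o (f * g) = o f + o g.
  move=> fn gn; apply: (mulfI e0'); rewrite -dv mulrDr -!dv rmorphM ordM ?fmorph_eq0 //.
have oD f g : f != 0 -> g != 0 -> f + g != 0 -> Num.min (o f) (o g) <= o (f + g).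
  move=> fn gn fgn; have ep : 0 < e%:Z by lia.
  rewrite -(ler_pM2l ep) -dv rmorphD.
  have := @ordD _ _ w (j f) (j g); rewrite !fmorph_eq0 -rmorphD fmorph_eq0 => /(_ fn gn fgn).
  rewrite rmorphD; apply: le_trans; rewrite le_min.
  have [ofg|ofg] := leP (o f) (o g).
    by rewrite {1}(dv f) (dv g) !ler_pM2l // lexx.
  by rewrite {1}(dv f) (dv g) !ler_pM2l // lexx (ltW ofg).
have oc c : o (const X c) = 0 by rewrite /o jc ord_const div0z.
have os : exists f, o f = 1 by exists u; rewrite /o uE divzz e0'.
by exists (Place o0 oM oD oc os), e.
Qed.

Section Fibre.
Variables (k : finFieldType) (X : curve k) (Y : geometric_fibre X).
Local Notation F := (funfield X).
Local Notation K := (kbar Y).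
Local Notation Z := (fibre Y).
Local Notation FZ := (funfield Z).
Local Notation io := (kbar_emb Y).
Local Notation tau := (to_fibre Y).
Local Notation q := #|k|.

Definition kindep n (b : 'I_n -> K) :=
  forall c : 'I_n -> k, \sum_i io (c i) * b i = 0 -> forall i, c i = 0.

Lemma q_gt1 : (1 < q)%N. Proof. exact: card_finNzRing_gt1. Qed.

Lemma frobD (a b : K) : (a + b) ^+ q = a ^+ q + b ^+ q.
Proof.
apply: exprDn_pchar; have [p pr pc] := finPcharP k.
have pK : p \in [pchar K] by exact: (rmorph_pchar io pc).
rewrite (eq_pnat _ (pcharf_eq pK)).
by have := pprimeChar_pgroup pc; rewrite /pgroup cardsT.
Qed.

Lemma frobN (a : K) : (- a) ^+ q = - a ^+ q.
Proof. by apply/eqP; rewrite -addr_eq0 -frobD addNr expr0n -[q]prednK // ltnW // q_gt1. Qed.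

Lemma frobB (a b : K) : (a - b) ^+ q = a ^+ q - b ^+ q.
Proof. by rewrite frobD frobN. Qed.

Lemma frob_sum n (a : 'I_n -> K) : (\sum_i a i) ^+ q = \sum_i a i ^+ q.
Proof. by apply: (big_morph (fun x => x ^+ q) frobD); rewrite expr0n -[q]prednK // ltnW // q_gt1. Qed.

Lemma frob_io c : io c ^+ q = io c.
Proof. by rewrite -rmorphXn expf_card. Qed.

Lemma frob_fixed (b : K) : b ^+ q = b -> exists c, b = io c.
Proof.
move=> hb; have : (map_poly io ('X^q - 'X)).[b] = 0.
  by rewrite rmorphB /= map_polyXn map_polyX !hornerE hb subrr.
rewrite finField_genPoly rmorph_prod horner_prod => /eqP.
rewrite prodf_seq_eq0 => /hasP[c _ /=].
rewrite rmorphB /= map_polyX map_polyC !hornerE subr_eq0 => /eqP ->; by exists c.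
Qed.

(** If the a i are independent over k, linear disjointness gives b i = 0. Otherwise one a i is
    eliminated by a relation over k, which Frobenius does not disturb. *)
Lemma sigma_wd n (a : 'I_n -> F) (b : 'I_n -> K) :
  \sum_i tau (a i) * const Z (b i) = 0 -> \sum_i tau (a i) * const Z (b i ^+ q) = 0.
Proof.
elim: n a b => [|n IH] a b hab; first by rewrite big_ord0.
have [ia|/existsNP[c /not_implyP[hc /existsNP[i0 /eqP ci0]]]] :=
    pselect (forall c : 'I_n.+1 -> k, \sum_i a i * const X (c i) = 0 -> forall i, c i = 0).
  have b0 := fibre_free ia hab; apply: big1 => i _.
  by rewrite b0 expr0n -[q]prednK ?(ltnW q_gt1) // rmorph0 mulr0.
pose d j := c (lift i0 j) / c i0.
have aE : a i0 = - \sum_j a (lift i0 j) * const X (d j).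
  move: hc; rewrite (bigD1_ord i0) //= => /eqP; rewrite addr_eq0 => /eqP hc.
  have ci0' : const X (c i0) != 0 by rewrite const_eq0.
  apply: (mulIf ci0'); rewrite hc mulNr mulr_suml; congr (- _); apply: eq_bigr => j _.
  by rewrite /d fmorph_div -mulrA divfK.
have tE (x : K) : tau (a i0) * const Z x = - \sum_j tau (a (lift i0 j)) * const Z (io (d j) * x).
  rewrite aE rmorphN rmorph_sum mulNr mulr_suml; congr (- _); apply: eq_bigr => j _.
  by rewrite rmorphM to_fibre_const -mulrA -rmorphM.
have comb (x : K) (y : 'I_n -> K) : tau (a i0) * const Z x + \sum_j tau (a (lift i0 j)) * const Z (y j) =
    \sum_j tau (a (lift i0 j)) * const Z (y j - io (d j) * x).
  rewrite tE addrC -sumrB; apply: eq_bigr => j _.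
  by rewrite rmorphB mulrBr.
rewrite (bigD1_ord i0) //= comb; move: hab; rewrite (bigD1_ord i0) //= comb => /IH h.
by rewrite -[RHS]h; apply: eq_bigr => j _; rewrite frobB exprMn frob_io.
Qed.

Lemma fibre_ex z : exists s, exists n (a : 'I_n -> F) (b : 'I_n -> K),
  z = \sum_i tau (a i) * const Z (b i) /\ s = \sum_i tau (a i) * const Z (b i ^+ q).
Proof.
have [n [a [b ->]]] := fibre_gen z.
by exists (\sum_i tau (a i) * const Z (b i ^+ q)), n, a, b.
Qed.

(* The automorphism 1 (x) Frobenius of the function field of the fibre. *)
Definition sigma (z : FZ) : FZ := projT1 (cid (fibre_ex z)).

Lemma sigmaE n (a : 'I_n -> F) (b : 'I_n -> K) :
  sigma (\sum_i tau (a i) * const Z (b i)) = \sum_i tau (a i) * const Z (b i ^+ q).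
Proof.
rewrite /sigma; case: cid => s [m [a' [b' [E Es]]]] /=; rewrite Es.
pose A i := match fintype.split i with inl i => a i | inr j => a' j end.
pose B i := match fintype.split i with inl i => b i | inr j => - b' j end.
have := @sigma_wd (n + m) A B; rewrite !big_split_ord /=.
have lE i : A (lshift m i) = a i /\ B (lshift m i) = b i by rewrite /A /B (unsplitK (inl _)).
have rE i : A (rshift n i) = a' i /\ B (rshift n i) = - b' i by rewrite /A /B (unsplitK (inr _)).
under eq_bigr do rewrite (lE _).1 (lE _).2.
under [X in _ + X]eq_bigr do rewrite (rE _).1 (rE _).2 rmorphN mulrN.
rewrite sumrN -E subrr => /(_ erefl).
under eq_bigr do rewrite (lE _).1 (lE _).2.
under [X in _ + X]eq_bigr do rewrite (rE _).1 (rE _).2 frobN rmorphN mulrN.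
by rewrite sumrN => /eqP; rewrite subr_eq0 => /eqP.
Qed.

Lemma sigmaD y z : sigma (y + z) = sigma y + sigma z.
Proof.
have [n [a [b ->]]] := fibre_gen y; have [m [a' [b' ->]]] := fibre_gen z.
rewrite !sigmaE.
pose A i := match fintype.split i with inl i => a i | inr j => a' j end.
pose B i := match fintype.split i with inl i => b i | inr j => b' j end.
have lE i : A (lshift m i) = a i /\ B (lshift m i) = b i by rewrite /A /B (unsplitK (inl _)).
have rE i : A (rshift n i) = a' i /\ B (rshift n i) = b' i by rewrite /A /B (unsplitK (inr _)).
have cat (phi : K -> K) : \sum_i tau (A i) * const Z (phi (B i)) =
    \sum_i tau (a i) * const Z (phi (b i)) + \sum_i tau (a' i) * const Z (phi (b' i)).
  rewrite big_split_ord /=; congr (_ + _); apply: eq_bigr => i _.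
    by rewrite (lE i).1 (lE i).2.
  by rewrite (rE i).1 (rE i).2.
by rewrite -(cat (fun x => x ^+ q)) -(cat id) sigmaE.
Qed.

Lemma sigma_pure a b : sigma (tau a * const Z b) = tau a * const Z (b ^+ q).
Proof. by have := @sigmaE 1 (fun=> a) (fun=> b); rewrite !big_ord1. Qed.

Lemma sigma_tau a : sigma (tau a) = tau a.
Proof. by have := sigma_pure a 1; rewrite expr1n rmorph1 !mulr1. Qed.

Lemma sigma_const b : sigma (const Z b) = const Z (b ^+ q).
Proof. by have := sigma_pure 1 b; rewrite rmorph1 !mul1r. Qed.

Lemma sigma0 : sigma 0 = 0. Proof. by rewrite -(rmorph0 tau) sigma_tau. Qed.
Lemma sigma1 : sigma 1 = 1. Proof. by rewrite -(rmorph1 tau) sigma_tau. Qed.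

Lemma sigma_sum n (E : 'I_n -> FZ) : sigma (\sum_i E i) = \sum_i sigma (E i).
Proof. exact: (big_morph _ sigmaD sigma0). Qed.

Lemma sigmaM y z : sigma (y * z) = sigma y * sigma z.
Proof.
have pure a b w : sigma (tau a * const Z b * w) = tau a * const Z (b ^+ q) * sigma w.
  have [n [c [d ->]]] := fibre_gen w.
  rewrite sigmaE !mulr_sumr sigma_sum; apply: eq_bigr => i _.
  by rewrite mulrACA -!rmorphM sigma_pure exprMn !rmorphM mulrACA.
have [n [a [b ->]]] := fibre_gen y.
by rewrite mulr_suml sigma_sum sigmaE mulr_suml; apply: eq_bigr => i _; exact: pure.
Qed.

Lemma sigmaN z : sigma (- z) = - sigma z.
Proof. by apply/eqP; rewrite -addr_eq0 -sigmaD addNr sigma0. Qed.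

Lemma sigmaB y z : sigma (y - z) = sigma y - sigma z.
Proof. by rewrite sigmaD sigmaN. Qed.

Lemma sigma_eq0 z : (sigma z == 0) = (z == 0).
Proof.
have [->|z0] := eqVneq z 0; first by rewrite sigma0 eqxx.
apply/negP => /eqP h; have := sigmaM z z^-1.
by rewrite divff // sigma1 h mul0r => /eqP; rewrite oner_eq0.
Qed.

Lemma sigmaV z : sigma z^-1 = (sigma z)^-1.
Proof.
have [->|z0] := eqVneq z 0; first by rewrite invr0 sigma0 invr0.
have s0 : sigma z != 0 by rewrite sigma_eq0.
by apply: (mulfI s0); rewrite -sigmaM !divff // sigma1.
Qed.

Lemma frob_surj (b : K) : exists c : K, c ^+ q = b.
Proof.
have q0 : (0 < q)%N by rewrite ltnW // q_gt1.
have [c hc] := @solve_monicpoly K q (nth 0 [:: b]) q0; exists c; rewrite hc.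
rewrite -[q]prednK // big_ord_recl /= expr0 mulr1 big1 ?addr0 // => i _.
by rewrite nth_nil mul0r.
Qed.

Lemma sigma_surj z : exists y, sigma y = z.
Proof.
have [n [a [b ->]]] := fibre_gen z; have /choice[c hc] := fun i => frob_surj (b i).
exists (\sum_i tau (a i) * const Z (c i)); rewrite sigmaE.
by apply: eq_bigr => i _; rewrite hc.
Qed.

Section PlaceSigma.
Variable w : place Z.
Let o z := ord w (sigma z).
Lemma psigma0 : o 0 = 0. Proof. by rewrite /o sigma0 Defs.ord0. Qed.
Lemma psigmaM f g : f != 0 -> g != 0 -> o (f * g) = o f + o g.
Proof. by move=> f0 g0; rewrite /o sigmaM ordM ?sigma_eq0. Qed.
Lemma psigmaD f g : f != 0 -> g != 0 -> f + g != 0 -> Num.min (o f) (o g) <= o (f + g).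
Proof. by move=> f0 g0 fg0; rewrite /o sigmaD ordD ?sigma_eq0 // -sigmaD sigma_eq0. Qed.
Lemma psigma_const c : o (const Z c) = 0.
Proof. by rewrite /o sigma_const ord_const. Qed.
Lemma psigma_surj : exists f, o f = 1.
Proof. by have [g hg] := ord_surj w; have [f fg] := sigma_surj g; exists f; rewrite /o fg. Qed.
Definition psigma : place Z := Place psigma0 psigmaM psigmaD psigma_const psigma_surj.
End PlaceSigma.

Lemma vge_psigma w n z : vge (psigma w) n z <-> vge w n (sigma z).
Proof.
split=> -[h|h]; [by left; rewrite h sigma0|by right| |by right].
by left; apply/eqP; rewrite -sigma_eq0 h.
Qed.

(** Artin's trick. Scale the last coefficient to 1 and apply sigma - 1, which preserves regularity
    on S: the last term disappears and the others get coefficients c_i^q - c_i. These are again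
    independent over k, because a relation between them yields a combination of the c_i fixed by
    Frobenius, that is, an element of k. *)
Lemma descent (S : set (place Z)) : (forall w, S w -> S (psigma w)) ->
  forall n (f : 'I_n -> F) (b : 'I_n -> K), kindep b ->
  (forall w, S w -> vge w 0 (\sum_i tau (f i) * const Z (b i))) ->
  forall i w, S w -> vge w 0 (tau (f i)).
Proof.
move=> Ss; elim=> [|n IH] f b ib h; first by case.
have ex_last (l : k) (c : 'I_n -> k) :
    \sum_(i < n) io (c i) * b (widen_ord (leqnSn n) i) + io l * b ord_max = 0 ->
    l = 0 /\ forall i, c i = 0.
  move=> hc; pose c' (i : 'I_n.+1) := if insub (nat_of_ord i) is Some j then c j else l.
  have c'E : \sum_i io (c' i) * b i = 0.
    rewrite big_ord_recr /= -[RHS]hc; congr (_ + _); last by rewrite /c' insubF //= ltnn.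
    by apply: eq_bigr => i _; rewrite /c' /= valK.
  split; first by have := ib _ c'E ord_max; rewrite /c' insubF //= ltnn.
  by move=> i; have := ib _ c'E (widen_ord (leqnSn n) i); rewrite /c' /= valK.
have bn0 : b ord_max != 0.
  apply/eqP => bn; have [|] := ex_last 1 (fun=> 0).
    by rewrite bn mulr0 addr0 big1 // => i _; rewrite rmorph0 mul0r.
  by move/eqP; rewrite oner_eq0.
have cbn0 : const Z (b ord_max) != 0 by rewrite const_eq0.
pose c i := b (widen_ord (leqnSn n) i) / b ord_max.
have hz w : S w -> vge w 0 (\sum_(i < n) tau (f (widen_ord (leqnSn n) i)) * const Z (c i) + tau (f ord_max)).
  move=> Sw; have -> : \sum_(i < n) tau (f (widen_ord (leqnSn n) i)) * const Z (c i) + tau (f ord_max) =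
     const Z (b ord_max)^-1 * \sum_i tau (f i) * const Z (b i).
    rewrite big_ord_recr /= mulrDr mulr_sumr; congr (_ + _); last first.
      by rewrite mulrCA -rmorphM mulVf // rmorph1 mulr1.
    by apply: eq_bigr => i _; rewrite mulrCA -rmorphM [_^-1 * _]mulrC.
  by rewrite -[0]addr0; apply: vgeM; [exact: vge_const|exact: h].
have hi : forall i w, S w -> vge w 0 (tau (f (widen_ord (leqnSn n) i))).
  apply: (IH (fun i => f (widen_ord (leqnSn n) i)) (fun i => c i ^+ q - c i)).
    move=> l hl; pose s := \sum_i io (l i) * c i.
    have /frob_fixed[l0 sl0] : s ^+ q = s.
      rewrite /s frob_sum; apply/eqP; rewrite -subr_eq0 -sumrB; apply/eqP.
      by rewrite -[RHS]hl; apply: eq_bigr => i _; rewrite exprMn frob_io mulrBr.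
    have [|_ //] := ex_last (- l0) l.
    rewrite rmorphN mulNr -sl0 /s mulr_suml; apply/eqP; rewrite subr_eq0; apply/eqP.
    by apply: eq_bigr => i _; rewrite -mulrA divfK.
  move=> w Sw; have := vgeB ((vge_psigma w 0 _).1 (hz _ (Ss w Sw))) (hz w Sw).
  rewrite sigmaD sigmaE sigma_tau opprD addrACA subrr addr0 -sumrB.
  by under eq_bigr do rewrite -mulrBr -rmorphB.
move=> i w Sw; have [lt_in|ge_in] := ltnP i n.
  by have := hi (Ordinal lt_in) w Sw; congr (vge _ _ (tau (f _))); apply/val_inj.
have -> : i = ord_max by apply/val_inj/eqP; rewrite /= eqn_leq ge_in -ltnS ltn_ord.
rewrite -[tau _](addKr (\sum_(i < n) tau (f (widen_ord (leqnSn n) i)) * const Z (c i))).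
apply: vgeD; last exact: hz.
apply/vgeN; apply: vge_sum => j _; rewrite -[0]addr0; apply: vgeM; first exact: hi.
exact: vge_const.
Qed.

Lemma transc_tau f : transc f -> transc (tau f).
Proof.
move=> tf p; rewrite (ev_coef _ (leqnn _)) => h; apply/polyP => i; rewrite coef0.
have [ip|ip] := ltnP i (size p); last by rewrite nth_default.
have := @fibre_free _ _ Y (size p) (fun i => f ^+ i) _ (fun i => p`_i) _ (Ordinal ip); apply.
- move=> c hc j; have := tf (\poly_(i < size p) (if insub i is Some i then c i else 0)).
  rewrite (ev_coef _ (size_poly _ _)) => /(_ _)/polyP/(_ j); rewrite coef_poly ltn_ord valK coef0; apply.
  rewrite -[RHS]hc; apply: eq_bigr => l _.
  by rewrite coef_poly ltn_ord valK mulrC.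
- by rewrite -[RHS]h; apply: eq_bigr => j _; rewrite rmorphXn mulrC.
Qed.

Lemma fibre_root (p : {poly K}) z : p != 0 -> ev z p = 0 -> exists c, z = const Z c.
Proof.
move=> p0; have [r ->] := closed_field_poly_normal p.
rewrite -mul_polyC evM evC => /eqP; rewrite mulf_eq0 const_eq0 lead_coef_eq0 (negPf p0) /=.
rewrite ev_prod prodf_seq_eq0 => /hasP[c _ /=]; rewrite evB evX evC subr_eq0 => /eqP ->.
by exists c.
Qed.

Lemma ev_tau f (p : {poly k}) : ev (tau f) (map_poly io p) = tau (ev f p).
Proof.
rewrite (@ev_coef _ _ _ (size p)) ?size_poly // (ev_coef _ (leqnn _)) rmorph_sum.
by apply: eq_bigr => i _; rewrite coef_map rmorphM rmorphXn to_fibre_const.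
Qed.

(** If f were not a constant, 1 and f would be independent over k, hence over K by linear
    disjointness. *)
Lemma tau_const f c : tau f = const Z c -> exists z, f = const X z.
Proof.
move=> h; apply: contrapT => /forallNP nf.
have := @fibre_free _ _ Y 2 (fun i => if i == 0%N :> nat then 1 else f) _
  (fun i => if i == 0%N :> nat then c else -1) _ (lift fintype.ord0 fintype.ord0).
rewrite /= => H; have /eqP : (-1 : K) = 0; last by rewrite oppr_eq0 oner_eq0.
apply: H; last by rewrite !big_ord_recl big_ord0 /= rmorph1 mul1r h rmorphN rmorph1 mulrN1 addr0 subrr.
move=> d; rewrite !big_ord_recl big_ord0 /= mul1r addr0 => /eqP hd.
have d1 : d (lift fintype.ord0 fintype.ord0) = 0.
  apply/eqP/negPn/negP => d1; apply: (nf (- d fintype.ord0 / d (lift fintype.ord0 fintype.ord0))).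
  have cd1 : const X (d (lift fintype.ord0 fintype.ord0)) != 0 by rewrite const_eq0.
  apply: (mulIf cd1); rewrite fmorph_div rmorphN divfK //; apply/eqP.
  by rewrite -addr_eq0 addrC.
move: hd; rewrite d1 rmorph0 mulr0 addr0 const_eq0 => /eqP d0.
by move=> i; case: (unliftP fintype.ord0 i) => [j ->|-> //]; rewrite (ord1 j).
Qed.

(** Upstairs the minimal relation of f splits into linear factors, so tau f is a constant there, and
    [tau_const] brings it down: k is the exact field of constants. *)
Lemma algebraic_const f : ~ transc f -> exists z, f = const X z.
Proof.
move=> /existsNP[p /not_implyP[pf /eqP p0]].
have [c hc] : exists c, tau f = const Z c; last exact: tau_const hc.
by apply: (@fibre_root (map_poly io p)); rewrite ?map_poly_eq0 // ev_tau pf rmorph0.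
Qed.

Lemma Lsp0_const f : Lsp 0 f -> exists z, f = const X z.
Proof.
move=> Lf; apply: algebraic_const => tf.
have [v] := exists_zero (transcV tf); have f0 := transc_neq0 tf.
by have := Lf v; rewrite oppr0 vge_ord // ordV; lia.
Qed.

Lemma ldim0 : ldim (0 : place X -> int) = 1%N.
Proof.
apply: ldimE; apply/(qdimP (kscaling X) _ _ (kscale_sub0 X)).
exists (fun=> 1); split=> [_ v|c|f /Lsp0_const[z ->]].
- by rewrite oppr0; right; rewrite ord_one.
- rewrite big_ord1 /kscale mulr1 => /eqP; rewrite const_eq0 => /eqP c0 i.
  by rewrite (ord1 i).
- by exists (fun=> z); rewrite big_ord1 /kscale mulr1 subrr.
Qed.

(** The restriction to F is not trivial: otherwise a transcendental t would have a residue c in K,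
    algebraic over k, and a polynomial over k killing c would give p(t) a zero at w. *)
Lemma place_below (w : place Z) : exists v : place X, exists2 e : nat, (0 < e)%N &
  forall f, ord w (tau f) = e%:Z * ord v f.
Proof.
have [|v [e [e0 h]]] := @place_restrict _ _ X Z io tau w (@to_fibre_const k X Y); last by exists v, e.
apply: contrapT => /forallNP h0.
have h f : ord w (tau f) = 0 by apply/eqP/negPn/negP/h0.
have [t tt] := exists_transc X.
have [|c hc] := @residue_closed _ Z w (tau t); first by right; rewrite h.
have [p p0 /rootP pc] := kbar_alg c.
have tp0 : ev t p != 0 by apply: contraNneq p0 => /tt ->.
have ht : vge w 0 (tau t) by right; rewrite h.
have := ev_congr (map_poly io p) ht hc.
by rewrite pc rmorph0 subr0 ev_tau vge_ord ?fmorph_eq0 // h.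
Qed.

Lemma lies_overP w v : lies_over (Y := Y) w v <-> exists2 e : nat, (0 < e)%N & forall f, ord w (tau f) = e%:Z * ord v f.
Proof.
split=> [h|[e e0 h] f]; last by rewrite /regular /= h pmulr_rge0.
have [v' [e e0 h']] := place_below w; suff -> : v = v' by exists e.
apply: place_sub => f; rewrite -!regularE => /h; by rewrite /regular /= h' pmulr_rge0.
Qed.

Lemma lies_over_uniq w v v' : lies_over (Y := Y) w v -> lies_over (Y := Y) w v' -> v = v'.
Proof. by move=> h h'; apply: place_sub => f; rewrite -!regularE => /h /h'. Qed.

Lemma lies_over_vge w v f : lies_over (Y := Y) w v -> vge w 0 (tau f) <-> vge v 0 f.
Proof. by move=> h; rewrite -!regularE; exact: h. Qed.

Lemma lies_over_sigma w v : lies_over (Y := Y) w v -> lies_over (Y := Y) (psigma w) v.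
Proof. by move=> h f; rewrite -[regular v f]h /regular /= sigma_tau. Qed.

(** By Riemann's inequality L((g + 1) v) has dimension at least 2, more than L(0). *)
Lemma one_pole (v : place X) : exists f, [/\ f != 0, ord v f < 0 & forall u, u != v -> 0 <= ord u f].
Proof.
pose D := Defs.point v *+ (genus X).+1.
have dD : divisor X D by exact/divisorMn/divisor_point.
have [f Lf nf] : exists2 f, Lsp D f & ~ Lsp 0 f.
  apply: contrapT => h; have : (1 < ldim D)%N.
    have := ldim_ge dD; rewrite div_pointMn ldim0; have := pdeg_gt0 v; nia.
  have -> : ldim D = 1%N; last by [].
  apply: ldimE; have -> : Lsp D = Lsp 0; last by have := ldimP (divisor0 X); rewrite ldim0.
  apply/seteqP; split=> g Lg; first by apply: contrapT => ng; apply: h; exists g.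
  apply: Lsp_le Lg => u; rewrite /D; elim: (genus X).+1 => [|n IH]; first by rewrite mulr0n.
  by rewrite mulrS fctE addr_ge0 // /Defs.point; case: eqP.
have f0 : f != 0 by apply/eqP => f0; apply: nf; rewrite f0 => u; left.
have reg u : u != v -> 0 <= ord u f.
  move=> uv; have := Lf u; rewrite vge_ord //; have -> // : D u = 0.
  rewrite /D; elim: (genus X).+1 => [|n IH]; first by rewrite mulr0n.
  by rewrite mulrS fctE IH addr0 /Defs.point (negPf uv).
exists f; split=> //; rewrite ltNge; apply/negP => vf; apply: nf => u; rewrite oppr0; right.
by have [->//|/reg] := eqVneq u v.
Qed.

(** Take f with its only pole at v. Any pole of tau f lies over a pole of f, hence over v. *)
Lemma place_above (v : place X) : exists w, lies_over (Y := Y) w v.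
Proof.
have [f [f0 vf reg]] := one_pole v.
have tf : transc f by apply: (@ord_transc _ _ v); lia.
have [w hw] := exists_zero (transcV (transc_tau tf)).
exists w; apply/lies_overP; have [v' [e e0 h]] := place_below w.
suff <- : v' = v by exists e.
apply/eqP/negPn/negP => /reg; move: hw; rewrite ordV h; nia.
Qed.
End Fibre.

(** * Extension of the constant field *)

Section FixedField.
Variables (k : finFieldType) (X : curve k) (Y : geometric_fibre X) (l : nat).
Local Notation F := (funfield X).
Local Notation K := (kbar Y).
Local Notation Z := (fibre Y).
Local Notation FZ := (funfield Z).
Local Notation io := (kbar_emb Y).
Local Notation tau := (to_fibre Y).
Local Notation q := #|k|.
Local Notation sigma := (@sigma k X Y).

Lemma iter_sigmaE j n (a : 'I_n -> F) (b : 'I_n -> K) :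
  iter j sigma (\sum_i tau (a i) * const Z (b i)) = \sum_i tau (a i) * const Z (b i ^+ (q ^ j)).
Proof.
elim: j => [|j IH]; first by rewrite expn0; apply: eq_bigr => i _; rewrite expr1.
by rewrite iterS IH sigmaE; apply: eq_bigr => i _; rewrite -exprM -expnSr.
Qed.

Lemma iter_sigmaM j y z : iter j sigma (y * z) = iter j sigma y * iter j sigma z.
Proof. by elim: j => //= j ->; rewrite sigmaM. Qed.

Lemma iter_sigmaB j y z : iter j sigma (y - z) = iter j sigma y - iter j sigma z.
Proof. by elim: j => //= j ->; rewrite sigmaB. Qed.

Lemma iter_sigmaV j z : iter j sigma z^-1 = (iter j sigma z)^-1.
Proof. by elim: j => //= j ->; rewrite sigmaV. Qed.

Lemma iter_sigma1 j : iter j sigma 1 = 1.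
Proof. by elim: j => //= j ->; rewrite sigma1. Qed.

Lemma iter_sigma_tau j f : iter j sigma (tau f) = tau f.
Proof. by elim: j => //= j ->; rewrite sigma_tau. Qed.

Lemma iter_sigma_const j b : iter j sigma (const Z b) = const Z (b ^+ (q ^ j)).
Proof.
elim: j => [|j IH]; first by rewrite expn0 expr1.
by rewrite iterS IH sigma_const -exprM -expnSr.
Qed.

(** The fixed field of sigma^l is the compositum of F with the extension of k of degree l inside K;
    [fix_rep] makes this precise. *)
Definition fixS : {pred FZ} := fun z => iter l sigma z == z.

Fact fixS_divring : divring_closed fixS.
Proof.
split=> [|y z /eqP hy /eqP hz|y z /eqP hy /eqP hz]; apply/eqP.
- exact: iter_sigma1.
- by rewrite iter_sigmaB hy hz.
- by rewrite iter_sigmaM iter_sigmaV hy hz.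
Qed.

HB.instance Definition _ := GRing.isDivringClosed.Build FZ fixS fixS_divring.

Record fixT := FixT { fixval :> FZ; fixvalP : fixval \in fixS }.

HB.instance Definition _ := [isSub for fixval].
HB.instance Definition _ := [Choice of fixT by <:].
HB.instance Definition _ := [SubChoice_isSubComUnitRing of fixT by <:].
HB.instance Definition _ := [SubComUnitRing_isSubIntegralDomain of fixT by <:].
HB.instance Definition _ := [SubIntegralDomain_isSubField of fixT by <:].

Lemma fix_tau f : tau f \in fixS.
Proof. by rewrite unfold_in iter_sigma_tau. Qed.

Lemma fix_const b : b ^+ (q ^ l) = b -> const Z b \in fixS.
Proof. by rewrite unfold_in iter_sigma_const => ->. Qed.

Definition fixtau f : fixT := FixT (fix_tau f).

Lemma fixtau_zmod : zmod_morphism fixtau.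
Proof. by move=> f g; apply/val_inj; rewrite /= rmorphB. Qed.
Lemma fixtau_monoid : monoid_morphism fixtau.
Proof. by split=> [|f g]; apply/val_inj; rewrite /= ?rmorph1 ?rmorphM. Qed.
HB.instance Definition _ := GRing.isZmodMorphism.Build F fixT fixtau fixtau_zmod.
HB.instance Definition _ := GRing.isMonoidMorphism.Build F fixT fixtau fixtau_monoid.

Definition fixc : {rmorphism k -> fixT} := [the {rmorphism k -> fixT} of fixtau \o const X].

Lemma fixcE c : fixval (fixc c) = const Z (io c).
Proof. by rewrite /= to_fibre_const. Qed.

(* Eliminating linear relations between the coefficients in F of an element of F (x) K. *)
Lemma rep_indepl n (a : 'I_n -> F) (b : 'I_n -> K) : exists m (a' : 'I_m -> F) (b' : 'I_m -> K),
  (forall c : 'I_m -> k, \sum_i a' i * const X (c i) = 0 -> forall i, c i = 0) /\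
  \sum_i tau (a i) * const Z (b i) = \sum_i tau (a' i) * const Z (b' i).
Proof.
elim: n a b => [|n IH] a b; first by exists 0%N, a, b; split=> // c _ [].
have [ia|/existsNP[c /not_implyP[hc /existsNP[i0 /eqP ci0]]]] :=
    pselect (forall c : 'I_n.+1 -> k, \sum_i a i * const X (c i) = 0 -> forall i, c i = 0).
  by exists n.+1, a, b.
pose d j := c (lift i0 j) / c i0.
have aE : a i0 = - \sum_j a (lift i0 j) * const X (d j).
  move: hc; rewrite (bigD1_ord i0) //= => /eqP; rewrite addr_eq0 => /eqP hc.
  have ci0' : const X (c i0) != 0 by rewrite const_eq0.
  apply: (mulIf ci0'); rewrite hc mulNr mulr_suml; congr (- _); apply: eq_bigr => j _.
  by rewrite /d fmorph_div -mulrA divfK.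
have [m [a' [b' [ia' E]]]] := IH (fun j => a (lift i0 j)) (fun j => b (lift i0 j) - io (d j) * b i0).
exists m, a', b'; split=> //; rewrite -E (bigD1_ord i0) //=.
rewrite aE rmorphN rmorph_sum mulNr mulr_suml addrC -sumrB; apply: eq_bigr => j _.
by rewrite rmorphM to_fibre_const -mulrA -rmorphM -mulrBr -rmorphB.
Qed.

(** The b' are taken from among the b, so the property Q survives the elimination. *)
Lemma rep_indepr (Q : set K) n (a : 'I_n -> F) (b : 'I_n -> K) : (forall i, Q (b i)) ->
  exists m (a' : 'I_m -> F) (b' : 'I_m -> K),
  [/\ kindep b', forall i, Q (b' i) &
    \sum_i tau (a i) * const Z (b i) = \sum_i tau (a' i) * const Z (b' i)].
Proof.
elim: n a b => [|n IH] a b Qb; first by exists 0%N, a, b; split=> // c _ [].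
have [ib|/existsNP[c /not_implyP[hc /existsNP[i0 /eqP ci0]]]] := pselect (kindep b).
  by exists n.+1, a, b.
pose d j := c (lift i0 j) / c i0.
have bE : b i0 = - \sum_j io (d j) * b (lift i0 j).
  move: hc; rewrite (bigD1_ord i0) //= => /eqP; rewrite addr_eq0 => /eqP hc.
  have ci0' : io (c i0) != 0 by rewrite fmorph_eq0.
  apply: (mulfI ci0'); rewrite hc mulrN mulr_sumr; congr (- _); apply: eq_bigr => j _.
  by rewrite /d fmorph_div mulrA [_ * (_ / _)]mulrC divfK.
have [m [a' [b' [ib' Qb' E]]]] := IH (fun j => a (lift i0 j) - const X (d j) * a i0)
  (fun j => b (lift i0 j)) (fun j => Qb _).
exists m, a', b'; split=> //; rewrite -E (bigD1_ord i0) //=.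
rewrite bE rmorphN rmorph_sum mulrN mulr_sumr addrC -sumrB; apply: eq_bigr => j _.
by rewrite [const Z (_ * _)]rmorphM rmorphB [tau (_ * _)]rmorphM to_fibre_const mulrBl; congr (_ - _); ring.
Qed.

(** For a i independent over k, invariance under sigma^l compares coefficients and forces every b i
    to be fixed by the l-th power of Frobenius. *)
Lemma fix_rep z : z \in fixS -> exists n (a : 'I_n -> F) (b : 'I_n -> K),
  (forall i, b i ^+ (q ^ l) = b i) /\ z = \sum_i tau (a i) * const Z (b i).
Proof.
rewrite unfold_in => /eqP; have [n0 [a0 [b0 ->]]] := fibre_gen z.
have [n [a [b [ia ->]]]] := rep_indepl a0 b0; rewrite iter_sigmaE => hz.
exists n, a, b; split=> // i; apply/eqP; rewrite -subr_eq0; apply/eqP.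
apply: (fibre_free ia (b := fun i => b i ^+ (q ^ l) - b i)).
under eq_bigr do rewrite rmorphB mulrBr.
by rewrite sumrB hz subrr.
Qed.

Lemma frob_roots : (0 < l)%N -> exists r : seq K, 'X^(q ^ l) - 'X = \prod_(z <- r) ('X - z%:P).
Proof.
move=> l0; have [r Er] := closed_field_poly_normal ('X^(q ^ l) - 'X : {poly K}); exists r.
rewrite {1}Er; suff -> : lead_coef ('X^(q ^ l) - 'X : {poly K}) = 1 by rewrite scale1r.
have Ql : (1 < q ^ l)%N by rewrite -(expn0 q) ltn_exp2l // q_gt1.
by rewrite lead_coefDl ?lead_coefXn // size_polyN size_polyXn size_polyX ltnS.
Qed.

Lemma fixval_sum (I : Type) (r : seq I) (P : pred I) (E : I -> fixT) :
  fixval (\sum_(i <- r | P i) E i) = \sum_(i <- r | P i) fixval (E i).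
Proof. exact: (big_morph fixval). Qed.

(** Generators over k(t) are the products of the generators b of F with the finitely many roots of
    X^(q^l) - X. *)
Lemma fix_function_field : (0 < l)%N -> function_field fixc.
Proof.
move=> l0; have [t [nt [n [b hb]]]] := curveP X; exists (fixtau t).
have ev_fix (p : {poly k}) : (map_poly fixc p).[fixtau t] = fixtau (map_poly (const X) p).[t].
  have -> : map_poly fixc p = map_poly fixtau (map_poly (const X) p) by rewrite -map_poly_comp.
  by rewrite horner_map.
split.
  move=> [p p0 /rootP hp]; apply: nt; exists p => //; apply/rootP.
  by move: hp; rewrite ev_fix => /eqP; rewrite fmorph_eq0 => /eqP.
have [r Er] := frob_roots l0.
have rP c : c \in r = (c ^+ (q ^ l) == c).
  by rewrite -root_prod_XsubC -Er /root !hornerE subr_eq0.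
pose s := undup r.
have sP (i : 'I_(size s)) : const Z (tnth (in_tuple s) i) \in fixS.
  by apply: fix_const; apply/eqP; rewrite -rP -mem_undup mem_tnth.
pose J := ('I_n * 'I_(size s))%type.
pose e (z : J) : fixT := fixtau (b z.1) * FixT (sP z.2).
exists #|{: J}|, (e \o enum_val) => z.
have [m [a [d [hd Ez]]]] := fix_rep (fixvalP z).
(* The coefficients d u may repeat, so the a u belonging to the same root are collected first. *)
pose g (i : 'I_(size s)) := \sum_(u < m | d u == tnth (in_tuple s) i) a u.
have /choice[c hc] : forall i, exists c : 'I_n -> F, (forall j, exists p q : {poly k},
       q != 0 /\ c j = (map_poly (const X) p).[t] / (map_poly (const X) q).[t]) /\
    g i = \sum_j c j * b j by move=> i; exact: hb.
exists (fun u => fixtau (c (enum_val u).2 (enum_val u).1)); split.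
  move=> u; have [p [q0 [q00 ->]]] := (hc (enum_val u).2).1 (enum_val u).1.
  by exists p, q0; split=> //; rewrite !ev_fix fmorph_div.
rewrite /= -(big_enum_val (A := {: J}) (fun z => fixtau (c z.2 z.1) * e z)) /=.
rewrite -(pair_bigA _ (fun j i => fixtau (c i j) * e (j, i))) /= exchange_big /=.
apply/val_inj; rewrite /= Ez fixval_sum /=.
under [RHS]eq_bigr => i _.
  have -> : fixval (\sum_(j < n) fixtau (c i j) * e (j, i)) = tau (g i) * const Z (tnth (in_tuple s) i).
    rewrite (hc i).2 fixval_sum rmorph_sum mulr_suml; apply: eq_bigr => j _.
    by rewrite rmorphM mulrA.
  rewrite /g rmorph_sum mulr_suml.
  over.
rewrite (exchange_big_dep xpredT) //=; apply: eq_bigr => u _.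
have us : d u \in s by rewrite mem_undup rP hd.
have ui : (index (d u) s < size s)%N.
  by rewrite index_mem.
rewrite (big_pred1 (Ordinal ui)).
  by rewrite (tnth_nth 0) /= nth_index.
move=> i /=; rewrite (tnth_nth 0) /= -val_eqE /=; apply/eqP/eqP => [->|->].
  by rewrite index_uniq // undup_uniq.
by rewrite nth_index.
Qed.
End FixedField.

(** * Divisors of degree one *)

Section Residues.
Variables (k : finFieldType) (X : curve k) (Y : geometric_fibre X).
Local Notation F := (funfield X).
Local Notation K := (kbar Y).
Local Notation Z := (fibre Y).
Local Notation FZ := (funfield Z).
Local Notation io := (kbar_emb Y).
Local Notation tau := (to_fibre Y).
Local Notation q := #|k|.

Lemma frobnD j (a b : K) : (a + b) ^+ (q ^ j) = a ^+ (q ^ j) + b ^+ (q ^ j).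
Proof. by elim: j => [|j IH]; rewrite ?expn0 ?expr1 // expnSr !exprM IH frobD. Qed.

Lemma frobn0 j : (0 : K) ^+ (q ^ j) = 0.
Proof. by rewrite expr0n expn_eq0 -leqn0 leqNgt ltnW // q_gt1. Qed.

Lemma frobn_sum j n (a : 'I_n -> K) : (\sum_i a i) ^+ (q ^ j) = \sum_i a i ^+ (q ^ j).
Proof. by apply: (big_morph (fun x => x ^+ (q ^ j)) (frobnD j)); exact: frobn0. Qed.

Lemma frobn_mul i j (c : K) : c ^+ (q ^ i) = c -> c ^+ (q ^ (i * j)) = c.
Proof.
move=> hc; elim: j => [|j IH]; first by rewrite muln0 expn0 expr1.
by rewrite mulnS expnD exprM hc.
Qed.

Lemma frobn_coprime i j (c : K) : (0 < i)%N -> coprime i j ->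
  c ^+ (q ^ i) = c -> c ^+ (q ^ j) = c -> c ^+ q = c.
Proof.
move=> i0 cij hi hj; have [u v Euv _] := egcdnP j i0.
have := frobn_mul u hi.
by rewrite mulnC Euv (eqP cij) expnD expn1 exprM [(v * j)%N]mulnC (frobn_mul v hj).
Qed.

Lemma residue_uniq (w : place Z) z a b :
  vge w 1 (z - const Z a) -> vge w 1 (z - const Z b) -> a = b.
Proof.
move=> ha hb; apply/eqP; rewrite -subr_eq0; apply/eqP/(@vge_const1 _ Z w).
have := vgeB hb ha; congr (vge _ _ _).
by rewrite rmorphB; ring.
Qed.

Lemma residueM (w : place Z) y z a b : vge w 0 y -> vge w 1 (y - const Z a) ->
  vge w 1 (z - const Z b) -> vge w 1 (y * z - const Z (a * b)).
Proof.
move=> hy ha hb.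
have -> : y * z - const Z (a * b) = y * (z - const Z b) + (y - const Z a) * const Z b.
  by rewrite rmorphM; ring.
apply: vgeD; first by rewrite -[1]add0r; apply: vgeM.
by rewrite -[1]addr0; apply: vgeM => //; exact: vge_const.
Qed.

Lemma residue_sum (w : place Z) n (y : 'I_n -> FZ) (a : 'I_n -> K) :
  (forall i, vge w 1 (y i - const Z (a i))) -> vge w 1 (\sum_i y i - const Z (\sum_i a i)).
Proof. by move=> h; rewrite rmorph_sum -sumrB; apply: vge_sum => i _. Qed.

Lemma vge_residue (w : place Z) z a : vge w 1 (z - const Z a) -> vge w 0 z.
Proof.
move=> h; rewrite -(subrK (const Z a) z); apply: vgeD; last exact: vge_const.
exact: vgeW h.
Qed.

Variables (P : place X) (w : place Z).
Hypothesis hw : lies_over (Y := Y) w P.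
Local Notation d := (pdeg P).

Lemma vge1_tau f : vge w 1 (tau f) <-> vge P 1 f.
Proof.
have [e e0 h] := (lies_overP w P).1 hw.
have [->|f0] := eqVneq f 0; first by split=> _; rewrite ?rmorph0; left.
by rewrite !vge_ord ?fmorph_eq0 // h; split; nia.
Qed.

Lemma residue_field : exists L : seq K, [/\ uniq L, size L = (q ^ d)%N,
  forall c, c \in L <-> exists2 f, vge P 0 f & vge w 1 (tau f - const Z c) &
  forall a b, a \in L -> b \in L -> a * b \in L].
Proof.
have /(qdimP (kscaling X) _ _ (vge_subsp P 1))[e [Pe ie se]] := pdegP P.
have /choice[rho hrho] : forall f, exists c, vge P 0 f -> vge w 1 (tau f - const Z c).
  move=> f; have [/(lies_over_vge f hw)/residue_closed[c hc]|nf] := pselect (vge P 0 f); first by exists c.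
  by exists 0.
pose val (c : {ffun 'I_d -> k}) := \sum_i io (c i) * rho (e i).
have hval (c : {ffun 'I_d -> k}) : vge w 1 (tau (\sum_i kscale (c i) (e i)) - const Z (val c)).
  rewrite rmorph_sum; apply: residue_sum => i; rewrite /kscale rmorphM to_fibre_const.
  apply: residueM; [exact: vge_const|rewrite subrr; left|] => //.
  exact/hrho/Pe.
have val_inj' : injective val.
  move=> c c' E; apply/ffunP => i; apply/eqP; rewrite -subr_eq0; apply/eqP.
  apply: (ie (fun i => c i - c' i)); apply/vge1_tau.
  have := hval c'; rewrite -E => h; have := vgeB (hval c) h; congr (vge _ _ _).
  rewrite opprB addrA subrK -rmorphB -sumrB; congr (tau _); apply: eq_bigr => j _.
  by rewrite /kscale rmorphB mulrBl.
pose L := codom val.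
have LP c : c \in L <-> exists2 f, vge P 0 f & vge w 1 (tau f - const Z c).
  split=> [/codomP[x ->]|[f Pf hf]].
    exists (\sum_i kscale (x i) (e i)); last exact: hval.
    exact: (lin_sum _ (vge_subsp P 0)).
  have [x hx] := se f Pf; apply/codomP; exists [ffun i => x i].
  apply: (residue_uniq hf).
  rewrite -(subrK (tau (\sum_i kscale ([ffun i => x i] i) (e i))) (tau f)) -addrA.
  apply: vgeD; last exact: hval.
  by rewrite -rmorphB; apply/vge1_tau; under eq_bigr do rewrite ffunE.
exists L; split=> //.
- by rewrite map_inj_uniq // enum_uniq.
- by rewrite size_codom card_ffun card_ord.
- move=> a b /LP[f Pf hf] /LP[g Pg hg]; apply/LP; exists (f * g).
    by rewrite -[0]addr0; apply: vgeM.
  by rewrite rmorphM; apply: residueM => //; apply/(lies_over_vge f hw).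
Qed.

(* The constants fixed by the d-th power of Frobenius form the image of the residue field of P. *)
Lemma residue_fixedP c : c ^+ (q ^ d) = c <-> exists2 f, vge P 0 f & vge w 1 (tau f - const Z c).
Proof.
have [L [uL sL LP LM]] := residue_field.
have fixedL b : b \in L -> b ^+ (q ^ d) = b.
  move=> bL; have [->|b0] := eqVneq b 0; first exact: frobn0.
  pose M := rem 0 L.
  have zL : 0 \in L.
    by apply/LP; exists 0; [left|rewrite !rmorph0 subrr; left].
  have uM : uniq M by rewrite rem_uniq.
  have inM x : (x \in M) = (x != 0) && (x \in L) by rewrite /M (mem_rem_uniq _ uL) inE.
  have perm : perm_eq (map (fun x => b * x) M) M.
    have um : uniq (map (fun x => b * x) M) by rewrite map_inj_uniq //; exact: mulfI.
    apply: uniq_perm => //; have sub : {subset map (fun x => b * x) M <= M}.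
      move=> _ /mapP[x xM ->]; move: xM; rewrite !inM mulf_eq0 negb_or b0 => /andP[-> xL].
      by rewrite LM.
    by have [|] := uniq_min_size um sub; rewrite ?size_map.
  (* Multiplication by b permutes the q^d - 1 nonzero elements of L; comparing their products gives
     b^(q^d - 1) = 1. *)
  have : \prod_(x <- map (fun x => b * x) M) x = \prod_(x <- M) x by exact: perm_big.
  rewrite big_map big_split /= big_const_seq count_predT iter_mulr_1 => /eqP.
  have pM : \prod_(x <- M) x != 0.
    by rewrite prodf_seq_neq0; apply/allP => x; rewrite inM => /andP[].
  rewrite -[X in _ == X]mul1r (inj_eq (mulIf pM)) => /eqP bs.
  by rewrite -sL (perm_size (perm_to_rem zL)) /= exprS bs mulr1.
split=> [hc|h]; last exact/fixedL/LP.
(* A fixed element outside L would be one root too many for X^(q^d) - X. *)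
apply/LP; apply/negPn/negP => cL.
have Q1 : (1 < q ^ d)%N by rewrite -{1}(expn0 q) ltn_exp2l ?q_gt1 // pdeg_gt0.
have p0 : 'X^(q ^ d) - 'X != 0 :> {poly K}.
  rewrite -size_poly_eq0 size_polyDl ?size_polyXn //.
  by rewrite size_polyN size_polyX ltnS.
have al : all (root ('X^(q ^ d) - 'X)) (c :: L).
  apply/allP => x; rewrite inE => /orP[/eqP->|/fixedL xL].
    by rewrite /root !hornerE hc subrr.
  by rewrite /root !hornerE xL subrr.
have ucL : uniq (c :: L) by rewrite /= cL.
have := max_poly_roots p0 al ucL.
by rewrite /= sL size_polyDl ?size_polyXn ?size_polyN ?size_polyX ?ltnS // ltnn.
Qed.
End Residues.

(** * Splitting of places in the constant extension of degree l *)

Section SplitPlaces.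
Variables (k : finFieldType) (X : curve k) (Y : geometric_fibre X) (l : nat).
Hypothesis l_prime : prime l.
Hypothesis l_dvd : forall P : place X, (l %| pdeg P)%N.
Local Notation F := (funfield X).
Local Notation K := (kbar Y).
Local Notation Z := (fibre Y).
Local Notation FZ := (funfield Z).
Local Notation io := (kbar_emb Y).
Local Notation tau := (to_fibre Y).
Local Notation q := #|k|.
Local Notation sigma := (@sigma k X Y).
Local Notation psigma := (@psigma k X Y).

Lemma l_gt0 : (0 < l)%N. Proof. exact: prime_gt0. Qed.

(** The extension is viewed as a curve over the same k, so that degrees of places can be compared
    with those on X. Its constants form a larger field, which is why the counting lemmas carry
    [ldim 0] along. *)
Definition fixcurve : curve k := Curve (fix_function_field Y l_gt0).

Definition fixemb : {rmorphism funfield fixcurve -> FZ} := [the {rmorphism fixT Y l -> FZ} of val].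

Lemma fixemb_const c : fixemb (const fixcurve c) = const Z (io c).
Proof. by rewrite -(fixcE Y l c). Qed.

Lemma fixemb_tau f : fixemb (fixtau Y l f) = tau f. Proof. by []. Qed.

Lemma vge_iter_psigma j (w : place Z) n z : vge (iter j psigma w) n z <-> vge w n (iter j sigma z).
Proof. by elim: j z => //= j IH z; rewrite vge_psigma IH -iterSr. Qed.

Lemma fix_restrict (w : place Z) : exists w' : place fixcurve, exists2 e : nat, (0 < e)%N &
  forall f, ord w (fixemb f) = e%:Z * ord w' f.
Proof.
have [|v [e [e0 h]]] := @place_restrict _ _ fixcurve Z io fixemb w fixemb_const; last by exists v, e.
have [v [e e0 h]] := place_below w; have [f [f0 fv _]] := one_pole Y v.
by exists (fixtau Y l f); rewrite fixemb_tau h; nia.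
Qed.

Lemma iter_sigma_mod j z : iter l sigma z = z -> iter j sigma z = iter (j %% l) sigma z.
Proof.
move=> hz; rewrite {1}(divn_eq j l) addnC iterD; congr (iter _ _ _).
by elim: (j %/ l)%N => [|m IH]; rewrite ?mul0n // mulSn iterD IH.
Qed.

(** The polynomial X^(q^l) - X is separable, its derivative being -1, so it has q^l > q distinct
    roots, and not all of them lie in k. *)
Lemma exists_theta : exists th : K, th ^+ (q ^ l) = th /\ th ^+ q <> th.
Proof.
have [r Er] := frob_roots Y l_gt0.
have rP c : c \in r = (c ^+ (q ^ l) == c).
  by rewrite -root_prod_XsubC -Er /root !hornerE subr_eq0.
apply: contrapT => /forallNP h.
have sub : {subset r <= [seq io c | c <- enum k]}.
  move=> c; rewrite rP => /eqP hc.
  have /frob_fixed[a ->] : c ^+ q = c by apply: contrapT => nc; apply: (h c).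
  by rewrite map_f // mem_enum.
have Ql : (q < q ^ l)%N by rewrite -{1}(expn1 q) ltn_exp2l ?q_gt1 // prime_gt1.
have szr : size r = (q ^ l)%N.
  have := congr1 (fun p : {poly K} => size p) Er; rewrite size_prod_XsubC size_polyDl ?size_polyXn => [[->//]|].
  by rewrite size_polyN size_polyX ltnS; exact: leq_ltn_trans (ltnW (q_gt1 k)) Ql.
have [ur|nur] := boolP (uniq r).
  have := uniq_leq_size ur sub; rewrite size_map -cardE szr.
  by rewrite leqNgt Ql.
have [a [r' Er']] : exists a r', perm_eq r (a :: a :: r').
  elim: (r) nur => //= a s IH; rewrite negb_and negbK => /orP[as_|/IH[b [s' hs']]].
    by exists a, (rem a s); rewrite perm_cons perm_to_rem.
  exists b, (a :: s'); rewrite -(perm_cons a) in hs'; apply: perm_trans hs' _.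
  by rewrite -[[:: b, b, a & s']]/([:: b; b] ++ a :: s') perm_sym perm_catC /= perm_cons perm_catC.
have := congr1 (fun p : {poly K} => p^`().[a]) Er; rewrite (perm_big _ Er') /= !big_cons.
have [p pr pc] := finPcharP k; have pK : p \in [pchar K] by exact: (rmorph_pchar io pc).
have pq : (p %| q)%N.
  have := pprimeChar_pgroup pc; rewrite /pgroup cardsT => /p_natP[n E].
  have := q_gt1 k; have {E}E : q = (p ^ n)%N := E.
  by rewrite E; case: (n) => [|m] //; rewrite expnS dvdn_mulr.
have /dvdnP[m Em] : (p %| q ^ l)%N by apply: dvdn_trans pq _; apply: dvdn_exp; rewrite ?l_gt0.
rewrite derivB derivXn derivX hornerD hornerN hornerMn {2}Em mulrnA mulrnAC (mulrn_pchar pK) mul0rn.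
rewrite derivM hornerD !hornerM hornerXsubC subrr !mul0r mulr0 addr0 sub0r -polyC1 hornerC.
by move/eqP; rewrite oppr_eq0 oner_eq0.
Qed.

Section OverPlace.
Variables (P : place X) (w : place Z).
Hypothesis hw : lies_over (Y := Y) w P.
Local Notation d := (pdeg P).

(** The residue field does not grow. Since l divides deg P, the constants of degree l already lie in
    the residue field of P, so a combination of them with coefficients regular at P has its residue
    there. Now z may have poles at the conjugates of w, where [descent] needs regularity; it is
    first multiplied by a power of U, which vanishes at the other conjugates and is a unit at w. *)
Lemma residue_fix (z : funfield fixcurve) : vge w 0 (fixemb z) ->
  exists2 f, vge P 0 f & vge w 1 (fixemb z - tau f).
Proof.
move=> hz; have [th [thl thq]] := exists_theta.
have [m Em] := dvdnP (l_dvd P).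
have fxl (c : K) : c ^+ (q ^ l) = c -> c ^+ (q ^ d) = c.
  by move=> hc; rewrite Em mulnC; exact: (frobn_mul m hc).
pose thj j := th ^+ (q ^ j).
have thjl j : thj j ^+ (q ^ l) = thj j by rewrite /thj -exprM mulnC exprM thl.
have /choice[rho hrho] : forall j, exists f, vge P 0 f /\ vge w 1 (tau f - const Z (thj j)).
  by move=> j; have [f ? ?] := (residue_fixedP hw _).1 (fxl _ (thjl j)); exists f.
(* Here rho j in F has residue th^(q^j) at w. The factor th - rho j vanishes at the j-th conjugate
   of w, and its residue th - th^(q^j) at w is nonzero for 0 < j < l because l is prime. *)
pose fac j : funfield fixcurve := FixT (fix_const thl) - fixtau Y l (rho j).
have facE j : fixemb (fac j) = const Z th - tau (rho j) by [].
have regr j : vge w 0 (tau (rho j)) by apply/(lies_over_vge _ hw); case: (hrho j).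
have fac_sigma i j n : vge (iter i psigma w) n (fixemb (fac j)) <-> vge w n (const Z (thj i) - tau (rho j)).
  by rewrite vge_iter_psigma facE iter_sigmaB iter_sigma_const iter_sigma_tau.
have fac0 i j : vge (iter i psigma w) 0 (fixemb (fac j)).
  by apply/fac_sigma; apply: vgeB => //; exact: vge_const.
have fac1 i : vge (iter i psigma w) 1 (fixemb (fac i)).
  by apply/fac_sigma; rewrite -opprB; apply/vgeN; case: (hrho i).
have facres j : vge w 1 (fixemb (fac j) - const Z (th - thj j)).
  rewrite facE rmorphB; have [_ h] := hrho j; have := h => /vgeN.
  by congr (vge _ _ _); ring.
pose U : funfield fixcurve := \prod_(j < l.-1) fac j.+1.
have UE : fixemb U = \prod_(j < l.-1) fixemb (fac j.+1) by rewrite /U rmorph_prod.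
pose cU := \prod_(j < l.-1) (th - thj j.+1).
have resU : vge w 1 (fixemb U - const Z cU).
  rewrite UE /cU; elim: (l.-1) => [|n IH]; first by rewrite !big_ord0 rmorph1 subrr; left.
  rewrite !big_ord_recr /=; apply: residueM; [exact: vge_residue IH|exact: IH|exact: facres].
have cU0 : cU != 0.
  rewrite prodf_seq_neq0; apply/allP => j _ /=; rewrite subr_eq0; apply/eqP => h; apply: thq.
  apply: (@frobn_coprime _ _ Y j.+1 l) => //.
  rewrite coprime_sym prime_coprime //; apply/negP => /dvdn_leq; have := ltn_ord j.
  by have := prime_gt1 l_prime; move: (nat_of_ord j) => n; lia.
have U0 i : vge (iter i psigma w) 0 (fixemb U).
  rewrite UE; elim/big_ind : _ => [|x y hx hy|j _]; [by right; rewrite ord_one| |exact: fac0].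
  by rewrite -[0]addr0; apply: vgeM.
have U1 i : (0 < i < l)%N -> vge (iter i psigma w) 1 (fixemb U).
  move=> /andP[i0 il].
  have ij : (i.-1 < l.-1)%N by lia.
  rewrite UE (bigD1 (Ordinal ij)) //= prednK // -[1]addr0; apply: vgeM; first exact: fac1.
  elim/big_ind : _ => [|x y hx hy|j _]; [by right; rewrite ord_one| |exact: fac0].
  by rewrite -[0]addr0; apply: vgeM.
pose N := (\sum_(i < l) absz (ord (iter i psigma w) (fixemb z)))%N.
pose y : funfield fixcurve := z * U ^+ N.
have yE : fixemb y = fixemb z * fixemb U ^+ N by rewrite rmorphM rmorphXn.
have vgeXn v n (x : FZ) : vge v 1 x -> vge v n%:Z (x ^+ n).
  move=> hx; elim: n => [|n IH]; first by rewrite expr0; right; rewrite ord_one.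
  by rewrite exprS intS; apply: vgeM.
have vgeX0 v n (x : FZ) : vge v 0 x -> vge v 0 (x ^+ n).
  move=> hx; elim: n => [|n IH]; first by rewrite expr0; right; rewrite ord_one.
  by rewrite exprS -[0]addr0; apply: vgeM.
have yreg_lt : forall i, (i < l)%N -> vge (iter i psigma w) 0 (fixemb y).
  move=> i il; rewrite yE; have [i0|i0] := posnP i.
    by rewrite -[0]addr0; apply: vgeM; [rewrite i0|exact: vgeX0].
  have [->|z0] := eqVneq (fixemb z) 0; first by rewrite mul0r; left.
  have -> : 0 = - N%:Z + N%:Z by rewrite addNr.
  apply: vgeM; last by apply: vgeXn; apply: U1; rewrite i0.
  right; have : (absz (ord (iter i psigma w) (fixemb z)) <= N)%N.
    by rewrite /N (bigD1 (Ordinal il)) //= leq_addr.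
  by lia.
have yreg : forall i, vge (iter i psigma w) 0 (fixemb y).
  move=> i; apply/vge_iter_psigma; rewrite (@iter_sigma_mod i); last exact/eqP/(fixvalP y).
  by apply/vge_iter_psigma; apply: yreg_lt; rewrite ltn_mod l_gt0.
have [n0 [a0 [b0 [Qb0 Ey]]]] := fix_rep (fixvalP y).
have [n [a [b [ib Qb Ey']]]] := rep_indepr a0 (Q := [set b | b ^+ (q ^ l) = b]) Qb0.
have ya : fixemb y = \sum_i tau (a i) * const Z (b i) by rewrite -Ey' -Ey.
have areg i : vge P 0 (a i).
  apply/(lies_over_vge _ hw).
  apply: (@descent _ _ Y [set w' | exists i, w' = iter i psigma w] _ n a b ib).
  - by move=> _ [i0 ->]; exists i0.+1.
  - by move=> _ [i0 ->]; rewrite -ya.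
  - by exists 0%N.
have /choice[s hs] : forall i, exists s, vge w 1 (tau (a i) - const Z s).
  by move=> i; apply: residue_closed; apply/(lies_over_vge _ hw).
pose cy := \sum_i s i * b i.
have resy : vge w 1 (fixemb y - const Z cy).
  rewrite ya; apply: residue_sum => i; apply: residueM => //.
    exact/(lies_over_vge _ hw).
  by rewrite subrr; left.
have fxy : cy ^+ (q ^ d) = cy.
  rewrite frobn_sum; apply: eq_bigr => i _; rewrite exprMn (fxl _ (Qb i)); congr (_ * _).
  by apply/(residue_fixedP hw); exists (a i).
have fxU : cU ^+ (q ^ d) = cU.
  rewrite -prodrXl; apply: eq_bigr => j _; rewrite frobnD; congr (_ + _); first exact: fxl.
  apply/eqP; rewrite -subr_eq0 opprK -{2}(fxl _ (thjl j.+1)) -frobnD addNr frobn0.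
  by [].
have [cz hcz] := residue_closed hz.
have Ecz : cz * cU ^+ N = cy.
  apply: (@residue_uniq _ _ Y w (fixemb y)) resy; rewrite yE; apply: residueM => //.
  elim: (N) => [|m' IH]; first by rewrite !expr0 rmorph1 subrr; left.
  by rewrite !exprS; apply: residueM => //; exact: (U0 0%N).
have fxz : cz ^+ (q ^ d) = cz.
  have cUN : cU ^+ N != 0 by rewrite expf_neq0.
  apply: (mulIf cUN); rewrite Ecz -[RHS]fxy -Ecz exprMn; congr (_ * _).
  by rewrite -exprM mulnC exprM fxU.
have [f Pf hf] := (residue_fixedP hw _).1 fxz.
exists f => //; have := vgeB hcz hf; congr (vge _ _ _); ring.
Qed.

Lemma pdeg_fix (w' : place fixcurve) (e : nat) : (0 < e)%N ->
  (forall f, ord w (fixemb f) = e%:Z * ord w' f) -> (pdeg w' <= pdeg P)%N.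
Proof.
move=> e0 h; have wv n z : (n = 0) \/ (n = 1) -> vge w n (fixemb z) <-> vge w' n z.
  move=> hn; have [->|z0] := eqVneq z 0; first by split=> _; rewrite ?rmorph0; left.
  by rewrite !vge_ord ?fmorph_eq0 // h; case: hn => ->; split; nia.
have /(qdimP (kscaling _) _ _ (vge_subsp w' 1))[u [Wu iu _]] := pdegP w'.
have /(qdimP (kscaling X) _ _ (vge_subsp P 1))[b [Pb _ sb]] := pdegP P.
apply: (indep_le (kscaling fixcurve) (B := vge w' 1) (u := u) (e := fun i => fixtau Y l (b i))) => //.
  exact: vge_subsp.
move=> i; have [f Pf hf] : exists2 f, vge P 0 f & vge w 1 (fixemb (u i) - tau f).
  by apply: residue_fix; apply/wv; [left|].
have [c hc] := sb f Pf; exists c; apply/wv; first by right.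
move: hc => /(vge1_tau hw); rewrite rmorphB => hc.
have := vgeD hf hc; congr (vge _ _ _).
rewrite addrA subrK !rmorphB !rmorph_sum; congr (_ - _); apply: eq_bigr => j _.
by rewrite /kscale !rmorphM.
Qed.

Lemma fix_below (w' : place fixcurve) (e : nat) (f : F) : (0 < e)%N ->
  (forall f, ord w (fixemb f) = e%:Z * ord w' f) -> vge w' 0 (fixtau Y l f) <-> vge P 0 f.
Proof.
move=> e0 h; rewrite -(lies_over_vge f hw).
have [->|f0] := eqVneq f 0; first by split=> _; rewrite rmorph0; left.
by rewrite -fixemb_tau !vge_ord ?fmorph_eq0 // h; split; nia.
Qed.

(** With f in F congruent to th at w, the function th - f vanishes at w but not at the conjugate,
    since th^q differs from th. *)
Lemma fix_split (w1 w2 : place fixcurve) (e1 e2 : nat) : (0 < e1)%N -> (0 < e2)%N ->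
  (forall f, ord w (fixemb f) = e1%:Z * ord w1 f) ->
  (forall f, ord (psigma w) (fixemb f) = e2%:Z * ord w2 f) -> w1 <> w2.
Proof.
move=> e10 e20 h1 h2 E; have [th [thl thq]] := exists_theta.
have [m Em] := dvdnP (l_dvd P).
have [f Pf hf] : exists2 f, vge P 0 f & vge w 1 (tau f - const Z th).
  by apply/(residue_fixedP hw); rewrite Em mulnC; exact: (frobn_mul m thl).
pose z : funfield fixcurve := FixT (fix_const thl) - fixtau Y l f.
have zE : fixemb z = const Z th - tau f by [].
have z1 : vge w 1 (fixemb z) by rewrite zE -opprB; apply/vgeN.
have z2 : ~ vge (psigma w) 1 (fixemb z).
  move/vge_psigma; rewrite zE sigmaB sigma_const sigma_tau => h3.
  apply: thq; apply/eqP; rewrite -subr_eq0; apply/eqP/(@vge_const1 _ Z w).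
  have := vgeD h3 hf; congr (vge _ _ _); rewrite rmorphB; ring.
have z0 : fixemb z != 0 by apply/eqP => z0; apply: z2; rewrite z0; left.
apply: z2; move: z1; rewrite !vge_ord // h1 h2 E; nia.
Qed.
End OverPlace.

(** The two lifts of P are the restrictions of a place above P and of its Frobenius conjugate. *)
Lemma degrees_not_all_divisible : False.
Proof.
have /choice[w hw] := fun P : place X => place_above Y P.
have /choice[w1 h1] := fun P => fix_restrict (w P).
have /choice[w2 h2] := fun P => fix_restrict (psigma (w P)).
apply: (@no_split_cover k X fixcurve w1 w2).
- move=> P Q E; have [e e0 h] := h1 P; have [e' e0' h'] := h1 Q.
  by apply: place_sub => f; rewrite -(fix_below (hw P) f e0 h) -(fix_below (hw Q) f e0' h') E.
- move=> P Q E; have [e e0 h] := h2 P; have [e' e0' h'] := h2 Q.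
  apply: place_sub => f.
  by rewrite -(fix_below (lies_over_sigma (hw P)) f e0 h) -(fix_below (lies_over_sigma (hw Q)) f e0' h') E.
- move=> P Q E; have [e e0 h] := h1 P; have [e' e0' h'] := h2 Q.
  have PQ : P = Q.
    apply: place_sub => f.
    by rewrite -(fix_below (hw P) f e0 h) -(fix_below (lies_over_sigma (hw Q)) f e0' h') E.
  by subst Q; exact: (fix_split (hw P) e0 e0' h h').
- by move=> P; have [e e0 h] := h1 P; exact: (pdeg_fix (hw P) e0 h).
- by move=> P; have [e e0 h] := h2 P; exact: (pdeg_fix (lies_over_sigma (hw P)) e0 h).
- exact: (Lsp0_const Y).
Qed.
End SplitPlaces.

(* F. K. Schmidt. *)
Lemma exists_divisor1 (k : finFieldType) (X : curve k) (Y : geometric_fibre X) :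
  exists D, divisor X D /\ div_deg D = 1.
Proof.
pose P n := `[< (0 < n)%N /\ exists D, divisor X D /\ div_deg D = n%:Z >].
have [v0 _] := exists_place X.
have P0 : exists n, P n.
  exists (pdeg v0); apply/asboolP; split; first exact: pdeg_gt0.
  by exists (Defs.point v0); split; [exact: divisor_point|exact: div_deg_point].
case: (ex_minnP P0) => n /asboolP[n0 [D [dD degD]]] nmin.
have [n1|n1] := eqVneq n 1%N; first by exists D; rewrite degD n1.
(* Division with remainder shows that the least positive degree n divides all degrees of places; so
   does any prime factor of n. *)
have l_prime : prime (pdiv n) by apply: pdiv_prime; lia.
case: (@degrees_not_all_divisible k X Y (pdiv n) l_prime) => Q.
apply: dvdn_trans (pdiv_dvd n) _; apply/negPn/negP => nd.
have r0 : (0 < pdeg Q %% n)%N by rewrite lt0n.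
have /nmin : P (pdeg Q %% n)%N; last by rewrite leqNgt ltn_mod n0.
apply/asboolP; split=> //; exists (Defs.point Q - D *+ (pdeg Q %/ n)); split.
  by apply: divisorB; [exact: divisor_point|exact: divisorMn].
rewrite (div_degB (divisor_point Q) (divisorMn _ dD)) div_deg_point (div_degMn _ dD) degD.
by rewrite {1}(divn_eq (pdeg Q) n) PoszD PoszM mulrC addrAC subrr add0r.
Qed.

(** * Lattices in the plane *)

Section Vec.
Variable F : fieldType.
Definition vec (a b : F) : 'rV[F]_2 := \row_j (if j == 0 then a else b).
Definition mx2 (a b c d : F) : 'M[F]_2 :=
  \matrix_(i, j) (if i == 0 then if j == 0 then a else b else if j == 0 then c else d).

Lemma vec0 a b : vec a b 0 0 = a. Proof. by rewrite mxE. Qed.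
Lemma vec1 a b : vec a b 0 1 = b. Proof. by rewrite mxE. Qed.
Lemma vecE (u : 'rV[F]_2) : u = vec (u 0 0) (u 0 1).
Proof.
apply/rowP => j; rewrite mxE; case: (unliftP 0 j) => [i|] -> //.
by rewrite (ord1 i); congr (u _ _); apply/val_inj.
Qed.
Lemma vec_inj a b c d : vec a b = vec c d -> a = c /\ b = d.
Proof.
move=> E; split; first by have := congr1 (fun u : 'rV[F]_2 => u 0 0) E; rewrite !vec0.
by have := congr1 (fun u : 'rV[F]_2 => u 0 1) E; rewrite !vec1.
Qed.
Lemma mx2E (A : 'M[F]_2) : A = mx2 (A 0 0) (A 0 1) (A 1 0) (A 1 1).
Proof.
apply/matrixP => i j; rewrite mxE; case: (unliftP 0 i) => [i'|] ->; case: (unliftP 0 j) => [j'|] -> //=;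
  rewrite ?(ord1 i') ?(ord1 j'); congr (A _ _); exact/val_inj.
Qed.
Lemma vec_mul x y a b c d : vec x y *m mx2 a b c d = vec (x * a + y * c) (x * b + y * d).
Proof.
apply/rowP => j; rewrite !mxE !big_ord_recl big_ord0 !mxE /= addr0.
by case: (j == 0).
Qed.
Lemma vecZ t a b : t *: vec a b = vec (t * a) (t * b).
Proof. by apply/rowP => j; rewrite !mxE; case: eqP. Qed.
Lemma vecD a b c d : vec a b + vec c d = vec (a + c) (b + d).
Proof. by apply/rowP => j; rewrite !mxE; case: eqP. Qed.

Lemma vec00 : vec 0 0 = 0. Proof. by apply/rowP => j; rewrite !mxE; case: eqP. Qed.
Lemma mx2_mul a b c d a' b' c' d' : mx2 a b c d *m mx2 a' b' c' d' =
  mx2 (a * a' + b * c') (a * b' + b * d') (c * a' + d * c') (c * b' + d * d').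
Proof.
apply/matrixP => i j; rewrite !mxE !big_ord_recl big_ord0 !mxE /= addr0.
by case: (i == 0); case: (j == 0).
Qed.
Lemma det_mx2 a b c d : \det (mx2 a b c d) = a * d - b * c.
Proof.
rewrite (expand_det_row _ 0) !big_ord_recl big_ord0 addr0 /cofactor !det_mx11 !mxE /=.
by rewrite expr0 expr1 mul1r mulN1r mulrN.
Qed.
Lemma mx2_1 : 1%:M = mx2 1 0 0 1.
Proof. by rewrite [LHS]mx2E !mxE. Qed.
Lemma unit_mx2 a b c d : (mx2 a b c d \in unitmx) = (a * d - b * c != 0).
Proof. by rewrite unitmxE det_mx2 unitfE. Qed.
Lemma vec_eq0 a b : (vec a b == 0) = (a == 0) && (b == 0).
Proof.
apply/eqP/andP => [|[/eqP-> /eqP->]]; last exact: vec00.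
by rewrite -vec00 => /vec_inj[-> ->].
Qed.
End Vec.

Section Lattices.
Variables (k : fieldType) (X : curve k).
Local Notation F := (funfield X).
Local Notation place := (place X).
Implicit Types (v w : place) (f g : F) (D E : place -> int).

Lemma lattice2P v (a b c d : F) x y : lattice v (mx2 a b c d) (vec x y) <->
  exists s t, [/\ vge v 0 s, vge v 0 t, x = s * a + t * c & y = s * b + t * d].
Proof.
split=> [[u hu]|[s [t [hs ht -> ->]]]].
  rewrite [u]vecE vec_mul => /vec_inj[<- <-]; exists (u 0 0), (u 0 1).
  by split=> //; rewrite -regularE; exact: hu.
exists (vec s t); last by rewrite vec_mul.
by move=> j; rewrite regularE mxE; case: eqP.
Qed.

(* Hermite normal form of a lattice in F^2. *)
Definition herm v (m n : int) (r : F) : set 'rV[F]_2 :=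
  [set u | vge v n (u 0 1) /\ vge v m (u 0 0 - r * u 0 1)].

(** Row reduction over the valuation ring, the pivot being the second entry of smaller order; [main]
    treats the case where this is d, and swapping the rows gives the other. *)
Lemma lattice_hermP v (B : 'M[F]_2) : B \in unitmx ->
  exists m n r, lattice v B = herm v m n r /\ m + n = ord v (\det B).
Proof.
rewrite [B]mx2E; move: (B 0 0) (B 0 1) (B 1 0) (B 1 1) => a b c d.
have main : forall a b c d : F, mx2 a b c d \in unitmx -> d != 0 -> vge v (ord v d) b ->
    exists m n r, lattice v (mx2 a b c d) = herm v m n r /\ m + n = ord v (\det (mx2 a b c d)).
  move=> {}a {}b {}c {}d uB d0 hb; rewrite unit_mx2 in uB; have D0 := uB; rewrite det_mx2.
  exists (ord v (a * d - b * c) - ord v d), (ord v d), (c / d); split; last by rewrite subrK.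
  have ord_dd : ord v ((a * d - b * c) / d) = ord v (a * d - b * c) - ord v d.
    by rewrite ordM ?invr_eq0 // ordV.
  have dd0 : (a * d - b * c) / d != 0 by rewrite mulf_neq0 ?invr_eq0.
  apply/seteqP; split=> u; rewrite [u]vecE; move: (u 0 0) (u 0 1) => x y.
    move=> /lattice2P[s [t [hs ht -> ->]]]; rewrite /herm /= vec0 vec1; split.
      apply: vgeD; rewrite -[ord v d]add0r; apply: vgeM => //.
      by right.
    have -> : s * a + t * c - c / d * (s * b + t * d) = ((a * d - b * c) / d) * s by field.
    by apply/vgeMl => //; rewrite ord_dd subrr.
  rewrite /herm /= vec0 vec1 => -[hy hx]; apply/lattice2P.
  pose s := (x - c / d * y) / ((a * d - b * c) / d).
  have sE : x - c / d * y = ((a * d - b * c) / d) * s by rewrite /s [RHS]mulrC divfK.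
  have hs : vge v 0 s by move: hx; rewrite sE vgeMl // ord_dd subrr.
  exists s, ((y - s * b) / d); split=> //.
  - have : vge v (ord v d) (y - s * b).
      by apply: vgeB => //; rewrite -[ord v d]add0r; apply: vgeM.
    by move=> h; rewrite mulrC; apply/vgeMl; rewrite ?invr_eq0 // ordV opprK add0r.
  - have -> : x = ((a * d - b * c) / d) * s + c / d * y by rewrite -sE subrK.
    by field.
  - by field.
move=> uB; have [d0|d0] := eqVneq d 0.
  have sw : lattice v (mx2 a b c d) = lattice v (mx2 c d a b).
    apply/seteqP; split=> u; rewrite [u]vecE => /lattice2P[s [t [hs ht -> ->]]];
    by apply/lattice2P; exists t, s; split=> //; rewrite addrC.
  have [|||m [n [r [E1 E2]]]] := main c d a b.
  - by move: uB; rewrite !unit_mx2 -oppr_eq0 opprB [d * a]mulrC [c * b]mulrC.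
  - by apply: contraTneq uB => ->; rewrite unit_mx2 d0 mulr0 mul0r subrr eqxx.
  - by rewrite d0; left.
  exists m, n, r; rewrite sw E1; split=> //; rewrite E2 !det_mx2 -ordN opprB.
  by rewrite [d * a]mulrC [c * b]mulrC.
have [hb|hb] := pselect (vge v (ord v d) b); first exact: main.
have b0 : b != 0 by apply/eqP => b0; apply: hb; rewrite b0; left.
have sw : lattice v (mx2 a b c d) = lattice v (mx2 c d a b).
  apply/seteqP; split=> u; rewrite [u]vecE => /lattice2P[s [t [hs ht -> ->]]];
  by apply/lattice2P; exists t, s; split=> //; rewrite addrC.
have [|||m [n [r [E1 E2]]]] := main c d a b.
- by move: uB; rewrite !unit_mx2 -oppr_eq0 opprB [d * a]mulrC [c * b]mulrC.
- exact: b0.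
- by right; move: hb; rewrite vge_ord //; lia.
exists m, n, r; rewrite sw E1; split=> //; rewrite E2 !det_mx2 -ordN opprB.
by rewrite [d * a]mulrC [c * b]mulrC.
Qed.

Lemma herm_lattice v m n r : herm v m n r =
  lattice v (mx2 (unif v ^ m) 0 (r * unif v ^ n) (unif v ^ n)).
Proof.
have um := unifz_neq0 v m; have un := unifz_neq0 v n.
apply/seteqP; split=> u; rewrite [u]vecE; move: (u 0 0) (u 0 1) => x y.
  rewrite /herm /= vec0 vec1 => -[hy hx]; apply/lattice2P.
  exists (unif v ^ (- m) * (x - r * y)), (unif v ^ (- n) * y); split.
  - by apply/vgeMl; rewrite ?unifz_neq0 // ord_unifz opprK add0r.
  - by apply/vgeMl; rewrite ?unifz_neq0 // ord_unifz opprK add0r.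
  - by rewrite -!invr_expz; field; rewrite um un.
  - by rewrite -!invr_expz; field; rewrite un.
move=> /lattice2P[s [t [hs ht -> ->]]]; rewrite /herm /= vec0 vec1; split.
  rewrite mulr0 add0r mulrC; apply/vgeMl; rewrite ?unifz_neq0 // ord_unifz subrr //.
have -> : s * unif v ^ m + t * (r * unif v ^ n) - r * (s * 0 + t * unif v ^ n) = unif v ^ m * s by ring.
by apply/vgeMl; rewrite ?unifz_neq0 // ord_unifz subrr.
Qed.

Lemma herm_basis_unit v m n (r : F) : mx2 (unif v ^ m) 0 (r * unif v ^ n) (unif v ^ n) \in unitmx.
Proof. by rewrite unit_mx2 mul0r subr0 mulf_neq0 // unifz_neq0. Qed.

Lemma herm_vec0 v m n r f : herm v m n r (vec f 0) <-> vge v m f.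
Proof.
rewrite /herm /= vec0 vec1 mulr0 subr0; split=> [[]//|h]; split=> //; exact: vge0.
Qed.

Lemma vge_eq v (m n : int) : (forall f, vge v m f <-> vge v n f) -> m = n.
Proof.
move=> h; apply/eqP; rewrite eq_le; apply/andP; split.
  have /h : vge v n (unif v ^ n) by right; rewrite ord_unifz.
  by rewrite vge_ord ?unifz_neq0 // ord_unifz.
have /h : vge v m (unif v ^ m) by right; rewrite ord_unifz.
by rewrite vge_ord ?unifz_neq0 // ord_unifz.
Qed.

Lemma herm_shift v m n r r' : vge v (m - n) (r - r') -> herm v m n r = herm v m n r'.
Proof.
have key r1 r2 : vge v (m - n) (r1 - r2) -> herm v m n r1 `<=` herm v m n r2.
  move=> h u [hy hx]; split=> //.
  have -> : u 0 0 - r2 * u 0 1 = (u 0 0 - r1 * u 0 1) + (r1 - r2) * u 0 1 by ring.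
  by apply: vgeD => //; rewrite -[m](subrK n); apply: vgeM.
move=> h; apply/seteqP; split; apply: key => //.
by rewrite -[r' - r]opprB; apply/vgeN.
Qed.

Lemma ord_det_uniq v n (B B' : 'M[F]_n) : B \in unitmx -> B' \in unitmx ->
  lattice v B = lattice v B' -> ord v (\det B) = ord v (\det B').
Proof.
have key (B1 B2 : 'M[F]_n) : B1 \in unitmx -> B2 \in unitmx -> lattice v B1 `<=` lattice v B2 ->
    ord v (\det B2) <= ord v (\det B1).
  move=> u1 u2 h.
  have /choice[c hc] : forall i, exists c : 'rV[F]_n, (forall j, vge v 0 (c 0 j)) /\ row i B1 = c *m B2.
    move=> i; have [c hc E] : lattice v B2 (row i B1).
      apply: h; exists (delta_mx 0 i); last by rewrite -rowE.
      move=> j; rewrite mxE regularE; case: (_ && _); [right; rewrite ord_one|left] => //.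
    by exists c; split=> // j; rewrite -regularE; exact: hc.
  pose C := \matrix_(i, j) c i 0 j.
  have EB : B1 = C *m B2.
    apply/row_matrixP => i; rewrite (hc i).2 row_mul; congr (_ *m _).
    by apply/rowP => j; rewrite !mxE.
  have detC : vge v 0 (\det C).
    rewrite /determinant; apply: vge_sum => s _; rewrite -[0]add0r; apply: vgeM.
      by right; rewrite ordX ordN ord_one mul0rn.
    elim/big_ind : _ => [|x y hx hy|i _]; first by right; rewrite ord_one.
      by rewrite -[0]addr0; apply: vgeM.
    by rewrite mxE; case: (hc i).
  have d2 : \det B2 != 0 by move: u2; rewrite unitmxE unitfE.
  have d1 : \det B1 != 0 by move: u1; rewrite unitmxE unitfE.
  have dC : \det C != 0 by apply: contraNneq d1 => dC; rewrite EB det_mulmx dC mul0r.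
  by rewrite EB det_mulmx ordM // lerDr; apply/vge_ord.
by move=> u u' E; apply/eqP; rewrite eq_le !key // E.
Qed.

Lemma ord_detE n (E : sheaf X n) v B : B \in unitmx -> E v = lattice v B ->
  ord_det E v = ord v (\det B).
Proof.
move=> uB EB; have := @xgetPex _ 0 [set a | exists B : 'M[F]_n,
    [/\ B \in unitmx, E v = lattice v B & a = ord v (\det B)]].
case; first by exists (ord v (\det B)), B.
by rewrite -/(ord_det E v) => B' [uB' EB' ->]; apply: ord_det_uniq; rewrite -?EB -?EB'.
Qed.

Lemma ord_det_herm (E : sheaf X 2) v m n r : E v = herm v m n r -> ord_det E v = m + n.
Proof.
move=> h; rewrite (ord_detE (herm_basis_unit v m n r)) -?herm_lattice //.
by rewrite det_mx2 mul0r subr0 ordM ?unifz_neq0 // !ord_unifz.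
Qed.

Lemma finite_nonregular f : finite_set [set v | ~ regular v f].
Proof.
have [->|f0] := eqVneq f 0.
  by apply: sub_finite_set (finite_set0 place) => v /=; rewrite /regular /= Defs.ord0.
by apply: sub_finite_set (divisor_principal f0) => v /=; rewrite /regular /principal /=; lia.
Qed.

Lemma lattice_sub v n (B B' : 'M[F]_n) : B' \in unitmx ->
  (forall i j, regular v ((B *m invmx B') i j)) -> lattice v B `<=` lattice v B'.
Proof.
move=> u h _ [c hc <-]; exists (c *m (B *m invmx B')); last by rewrite -!mulmxA mulVmx // mulmx1.
move=> j; rewrite mxE regularE; apply: vge_sum => i _; rewrite -[0]addr0.
by apply: vgeM; rewrite -regularE //; exact: hc.
Qed.

Lemma finite_lattice_neq n (B : 'M[F]_n) : B \in unitmx ->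
  finite_set [set v | lattice v B <> lattice v 1%:M].
Proof.
move=> uB; apply: (@sub_finite_set _ _ (\bigcup_(i in [set: 'I_n * 'I_n])
  ([set v | ~ regular v (B i.1 i.2)] `|` [set v | ~ regular v (invmx B i.1 i.2)]))); last first.
  by apply: bigcup_finite => // i _; rewrite finite_setU; split; exact: finite_nonregular.
move=> v /= h; apply: contrapT => hn; apply: h.
have hB i j : regular v (B i j) /\ regular v (invmx B i j).
  by split; apply: contrapT => nr; apply: hn; exists (i, j) => //=; [left|right].
apply/seteqP; split; apply: lattice_sub; rewrite ?unitmx1 // => i j.
  by rewrite invmx1 mulmx1; case: (hB i j).
by rewrite mul1mx; case: (hB i j).
Qed.

(** A basis over a neighbourhood and the standard basis span the same lattice at almost all places,
    because a matrix of GL_n(F) and its inverse have integral entries there. This replaces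
    Zariski-local triviality by a condition at each place plus finiteness. *)
Lemma bundleP n (E : sheaf X n) : bundle n E <->
  (forall v, exists2 B, B \in unitmx & E v = lattice v B) /\
  finite_set [set v | E v <> lattice v 1%:M].
Proof.
split=> [h|[h fE] v].
  split=> [v|]; first by have [U [B [[_ Uv] uB hB]]] := h v; exists B => //; exact: hB.
  have [v _] := exists_place X; have [U [B [[fU _] uB hB]]] := h v.
  apply: (@sub_finite_set _ _ (~` U `|` [set w | lattice w B <> lattice w 1%:M])).
    by move=> w /= hw; have [Uw|] := pselect (U w); [right; rewrite -hB|left].
  by rewrite finite_setU; split=> //; exact: finite_lattice_neq.
have [B uB EB] := h v.
exists [set w | w = v \/ E w = lattice w 1%:M /\ lattice w B = lattice w 1%:M], B; split=> //; last first.
  by move=> w [->//|[-> ->]].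
split; last by left.
apply: (@sub_finite_set _ _ ([set w | E w <> lattice w 1%:M] `|` [set w | lattice w B <> lattice w 1%:M])).
  move=> w /= /not_orP[_ /not_andP[h1|h1]]; [by left|by right].
by rewrite finite_setU; split=> //; exact: finite_lattice_neq.
Qed.

Lemma line_bundleE D v u : line_bundle D v u <-> vge v (- D v) (u 0 0).
Proof. by []. Qed.

Lemma lattice1P v (B : 'M[F]_1) u : B \in unitmx -> lattice v B u <-> vge v (ord v (B 0 0)) (u 0 0).
Proof.
rewrite unitmxE det_mx11 unitfE => b0; split=> [[c hc <-]|h].
  rewrite mxE big_ord1 mulrC; apply/vgeMl => //; rewrite subrr -regularE; exact: hc.
exists ((u 0 0 / B 0 0)%:M).
  move=> j; rewrite (ord1 j) mxE eqxx mulr1n regularE mulrC; apply/vgeMl; rewrite ?invr_eq0 //.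
  by rewrite ordV opprK add0r.
by apply/rowP => j; rewrite (ord1 j) mxE big_ord1 mxE eqxx mulr1n divfK.
Qed.

Lemma line_bundle_bundle D : divisor X D -> bundle 1 (line_bundle D).
Proof.
move=> dD; apply/bundleP; split=> [v|].
  exists (unif v ^ (- D v))%:M.
    by rewrite unitmxE det_scalar1 unitfE unifz_neq0.
  apply/seteqP; split=> u; rewrite lattice1P ?unitmxE ?det_scalar1 ?unitfE ?unifz_neq0 //;
  by rewrite mxE eqxx mulr1n ord_unifz.
apply: sub_finite_set dD => v /= h; apply/eqP => D0; apply: h.
apply/seteqP; split=> u; rewrite lattice1P ?unitmx1 // mxE eqxx ord_one.
  by rewrite line_bundleE D0 oppr0.
by rewrite line_bundleE D0 oppr0.
Qed.

Lemma bundle1P L : bundle 1 L -> exists2 D, divisor X D & L = line_bundle D.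
Proof.
move=> /bundleP[h fL].
have /choice[D hD] : forall v, exists n : int, (forall u, L v u <-> vge v (- n) (u 0 0)).
  move=> v; have [B uB EB] := h v; exists (- ord v (B 0 0)) => u.
  by rewrite EB lattice1P // opprK.
exists D; last by apply/funext => v; apply/seteqP; split=> u /hD.
apply: sub_finite_set fL => v /= /eqP Dv E; apply: Dv; apply/eqP; rewrite -oppr_eq0; apply/eqP.
apply: (@vge_eq v) => f; have := hD v f%:M; rewrite mxE eqxx mulr1n => <-.
by rewrite E lattice1P ?unitmx1 // !mxE eqxx ord_one.
Qed.
End Lattices.

(** * Bundles of rank two *)

Section Bundles.
Variables (k : fieldType) (X : curve k).
Local Notation F := (funfield X).
Local Notation place := (place X).
Implicit Types (v w : place) (f g : F) (D E G : place -> int) (M N : sheaf X 2).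

(* The extension of O(D') by O(D) with class r. *)
Definition Ext D D' (r : place -> F) : sheaf X 2 := fun v => herm v (- D v) (- D' v) (r v).

Lemma lattice1_herm v : lattice v 1%:M = herm v 0 0 (0 : F).
Proof. by rewrite herm_lattice mul0r !expr0z -mx2_1. Qed.

Lemma Ext_bundle D D' r : divisor X D -> divisor X D' -> adele r -> bundle 2 (Ext D D' r).
Proof.
move=> dD dD' Ar; apply/bundleP; split=> [v|].
  exists (mx2 (unif v ^ (- D v)) 0 (r v * unif v ^ (- D' v)) (unif v ^ (- D' v))).
    exact: herm_basis_unit.
  by rewrite -herm_lattice.
apply: (@sub_finite_set _ _ ([set v | D v != 0] `|` [set v | D' v != 0] `|` [set v | ~ regular v (r v)])).
  move=> v /= h; apply: contrapT => /not_orP[/not_orP[/negP/negPn/eqP h1 /negP/negPn/eqP h2] /contrapT h3].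
  apply: h; rewrite lattice1_herm /Ext h1 h2 oppr0; apply: herm_shift.
  by rewrite !subr0 -regularE.
by rewrite !finite_setU.
Qed.

Lemma bundle_ExtE M : bundle 2 M ->
  exists D D' r, [/\ divisor X D, divisor X D', adele r & M = Ext D D' r].
Proof.
move=> /bundleP[h fM].
(* At a standard stalk the zero data are chosen, so that D and D' have finite support and r is an
   adele. *)
have /choice[d hd] : forall v, exists d : int * int * F, M v = herm v (- d.1.1) (- d.1.2) d.2 /\
    (M v = lattice v 1%:M -> d.1.1 = 0 /\ d.1.2 = 0 /\ d.2 = 0).
  move=> v; have [E|nE] := pselect (M v = lattice v 1%:M).
    by exists (0, 0, 0); split=> //=; rewrite E lattice1_herm oppr0.
  have [B uB EB] := h v; have [m [n [r [E _]]]] := lattice_hermP v uB.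
  by exists (- m, - n, r); split=> //=; rewrite !opprK EB E.
exists (fun v => (d v).1.1), (fun v => (d v).1.2), (fun v => (d v).2); split.
- by apply: sub_finite_set fM => v /= /eqP h0 E; apply: h0; case: (hd v) => _ /(_ E)[].
- by apply: sub_finite_set fM => v /= /eqP h0 E; apply: h0; case: (hd v) => _ /(_ E)[_ []].
- apply: sub_finite_set fM => v /= h0 E; apply: h0; case: (hd v) => _ /(_ E)[_ [_ ->]].
  by rewrite /regular /= Defs.ord0.
- by apply/funext => v; case: (hd v).
Qed.

(* M' is the image under A of the twist of M by O(E). *)
Definition pew E (A : 'M[F]_2) M M' :=
  forall v u, M v u <-> M' v (unif v ^ (- E v) *: (u *m A)).

Definition pe M M' := exists E A, [/\ divisor X E, A \in unitmx & pew E A M M'].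

Lemma pew_refl M : pew 0 1%:M M M.
Proof. by move=> v u; rewrite mulmx1 oppr0 expr0z scale1r. Qed.

Lemma pew_sym E A M M' : A \in unitmx -> pew E A M M' -> pew (- E) (invmx A) M' M.
Proof.
move=> uA h v u; rewrite h -[(- E) v]/(- E v) opprK -scalemxAl -mulmxA mulVmx // mulmx1.
by rewrite scalerA -expfzDr ?unif_neq0 // addNr expr0z scale1r.
Qed.

Lemma pew_trans E A M M' E' A' M'' : pew E A M M' -> pew E' A' M' M'' -> pew (E + E') (A *m A') M M''.
Proof.
move=> h h' v u; rewrite h h' -scalemxAl scalerA -expfzDr ?unif_neq0 // mulmxA.
by rewrite -[(E + E') v]/(E v + E' v) opprD addrC.
Qed.

Lemma pe_refl M : pe M M.
Proof. exists 0, 1%:M; split; [exact: divisor0|exact: unitmx1|exact: pew_refl]. Qed.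

Lemma pe_sym M M' : pe M M' -> pe M' M.
Proof.
move=> [E [A [dE uA h]]]; exists (- E), (invmx A); rewrite unitmx_inv; split=> //.
  exact: divisorN.
exact: pew_sym.
Qed.

Lemma pe_trans M M' M'' : pe M M' -> pe M' M'' -> pe M M''.
Proof.
move=> [E [A [dE uA h]]] [E' [A' [dE' uA' h']]].
exists (E + E'), (A *m A'); rewrite unitmx_mul uA uA'; split=> //; first exact: divisorD.
exact: pew_trans h h'.
Qed.

Lemma lattice_comb v n (B : 'M[F]_n) m (a : 'I_m -> F) (u : 'I_m -> 'rV[F]_n) :
  (forall i, vge v 0 (a i)) -> (forall i, lattice v B (u i)) -> lattice v B (\sum_i a i *: u i).
Proof.
move=> ha hu; have /choice[c hc] : forall i, exists c : 'rV[F]_n,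
    (forall j, vge v 0 (c 0 j)) /\ u i = c *m B.
  by move=> i; have [c h E] := hu i; exists c; split=> // j; rewrite -regularE; exact: h.
exists (\sum_i a i *: c i).
  move=> j; rewrite summxE regularE; apply: vge_sum => i _; rewrite mxE -[0]addr0.
  by apply: vgeM => //; case: (hc i).
rewrite mulmx_suml; apply: eq_bigr => i _; rewrite -scalemxAl; by case: (hc i) => _ ->.
Qed.

Lemma bundle_comb M v m (a : 'I_m -> F) (u : 'I_m -> 'rV[F]_2) : bundle 2 M ->
  (forall i, vge v 0 (a i)) -> (forall i, M v (u i)) -> M v (\sum_i a i *: u i).
Proof. by move=> /bundleP[/(_ v)[B uB ->] _]; exact: lattice_comb. Qed.

Lemma bundleZ M v a u : bundle 2 M -> vge v 0 a -> M v u -> M v (a *: u).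
Proof. by move=> bM ha hu; have := @bundle_comb M v 1 (fun=> a) (fun=> u) bM; rewrite big_ord1; apply. Qed.

Lemma bundleDv M v u u' : bundle 2 M -> M v u -> M v u' -> M v (u + u').
Proof.
move=> bM hu hu'; have := @bundle_comb M v 2 (fun=> 1) (fun i => if i == 0 then u else u') bM.
rewrite !big_ord_recl big_ord0 addr0 /= !scale1r; apply=> [_|i]; first by right; rewrite ord_one.
by case: ifP.
Qed.

Lemma bundleNv M v u : bundle 2 M -> M v u -> M v (- u).
Proof.
move=> bM hu; rewrite -scaleN1r; apply: bundleZ => //; apply/vgeN; by right; rewrite ord_one.
Qed.

Lemma tensorE E M v u : bundle 2 M -> tensor (line_bundle E) M v u <-> M v (unif v ^ E v *: u).
Proof.
move=> bM; split=> [[m [a [z [ha hz ->]]]]|h]; last first.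
  exists 1%N, (fun=> 1), (fun=> u); split=> [_|_|]; last by rewrite big_ord1 scale1r.
    by rewrite regularE; right; rewrite ord_one.
  exists ((unif v ^ (- E v))%:M), (unif v ^ E v *: u); split=> //.
    by rewrite line_bundleE mxE eqxx mulr1n; right; rewrite ord_unifz.
  by rewrite mxE eqxx mulr1n scalerA -expfzDr ?unif_neq0 // addNr expr0z scale1r.
have /choice[lu hlu] : forall i, exists lu : F * 'rV[F]_2, [/\ vge v (- E v) lu.1, M v lu.2 & z i = lu.1 *: lu.2].
  by move=> i; have [l [x [hl hx ->]]] := hz i; exists (l 0 0, x).
have -> : unif v ^ E v *: (\sum_i a i *: z i) = \sum_i (a i * (unif v ^ E v * (lu i).1)) *: (lu i).2.
  rewrite scaler_sumr; apply: eq_bigr => i _; case: (hlu i) => _ _ ->.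
  by rewrite !scalerA mulrCA mulrA.
apply: bundle_comb => // i; last by case: (hlu i).
rewrite -[0]addr0; apply: vgeM; first by rewrite -regularE.
by apply/vgeMl; rewrite ?unifz_neq0 // ord_unifz sub0r; case: (hlu i).
Qed.

Lemma proj_equivP M M' : bundle 2 M -> proj_equiv M M' <-> pe M M'.
Proof.
move=> bM; split=> [[L /bundle1P[E dE ->] [A uA hA]]|[E [A [dE uA h]]]].
  exists E, A; split=> // v u; rewrite hA; split=> [hu|].
    exists (unif v ^ (- E v) *: u); last by rewrite scalemxAl.
    by apply/tensorE => //; rewrite scalerA -expfzDr ?unif_neq0 // addrN expr0z scale1r.
  case=> z /(tensorE _ _ _ bM) hz Ez; suff -> : u = unif v ^ E v *: z by [].
  have /(congr1 (fun x => unif v ^ E v *: (x *m invmx A))) := Ez.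
  rewrite mulmxK // => ->; rewrite -scalemxAl mulmxK // scalerA -expfzDr ?unif_neq0 //.
  by rewrite addrN expr0z scale1r.
exists (line_bundle E); first exact: line_bundle_bundle.
exists A => // v; apply/seteqP; split=> z.
  move=> hz; exists (z *m invmx A); last by rewrite mulmxKV.
  apply/tensorE => //; apply/h; rewrite -scalemxAl mulmxKV // scalerA -expfzDr ?unif_neq0 //.
  by rewrite addNr expr0z scale1r.
move=> [u /(tensorE _ _ _ bM)/h hu <-]; move: hu; rewrite -scalemxAl scalerA -expfzDr ?unif_neq0 //.
by rewrite addNr expr0z scale1r.
Qed.

Lemma latticeZ_pew v E A M M' (B : 'M[F]_2) : A \in unitmx -> pew E A M M' -> M v = lattice v B ->
  M' v = lattice v (unif v ^ (- E v) *: (B *m A)).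
Proof.
move=> uA h EB; apply/seteqP; split=> z.
  move=> hz; have : M v (unif v ^ E v *: (z *m invmx A)).
    apply/h; rewrite -scalemxAl mulmxKV // scalerA -expfzDr ?unif_neq0 //.
    by rewrite addNr expr0z scale1r.
  rewrite EB => -[c hc Ec]; exists c => //.
  rewrite -scalemxAr mulmxA Ec -scalemxAl mulmxKV // scalerA -expfzDr ?unif_neq0 //.
  by rewrite addNr expr0z scale1r.
move=> [c hc <-]; rewrite -scalemxAr mulmxA; apply/h; rewrite EB; by exists c.
Qed.

Lemma pew_bundle E A M M' : divisor X E -> A \in unitmx -> pew E A M M' -> bundle 2 M -> bundle 2 M'.
Proof.
move=> dE uA h /bundleP[hM fM]; apply/bundleP; split=> [v|].
  have [B uB EB] := hM v; exists (unif v ^ (- E v) *: (B *m A)); last exact: latticeZ_pew.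
  by rewrite unitmxZ ?unitfE ?unifz_neq0 // unitmx_mul uB.
apply: (@sub_finite_set _ _ ([set v | E v != 0] `|` [set v | M v <> lattice v 1%:M] `|`
   [set v | lattice v A <> lattice v 1%:M])).
  move=> v /= hv; apply: contrapT => /not_orP[/not_orP[/negP/negPn/eqP E0 /contrapT M1] /contrapT A1].
  by apply: hv; rewrite (latticeZ_pew uA h M1) E0 oppr0 expr0z scale1r mul1mx.
by rewrite !finite_setU; split=> //; exact: finite_lattice_neq.
Qed.

Lemma pe_bundle M M' : pe M M' -> bundle 2 M -> bundle 2 M'.
Proof. by move=> [E [A [dE uA h]]]; exact: pew_bundle h. Qed.

Lemma pclassP M M' : bundle 2 M -> bundle 2 M' -> pclass M = pclass M' <-> pe M M'.
Proof.
move=> bM bM'; split=> [h|h].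
  have : pclass M' M' by split=> //; apply/proj_equivP => //; exact: pe_refl.
  by rewrite -h => -[_ /proj_equivP]; apply.
apply/seteqP; split=> N [bN /proj_equivP hN]; split=> //; apply/proj_equivP => //.
  by apply: pe_trans (pe_sym h) _; exact: hN.
by apply: pe_trans h _; exact: hN.
Qed.

(** O(D), embedded by f -> f e, is the saturated line subbundle through e. *)
Definition has_div M (e : 'rV[F]_2) D := forall v f, M v (f *: e) <-> vge v (- D v) f.

Lemma has_div_uniq M e D D' : has_div M e D -> has_div M e D' -> D = D'.
Proof.
move=> h h'; apply/funext => v; apply: oppr_inj; apply: (@vge_eq _ _ v) => f.
by rewrite -h h'.
Qed.

Lemma has_div_pew E A M M' e D : pew E A M M' -> has_div M e D -> has_div M' (e *m A) (D + E).
Proof.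
move=> h hD v f; have := h v ((unif v ^ E v * f) *: e).
rewrite -scalemxAl scalerA mulrA -expfzDr ?unif_neq0 // addNr expr0z mul1r => <-.
rewrite hD vgeMl ?unifz_neq0 // ord_unifz -[(D + E) v]/(D v + E v).
by rewrite opprD.
Qed.

Lemma complete_vec (e : 'rV[F]_2) : e != 0 -> exists2 A, A \in unitmx & e *m A = vec 1 0.
Proof.
rewrite [e]vecE; move: (e 0 0) (e 0 1) => a b; rewrite vec_eq0 negb_and.
have [->/= b0|a0 _] := eqVneq a 0.
  exists (mx2 0 1 b^-1 0); last by rewrite vec_mul; congr vec; field.
  by rewrite unit_mx2 mul0r sub0r mul1r oppr_eq0 invr_eq0.
exists (mx2 a^-1 (- b / a) 0 1); last by rewrite vec_mul; congr vec; field.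
by rewrite unit_mx2 mulr1 mulr0 subr0 invr_eq0.
Qed.

Lemma norm_ext M e : bundle 2 M -> e != 0 -> exists A D D' r,
  [/\ A \in unitmx, e *m A = vec 1 0, divisor X D, divisor X D' & adele r] /\ pew 0 A M (Ext D D' r).
Proof.
move=> bM /complete_vec[A uA eA]; pose M' : sheaf X 2 := fun v => [set u | M v (u *m invmx A)].
have h : pew 0 A M M'.
  by move=> v u; rewrite /M' /= oppr0 expr0z scale1r mulmxK.
have [D [D' [r [dD dD' Ar E]]]] := bundle_ExtE (pew_bundle (divisor0 X) uA h bM).
by exists A, D, D', r; split=> //; rewrite -E.
Qed.

Lemma has_div_Ext D D' r : has_div (Ext D D' r) (vec 1 0) D.
Proof. move=> v f; rewrite /Ext vecZ mulr1 mulr0; exact: herm_vec0. Qed.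

Lemma has_div_ex M e : bundle 2 M -> e != 0 -> exists2 D, divisor X D & has_div M e D.
Proof.
move=> bM e0; have [A [D [D' [r [[uA eA dD dD' Ar] h]]]]] := norm_ext bM e0.
exists D => //; have := has_div_pew (pew_sym uA h) (@has_div_Ext D D' r).
by rewrite oppr0 addr0 -eA mulmxK.
Qed.

Definition ddet M : place -> int := fun v => - ord_det M v.

Lemma ddet_Ext D D' r : ddet (Ext D D' r) = D + D'.
Proof.
apply/funext => v; rewrite /ddet (@ord_det_herm _ _ _ _ (- D v) (- D' v) (r v)) //.
by rewrite opprD !opprK.
Qed.

Lemma ddet_pew E A M M' : bundle 2 M -> A \in unitmx -> pew E A M M' ->
  ddet M' = ddet M + E *+ 2 - principal (\det A).
Proof.
move=> /bundleP[hM _] uA h; apply/funext => v; have [B uB EB] := hM v.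
have dA : \det A != 0 by move: uA; rewrite unitmxE unitfE.
have dB : \det B != 0 by move: (uB); rewrite unitmxE unitfE.
rewrite -[LHS]/(- ord_det M' v) -[RHS]/(- ord_det M v + (E *+ 2) v - ord v (\det A)) (ord_detE uB EB).
rewrite (@ord_detE _ _ _ _ v (unif v ^ (- E v) *: (B *m A))); last exact: latticeZ_pew EB.
  rewrite detZ det_mulmx expr2 !ordM ?mulf_neq0 ?unifz_neq0 // ord_unifz.
  have -> : (E *+ 2) v = E v + E v by rewrite mulr2n.
  by ring.
by rewrite unitmxZ ?unitfE ?unifz_neq0 // unitmx_mul uB.
Qed.

Lemma divisor_ddet M : bundle 2 M -> divisor X (ddet M).
Proof.
move=> /bundle_ExtE[D [D' [r [dD dD' _ ->]]]]; rewrite ddet_Ext; exact: divisorD.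
Qed.

Lemma degE n (E : sheaf X n) : deg E = - div_deg (ord_det E). Proof. by []. Qed.

Lemma deg_ddet M : bundle 2 M -> deg M = div_deg (ddet M).
Proof.
move=> bM; rewrite degE -div_degN.
  by congr div_deg; apply/funext => v.
have -> : ord_det M = - ddet M by apply/funext => v; rewrite -[RHS]/(- (- ord_det M v)) opprK.
exact/divisorN/divisor_ddet.
Qed.

Lemma deg_Ext D D' r : divisor X D -> divisor X D' -> adele r ->
  deg (Ext D D' r) = div_deg D + div_deg D'.
Proof. by move=> dD dD' Ar; rewrite deg_ddet ?ddet_Ext ?div_degD //; exact: Ext_bundle. Qed.

Lemma deg_pew E A M M' : bundle 2 M -> divisor X E -> A \in unitmx -> pew E A M M' ->
  deg M' = deg M + 2 * div_deg E.
Proof.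
move=> bM dE uA h; rewrite !deg_ddet //; last exact: pew_bundle h bM.
have dA : \det A != 0 by move: uA; rewrite unitmxE unitfE.
have dp := divisor_principal dA; have dM := divisor_ddet bM; have d2 := divisorMn 2 dE.
rewrite (ddet_pew bM uA h) (div_degB (divisorD dM d2) dp) (div_degD dM d2) (div_degMn 2 dE).
by rewrite (div_deg_principal dA) subr0 mulrC.
Qed.

Lemma deg_line_bundle D : divisor X D -> deg (line_bundle D) = div_deg D.
Proof.
move=> dD; rewrite degE.
have -> : ord_det (line_bundle D) = - D.
  apply/funext => v; rewrite (@ord_detE _ _ _ _ v ((unif v ^ (- D v))%:M)).
  - by rewrite det_scalar1 ord_unifz.
  - by rewrite unitmxE det_scalar1 unitfE unifz_neq0.
  - apply/seteqP; split=> u; rewrite lattice1P ?unitmxE ?det_scalar1 ?unitfE ?unifz_neq0 //;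
    by rewrite mxE eqxx mulr1n ord_unifz.
by rewrite div_degN // opprK.
Qed.

Lemma bundle_span M v (e : 'rV[F]_2) : bundle 2 M -> ~ (forall u, M v u -> exists a, u = a *: e).
Proof.
move=> /bundleP[/(_ v)[B uB ->] _] h.
have hr i : lattice v B (row i B).
  exists (delta_mx 0 i); last by rewrite -rowE.
  by move=> j; rewrite mxE regularE; case: (_ && _); [right; rewrite ord_one|left].
have [a0 E0] := h _ (hr 0); have [a1 E1] := h _ (hr 1).
have : \det B = 0.
  have Bij i j : B i j = row i B 0 j by rewrite mxE.
  rewrite [B]mx2E det_mx2 !(Bij 0) !(Bij 1) E0 E1 !mxE; ring.
by move: uB; rewrite unitmxE unitfE => /eqP.
Qed.

(** Local freeness of the cokernel means saturation: a multiple f A in M with f outside L would make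
    the local generator e of the cokernel a multiple of A, and the stalk would have rank one. *)
Lemma line_subbundle_div L M : bundle 2 M -> line_subbundle L M ->
  exists e D, [/\ e != 0, has_div M e D, divisor X D & L = line_bundle D].
Proof.
move=> bM [/bundle1P[D dD ->] [A [fA AM coker]]]; exists A, D.
have A0 : A != 0 by apply: contraTneq fA => ->; rewrite -row_leq_rank mxrank0.
split=> // v f; split=> [hf|hf]; last first.
  by have := AM v f%:M; rewrite mul_scalar_mx; apply; rewrite line_bundleE mxE eqxx mulr1n.
apply: contrapT => nf; have [U [e [[_ Uv] hU]]] := coker v; have [Me uniqe] := hU v Uv.
have [a [[ra [l hl El]] _]] := uniqe _ hf.
have l00 : l = (l 0 0)%:M by apply/rowP => j; rewrite (ord1 j) mxE eqxx mulr1n.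
have Ee : (f - l 0 0) *: A = a *: e.
  by rewrite scalerBl El {1}l00 mul_scalar_mx addrC addKr.
have [a0|a0] := eqVneq a 0.
  apply: nf; move: Ee; rewrite a0 scale0r => /eqP; rewrite scaler_eq0 (negPf A0) orbF subr_eq0 => /eqP ->.
  exact: hl.
apply: (@bundle_span M v A bM) => u /uniqe[b [[_ [l' _ ->]] _]].
have -> : e = (a^-1 * (f - l 0 0)) *: A by rewrite -scalerA Ee scalerA mulVf // scale1r.
exists (l' 0 0 + b * (a^-1 * (f - l 0 0))).
have -> : l' = (l' 0 0)%:M by apply/rowP => j; rewrite (ord1 j) mxE eqxx mulr1n.
by rewrite mul_scalar_mx scalerA -scalerDl mxE eqxx mulr1n.
Qed.

Lemma div_line_subbundle M e D : bundle 2 M -> e != 0 -> divisor X D -> has_div M e D ->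
  line_subbundle (line_bundle D) M.
Proof.
move=> bM e0 dD hD; split; first exact: line_bundle_bundle.
have [A [D1 [D' [r [[uA eA dD1 dD' Ar] h]]]]] := norm_ext bM e0.
have hpew v u : M v u <-> Ext D1 D' r v (u *m A) by rewrite h oppr0 expr0z scale1r.
have ED : D = D1.
  apply: (has_div_uniq hD); have := has_div_pew (pew_sym uA h) (@has_div_Ext D1 D' r).
  by rewrite oppr0 addr0 -eA mulmxK.
exists e; split.
- by rewrite -row_leq_rank rank_rV e0.
- move=> v l hl; have -> : l = (l 0 0)%:M by apply/rowP => j; rewrite (ord1 j) mxE eqxx mulr1n.
  by rewrite mul_scalar_mx; apply/hD.
move=> v.
(* (x, y) is the second Hermite basis vector at v; the open set below consists of the places where
   it still completes e to a local basis. *)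
pose y := unif v ^ (- D' v); pose x := r v * y.
have y0 : y != 0 by exact: unifz_neq0.
exists [set w | ord w y = - D' w /\ vge w (- D w) (x - r w * y)], (vec x y *m invmx A); split.
  split; last first.
    by split; [rewrite ord_unifz|rewrite /x subrr; left].
  apply: (@sub_finite_set _ _ ([set w | D' w != 0] `|` [set w | D w != 0] `|` [set w | ~ regular w (r w)] `|`
      ([set w | principal y w != 0] `|` [set w | ~ regular w x]))).
    move=> w /= h1; apply: contrapT => /not_orP[/not_orP[/not_orP[/negP/negPn/eqP a /negP/negPn/eqP b] /contrapT c]].
    move=> /not_orP[/negP/negPn/eqP d /contrapT e'].
    apply: h1; rewrite a b oppr0 -[ord w y]/(principal y w) d; split=> //.
    apply: vgeB; first by rewrite -regularE.
    rewrite -[0]addr0; apply: vgeM; first by rewrite -regularE.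
    by right; rewrite -[ord w y]/(principal y w) d.
  rewrite !finite_setU; do !split=> //; last exact: finite_nonregular.
  exact: divisor_principal.
move=> w [wy wx]; split.
  apply/hpew; rewrite mulmxKV // /Ext /herm /= vec0 vec1; split; last by rewrite -ED.
  by right; rewrite wy.
have yw0 : vge w (- D' w) y by right; rewrite wy.
move=> u Mu; have /hpew := Mu; have Eu := vecE (u *m A).
rewrite Eu /Ext /herm /= vec0 vec1; move: Eu; set s := (u *m A) 0 0; set t := (u *m A) 0 1 => Eu [ht hs].
have Eiff l a : u = l *m e + a *: (vec x y *m invmx A) <-> s = l 0 0 + a * x /\ t = a * y.
  have El : l = (l 0 0)%:M by apply/rowP => j; rewrite (ord1 j) mxE eqxx mulr1n.
  have -> : u = vec s t *m invmx A by rewrite -Eu mulmxK.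
  have -> : l *m e + a *: (vec x y *m invmx A) = vec (l 0 0 + a * x) (a * y) *m invmx A.
    rewrite scalemxAl {1}El mul_scalar_mx -{1}[e](mulmxK uA) eA scalemxAl -mulmxDl.
    by rewrite !vecZ vecD mulr1 mulr0 add0r.
  split=> [/(congr1 (mulmx^~ A))|[-> ->] //]; rewrite !mulmxKV // => /vec_inj[] //.
have ra : vge w 0 (t / y).
  have := vgeMl w (- D' w) (t / y) y0; rewrite mulrC divfK // wy subrr => -[+ _]; exact.
exists (t / y); split.
  split; first by rewrite regularE.
  exists ((s - t / y * x)%:M); last by apply/Eiff; rewrite mxE eqxx mulr1n subrK divfK.
  rewrite line_bundleE mxE eqxx mulr1n ED.
  have -> : s - t / y * x = (s - r w * t) - t / y * (x - r w * y) by field.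
  apply: vgeB => //; rewrite -[(- D1 w)]add0r; apply: vgeM => //; by rewrite -ED.
by move=> a [_ [l _ /Eiff[_ ->]]]; rewrite mulfK.
Qed.
End Bundles.

(** * Line subbundles of maximal degree *)

Section Delta.
Variables (k : fieldType) (X : curve k).
Local Notation F := (funfield X).
Local Notation place := (place X).
Implicit Types (v w : place) (f g : F) (D E G : place -> int) (M N : sheaf X 2).

Lemma int_max (S : set int) b : S !=set0 -> ubound S b -> exists2 m, S m & ubound S m.
Proof.
move=> [s0 Ss0] Sb; have ex : exists n, `[< S (b - n%:Z) >].
  exists `|b - s0|%N; apply/asboolP; have -> : b - `|b - s0|%:Z = s0 by have := Sb _ Ss0; lia.
  by [].
have [n /asboolP Sn minn] := ex_minnP ex; exists (b - n%:Z) => // s Ss.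
have sb := Sb _ Ss; have := minn `|b - s|%N; have -> : b - `|b - s|%:Z = s by lia.
by move=> /(_ (introT (asboolP _) Ss)); lia.
Qed.

Lemma supremum_max (S : set int) m x0 : S m -> ubound S m -> supremum x0 S = m.
Proof.
move=> Sm um; rewrite /supremum ifF; last by apply/negbTE/set0P; exists m.
case: xgetP => [y _ [uy ly]|h]; last first.
  by case: (h m); split=> // z; apply.
by apply/le_anti; rewrite (ly _ um) (uy _ Sm).
Qed.

(** Either e spans the subbundle O(D), or its second coordinate is a nonzero morphism from O(G) to
    the quotient O(D'). *)
Lemma has_div_bound D D' r e G : divisor X D -> divisor X D' -> adele r -> divisor X G ->
  e != 0 -> has_div (Ext D D' r) e G ->
  (div_deg G <= div_deg D') \/ (e 0 1 = 0 /\ div_deg G = div_deg D).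
Proof.
move=> dD dD' Ar dG; rewrite [e]vecE vec1 vec_eq0; move: (e 0 0) (e 0 1) => a b nz h.
have [b0|b0] := eqVneq b 0.
  right; split=> //; have a0 : a != 0 by move: nz; rewrite b0 eqxx andbT.
  have := @has_div_uniq _ X (Ext D D' r) (vec a b) G (D + principal a) h.
  move=> ->; first by rewrite div_degD ?div_deg_principal ?addr0 //; exact: divisor_principal.
  move=> v f; rewrite vecZ b0 mulr0 /Ext herm_vec0 mulrC vgeMl //.
  by rewrite -[(D + principal a) v]/(D v + ord v a) opprD.
left; have le v : 0 <= (D' + principal b - G) v.
  rewrite -[_ v]/(D' v + ord v b - G v).
  have /h : vge v (- G v) (unif v ^ (- G v)) by right; rewrite ord_unifz.
  rewrite vecZ /Ext /herm /= vec1 => -[+ _]; rewrite vge_ord ?mulf_neq0 ?unifz_neq0 // ordM ?unifz_neq0 //.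
  by rewrite ord_unifz; lia.
have db := divisor_principal b0.
have := div_deg_ge0 (divisorB (divisorD dD' db) dG) le.
by rewrite div_degB ?div_degD ?div_deg_principal ?addr0 ?subr_ge0 //; exact: divisorD.
Qed.

(** Degrees of line subbundles are integers bounded by [has_div_bound], so the supremum is a maximum
    and its default value never occurs. *)
Lemma deltaP M : bundle 2 M -> exists e D,
  [/\ e != 0, has_div M e D, divisor X D & delta M = 2 * div_deg D - deg M] /\
  forall e' D', e' != 0 -> has_div M e' D' -> 2 * div_deg D' - deg M <= delta M.
Proof.
move=> bM; pose S := [set 2 * div_deg eD.2 - deg M | eD in
  [set eD : 'rV[F]_2 * (place -> int) | eD.1 != 0 /\ has_div M eD.1 eD.2]].
have dv e D : e != 0 -> has_div M e D -> divisor X D.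
  by move=> e0 h; have [D' dD' h'] := has_div_ex bM e0; rewrite (has_div_uniq h h').
have -> : delta M = supremum 0 S.
  congr (supremum 0 _); apply/seteqP; split=> z.
    move=> [L /(line_subbundle_div bM)[e [D [e0 h dD ->]]] <-]; exists (e, D) => //.
    by rewrite /deltaL deg_line_bundle.
  move=> [[e D] /= [e0 h] <-]; exists (line_bundle D).
    by apply: div_line_subbundle (h) => //; exact: dv h.
  by rewrite /deltaL deg_line_bundle //; exact: dv h.
have [z0 [z uz]] : S !=set0 /\ exists z, ubound S z.
  have e10 : vec 1 0 != 0 :> 'rV[F]_2 by rewrite vec_eq0 oner_eq0.
  split; first by have [D dD h] := has_div_ex bM e10; exists (2 * div_deg D - deg M), (vec 1 0, D).
  have [A [D [D' [r [[uA eA dD dD' Ar] h]]]]] := norm_ext bM e10.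
  exists (2 * Num.max (div_deg D) (div_deg D') - deg M) => _ [[e G] /= [e0 hG] <-].
  have dG := dv _ _ e0 hG.
  have eA0 : e *m A != 0.
    by apply: contraNneq e0 => /(congr1 (mulmx^~ (invmx A))); rewrite mulmxK // mul0mx => ->.
  have := has_div_pew h hG; rewrite addr0 => hG'.
  have := has_div_bound dD dD' Ar dG eA0 hG'.
  by case=> [|[_ ->]]; lia.
have [m [[e D] /= [e0 hD] Em] um] := int_max z0 uz.
exists e, D; rewrite (@supremum_max S m) //; last by exists (e, D).
split; first by split=> //; exact: dv hD.
by move=> e' D' e'0 h'; apply: um; exists (e', D').
Qed.

Lemma delta_pew_le E A M M' : bundle 2 M -> divisor X E -> A \in unitmx -> pew E A M M' ->
  delta M <= delta M'.
Proof.
move=> bM dE uA h; have [e [D [[e0 hD dD ->] _]]] := deltaP bM.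
have bM' := pew_bundle dE uA h bM; have [_ [_ [_ hm]]] := deltaP bM'.
have eA0 : e *m A != 0.
  by apply: contraNneq e0 => /(congr1 (mulmx^~ (invmx A))); rewrite mulmxK // mul0mx => ->.
have := hm _ _ eA0 (has_div_pew h hD).
by rewrite (deg_pew bM dE uA h) div_degD //; lia.
Qed.

Lemma delta_pe M M' : bundle 2 M -> pe M M' -> delta M = delta M'.
Proof.
move=> bM h; have bM' := pe_bundle h bM; apply/le_anti/andP; split.
  by case: (h) => E [A [dE uA hh]]; exact: delta_pew_le hh.
by case/pe_sym: h => E [A [dE uA hh]]; exact: delta_pew_le hh.
Qed.

Lemma delta_Ext D D' r : divisor X D -> divisor X D' -> adele r ->
  div_deg D - div_deg D' <= delta (Ext D D' r).
Proof.
move=> dD dD' Ar; have [_ [_ [_ hm]]] := deltaP (Ext_bundle dD dD' Ar).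
have e10 : vec 1 0 != 0 :> 'rV[F]_2 by rewrite vec_eq0 oner_eq0.
by have := hm _ _ e10 (@has_div_Ext _ X D D' r); rewrite deg_Ext //; lia.
Qed.

Lemma adele0 : adele (0 : place -> F).
Proof. by apply: sub_finite_set (finite_set0 place) => v /=; rewrite /regular /= Defs.ord0. Qed.

Lemma adele_const f : adele (fun _ : place => f).
Proof. exact: finite_nonregular. Qed.

Lemma adeleM (a b : place -> F) : adele a -> adele b -> adele (fun v => a v * b v).
Proof.
move=> ha hb; apply: sub_finite_set (_ : finite_set ([set v | ~ regular v (a v)] `|` [set v | ~ regular v (b v)])).
  move=> v /= h; apply: contrapT => /not_orP[/contrapT + /contrapT +]; rewrite !regularE => x y.
  by apply: h; rewrite regularE -[0]addr0; exact: vgeM.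
by rewrite finite_setU.
Qed.

Lemma delta_split D D' : divisor X D -> divisor X D' -> delta (Ext D D' 0) = `|div_deg D - div_deg D'|.
Proof.
move=> dD dD'; have bM := Ext_bundle dD dD' adele0.
have [e [G [[e0 hG dG dl]]] hm] := deltaP bM; apply/le_anti/andP; split.
  rewrite dl deg_Ext //; last exact: adele0.
  have := has_div_bound dD dD' adele0 dG e0 hG; case=> [|[_ ->]]; lia.
have := delta_Ext dD dD' adele0.
have e10 : vec 0 1 != 0 :> 'rV[F]_2 by rewrite vec_eq0 oner_eq0 andbF.
have hd : has_div (Ext D D' 0) (vec 0 1) D'.
  move=> v f; rewrite vecZ mulr1 mulr0 /Ext /herm /= vec0 vec1 -[(0 : place -> F) v]/(0 : F) mul0r subr0.
  by split=> [[]//|]; split=> //; left.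
have := hm _ _ e10 hd; rewrite (deg_Ext dD dD' adele0); lia.
Qed.

Lemma Ext_unsplit D D' r f : divisor X D -> divisor X D' ->
  (forall v, vge v (- (D - D') v) (r v - f)) ->
  mx2 1 0 (- f) 1 \in unitmx /\ pew 0 (mx2 1 0 (- f) 1) (Ext D D' r) (Ext D D' 0).
Proof.
move=> dD dD' hf; split; first by rewrite unit_mx2 mulr1 mul0r subr0 oner_eq0.
have hb v b : vge v (- D' v) b -> vge v (- D v) ((r v - f) * b).
  move=> hb; have -> : - D v = - (D - D') v + - D' v by rewrite -[(D - D') v]/(D v - D' v); lia.
  exact: vgeM.
move=> v u; rewrite [u]vecE vec_mul oppr0 expr0z scale1r /Ext /herm /= !vec0 !vec1.
move: (u 0 0) (u 0 1) => a b; rewrite -[(0 : place -> F) v]/(0 : F) mul0r subr0 !mulr1 mulr0 add0r mulrN.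
split=> -[h1 h2]; split=> //; have h3 := hb _ _ h1.
  have -> : a - b * f = (a - r v * b) + (r v - f) * b by ring.
  exact: vgeD.
have -> : a - r v * b = (a - b * f) - (r v - f) * b by ring.
exact: vgeB.
Qed.

(** The class of r lives in H^1(O(D - D')). When this vanishes, r differs from a global f by an
    element of W(D - D'), and a unipotent matrix with entry -f splits the extension. *)
Lemma Ext_split D D' r : divisor X D -> divisor X D' -> adele r -> hdim (D - D') = 0%N ->
  pe (Ext D D' r) (Ext D D' 0).
Proof.
move=> dD dD' Ar h0; have [f hf] := strong_approx (divisorB dD dD') h0 Ar.
have [uA h] := Ext_unsplit dD dD' hf.
by exists 0, (mx2 1 0 (- f) 1); split=> //; exact: divisor0.
Qed.

Lemma Ext_twist D D' E r : divisor X E -> pew E 1%:M (Ext D D' r) (Ext (D + E) (D' + E) r).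
Proof.
move=> dE v u; rewrite mulmx1 [u]vecE vecZ /Ext /herm /= !vec0 !vec1.
rewrite -[(D + E) v]/(D v + E v) -[(D' + E) v]/(D' v + E v) mulrCA -mulrBr.
by rewrite !vgeMl ?unifz_neq0 // ord_unifz !opprD !addrK.
Qed.

(** Either L(D) already contains a section, or the connecting map b -> r b from L(D') to H^1(O(D))
    has a kernel: with L(D) = 0, Riemann-Roch and the degree condition give hdim D < ldim D'. *)
Lemma Ext_section D D' r : divisor X D -> divisor X D' -> adele r ->
  0 < div_deg D + div_deg D' + 2 * (ldim (0 : place -> int))%:Z - 2 * (genus X)%:Z ->
  exists2 u, u != 0 & forall v, Ext D D' r v u.
Proof.
move=> dD dD' Ar pos; have [l0|lpos] := posnP (ldim D); last first.
  have [f f0 Lf] := (ldim_gt0P dD).1 lpos; exists (vec f 0); first by rewrite vec_eq0 negb_and f0.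
  by move=> v; apply/herm_vec0; exact: Lf.
have := riemann_roch dD; rewrite l0 => RR; have ge := ldim_ge dD'.
have lt : (hdim D < ldim D')%N by lia.
have [e [Le ie _]] := (qdimP (kscaling X) _ _ (kscale_sub0 X)).1 (ldimP dD').
pose a i := fun v => r v * e i.
have [ia|/existsNP[c /not_implyP[hc /existsNP[i /eqP ci]]]] := pselect (indep (@ascale _ X) (WFsp D) a).
  have := qdim_indep (ascaling X) (WFsp_subsp D) (hdimP dD) (fun i => adeleM Ar (adele_const (e i))) ia; lia.
have [f hf] := hc; pose b := \sum_i kscale (c i) (e i).
exists (vec f b).
  rewrite vec_eq0 negb_and; apply/orP; right; apply/negP => /eqP b0.
  by have := ie c b0 i => /eqP; rewrite (negPf ci).
move=> v; rewrite /Ext /herm /= vec0 vec1; split.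
  by have := lin_sum c (Lsp_subsp D') Le v.
have -> : f - r v * b = - ((\sum_i ascale (c i) (a i)) v - f).
  rewrite opprB ascaleE /b mulr_sumr; congr (_ - _); apply: eq_bigr => j _.
  by rewrite /a /kscale mulrCA.
by apply/vgeN; exact: hf.
Qed.

(** Twist by n D1 so that the degree becomes 2g - 1 or 2g; then [Ext_section] yields a section, that
    is, a line subbundle of degree at least -n. Hence delta >= -(deg M + 2n) >= -2g. *)
Lemma delta_ge M : bundle 2 M -> (exists D, divisor X D /\ div_deg D = 1) ->
  ldim (0 : place -> int) = 1%N -> - (2 * (genus X)%:Z) <= delta M.
Proof.
move=> bM [D1 [dD1 deg1]] l1; have [D [D' [r [dD dD' Ar EM]]]] := bundle_ExtE bM.
have [n nP] : exists n : int, 2 * (genus X)%:Z - 1 <= deg M + 2 * n <= 2 * (genus X)%:Z.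
  exists ((2 * (genus X)%:Z - deg M) %/ 2)%Z.
  by have := divz_eq (2 * (genus X)%:Z - deg M) 2; have := @modz_ge0 (2 * (genus X)%:Z - deg M) 2;
    have := @ltz_pmod (2 * (genus X)%:Z - deg M) 2; lia.
pose E := D1 *~ n; have dE : divisor X E by exact: divisorMz.
have degE : div_deg E = n by rewrite div_degMz // deg1 mul1r.
have degM : deg M = div_deg D + div_deg D' by rewrite EM deg_Ext.
have [|u u0 hu] := @Ext_section (D + E) (D' + E) r (divisorD dD dE) (divisorD dD' dE) Ar.
  by rewrite !div_degD // degE l1; lia.
have [_ [_ [_ hm]]] := deltaP bM; have [G dG hG] := has_div_ex bM u0.
apply: le_trans (hm _ _ u0 hG).
have : 0 <= div_deg (G + E).
  apply: div_deg_ge0; first exact: divisorD.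
  move=> v; have := hu v; have {1}-> : u = unif v ^ (- E v) *: ((unif v ^ E v *: u) *m 1%:M).
    by rewrite mulmx1 scalerA -expfzDr ?unif_neq0 // addNr expr0z scale1r.
  move/(@Ext_twist D D' E r dE v); rewrite -EM => /hG; rewrite vge_ord ?unifz_neq0 // ord_unifz.
  by rewrite -[(G + E) v]/(G v + E v); lia.
by rewrite div_degD // degE; lia.
Qed.
End Delta.

(** * Decomposable bundles *)

Section Vertices.
Variables (k : fieldType) (X : curve k).
Local Notation F := (funfield X).
Local Notation place := (place X).
Implicit Types (v w : place) (f g : F) (D E G : place -> int) (M N : sheaf X 2).

Lemma dsumE D D' : dsum (line_bundle D) (line_bundle D') = Ext D D' 0.
Proof.
have rE (u u' : 'rV[F]_1) : row_mx u u' = vec (u 0 0) (u' 0 0).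
  rewrite [LHS]vecE; congr vec.
    by rewrite -(row_mxEl u u'); congr (row_mx u u' _ _); exact/val_inj.
  by rewrite -(row_mxEr u u'); congr (row_mx u u' _ _); exact/val_inj.
apply/funext => v; apply/seteqP; split=> z.
  move=> [u [u' [hu hu' ->]]]; move: hu hu'; rewrite !line_bundleE rE /Ext /herm /= vec0 vec1 => hu hu'.
  by rewrite -[(0 : place -> F) v]/(0 : F) mul0r subr0.
rewrite [z]vecE /Ext /herm /= vec0 vec1 -[(0 : place -> F) v]/(0 : F) mul0r subr0 => -[h1 h0].
exists (z 0 0)%:M, (z 0 1)%:M; rewrite rE; split; rewrite ?line_bundleE !mxE ?eqxx ?mulr1n //.
Qed.

Lemma ExtzE D D' v a b : Ext D D' 0 v (vec a b) <-> vge v (- D v) a /\ vge v (- D' v) b.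
Proof. by rewrite /Ext /herm /= vec0 vec1 -[(0 : place -> F) v]/(0 : F) mul0r subr0; tauto. Qed.

Lemma Extz_bundle D D' : divisor X D -> divisor X D' -> bundle 2 (Ext D D' 0).
Proof. by move=> dD dD'; apply: Ext_bundle => //; exact: adele0. Qed.

Lemma cvertE D : cvert D = pclass (Ext D 0 0).
Proof. by rewrite /cvert dsumE. Qed.

Lemma decomposableP M : decomposable M <-> exists A D D',
  [/\ A \in unitmx, divisor X D, divisor X D' & pew 0 A (Ext D D' 0) M].
Proof.
split=> [[L [L' [/bundle1P[D dD ->] /bundle1P[D' dD' ->] [A uA h]]]]|[A [D [D' [uA dD dD' h]]]]].
  exists A, D, D'; split=> // v u; rewrite h oppr0 expr0z scale1r -dsumE; split=> [hu|[z hz /(congr1 (mulmx^~ (invmx A)))]].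
    by exists u.
  by rewrite !mulmxK // => <-.
exists (line_bundle D), (line_bundle D'); split; try exact: line_bundle_bundle.
exists A => // v; rewrite dsumE; apply/seteqP; split=> z.
  move=> hz; exists (z *m invmx A); last by rewrite mulmxKV.
  by apply/h; rewrite oppr0 expr0z scale1r mulmxKV.
by move=> [u /h + <-]; rewrite oppr0 expr0z scale1r.
Qed.

Lemma Ext_cvert D D' : divisor X D -> divisor X D' -> pclass (Ext D D' 0) = cvert (D - D').
Proof.
move=> dD dD'; rewrite cvertE; apply/pclassP; try exact: Extz_bundle; first by apply: Extz_bundle; [exact: divisorB|exact: divisor0].
exists (- D'), 1%:M; split; [exact: divisorN|exact: unitmx1|].
by have := @Ext_twist _ X D D' (- D') 0 (divisorN dD'); rewrite subrr.
Qed.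

Lemma cvert_equiv D f : divisor X D -> f != 0 -> cvert (D + principal f) = cvert D.
Proof.
move=> dD f0; have df := divisor_principal f0; rewrite !cvertE; apply/pclassP; try by apply: Extz_bundle; [|exact: divisor0].
  by apply: Extz_bundle; [exact: divisorD|exact: divisor0].
exists 0, (mx2 f 0 0 1); split; [exact: divisor0|by rewrite unit_mx2 mulr1 mulr0 subr0|].
move=> v u; rewrite oppr0 expr0z scale1r [u]vecE vec_mul !ExtzE !mulr0 add0r addr0 mulr1.
by rewrite [u 0 0 * f]mulrC vgeMl // -[(D + principal f) v]/(D v + ord v f) opprD.
Qed.

Lemma bundle_c D : divisor X D -> bundle 2 (Ext D 0 0).
Proof. by move=> dD; apply: Extz_bundle => //; exact: divisor0. Qed.

Lemma delta_c D : divisor X D -> delta (Ext D 0 0) = `|div_deg D|.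
Proof. by move=> dD; rewrite delta_split ?div_deg0 ?subr0 //; exact: divisor0. Qed.

(** Invariance of delta gives equal degrees and a twist of degree 0. A line of positive degree
    cannot map to the summand O, so the matrix preserves the line (1, 0); comparing its divisor and
    the determinant eliminates the twist E. *)
Lemma cvert_inj D D' : divisor X D -> divisor X D' -> 0 < div_deg D -> 0 <= div_deg D' ->
  cvert D = cvert D' -> exists2 f, f != 0 & D' = D + principal f.
Proof.
move=> dD dD' pD pD'; rewrite !cvertE => /pclassP-/(_ (bundle_c dD) (bundle_c dD'))h.
have := delta_pe (bundle_c dD) h; rewrite !delta_c // (ger0_norm pD') (ger0_norm (ltW pD)) => eqd.
have [E [A [dE uA hA]]] := h.
have dA0 : \det A != 0 by move: uA; rewrite unitmxE unitfE.
have dpA := divisor_principal dA0.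
have := ddet_pew (bundle_c dD) uA hA; rewrite !ddet_Ext !addr0 => ED'.
have d2 := divisorMn 2 dE.
have degE : div_deg E = 0.
  have := congr1 (@div_deg _ X) ED'.
  rewrite (div_degB (divisorD dD d2) dpA) (div_degD dD d2) (div_degMn 2 dE) (div_deg_principal dA0); lia.
have e10 : vec 1 0 != 0 :> 'rV[F]_2 by rewrite vec_eq0 oner_eq0.
have eA0 : vec 1 0 *m A != 0.
  by apply: contraNneq e10 => /(congr1 (mulmx^~ (invmx A))); rewrite mulmxK // mul0mx => ->.
have hd := has_div_pew hA (@has_div_Ext _ X D 0 0); rewrite -/(D + E) in hd.
have := has_div_bound dD' (divisor0 X) (adele0 X) (divisorD dD dE) eA0 hd.
rewrite div_degD // degE addr0 div_deg0 => -[|[b0 _]]; first lia.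
move: hd eA0; rewrite [vec 1 0 *m A]vecE b0 vec_eq0 eqxx andbT; set a := (_ *m A) 0 0 => hd a0.
have da := divisor_principal a0.
have hd' : has_div (Ext D' 0 0) (vec a 0) (D' + principal a).
  move=> v f; rewrite vecZ mulr0 /Ext herm_vec0 mulrC vgeMl //.
  by rewrite -[(D' + principal a) v]/(D' v + ord v a) opprD.
have EE : E = D' + principal a - D by rewrite -(has_div_uniq hd hd') addrC addKr.
exists (\det A / (a * a)); first by rewrite mulf_neq0 ?invr_neq0 // mulf_neq0.
have aa : a * a != 0 by rewrite mulf_neq0.
rewrite principalM ?invr_neq0 // principalV principalM //.
apply/funext => v; have := congr1 (fun D => D v) ED'; rewrite EE mulr2n !fctE; lia.
Qed.

Lemma large_delta M : bundle 2 M -> ldim (0 : place -> int) = 1%N -> 2 * (genus X)%:Z - 2 < delta M ->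
  exists D, [/\ divisor X D, pclass M = cvert D & div_deg D = delta M].
Proof.
move=> bM l1 hd; have [e [G [[e0 hG dG dE] _]]] := deltaP bM.
have [A [D [D' [r [[uA eA dD dD' Ar] h]]]]] := norm_ext bM e0.
have EG : G = D.
  apply: has_div_uniq (@has_div_Ext _ X D D' r); rewrite -[G]addr0 -eA; exact: has_div_pew h hG.
have dDD := divisorB dD dD'.
have dl : div_deg (D - D') = delta M.
  have : deg M = div_deg D + div_deg D'.
    by rewrite -(deg_Ext dD dD' Ar) (deg_pew bM (divisor0 X) uA h) div_deg0 mulr0 addr0.
  by rewrite div_degB // dE EG; lia.
exists (D - D'); split=> //; rewrite -Ext_cvert //; apply/pclassP => //; first exact: Extz_bundle.
apply: pe_trans (_ : pe (Ext D D' r) _); first by exists 0, A; split=> //; exact: divisor0.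
by apply: Ext_split => //; apply: hdim_vanish => //; rewrite l1 dl.
Qed.

Lemma decomposable_pe M M' : pe M M' -> decomposable M' -> decomposable M.
Proof.
move=> /pe_sym [E [A [dE uA h]]] /decomposableP[B [D [D' [uB dD dD' hB]]]]; apply/decomposableP.
exists (B *m A), (D + E), (D' + E); rewrite unitmx_mul uA uB; split=> //; try exact: divisorD.
have h1 := pew_sym (unitmx1 _ 2) (@Ext_twist _ X D D' E 0 dE).
by have := pew_trans h1 (pew_trans hB h); rewrite add0r addNr invmx1 mul1mx.
Qed.

Lemma vec_mul_rows (c e e' : 'rV[F]_2) :
  c *m mx2 (e 0 0) (e 0 1) (e' 0 0) (e' 0 1) = c 0 0 *: e + c 0 1 *: e'.
Proof. by rewrite [RHS]vecE [c in LHS]vecE vec_mul; congr vec; rewrite !mxE. Qed.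

Lemma split_basis M (e e' : 'rV[F]_2) : bundle 2 M -> e != 0 -> e' != 0 ->
  mx2 (e 0 0) (e 0 1) (e' 0 0) (e' 0 1) \in unitmx ->
  (forall v s t, M v (s *: e + t *: e') -> M v (s *: e)) -> decomposable M.
Proof.
move=> bM e0 e'0 uA hs; have [D dD hD] := has_div_ex bM e0; have [D' dD' hD'] := has_div_ex bM e'0.
apply/decomposableP; exists (mx2 (e 0 0) (e 0 1) (e' 0 0) (e' 0 1)), D, D'; split=> // v u.
rewrite oppr0 expr0z scale1r vec_mul_rows {1}[u]vecE ExtzE.
split=> [[/hD h1 /hD' h2]|h]; first exact: bundleDv.
have h1 := hs _ _ _ h; split; first exact/hD.
apply/hD'; rewrite -[_ *: e'](addKr (u 0 0 *: e)); apply: bundleDv => //; exact: bundleNv.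
Qed.

Definition bend M : set 'M[F]_2 := [set phi | forall v u, M v u -> M v (u *m phi)].

Lemma bend_entries n (E : sheaf X n) v (B phi : 'M[F]_n) : B \in unitmx -> E v = lattice v B ->
  (forall u, E v u -> E v (u *m phi)) <-> (forall i j, vge v 0 ((B *m phi *m invmx B) i j)).
Proof.
move=> uB ->; split=> [h i j|h _ [c hc <-]].
  have : lattice v B (row i B).
    exists (delta_mx 0 i); last by rewrite -rowE.
    by move=> l; rewrite mxE regularE; case: (_ && _); [right; rewrite ord_one|left].
  move=> /h[c hc Ec]; have : row i B *m phi *m invmx B = c by rewrite -Ec mulmxK.
  by rewrite -!row_mul => /rowP/(_ j); rewrite mxE => ->; rewrite -regularE; exact: hc.
exists (c *m (B *m phi *m invmx B)); last by rewrite -!mulmxA mulVmx // mulmx1.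
move=> j; rewrite mxE regularE; apply: vge_sum => i _; rewrite -[0]addr0; apply: vgeM => //.
by rewrite -regularE; exact: hc.
Qed.

Lemma vge_det v n (A : 'M[F]_n) : (forall i j, vge v 0 (A i j)) -> vge v 0 (\det A).
Proof.
move=> h; rewrite /determinant; apply: vge_sum => s _; rewrite -[0]addr0; apply: vgeM.
  by rewrite -signr_odd; case: (odd _); rewrite ?expr0 ?expr1; [apply/vgeN|]; right; rewrite ord_one.
by apply: (big_ind (vge v 0)) => [|a b ha hb|//]; [right; rewrite ord_one|rewrite -[0]addr0; exact: vgeM].
Qed.

Lemma bend_tr_det M phi : bundle 2 M -> bend M phi -> Lsp 0 (\tr phi) /\ Lsp 0 (\det phi).
Proof.
move=> /bundleP[hM _] h; suff H v : vge v 0 (\tr phi) /\ vge v 0 (\det phi).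
  by split=> v; rewrite oppr0; case: (H v).
have [B uB EB] := hM v; have hr := (bend_entries phi uB EB).1 (h v).
have -> : \tr phi = \tr (B *m phi *m invmx B) by rewrite mxtrace_mulC mulmxA mulVmx // mul1mx.
have -> : \det phi = \det (B *m phi *m invmx B).
  by rewrite !det_mulmx det_inv mulrAC divff ?mul1r //; move: uB; rewrite unitmxE unitfE.
by split; [apply: vge_sum|exact: vge_det].
Qed.

Lemma eigenvec (phi : 'M[F]_2) a : a ^+ 2 - \tr phi * a + \det phi = 0 ->
  exists2 e : 'rV[F]_2, e != 0 & e *m phi = a *: e.
Proof.
move=> h; have : \det (phi - a%:M) == 0.
  rewrite -h [phi]mx2E det_mx2 /mxtrace big_ord_recl big_ord1.
  have -> : mx2 (phi 0 0) (phi 0 1) (phi 1 0) (phi 1 1) - a%:M = mx2 (phi 0 0 - a) (phi 0 1) (phi 1 0) (phi 1 1 - a).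
    by rewrite [LHS]mx2E; congr mx2; rewrite !mxE /= ?mulr1n ?mulr0n ?subr0.
  rewrite det_mx2 !mxE /=; apply/eqP; ring.
case/det0P => e e0; rewrite mulmxBr mul_mx_scalar => /eqP; rewrite subr_eq0 => /eqP E.
by exists e.
Qed.

(** The projector (phi - b) / (a - b) onto an eigenline has constant denominator, so it maps every
    stalk of M into itself. *)
Lemma eigen_split M phi (a b : k) : bundle 2 M -> bend M phi -> a != b ->
  \tr phi = const X (a + b) -> \det phi = const X (a * b) -> decomposable M.
Proof.
move=> bM hphi ab Et Ed.
have [e e0 He] : exists2 e : 'rV[F]_2, e != 0 & e *m phi = const X a *: e.
  by apply: eigenvec; rewrite Et Ed rmorphD rmorphM; ring.
have [e' e'0 He'] : exists2 e : 'rV[F]_2, e != 0 & e *m phi = const X b *: e.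
  by apply: eigenvec; rewrite Et Ed rmorphD rmorphM; ring.
have cab : const X a - const X b != 0 by rewrite -rmorphB const_eq0 subr_eq0.
have act s t : (s *: e + t *: e') *m phi - const X b *: (s *: e + t *: e') = ((const X a - const X b) * s) *: e.
  rewrite mulmxDl -!scalemxAl He He' scalerDr !scalerA opprD addrACA [t * _]mulrC subrr addr0 -scalerBl.
  by rewrite [s * _]mulrC mulrBl.
have hs v s t : M v (s *: e + t *: e') -> M v (s *: e).
  move=> h; have -> : s *: e = const X (a - b)^-1 *: ((s *: e + t *: e') *m phi - const X b *: (s *: e + t *: e')).
    by rewrite act scalerA fmorphV rmorphB mulrA mulVf // mul1r.
  apply: (bundleZ bM (vge_const _ _)); apply: bundleDv => //; first exact: hphi.
  by apply: bundleNv => //; apply: (bundleZ bM (vge_const _ _)).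
apply: split_basis hs => //; rewrite unitmxE unitfE; apply/negP => /det0P[c c0].
rewrite vec_mul_rows => hc.
have := act (c 0 0) (c 0 1); rewrite hc mul0mx scaler0 subr0 => /esym/eqP.
rewrite scaler_eq0 (negPf e0) orbF mulf_eq0 (negPf cab) /= => /eqP c00.
move: hc; rewrite c00 scale0r add0r => /eqP; rewrite scaler_eq0 (negPf e'0) orbF => /eqP c01.
by move: c0; rewrite [c]vecE c00 c01 vec_eq0 eqxx.
Qed.

(** A / B is a vector space over the quadratic field k[z] / (z^2 - t z + n), with z acting as c. The
    induction enlarges B by the plane spanned by some a outside B and by c a. *)
Lemma even_qdim (A : set F) (c : F) (t n : k) : subsp (@kscale _ X) A ->
  (forall a, A a -> A (c * a)) -> (forall z : k, z ^+ 2 - t * z + n != 0) ->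
  forall d (B : set F), subsp (@kscale _ X) B -> B `<=` A -> (forall a, B a -> B (c * a)) ->
  (forall a, A a -> B ((c ^+ 2 - const X t * c + const X n) * a)) ->
  quotient_dim (@kscale _ X) A B d -> ~~ odd d.
Proof.
move=> sA cA irr; elim/ltn_ind => d IH B sB BA cB pB qd.
have [AB|/existsNP[a /not_implyP[Aa nBa]]] := pselect (A `<=` B).
  by rewrite (qdim_uniq (kscaling X) sB qd ((qdim_eq0 (kscaling X) A sB).2 AB)).
pose C := [set x | exists al be, B (x - (kscale al a + kscale be (c * a)))].
have [B0 BD BZ] := sB.
have sC : subsp (@kscale _ X) C.
  split.
  - by exists 0, 0; rewrite /kscale !rmorph0 !mul0r addr0 subr0.
  - move=> x y [al [be hx]] [al' [be' hy]]; exists (al + al'), (be + be').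
    by have := BD _ _ hx hy; rewrite /kscale !rmorphD; congr B; ring.
  - move=> z x [al [be hx]]; exists (z * al), (z * be).
    by have := BZ z _ hx; rewrite /kscale !rmorphM; congr B; ring.
have BC : B `<=` C by move=> x Bx; exists 0, 0; rewrite /kscale !rmorph0 !mul0r addr0 subr0.
have CA : C `<=` A.
  move=> x [al [be hx]]; rewrite -[x](subrK (kscale al a + kscale be (c * a))).
  by case: (sA) => _ AD AZ; apply: (AD _ _ (BA _ hx)); apply: AD; apply: AZ => //; exact: cA.
have cC x : C x -> C (c * x).
  move=> [al [be hx]]; exists (- (n * be)), (al + t * be).
  have := BD _ _ (cB _ hx) (BZ be _ (pB _ Aa)).
  by rewrite /kscale rmorphN rmorphD !rmorphM; congr B; ring.
have pC x : A x -> C ((c ^+ 2 - const X t * c + const X n) * x) by move=> Ax; apply: BC; exact: pB.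
have [m [l [qm ql El]]] := qdim_split (kscaling X) sA sB sC BC CA qd.
suff ql2 : quotient_dim (@kscale _ X) C B 2.
  rewrite El (qdim_uniq (kscaling X) sB ql ql2) in IH *; rewrite oddD addbF.
  by apply: (IH m) qm => //; rewrite addn2.
apply/(qdimP (kscaling X) _ _ sB); exists (fun i : 'I_2 => if i == 0 then a else c * a); split.
- move=> i; case: ifP => _; [exists 1, 0|exists 0, 1];
  by rewrite /kscale !rmorph0 !rmorph1 !mul0r !mul1r ?addr0 ?add0r subrr.
- move=> g; rewrite big_ord_recl big_ord1 /= => hg.
  have z0 : forall al, ~ B (c * a - kscale al a).
    move=> al h; apply: nBa; have := BD _ _ (BD _ _ (cB _ h) (BZ (al - t) _ h)) (BZ (-1) _ (pB _ Aa)).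
    rewrite /kscale rmorphN rmorph1 rmorphB => h1.
    have {h1} : B (kscale (- (al ^+ 2 - t * al + n)) a).
      by move: h1; rewrite /kscale rmorphN rmorphD rmorphB rmorphXn rmorphM; congr B; ring.
    move/(BZ (- (al ^+ 2 - t * al + n))^-1); rewrite /kscale mulrA -rmorphM mulVf ?rmorph1 ?mul1r //.
    by rewrite oppr_eq0 irr.
  have g1 : g (lift fintype.ord0 fintype.ord0) = 0.
    apply/eqP; apply/negP => /negP g1; apply: (z0 (- (g fintype.ord0 / g (lift fintype.ord0 fintype.ord0)))).
    have := BZ (g (lift fintype.ord0 fintype.ord0))^-1 _ hg; congr B.
    by rewrite /kscale rmorphN !rmorphM fmorphV; field; rewrite const_eq0.
  have g0 : g fintype.ord0 = 0.
    apply/eqP; apply/negP => /negP g0; apply: nBa.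
    have := BZ (g fintype.ord0)^-1 _ hg; congr B.
    by rewrite g1 /kscale rmorph0 mul0r addr0 fmorphV mulrA mulVf ?mul1r ?const_eq0.
  by move=> i; case: (unliftP fintype.ord0 i) => [j|] -> //; rewrite (ord1 j).
- move=> x [al [be hx]]; exists (fun i => if i == 0 then al else be).
  by rewrite big_ord_recl big_ord1.
Qed.

Lemma even_pdeg v c (t n : k) : vge v 0 c -> (forall z : k, z ^+ 2 - t * z + n != 0) ->
  vge v 1 (c ^+ 2 - const X t * c + const X n) -> ~~ odd (pdeg v).
Proof.
move=> hc irr hp; apply: (@even_qdim (vge v 0) c t n (vge_subsp v 0) _ irr _ (vge v 1) (vge_subsp v 1) _ _ _ (pdegP v)).
- by move=> a ha; rewrite -[0]addr0; exact: vgeM.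
- by move=> a; exact: vgeW.
- by move=> a ha; rewrite -[1]add0r; exact: vgeM.
- by move=> a ha; rewrite -[1]addr0; exact: vgeM.
Qed.

(** In coordinates adapted to the maximal line subbundle O(D), b is the component of phi from O(D)
    to the quotient O(D'). Its divisor E of zeros is effective of degree -delta. If E = 0, then O(D)
    and its image under phi span M, which splits. At a place of E the line O(D) is stable under phi
    modulo v, which forces even degree. *)
Lemma irr_delta M phi (t n : k) : bundle 2 M -> bend M phi ->
  \tr phi = const X t -> \det phi = const X n -> (forall z : k, z ^+ 2 - t * z + n != 0) ->
  (forall f, Lsp (0 : place -> int) f -> exists z, f = const X z) -> ~ decomposable M ->
  delta M < 0 /\ (2 %| delta M)%Z.
Proof.
move=> bM hphi Et En irr Lc nd; have [e [G [[e0 hG dG dE] _]]] := deltaP bM.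
have [A [D [D' [r [[uA eA dD dD' Ar] h]]]]] := norm_ext bM e0.
have EG : G = D.
  apply: has_div_uniq (@has_div_Ext _ X D D' r); rewrite -[G]addr0 -eA; exact: has_div_pew h hG.
have dl : delta M = div_deg D - div_deg D'.
  have : deg M = div_deg D + div_deg D'.
    by rewrite -(deg_Ext dD dD' Ar) (deg_pew bM (divisor0 X) uA h) div_deg0 mulr0 addr0.
  by rewrite dE EG; lia.
have hpe : pe M (Ext D D' r) by exists 0, A; split=> //; exact: divisor0.
pose psi := invmx A *m phi *m A.
have hpsi v u : Ext D D' r v u -> Ext D D' r v (u *m psi).
  have hA w z : M w z <-> Ext D D' r w (z *m A) by rewrite h oppr0 expr0z scale1r.
  rewrite -{1}[u](mulmxKV uA) -hA => /hphi; rewrite hA; congr (Ext _ _ _ _ _).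
  by rewrite /psi !mulmxA.
have [a [b [c [d Epsi]]]] : exists a b c d, psi = mx2 a b c d by do 4!eexists; exact: mx2E.
have Tpsi : a + d = const X t.
  have : \tr psi = const X t by rewrite /psi mxtrace_mulC mulmxA mulmxV // mul1mx.
  by rewrite Epsi /mxtrace big_ord_recl big_ord1 !mxE.
have Dpsi : a * d - b * c = const X n.
  by rewrite -En -det_mx2 -Epsi /psi !det_mulmx det_inv mulrAC mulVf ?mul1r //; move: uA; rewrite unitmxE unitfE.
pose p v := unif v ^ (- D v).
have h1 v : vge v (- D' v) (p v * b) /\ vge v (- D v) (p v * a - r v * (p v * b)).
  have /hpsi : Ext D D' r v (vec (p v) 0) by apply/herm_vec0; right; rewrite ord_unifz.
  by rewrite Epsi vec_mul !mul0r !addr0 /Ext /herm /= vec0 vec1.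
have h1' v : vge v 0 (a - r v * b).
  have [_] := h1 v; rewrite mulrCA -mulrBr vgeMl ?unifz_neq0 // ord_unifz addrN //.
(* Otherwise O(D) is stable under phi, and the eigenvalue a, regular everywhere, is a root in k. *)
have b0 : b != 0.
  apply/eqP => b0; have [|z Ez] := Lc a.
    by move=> v; rewrite oppr0; have := h1' v; rewrite b0 mulr0 subr0.
  have := irr z; rewrite -(const_eq0 X) rmorphD rmorphB rmorphXn rmorphM -Ez -Tpsi -Dpsi b0.
  by move/negP; apply; apply/eqP; ring.
(* E v is the length at v of the quotient of M by O(D) + phi O(D). *)
have db := divisor_principal b0; pose E := D' + principal b - D.
have dE' : divisor X E by apply: divisorB => //; exact: divisorD.
have EE v : E v = D' v + ord v b - D v by [].
have E0 v : 0 <= E v.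
  have [+ _] := h1 v; rewrite vge_ord ?mulf_neq0 ?unifz_neq0 // ordM ?unifz_neq0 // ord_unifz EE; lia.
have degE : div_deg E = - delta M.
  by rewrite dl div_degB ?div_degD ?div_deg_principal ?addr0 ?opprB //; exact: divisorD.
split.
  rewrite lt_neqAle; apply/andP; split; last by rewrite -oppr_ge0 -degE; exact: div_deg_ge0.
  apply/eqP => dl0; apply: nd; apply: decomposable_pe hpe _; apply/decomposableP.
  exists (mx2 1 0 a b), D, D; rewrite unit_mx2 mul1r mul0r subr0; split=> // v u.
  have Ev : E v = 0.
    have := eff_le v dE' E0; rewrite degE dl0; have := E0 v; have := pdeg_gt0 v; nia.
  rewrite oppr0 expr0z scale1r [u]vecE ExtzE vec_mul /Ext /herm /= !vec0 !vec1 mulr1 mulr0 add0r.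
  move: (u 0 0) (u 0 1) => s x.
  have -> : vge v (- D' v) (x * b) <-> vge v (- D v) x.
    rewrite mulrC vgeMl //; have -> : - D' v - ord v b = - D v by move: Ev; rewrite EE; lia.
    by [].
  have hx : vge v (- D v) x -> vge v (- D v) (x * (a - r v * b)).
    by move=> hx; rewrite -[- D v]addr0; exact: vgeM.
  split=> [[hs hx']|[hx' hs]]; split=> //.
    have -> : s + x * a - r v * (x * b) = s + x * (a - r v * b) by ring.
    by apply: vgeD => //; exact: hx.
  have -> : s = (s + x * a - r v * (x * b)) - x * (a - r v * b) by ring.
  by apply: vgeB => //; exact: hx.
have -> : delta M = - div_deg E by rewrite degE opprK.
rewrite rpredN; have [s [us hs]] := divisor_seq dE'.
rewrite (div_deg_seq us hs) big_seq; apply: (big_ind (fun z : int => (2 %| z)%Z)) => // [x y|v _].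
  exact: rpredD.
have := E0 v; rewrite le_eqVlt => /predU1P[<-|Ev]; first by rewrite mulr0.
suff : ~~ odd (pdeg v) by move=> od; apply: dvdz_mulr; rewrite dvdzE /= dvdn2.
pose q := unif v ^ (- D' v).
(* Where E v > 0, phi acts on the line O(D) modulo v by the scalar a - r v b, so its residue is a
   root of the irreducible characteristic polynomial. *)
apply: (@even_pdeg v (a - r v * b) t n) => //.
have -> : (a - r v * b) ^+ 2 - const X t * (a - r v * b) + const X n =
    - b * ((r v * a + c) - r v * (r v * b + d)) by rewrite -Tpsi -Dpsi; ring.
have /hpsi : Ext D D' r v (vec (r v * q) q).
  by rewrite /Ext /herm /= vec0 vec1 subrr; split; [right; rewrite ord_unifz|left].
rewrite Epsi vec_mul /Ext /herm /= vec0 vec1 => -[_].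
have -> : r v * q * a + q * c - r v * (r v * q * b + q * d) = q * ((r v * a + c) - r v * (r v * b + d)) by ring.
rewrite vgeMl ?unifz_neq0 // ord_unifz mulNr => hz; apply/vgeN; apply/vgeMl => //; apply: vgeW hz.
by move: Ev; rewrite EE; lia.
Qed.
End Vertices.

(** * Pullback to the geometric fibre *)

Section Pullback.
Variables (k : finFieldType) (X : curve k) (Y : geometric_fibre X).
Local Notation F := (funfield X).
Local Notation K := (kbar Y).
Local Notation Z := (fibre Y).
Local Notation FZ := (funfield Z).
Local Notation io := (kbar_emb Y).
Local Notation tau := (to_fibre Y).
Local Notation over := (lies_over (Y := Y)).
Implicit Types (v : place X) (w : place Z) (M : sheaf X 2).

Lemma below_ex w : exists v, over w v.
Proof. by have [v [e e0 h]] := place_below w; exists v; apply/lies_overP; exists e. Qed.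
Definition below w : place X := projT1 (cid (below_ex w)).
Lemma belowP w : over w (below w). Proof. exact: projT2 (cid (below_ex w)). Qed.
Lemma below_eq w v : over w v -> below w = v. Proof. exact/lies_over_uniq/belowP. Qed.

Lemma finite_above v : finite_set [set w | below w = v].
Proof.
have tu : tau (unif v) != 0 by rewrite fmorph_eq0 unif_neq0.
apply: sub_finite_set (finite_zeros tu) => w /= hw.
have /lies_overP[e e0 ->] := belowP w; by rewrite hw ord_unif mulr1.
Qed.

Lemma finite_above_set (S : set (place X)) : finite_set S -> finite_set [set w | S (below w)].
Proof.
move=> fS; have -> : [set w | S (below w)] = \bigcup_(v in S) [set w | below w = v].
  by apply/seteqP; split=> w /=; [move=> h; exists (below w)|move=> [v Sv] /= ->].
by apply: bigcup_finite => // v _; exact: finite_above.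
Qed.

Lemma pullback_lattice n (E : sheaf X n) w (B : 'M[F]_n) : E (below w) = lattice (below w) B ->
  pullback Y E w = lattice w (map_mx tau B).
Proof.
move=> EB; apply/seteqP; split=> z.
  move=> [v /below_eq <-]; rewrite EB => -[m [a [u [ha hu ->]]]]; apply: lattice_comb => i.
    by rewrite -regularE.
  have [c [c' hc' <-] <-] := hu i; exists (map_mx tau c'); last by rewrite map_mxM.
  by move=> j; rewrite mxE regularE; apply/lies_over_vge; [exact: belowP|rewrite -regularE; exact: hc'].
move=> [c hc <-]; exists (below w); first exact: belowP.
exists n, (fun i => c 0 i), (fun i => row i (map_mx tau B)); split=> //; last exact: mulmx_sum_row.
move=> i; exists (row i B); last by rewrite map_row.
rewrite EB; exists (delta_mx 0 i); last by rewrite -rowE.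
by move=> j; rewrite mxE regularE; case: (_ && _); [right; rewrite ord_one|left].
Qed.

(** Written through the order of a pulled-back local generator, which spares the ramification
    index. *)
Definition pull_div (D : place X -> int) : place Z -> int :=
  fun w => - ord w (tau (unif (below w) ^ (- D (below w)))).

Lemma pull_div_divisor D : divisor X D -> divisor Z (pull_div D).
Proof.
move=> dD; apply: sub_finite_set (finite_above_set dD) => w /= /eqP h; apply/eqP => D0; apply: h.
by rewrite /pull_div D0 oppr0 expr0z rmorph1 ord_one.
Qed.

Lemma pullback_pew A D D' M : A \in unitmx -> pew 0 A (Ext D D' 0) M ->
  pew 0 (map_mx tau A) (Ext (pull_div D) (pull_div D') 0) (pullback Y M).
Proof.
move=> uA h w; have EM := latticeZ_pew uA h (herm_lattice (below w) (- D (below w)) (- D' (below w)) 0).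
have map2 a b c d : map_mx tau (mx2 a b c d) = mx2 (tau a) (tau b) (tau c) (tau d).
  by rewrite [LHS]mx2E !mxE.
move=> u; rewrite (pullback_lattice EM) oppr0 !expr0z !scale1r map_mxM mul0r map2 !rmorph0.
have -> : Ext (pull_div D) (pull_div D') 0 w =
   lattice w (mx2 (tau (unif (below w) ^ (- D (below w)))) 0 0 (tau (unif (below w) ^ (- D' (below w))))).
  have tu D0 : tau (unif (below w) ^ (- D0)) != 0 by rewrite fmorph_eq0 unifz_neq0.
  have hdiv D0 z : vge w (ord w (tau (unif (below w) ^ (- D0)))) z -> vge w 0 (z / tau (unif (below w) ^ (- D0))).
    by move=> hz; rewrite mulrC; apply/vgeMl; rewrite ?invr_neq0 // ordV sub0r opprK.
  apply/seteqP; split=> z; rewrite [z]vecE lattice2P ExtzE /pull_div !opprK.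
    move=> [h0 h1]; exists (z 0 0 / tau (unif (below w) ^ (- D (below w)))), (z 0 1 / tau (unif (below w) ^ (- D' (below w)))).
    by rewrite !mulr0 addr0 add0r !divfK //; split=> //; exact: hdiv.
  move=> [s [t [hs ht -> ->]]]; rewrite !mulr0 addr0 add0r ![_ * tau _]mulrC.
  by split; apply/vgeMl => //; rewrite subrr.
split=> [[c hc <-]|[c hc /(congr1 (mulmx^~ (invmx (map_mx tau A))))]].
  by exists c => //; rewrite mulmxA.
by rewrite mulmxA !mulmxK ?map_unitmx // => <-; exists c.
Qed.

Lemma decomposable_pullback M : decomposable M -> decomposable (pullback Y M).
Proof.
move=> /decomposableP[A [D [D' [uA dD dD' h]]]]; apply/decomposableP.
exists (map_mx tau A), (pull_div D), (pull_div D'); rewrite map_unitmx; split=> //; try exact: pull_div_divisor.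
exact: pullback_pew.
Qed.

Definition rep n (b : 'I_n -> K) z := exists a : 'I_n -> F, z = \sum_i tau (a i) * const Z (b i).

Lemma rep_cat n m (b : 'I_n -> K) (b' : 'I_m -> K) : exists b'' : 'I_(n + m) -> K,
  (forall z, rep b z -> rep b'' z) /\ (forall z, rep b' z -> rep b'' z).
Proof.
exists (fun i => match fintype.split i with inl i => b i | inr i => b' i end); split=> _ [a ->].
  exists (fun i => match fintype.split i with inl i => a i | inr i => 0 end).
  rewrite big_split_ord /= [X in _ = _ + X]big1 ?addr0 => [|i _]; last first.
    by rewrite (unsplitK (inr i)) rmorph0 mul0r.
  by apply: eq_bigr => i _; rewrite (unsplitK (inl i)).
exists (fun i => match fintype.split i with inl i => 0 | inr i => a i end).
rewrite big_split_ord /= [X in _ = X + _]big1 ?add0r => [|i _]; last first.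
  by rewrite (unsplitK (inl i)) rmorph0 mul0r.
by apply: eq_bigr => i _; rewrite (unsplitK (inr i)).
Qed.

Lemma rep_kindep n (b : 'I_n -> K) : exists m (b' : 'I_m -> K), kindep b' /\ forall z, rep b z -> rep b' z.
Proof.
pose s (c : k) (z : K) := io c * z.
have sc : scaling s.
  by split=> [u|a c u|a c u|a u v]; rewrite /s ?rmorph1 ?mul1r // ?rmorphM ?rmorphD ?mulrA ?mulrDl ?mulrDr.
pose A := [set z | exists c : 'I_n -> k, z = \sum_i s (c i) (b i)].
have [d qd] : exists d, quotient_dim s A [set 0] d.
  apply: (qdim_bound sc (N := n) (subsp0 sc)) => m u Au iu; apply: (indep_le sc (subsp0 sc) (e := b)) iu => i.
  by have [c ->] := Au i; exists c; rewrite /= subrr.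
have [e [Ae ie gen]] := (qdimP sc _ _ (subsp0 sc)).1 qd.
exists d, e; split; first exact: ie.
move=> _ [a ->].
have /choice[C hC] : forall i, exists c : 'I_d -> k, b i = \sum_j io (c j) * e j.
  move=> i; have [|c /eqP] := gen (b i); last by rewrite subr_eq0 => /eqP; exists c.
  exists (fun j => (j == i)%:R); rewrite (bigD1 i) //= eqxx /s rmorph1 mul1r big1 ?addr0 // => j /negPf ->.
  by rewrite rmorph0 mul0r.
exists (fun j => \sum_i a i * const X (C i j)).
under [RHS]eq_bigr do rewrite rmorph_sum mulr_suml.
rewrite exchange_big; apply: eq_bigr => i _; rewrite hC rmorph_sum mulr_sumr; apply: eq_bigr => j _.
by rewrite !rmorphM /= to_fibre_const mulrA.
Qed.

Lemma rep_mx (P : 'M[FZ]_2) : exists n (b : 'I_n -> K) (a : 'I_n -> 'M[F]_2), kindep b /\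
  P = \sum_i const Z (b i) *: map_mx tau (a i).
Proof.
have ex z : exists n (b : 'I_n -> K), rep b z by have [n [a [b ->]]] := fibre_gen z; exists n, b, a.
have [n0 [b0 r0]] := ex (P 0 0); have [n1 [b1 r1]] := ex (P 0 1).
have [n2 [b2 r2]] := ex (P 1 0); have [n3 [b3 r3]] := ex (P 1 1).
have [c0 [h0 h0']] := rep_cat b0 b1; have [c1 [h1 h1']] := rep_cat b2 b3.
have [c2 [h2 h2']] := rep_cat c0 c1; have [n [b [ib hb]]] := rep_kindep c2.
have [a0 E0] := hb _ (h2 _ (h0 _ r0)); have [a1 E1] := hb _ (h2 _ (h0' _ r1)).
have [a2 E2] := hb _ (h2' _ (h1 _ r2)); have [a3 E3] := hb _ (h2' _ (h1' _ r3)).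
exists n, b, (fun i => mx2 (a0 i) (a1 i) (a2 i) (a3 i)); split=> //.
rewrite [LHS]mx2E [RHS]mx2E E0 E1 E2 E3 !summxE.
by congr mx2; apply: eq_bigr => i _; rewrite !mxE mulrC.
Qed.

(** In a local basis B of M the entries of B (a i) B^-1 are the coefficients of functions regular at
    all places over v. This set of places is stable under Frobenius, so [descent] applies
    entrywise. *)
Lemma bend_descent M n (b : 'I_n -> K) (a : 'I_n -> 'M[F]_2) : bundle 2 M -> kindep b ->
  (forall w u, pullback Y M w u -> pullback Y M w (u *m \sum_i const Z (b i) *: map_mx tau (a i))) ->
  forall i, bend M (a i).
Proof.
move=> /bundleP[hM _] ib hP i v; have [B uB EB] := hM v.
apply/(bend_entries (a i) uB EB) => r c; have [w0 ow0] := place_above Y v.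
apply/(lies_over_vge _ ow0).
apply: (descent (S := [set w | over w v]) (fun w => @lies_over_sigma _ _ _ w v) (f := fun i => (B *m a i *m invmx B) r c) ib) ow0.
move=> w ow; have EBw : pullback Y M w = lattice w (map_mx tau B).
  by apply: pullback_lattice; rewrite (below_eq ow).
have uBw : map_mx tau B \in unitmx by rewrite map_unitmx.
have := (bend_entries _ uBw EBw).1 (hP w) r c; congr (vge w 0 _).
rewrite mulmx_sumr mulmx_suml summxE; apply: eq_bigr => j _.
by rewrite -scalemxAr -scalemxAl -map_invmx -!map_mxM !mxE mulrC.
Qed.

Lemma mxtrace2 (R : nzRingType) (A : 'M[R]_2) : \tr A = A 0 0 + A 1 1.
Proof. by rewrite /mxtrace big_ord_recl big_ord1; congr (_ + A _ _); exact/val_inj. Qed.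

(** This is tr^2 - 4 det in a form that is visibly quadratic over any commutative ring; a rank one
    idempotent has discriminant 1. *)
Definition disc (R : comUnitRingType) (A : 'M[R]_2) : R := (A 0 0 - A 1 1) ^+ 2 + 4 * (A 0 1 * A 1 0).

(** The projector P of the splitting has discriminant 1 and is a combination, over the algebraic
    closure, of endomorphisms of M. If the discriminant and its polar form vanished on these
    endomorphisms, they would vanish on all such combinations. *)
Lemma disc_bend_ex M : bundle 2 M -> decomposable (pullback Y M) -> exists2 phi, bend M phi & disc phi != 0.
Proof.
move=> bM /decomposableP[A [D [D' [uA dD dD' h]]]].
pose P := invmx A *m mx2 1 0 0 0 *m A.
have hP w u : pullback Y M w u -> pullback Y M w (u *m P).
  have hA z : Ext D D' 0 w z <-> pullback Y M w (z *m A) by rewrite h oppr0 expr0z scale1r.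
  rewrite -{1}[u](mulmxKV uA) -hA; rewrite /P !mulmxA -hA [u *m invmx A]vecE vec_mul !ExtzE.
  by rewrite !mulr0 mulr1 !addr0 => -[? _]; split=> //; left.
have [n [b [a [ib EP]]]] := rep_mx P; rewrite EP in hP; have ha := bend_descent bM ib hP.
apply: contrapT => /forall2NP nd.
have d0 phi : bend M phi -> disc phi = 0 by move=> hphi; case: (nd phi) => // /negP/negPn/eqP.
have badd phi psi : bend M phi -> bend M psi -> bend M (phi + psi).
  by move=> h1 h2 v u hu; rewrite mulmxDr; apply: bundleDv => //; [exact: h1|exact: h2].
suff : disc P = 0.
  have T : P 0 0 + P 1 1 = 1.
    have : \tr P = 1.
      by rewrite /P mxtrace_mulC mulmxA mulmxV // mul1mx mxtrace2 !mxE addr0.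
    by rewrite mxtrace2.
  have N : P 0 0 * P 1 1 - P 0 1 * P 1 0 = 0.
    by rewrite -det_mx2 -mx2E /P !det_mulmx det_mx2 mulr0 mul0r subr0 mulr0 mul0r.
  have -> : disc P = (P 0 0 + P 1 1) ^+ 2 - 4 * (P 0 0 * P 1 1 - P 0 1 * P 1 0) by rewrite /disc; ring.
  by rewrite T N expr1n mulr0 subr0 => /eqP; rewrite oner_eq0.
(* A quadratic form vanishing on a set closed under addition has vanishing polar form there. *)
pose pol (R : comUnitRingType) (A B : 'M[R]_2) := disc (A + B) - disc A - disc B.
rewrite EP; suff [] : disc (\sum_i const Z (b i) *: map_mx tau (a i)) = 0 /\
   forall phi, bend M phi -> pol _ (\sum_i const Z (b i) *: map_mx tau (a i)) (map_mx tau phi) = 0 by [].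
have pol_expl (R : comUnitRingType) (A' B' : 'M[R]_2) :
    pol _ A' B' = 2 * ((A' 0 0 - A' 1 1) * (B' 0 0 - B' 1 1)) + 4 * (A' 0 1 * B' 1 0 + B' 0 1 * A' 1 0).
  by rewrite /pol /disc !mxE; ring.
have dtau phi : disc (map_mx tau phi) = tau (disc phi).
  by rewrite /disc !mxE !expr2 rmorphD !rmorphM rmorphB rmorph_nat.
have ptau phi psi : bend M phi -> bend M psi -> pol _ (map_mx tau phi) (map_mx tau psi) = 0.
  move=> h1 h2; rewrite /pol -map_mxD !dtau (d0 _ (badd _ _ h1 h2)) (d0 _ h1) (d0 _ h2).
  by rewrite rmorph0 !subr0.
elim/big_rec: _ => [|i S _ [S0 hS]].
  by split=> [|phi _]; rewrite ?pol_expl /disc !mxE; ring.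
split=> [|phi hphi].
  have -> (c : FZ) A' : disc (c *: A' + S) = c ^+ 2 * disc A' + disc S + c * pol _ S A'.
    by rewrite pol_expl /disc !mxE; ring.
  by rewrite S0 hS // dtau d0 // rmorph0; ring.
have -> (c : FZ) A' B' : pol _ (c *: A' + S) B' = c * pol _ A' B' + pol _ S B'.
  by rewrite !pol_expl !mxE; ring.
by rewrite ptau // hS // mulr0 addr0.
Qed.

Lemma tr_delta M : bundle 2 M -> ~ decomposable M -> decomposable (pullback Y M) ->
  delta M < 0 /\ (2 %| delta M)%Z.
Proof.
move=> bM nd dP; have [phi hphi d0] := disc_bend_ex bM dP.
have [/(@Lsp0_const _ _ Y)[t Et] /(@Lsp0_const _ _ Y)[n En]] := bend_tr_det bM hphi.
apply: (irr_delta bM hphi Et En) => //; last exact: (@Lsp0_const _ _ Y).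
move=> z; apply/eqP => z0; apply: nd; apply: (@eigen_split _ _ M phi z (t - z) bM hphi).
- apply: contraNneq d0 => zt.
  have : disc phi = const X (t * t - 4 * n).
    by rewrite rmorphB !rmorphM rmorph_nat -Et -En /disc [phi in \det phi]mx2E det_mx2 mxtrace2; ring.
  move=> ->; have -> : t * t - 4 * n = (t - z - z) ^+ 2 - 4 * (z ^+ 2 - t * z + n) by ring.
  by rewrite z0 -zt subrr expr0n mulr0 subr0 rmorph0.
- by rewrite Et; congr (const X _); ring.
- rewrite En; congr (const X _); have -> : n = (z ^+ 2 - t * z + n) + z * (t - z) by ring.
  by rewrite z0 add0r.
Qed.
End Pullback.

(** * Hecke neighbours *)

Section Hecke.
Variables (k : fieldType) (X : curve k).
Local Notation F := (funfield X).
Local Notation place := (place X).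
Implicit Types (v w x y : place) (f g : F) (D E G : place -> int) (M N : sheaf X 2) (e : 'rV[F]_2).

Definition rows e e' : 'M[F]_2 := mx2 (e 0 0) (e 0 1) (e' 0 0) (e' 0 1).

Lemma vec_rows s t e e' : vec s t *m rows e e' = s *: e + t *: e'.
Proof. by rewrite /rows vec_mul_rows vec0 vec1. Qed.

Lemma rowsE (B : 'M[F]_2) : B = rows (row 0 B) (row 1 B).
Proof. by rewrite [LHS]mx2E /rows !mxE. Qed.

Lemma rows_mul e e' (A : 'M[F]_2) : rows e e' *m A = rows (e *m A) (e' *m A).
Proof.
apply/row_matrixP => i; have r0 z z' : row 0 (rows z z') = z by rewrite [RHS]vecE [LHS]vecE !mxE.
have r1 z z' : row 1 (rows z z') = z' by rewrite [RHS]vecE [LHS]vecE !mxE.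
rewrite row_mul; case: (unliftP 0 i) => [j|] ->; last by rewrite !r0.
by rewrite (ord1 j) (_ : lift 0 0 = 1) ?r1 //; exact/val_inj.
Qed.

Lemma lattice_rowsP v e e' u : lattice v (rows e e') u <->
  exists s t, [/\ vge v 0 s, vge v 0 t & u = s *: e + t *: e'].
Proof.
split=> [[c hc <-]|[s [t [hs ht ->]]]].
  exists (c 0 0), (c 0 1); split; [have := hc 0|have := hc 1|by rewrite {1}[c]vecE vec_rows]; by rewrite regularE.
exists (vec s t); last exact: vec_rows.
by move=> j; rewrite regularE mxE; case: ifP.
Qed.

Lemma rows_mx2 a b c d e e' : rows (a *: e + b *: e') (c *: e + d *: e') = mx2 a b c d *m rows e e'.
Proof.
by rewrite /rows mx2_mul; congr mx2; rewrite !mxE.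
Qed.

Lemma inv_mx2 (a b c d : F) : a * d - b * c != 0 ->
  invmx (mx2 a b c d) = mx2 (d / (a * d - b * c)) (- b / (a * d - b * c)) (- c / (a * d - b * c)) (a / (a * d - b * c)).
Proof.
move=> nz; have u : mx2 a b c d \in unitmx by rewrite unit_mx2.
rewrite -[RHS](mulmxK u) mx2_mul -[LHS]mul1mx mx2_1; congr (mx2 _ _ _ _ *m _); by field.
Qed.

Lemma lattice_mulP v (P B : 'M[F]_2) : B \in unitmx -> (forall i j, vge v 0 (P i j)) ->
  \det P != 0 -> ord v (\det P) = 0 -> lattice v (P *m B) = lattice v B.
Proof.
move=> uB hP dP oP; have uP : P \in unitmx by rewrite unitmxE unitfE.
apply/seteqP; split; first by apply: lattice_sub => // i j; rewrite mulmxK // regularE.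
apply: lattice_sub => [|i j]; first by rewrite unitmx_mul uP.
have -> : B *m invmx (P *m B) = invmx P.
  apply: (can_inj (mulmxK (_ : P *m B \in unitmx))); first by rewrite unitmx_mul uP.
  by rewrite mulmxKV ?unitmx_mul ?uP // mulmxA mulVmx // mul1mx.
rewrite regularE; move: dP oP hP; rewrite [P]mx2E det_mx2 => dP oP hP.
have hdiv z : vge v 0 z -> vge v 0 (z / (P 0 0 * P 1 1 - P 0 1 * P 1 0)).
  by move=> hz; rewrite -[0]addr0; apply: vgeM => //; right; rewrite ordV oP.
have h00 := hP 0 0; have h01 := hP 0 1; have h10 := hP 1 0; have h11 := hP 1 1; rewrite !mxE /= in h00 h01 h10 h11.
by rewrite inv_mx2 // mxE; case: ifP => _; case: ifP => _; apply: hdiv => //; apply/vgeN.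
Qed.

Lemma vge1_div v z : vge v 1 z -> vge v 0 (z / unif v).
Proof.
by move=> h; rewrite mulrC; apply/vgeMl; rewrite ?invr_neq0 ?unif_neq0 // ordV ord_unif sub0r opprK.
Qed.

Lemma basis_complete v (B : 'M[F]_2) e : B \in unitmx -> lattice v B e ->
  ~ lattice v B ((unif v)^-1 *: e) -> exists2 e', rows e e' \in unitmx & lattice v B = lattice v (rows e e').
Proof.
move=> uB; rewrite [B]rowsE; set b := row 0 B; set b' := row 1 B.
have uR : rows b b' \in unitmx by rewrite -rowsE.
move=> /lattice_rowsP[s [t [hs ht ->]]] np.
have prim : ~ vge v 1 s \/ ~ vge v 1 t.
  apply/not_andP => -[s1 t1]; apply: np; apply/lattice_rowsP.
  exists (s / unif v), (t / unif v); split; try exact: vge1_div.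
  by rewrite scalerDr !scalerA ![_^-1 * _]mulrC.
have v1 : vge v 0 (1 : F) by right; rewrite ord_one.
have v0 : vge v 0 (0 : F) by left.
suff [c [d [hc hd nz od]]] : exists c d, [/\ vge v 0 c, vge v 0 d, s * d - t * c != 0 & ord v (s * d - t * c) = 0].
  exists (c *: b + d *: b').
    by rewrite rows_mx2 unitmx_mul uR unit_mx2 nz.
  rewrite rows_mx2 lattice_mulP ?det_mx2 // => i j.
  by rewrite mxE; case: ifP => _; case: ifP.
case: prim => [/(vge_unit hs)[s0 os]|/(vge_unit ht)[t0 ot]].
  by exists 0, 1; rewrite mulr1 mulr0 subr0.
by exists (-1), 0; rewrite mulr0 sub0r mulrN1 opprK; split=> //; apply/vgeN.
Qed.

Definition hnb x M N := bundle 2 N /\ skyscraper_quotient x M N.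

Lemma bundle_lattice M v : bundle 2 M -> exists2 B, B \in unitmx & M v = lattice v B.
Proof. by move=> /bundleP[+ _]; apply. Qed.

Lemma hnb_unif x M N u : bundle 2 M -> hnb x M N -> M x u -> N x (unif x *: u).
Proof.
move=> bM [bN [sub eq [e Me [h1 h2]]]] hu; have [a ra Na] := h1 _ hu.
rewrite -[u](subrK (a *: e)) scalerDr; apply: bundleDv => //.
  by apply: bundleZ => //; right; rewrite ord_unif.
have ru : vge x 1 (unif x * a).
  by rewrite -[1]addr0; apply: vgeM; [right; rewrite ord_unif|rewrite -regularE].
rewrite scalerA; apply/h2; last by rewrite maximal_idealE.
by rewrite regularE; exact: vgeW ru.
Qed.

Lemma hnb_basis x M N : bundle 2 M -> hnb x M N -> exists e e',
  [/\ rows e e' \in unitmx, M x = lattice x (rows e e') & N x = lattice x (rows (unif x *: e) e')].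
Proof.
move=> bM hN; have [bN [sub eq [e Me [h1 h2]]]] := hN.
have [B uB EB] := bundle_lattice x bM.
have [||e1 uR ER] := @basis_complete x B e uB; rewrite -?EB //.
  move=> /(hnb_unif bM hN); rewrite scalerA divff ?unif_neq0 // => /h2.
  rewrite regularE => /(_ (or_intror _)); rewrite ord_one => /(_ isT).
  by rewrite maximal_idealE vge_ord ?oner_eq0 // ord_one.
rewrite -EB in ER; have Me1 : M x e1.
  by rewrite ER; apply/lattice_rowsP; exists 0, 1; rewrite scale0r scale1r add0r; split=> //; [left|right; rewrite ord_one].
have [a ra Na] := h1 _ Me1; rewrite regularE in ra.
exists e, (e1 - a *: e).
have Er : rows e (e1 - a *: e) = mx2 1 0 (- a) 1 *m rows e e1.
  by rewrite -rows_mx2 !scale1r scale0r addr0 scaleNr addrC.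
have v1 : vge x 0 (1 : F) by right; rewrite ord_one.
have v0 : vge x 0 (0 : F) by left.
have EM : M x = lattice x (rows e (e1 - a *: e)).
  rewrite Er lattice_mulP // ?det_mx2 ?mulr1 ?mul0r ?subr0 ?oner_eq0 ?ord_one // => i j.
  by rewrite mxE; case: ifP => _; case: ifP => // _; apply/vgeN.
split=> //; first by rewrite Er unitmx_mul uR unit_mx2 mulr1 mul0r subr0 oner_eq0.
apply/seteqP; split=> u.
  move=> Nu; have := sub _ _ Nu; rewrite EM => /lattice_rowsP[s [t [hs ht Eu]]].
  have Ns : N x (s *: e).
    rewrite -[s *: e](addrK (t *: (e1 - a *: e))) -Eu; apply: bundleDv => //.
    by apply: bundleNv => //; apply: bundleZ.
  move: Ns; rewrite h2 ?regularE // maximal_idealE => s1.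
  apply/lattice_rowsP; exists (s / unif x), t; split=> //; first exact: vge1_div.
  by rewrite scalerA divfK // unif_neq0.
move=> /lattice_rowsP[s [t [hs ht ->]]]; apply: bundleDv => //; apply: bundleZ => //.
exact: hnb_unif hN _.
Qed.

Lemma hnb_make x M N e e' : bundle 2 M -> rows e e' \in unitmx -> M x = lattice x (rows e e') ->
  N x = lattice x (rows (unif x *: e) e') -> (forall v, v != x -> N v = M v) -> hnb x M N.
Proof.
move=> bM uR EM EN hN; have rw : rows (unif x *: e) e' = mx2 (unif x) 0 0 1 *m rows e e'.
  by rewrite -rows_mx2 scale1r !scale0r addr0 add0r.
have uR' : rows (unif x *: e) e' \in unitmx.
  by rewrite rw unitmx_mul uR unit_mx2 mulr1 mul0r subr0 unif_neq0.
have v1 : vge x 0 (1 : F) by right; rewrite ord_one.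
have v0 : vge x 0 (0 : F) by left.
split.
  move/bundleP: bM => [hM fM]; apply/bundleP; split=> [v|].
    by have [->|vx] := eqVneq v x; [exists (rows (unif x *: e) e')|rewrite hN].
  apply: (@sub_finite_set _ _ ([set v | M v <> lattice v 1%:M] `|` [set x])); last by rewrite finite_setU.
  by move=> v /= h; have [->|vx] := eqVneq v x; [right|left; rewrite -hN].
split=> [v||].
- have [->|vx] := eqVneq v x; last by rewrite hN.
  rewrite EM EN rw => _ [c hc <-]; rewrite mulmxA; exists (c *m mx2 (unif x) 0 0 1) => //.
  move=> j; rewrite [c]vecE vec_mul !mulr0 addr0 add0r mulr1 mxE regularE.
  have hc0 := hc 0; have hc1 := hc 1; rewrite !regularE in hc0 hc1.
  case: ifP => // _; rewrite -[0]addr0; apply: vgeM => //; right; by rewrite ord_unif.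
- exact: hN.
exists e; first by rewrite EM; apply/lattice_rowsP; exists 1, 0; rewrite scale0r scale1r addr0.
split=> [u|a ra]; rewrite EN.
  rewrite EM => /lattice_rowsP[s [t [hs ht ->]]]; exists s; first by rewrite regularE.
  by apply/lattice_rowsP; exists 0, t; rewrite scale0r add0r addrC addKr.
rewrite maximal_idealE; split=> [/lattice_rowsP[s [t [hs ht]]]|h]; last first.
  apply/lattice_rowsP; exists (a / unif x), 0; rewrite scale0r addr0 scalerA divfK ?unif_neq0 //.
  by split=> //; exact: vge1_div.
rewrite scalerA -[LHS]addr0 -[X in _ + X](scale0r e') -!vec_rows => /(can_inj (mulmxK uR))/vec_inj[-> _].
by rewrite -[1]add0r; apply: vgeM => //; right; rewrite ord_unif.
Qed.

Lemma hnb_ddet x M N : bundle 2 M -> hnb x M N -> ddet N = ddet M - Defs.point x.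
Proof.
move=> bM hN; have [e [e' [uR EM EN]]] := hnb_basis bM hN; have [_ [_ eq _]] := hN.
apply/funext => v; rewrite -[LHS]/(- ord_det N v) -[RHS]/(- ord_det M v - (v == x)%:R).
have [->|vx] := eqVneq v x; last first.
  have [B uB EB] := bundle_lattice v bM; rewrite subr0.
  by rewrite (ord_detE uB EB) (ord_detE (E := N) uB) // eq.
have rw : rows (unif x *: e) e' = mx2 (unif x) 0 0 1 *m rows e e'.
  by rewrite -rows_mx2 scale1r !scale0r addr0 add0r.
have d0 : \det (rows e e') != 0 by move: uR; rewrite unitmxE unitfE.
rewrite (ord_detE uR EM) (ord_detE (E := N) (B := rows (unif x *: e) e')) //; last first.
  by rewrite rw unitmx_mul uR unit_mx2 mulr1 mul0r subr0 unif_neq0.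
by rewrite rw det_mulmx det_mx2 mulr1 mul0r subr0 ordM ?unif_neq0 // ord_unif opprD addrC.
Qed.

Lemma hnb_div x M N e D D1 : bundle 2 M -> hnb x M N -> has_div M e D -> has_div N e D1 ->
  D1 = D \/ D1 = D - Defs.point x.
Proof.
move=> bM hN hD hD1; have [_ [sub eq _]] := hN.
have off v : v != x -> D1 v = D v.
  by move=> vx; apply: oppr_inj; apply: (@vge_eq _ _ v) => f; rewrite -hD -hD1 eq.
have le1 : D1 x <= D x.
  have /hD1/sub/hD : vge x (- D1 x) (unif x ^ (- D1 x)) by right; rewrite ord_unifz.
  by rewrite vge_ord ?unifz_neq0 // ord_unifz; lia.
have le2 : D x - 1 <= D1 x.
  have /hD/(hnb_unif bM hN) : vge x (- D x) (unif x ^ (- D x)) by right; rewrite ord_unifz.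
  rewrite scalerA => /hD1; rewrite vge_ord ?mulf_neq0 ?unifz_neq0 ?unif_neq0 // ordM ?unifz_neq0 ?unif_neq0 //.
  by rewrite ord_unif ord_unifz; lia.
have [E|/eqP nE] := eqVneq (D1 x) (D x); [left|right]; apply/funext => v.
  by have [->|] := eqVneq v x; [|exact: off].
rewrite -[RHS]/(D v - (v == x)%:R); have [->|vx] := eqVneq v x; last by rewrite off // subr0.
by rewrite -[1%:R]/(1 : int); lia.
Qed.

(** The twist M(-x), with stalk pi M at x, is a sublattice of colength one in N. *)
Lemma hnb_sym x M N : bundle 2 M -> hnb x M N -> exists2 N', hnb x N N' & pe M N'.
Proof.
move=> bM hN; have [e [e' [uR EM EN]]] := hnb_basis bM hN; have [bN [_ eq _]] := hN.
pose N' : sheaf X 2 := fun v => [set u | M v (unif v ^ (- (Defs.point x v)) *: u)].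
have Exx : Defs.point x x = 1 by rewrite /Defs.point eqxx.
have swap : rows e' (unif x *: e) = mx2 0 1 1 0 *m rows (unif x *: e) e'.
  by rewrite -rows_mx2 !scale1r !scale0r addr0 add0r.
have v1 : vge x 0 (1 : F) by right; rewrite ord_one.
have v0 : vge x 0 (0 : F) by left.
have uR' : rows (unif x *: e) e' \in unitmx.
  have -> : rows (unif x *: e) e' = mx2 (unif x) 0 0 1 *m rows e e'.
    by rewrite -rows_mx2 scale1r !scale0r addr0 add0r.
  by rewrite unitmx_mul uR unit_mx2 mulr1 mul0r subr0 unif_neq0.
have d01 : 0 * 0 - 1 * 1 = -1 :> F by rewrite mul0r mul1r sub0r.
exists N'; last first.
  exists (- Defs.point x), 1%:M; split; [exact/divisorN/divisor_point|exact: unitmx1|].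
  move=> v u; rewrite /N' /= mulmx1 scalerA -expfzDr ?unif_neq0 //.
  by rewrite -[(- Defs.point x) v]/(- Defs.point x v) opprK addNr expr0z scale1r.
apply: (@hnb_make x N N' e' (unif x *: e)) => //.
- by rewrite swap unitmx_mul uR' unit_mx2 d01 oppr_eq0 oner_eq0.
- rewrite EN swap lattice_mulP // ?det_mx2 ?d01 ?oppr_eq0 ?oner_eq0 ?ordN ?ord_one // => i j.
  by rewrite mxE; case: ifP => _; case: ifP.
- apply/seteqP; split=> u.
    rewrite /N' /= Exx EM => /lattice_rowsP[s [t [hs ht Eu]]]; apply/lattice_rowsP; exists t, s; split=> //.
    rewrite -[u]scale1r -(@divff _ (unif x)) ?unif_neq0 // -scalerA -[_^-1]/(unif x ^ (-1)) Eu scalerDr addrC.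
    by rewrite !scalerA ![unif x * _]mulrC.
  move=> /lattice_rowsP[s [t [hs ht ->]]]; rewrite /N' /= Exx EM; apply/lattice_rowsP; exists t, s; split=> //.
  rewrite scalerDr addrC !scalerA -[unif x ^ (-1)]/((unif x)^-1) ![_^-1 * _]mulrC.
  by rewrite !mulfK ?unif_neq0.
- move=> v vx; rewrite eq // /N'; apply/funext => u /=.
  by rewrite /Defs.point (negPf vx) oppr0 expr0z scale1r.
Qed.

Lemma hnb_pew x M N M0 E A : bundle 2 M -> hnb x M N -> divisor X E -> A \in unitmx -> pew E A M M0 ->
  exists2 N0, hnb x M0 N0 & pe N N0.
Proof.
move=> bM hN dE uA h; have [e [e' [uR EM EN]]] := hnb_basis bM hN; have [bN [_ eq _]] := hN.
pose N0 : sheaf X 2 := fun v => [set u | N v (unif v ^ E v *: (u *m invmx A))].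
have hN0 : pew E A N N0.
  move=> v u; rewrite /N0 /= -scalemxAl mulmxK // scalerA -expfzDr ?unif_neq0 //.
  by rewrite addrN expr0z scale1r.
exists N0; last by exists E, A.
have rZ (c : F) z z' : c *: rows z z' = rows (c *: z) (c *: z').
  by rewrite [LHS]mx2E /rows !mxE.
have uz : unif x ^ (- E x) \is a GRing.unit by rewrite unitfE unifz_neq0.
apply: (@hnb_make x M0 N0 (unif x ^ (- E x) *: (e *m A)) (unif x ^ (- E x) *: (e' *m A))).
- exact: pew_bundle h bM.
- by rewrite -rZ -rows_mul unitmxZ // unitmx_mul uR.
- by rewrite (latticeZ_pew uA h EM) rows_mul rZ.
- by rewrite (latticeZ_pew uA hN0 EN) rows_mul rZ -scalemxAl !scalerA [_ * unif x]mulrC.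
- move=> v vx; apply/funext => u; apply/propext; rewrite /N0 /= eq // h -scalemxAl mulmxKV //.
  by rewrite scalerA -expfzDr ?unif_neq0 // addNr expr0z scale1r.
Qed.

Lemma hnb_Ext2 x D D' r : divisor X D -> divisor X D' -> adele r ->
  hnb x (Ext D D' r) (Ext D (D' - Defs.point x) r).
Proof.
move=> dD dD' Ar; have v1 : vge x 0 (1 : F) by right; rewrite ord_one.
have v0 : vge x 0 (0 : F) by left.
have d01 : 0 * 0 - 1 * 1 = -1 :> F by rewrite mul0r mul1r sub0r.
have swap e e' : rows e' e = mx2 0 1 1 0 *m rows e e' by rewrite -rows_mx2 !scale1r !scale0r addr0 add0r.
have lsw e e' : rows e e' \in unitmx -> lattice x (rows e' e) = lattice x (rows e e').
  move=> uR; rewrite swap lattice_mulP // ?det_mx2 ?d01 ?oppr_eq0 ?oner_eq0 ?ordN ?ord_one // => i j.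
  by rewrite mxE; case: ifP => _; case: ifP.
pose b (D0 : int) := vec (unif x ^ (- D0)) 0; pose b' (D0 : int) := vec (r x * unif x ^ (- D0)) (unif x ^ (- D0)).
have uR (m n : int) : rows (b m) (b' n) \in unitmx by rewrite /rows /b /b' !vec0 !vec1 herm_basis_unit.
have ER (m n : int) : herm x (- m) (- n) (r x) = lattice x (rows (b m) (b' n)).
  by rewrite herm_lattice /rows /b /b' !vec0 !vec1.
apply: (@hnb_make _ _ _ (b' (D' x)) (b (D x))).
- exact: Ext_bundle.
- by rewrite swap unitmx_mul uR unit_mx2 d01 oppr_eq0 oner_eq0.
- by rewrite lsw // /Ext ER.
- have -> : unif x *: b' (D' x) = b' (D' x - 1).
    by rewrite /b' vecZ opprB expfzDr ?unif_neq0 // mulrCA.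
  by rewrite lsw // /Ext -[(D' - _) x]/(D' x - (x == x)%:R) eqxx ER.
- by move=> v /negPf vx; rewrite /Ext -[(D' - _) v]/(D' v - (v == x)%:R) vx subr0.
Qed.
End Hecke.

(** * Walks and components *)

Section Walks.
Variables (T : Type) (G : graph T).
Implicit Types (u v w : T).

Lemma adjC v w : adj G v w -> adj G w v.
Proof. by move=> [m [h|h]]; exists m; [right|left]. Qed.

Lemma walk0 v : vert G v -> walk G 0 v v.
Proof. by move=> vv; exists (fun=> v). Qed.

Lemma walk_cons n u v w : vert G u -> adj G u v -> walk G n v w -> walk G n.+1 u w.
Proof.
move=> vu uv [p [p0 pn vp ap]]; exists (fun i => if i is j.+1 then p j else u); split=> //.
- by case=> // i; exact: vp.
- by case=> [_|i]; [rewrite /= p0|exact: ap].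
Qed.

Lemma walk_consP n u w : walk G n.+1 u w -> exists v, [/\ vert G u, adj G u v & walk G n v w].
Proof.
move=> [p [p0 pn vp ap]]; exists (p 1%N); split; [by rewrite -p0; exact: vp|by rewrite -p0; exact: ap|].
by exists (fun i => p i.+1); split=> // i hi; [exact: vp|exact: ap].
Qed.

Lemma walk_vert n v w : walk G n v w -> vert G v /\ vert G w.
Proof. by move=> [p [<- <- vp _]]; split; apply: vp. Qed.

Lemma walk_cat n m u v w : walk G n u v -> walk G m v w -> walk G (n + m) u w.
Proof.
elim: n u => [|n IH] u; first by move=> [p [<- <- _ _]].
by move=> /walk_consP[z [vu uz /IH h]] /h; exact: walk_cons.
Qed.

Lemma walk_rev n v w : walk G n v w -> walk G n w v.
Proof.
elim: n v => [|n IH] v; first by move=> [p [<- <- vp _]]; apply: walk0; exact: vp.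
move=> /walk_consP[z [vv vz /IH h]]; rewrite -addn1; apply: walk_cat (h) _.
by apply: walk_cons (walk0 vv); [case: (walk_vert h)|exact: adjC].
Qed.

Definition conn v w := exists n, walk G n v w.

Lemma conn_trans u v w : conn u v -> conn v w -> conn u w.
Proof. by move=> [n h] [m h']; exists (n + m)%N; exact: walk_cat h h'. Qed.
Lemma conn_sym u v : conn u v -> conn v u.
Proof. by move=> [n h]; exists n; exact: walk_rev. Qed.
Lemma conn_refl v : vert G v -> conn v v.
Proof. by move=> h; exists 0%N; exact: walk0. Qed.
Lemma conn_adj v w : vert G v -> vert G w -> adj G v w -> conn v w.
Proof. by move=> hv hw a; exists 1%N; apply: walk_cons hv a (walk0 hw). Qed.

Lemma component_eq v w : vert G v -> component G v = component G w <-> conn v w.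
Proof.
move=> vv; split=> [h|h].
  have : component G v v by exact: conn_refl.
  by rewrite h; exact: conn_sym.
by apply/seteqP; split=> z hz; apply: conn_trans hz; [exact: conn_sym|].
Qed.
End Walks.

(** * Edges of the Hecke graph and local finiteness *)

Section HeckeEdges.
Variables (k : finFieldType) (X : curve k) (x : place X).
Local Notation F := (funfield X).
Local Notation place := (place X).
Implicit Types (D E : place -> int) (M N : sheaf X 2).

Lemma residue_reps (v : place) : exists (T : finType) (rho : T -> F), forall a, vge v 0 a -> exists t, vge v 1 (a - rho t).
Proof.
have [e [_ _ gen]] := (qdimP (kscaling X) _ _ (vge_subsp v 1)).1 (pdegP v).
exists {ffun 'I_(pdeg v) -> k}, (fun c : {ffun 'I_(pdeg v) -> k} => \sum_i kscale (c i) (e i)) => a /gen[c hc].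
by exists [ffun i => c i]; under eq_bigr do rewrite ffunE.
Qed.

(** A neighbour contains pi M at x, so it is determined by its image in the finite quotient of M at
    x by pi M. Subsets of T x T code these images; the bound is crude but uniform in M. *)
Lemma nbrs_bound : exists B : nat, forall M (S : set (sheaf X 2)), bundle 2 M -> S `<=` hnb x M ->
  finite_set S /\ (#|` fset_set S| <= B)%N.
Proof.
have [T [rho hrho]] := residue_reps x; exists #|{set T * T}| => M S bM hS.
have [B uB EB] := bundle_lattice x bM.
pose g (A : {set T * T}) : sheaf X 2 := fun v => if v == x then
  [set u | exists p z, [/\ p \in A, M x z & u = vec (rho p.1) (rho p.2) *m B + unif x *: z]] else M v.
have Sg : S `<=` g @` setT.
  move=> N /hS hN; exists [set p | `[< N x (vec (rho p.1) (rho p.2) *m B) >]]%SET => //.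
  have [bN [sub eq _]] := hN; apply/funext => v; rewrite /g; case: eqVneq => [->|vx]; last by rewrite eq.
  apply/seteqP; split=> u.
    move=> [p [z [pA Mz ->]]]; move: pA; rewrite inE => /asboolP hp.
    apply: bundleDv => //; exact: (hnb_unif bM hN Mz).
  move=> Nu; have : lattice x B u by rewrite -EB; exact: sub.
  move=> [c hc Ec].
  have h0 := hc 0; have h1 := hc 1; rewrite regularE in h0 h1.
  have [t0 e0] := hrho _ h0; have [t1 e1] := hrho _ h1.
  pose z := vec ((c 0 0 - rho t0) / unif x) ((c 0 1 - rho t1) / unif x) *m B.
  have Mz : M x z.
    rewrite EB; exists (vec ((c 0 0 - rho t0) / unif x) ((c 0 1 - rho t1) / unif x)) => // j.
    by rewrite mxE regularE; case: ifP => _; exact: vge1_div.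
  have Eu : u = vec (rho t0) (rho t1) *m B + unif x *: z.
    rewrite -Ec /z scalemxAl -mulmxDl vecZ vecD {1}[c]vecE.
    by congr (vec _ _ *m B); rewrite mulrCA divff ?unif_neq0 // mulr1 addrC subrK.
  exists (t0, t1), z; split; [rewrite inE; apply/asboolP => /=|exact: Mz|exact: Eu].
  have -> : vec (rho t0) (rho t1) *m B = u - unif x *: z by rewrite Eu addrK.
  by apply: bundleDv => //; apply: bundleNv => //; exact: (hnb_unif bM hN Mz).
have fg : finite_set (g @` setT) by apply: finite_image; exact: finite_finset.
have fS := sub_finite_set Sg fg; split=> //.
have := Sg; rewrite fset_set_sub // => /fsubset_leq_card/leq_trans; apply.
rewrite fset_set_image; last exact: finite_finset.
apply: leq_trans (leq_imfset_card _ _ _) _.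
have -> : size (enum_finmem (mem (fset_set [set: {set T * T}]))) = #|` fset_set [set: {set T * T}]| by [].
by rewrite cardE; apply: uniq_leq_size => [|t _]; [exact: fset_uniq|rewrite mem_enum].
Qed.

Local Notation G := (hecke_graph x).

Lemma vertP v : vert G v <-> exists2 M, bundle 2 M & v = pclass M.
Proof. by split=> [[M [bM _] <-]|[M bM ->]]; [exists M|exists M]. Qed.

(** The uniform bound on weights is what later makes the set of edges over finitely many vertices
    finite. *)
Lemma hecke_edgeP : exists B, forall v w m, edge G (v, w, m) -> exists M N,
  [/\ bundle 2 M, hnb x M N, v = pclass M, w = pclass N & (m <= B)%N].
Proof.
have [B hB] := nbrs_bound; exists B => v w m [M [M' [bM bM' mult [-> -> ->]]]].
pose S := [set N | [/\ bundle 2 N, skyscraper_quotient x M N & proj_equiv N M']].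
have [fS cS] := hB M S bM (fun N => ltac:(by case)).
have [N [bN hN NM']] : S !=set0.
  apply/set0P; apply/eqP => S0; apply: mult; rewrite /multiplicity -/S S0.
  by rewrite fset_set0 cardfs0.
exists M, N; split=> //; apply/pclassP => //; apply: pe_sym; exact/proj_equivP.
Qed.

Lemma hecke_edge M N : bundle 2 M -> hnb x M N -> exists m, edge G (pclass M, pclass N, m).
Proof.
move=> bM [bN hN]; exists (multiplicity x M N), M, N; split=> //.
pose S := [set N' | [/\ bundle 2 N', skyscraper_quotient x M N' & proj_equiv N' N]].
have [B hB] := nbrs_bound; have [fS _] := hB M S bM (fun N => ltac:(by case)).
rewrite /multiplicity -/S => /eqP; rewrite cardfs_eq0 => /eqP S0.
have : N \in fset_set S.
  by rewrite in_fset_set // inE; split=> //; apply/proj_equivP => //; exact: pe_refl.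
by rewrite S0 inE.
Qed.

Lemma adj_hnb M N : bundle 2 M -> hnb x M N -> adj G (pclass M) (pclass N).
Proof. by move=> bM hN; have [m h] := hecke_edge bM hN; exists m; left. Qed.

(** An edge is moved to the given representative M by an isomorphism and a twist; an edge arriving
    at M is first reversed by [hnb_sym]. *)
Lemma adj_at M w : bundle 2 M -> adj G (pclass M) w -> exists2 N, hnb x M N & w = pclass N.
Proof.
have [B hB] := hecke_edgeP; move=> bM [m [|] /hB[M1 [N1 [bM1 hN1 E1 E2 _]]]].
  have bN1 : bundle 2 N1 by case: hN1.
  move/pclassP: E1 => /(_ bM bM1)/pe_sym[E [A [dE uA h]]].
  have [N0 hN0 pN] := hnb_pew bM1 hN1 dE uA h; exists N0 => //.
  by rewrite E2; apply/pclassP => //; case: hN0.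
have bN1 : bundle 2 N1 by case: hN1.
have [N' hN' pN'] := hnb_sym bM1 hN1; have bN' : bundle 2 N' by case: hN'.
move/pclassP: E2 => /(_ bM bN1)/pe_sym[E [A [dE uA h]]].
have [N0 hN0 pN] := hnb_pew bN1 hN' dE uA h; exists N0 => //.
by rewrite E1; apply/pclassP => //; [case: hN0|exact: pe_trans pN' pN].
Qed.

Lemma finite_adj v : vert G v -> finite_set (adj G v).
Proof.
move=> /vertP[M bM ->]; have [B hB] := nbrs_bound; have [fS _] := hB M (hnb x M) bM (fun _ => id).
by apply: sub_finite_set (finite_image (@pclass _ X) fS) => w /(adj_at bM)[N hN ->]; exists N.
Qed.

Lemma edge_vert v w m : edge G (v, w, m) -> vert G v /\ vert G w.
Proof. by move=> [M [M' [bM bM' _ [-> -> _]]]]; split; apply/vertP; [exists M|exists M']. Qed.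

Lemma adj_vert v w : adj G v w -> vert G v /\ vert G w.
Proof. by move=> [m [|] /edge_vert[]]. Qed.

Lemma finite_ball S n : finite_set S -> S `<=` vert G ->
  finite_set [set w | exists v m, [/\ S v, (m <= n)%N & walk G m v w]].
Proof.
elim: n S => [|n IH] S fS Sv.
  apply: sub_finite_set fS => w [v [m [vS]]]; rewrite leqn0 => /eqP -> [p [p0 pn _ _]].
  by rewrite /= -pn p0.
pose S' := S `|` \bigcup_(v in S) adj G v.
have fS' : finite_set S'.
  by rewrite finite_setU; split=> //; apply: bigcup_finite => // v /Sv; exact: finite_adj.
apply: sub_finite_set (IH S' fS' _) => [w [v [[|m] [vS mn h]]]|w [/Sv//|[v _ /adj_vert[]//]]].
  by exists v, 0%N; split=> //; left.
have [z [vv az hz]] := walk_consP h; exists z, m; split=> //; right; by exists v.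
Qed.
End HeckeEdges.

(** * Strong approximation and connectivity *)

Section Connect.
Variables (k : finFieldType) (X : curve k) (x : place X).
Local Notation F := (funfield X).
Local Notation place := (place X).
Local Notation G := (hecke_graph x).
Implicit Types (v y : place) (f : F) (D E C : place -> int) (S T : sheaf X 2).

Lemma natmul_fctE D n v : (D *+ n) v = D v *+ n.
Proof. by elim: n => [|n IH]; rewrite ?mulr0n // !mulrS -IH. Qed.

Lemma vert_pclass S : bundle 2 S -> vert G (pclass S).
Proof. by move=> bS; apply/vertP; exists S. Qed.

(** Modulo v, one column of a singular matrix is a multiple of the other. For a sublattice given by
    the rows, this provides a new basis of the big lattice in which all first coordinates are
    divisible by the uniformizer. *)
Lemma singular_column v (a b c d : F) : vge v 0 a -> vge v 0 b -> vge v 0 c -> vge v 0 d ->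
  vge v 1 (a * d - b * c) ->
  (exists s, [/\ vge v 0 s, vge v 1 (a - b * s) & vge v 1 (c - d * s)]) \/
  (exists s, [/\ vge v 0 s, vge v 1 (b - a * s) & vge v 1 (d - c * s)]).
Proof.
move=> ha hb hc hd hdet.
have hdiv z z' n : z' != 0 -> ord v z' = 0 -> vge v n z -> vge v n (z / z').
  by move=> z0 oz hz; rewrite -[n]addr0; apply: vgeM => //; right; rewrite ordV oz.
have v0 : vge v 1 (0 : F) by left.
have [b1|/(vge_unit hb)[b0 ob]] := pselect (vge v 1 b); last first.
  left; exists (a / b); split; [exact: hdiv|by rewrite mulrCA divff // mulr1 subrr|].
  have -> : c - d * (a / b) = - ((a * d - b * c) / b) by field.
  by apply/vgeN; exact: hdiv.
have [a1|/(vge_unit ha)[a0 oa]] := pselect (vge v 1 a); last first.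
  right; exists (b / a); split; [exact: hdiv|by rewrite mulrCA divff // mulr1 subrr|].
  have -> : d - c * (b / a) = (a * d - b * c) / a by field.
  exact: hdiv.
have vM z z' : vge v 1 z -> vge v 0 z' -> vge v 1 (z * z').
  by move=> h h'; rewrite -[1]addr0; exact: vgeM.
have [d1|/(vge_unit hd)[d0 od]] := pselect (vge v 1 d); last first.
  left; exists (c / d); have h := hdiv _ _ _ d0 od hc; split=> //; last by rewrite mulrCA divff // mulr1 subrr.
  by apply: vgeB => //; exact: vM.
have [c1|/(vge_unit hc)[c0 oc]] := pselect (vge v 1 c); last first.
  right; exists (d / c); have h := hdiv _ _ _ c0 oc hd; split=> //; last by rewrite mulrCA divff // mulr1 subrr.
  by apply: vgeB => //; exact: vM.
by left; exists 0; rewrite !mulr0 !subr0; split=> //; left.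
Qed.

(** Induction on the colength of T in S at x: a proper sublattice lies in one of colength one, which
    is a Hecke neighbour of S. *)
Lemma sub_conn m S T : bundle 2 S -> bundle 2 T -> (forall v, v != x -> T v = S v) -> T x `<=` S x ->
  ord_det T x - ord_det S x = m%:Z -> conn G (pclass S) (pclass T).
Proof.
elim: m S => [|m IH] S bS bT eq sub dm.
all: have [B uB EB] := bundle_lattice x bS; have [C uC EC] := bundle_lattice x bT.
all: have Crow i : lattice x B (row i C) by
  rewrite -EB; apply: sub; rewrite EC; exists (delta_mx 0 i); [|by rewrite -rowE];
  move=> j; rewrite mxE regularE; case: (_ && _); [right; rewrite ord_one|left].
all: have [b0 [b1 EBr]] : exists b0 b1, B = rows b0 b1 by do 2!eexists; exact: rowsE.
all: move: (Crow 0) (Crow 1); rewrite EBr => /lattice_rowsP[a [b [ha hb E0]]] /lattice_rowsP[c [d [hc hd E1]]].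
all: have ECK : C = mx2 a b c d *m rows b0 b1 by rewrite [LHS]rowsE E0 E1 rows_mx2.
all: have d0 : \det B != 0 by move: uB; rewrite unitmxE unitfE.
all: have dK : a * d - b * c != 0 by
  move: uC; rewrite ECK unitmx_mul unit_mx2 => /andP[].
all: have oK : ord x (a * d - b * c) = ord_det T x - ord_det S x by
  rewrite (ord_detE uC EC) (ord_detE uB EB) ECK det_mulmx -EBr det_mx2 ordM // addrK.
  have -> : T = S; last by apply: conn_refl; exact: vert_pclass.
  apply/funext => v; have [->|] := eqVneq v x; last exact: eq.
  rewrite EC EB ECK EBr lattice_mulP -?EBr ?det_mx2 ?oK // => i j.
  by rewrite mxE; case: ifP => _; case: ifP.
have hdet : vge x 1 (a * d - b * c) by right; rewrite oK dm; lia.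
have [e [e' [p [q [p' [q' [uR ER [Ec0 Ec1] [hp hq hp' hq']]]]]]]] : exists e e' p q p' q',
    [/\ rows e e' \in unitmx, S x = lattice x (rows e e'),
      row 0 C = p *: e + q *: e' /\ row 1 C = p' *: e + q' *: e' &
      [/\ vge x 1 p, vge x 0 q, vge x 1 p' & vge x 0 q']].
  have v1 : vge x 0 (1 : F) by right; rewrite ord_one.
  have v0 : vge x 0 (0 : F) by left.
  have uB' : rows b0 b1 \in unitmx by rewrite -EBr.
  case: (singular_column ha hb hc hd hdet) => [[s [hs h0 h1]]|[s [hs h0 h1]]].
    exists b0, (s *: b0 + b1), (a - b * s), b, (c - d * s), d.
    have Er : rows b0 (s *: b0 + b1) = mx2 1 0 s 1 *m rows b0 b1 by rewrite -rows_mx2 !scale1r scale0r addr0.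
    have dd : 1 * 1 - 0 * s = 1 :> F by rewrite mul1r mul0r subr0.
    split=> //.
    - by rewrite Er unitmx_mul uB' unit_mx2 dd oner_eq0.
    - rewrite Er lattice_mulP ?det_mx2 ?dd ?oner_eq0 ?ord_one -?EBr // => i j.
      by rewrite mxE; case: ifP => _; case: ifP.
    - by rewrite E0 E1; split; apply/rowP => j; rewrite !mxE; ring.
  exists b1, (b0 + s *: b1), (b - a * s), a, (d - c * s), c.
  have Er : rows b1 (b0 + s *: b1) = mx2 0 1 1 s *m rows b0 b1 by rewrite -rows_mx2 !scale1r scale0r add0r.
  have dd : 0 * s - 1 * 1 = -1 :> F by rewrite mul1r mul0r sub0r.
  split=> //.
  - by rewrite Er unitmx_mul uB' unit_mx2 dd oppr_eq0 oner_eq0.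
  - rewrite Er lattice_mulP ?det_mx2 ?dd ?oppr_eq0 ?oner_eq0 ?ordN ?ord_one -?EBr // => i j.
    by rewrite mxE; case: ifP => _; case: ifP.
  - by rewrite E0 E1; split; apply/rowP => j; rewrite !mxE; ring.
(* The rows of C have first coordinates p, p' divisible by the uniformizer, so S' still contains
   T. *)
pose S' : sheaf X 2 := fun v => if v == x then lattice x (rows (unif x *: e) e') else S v.
have hS' : hnb x S S' by apply: (hnb_make bS uR ER); rewrite /S' ?eqxx // => v /negPf ->.
have bS' : bundle 2 S' by case: hS'.
apply: conn_trans (_ : conn G (pclass S') _).
  by apply: conn_adj (adj_hnb bS hS'); exact: vert_pclass.
apply: IH => // [v vx||]; first by rewrite eq // /S' (negPf vx).
  rewrite EC [C]rowsE => u /lattice_rowsP[s [t [hs ht ->]]].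
  have hr p1 q1 : vge x 1 p1 -> vge x 0 q1 -> S' x (p1 *: e + q1 *: e').
    move=> h1 h2; rewrite /S' eqxx; apply/lattice_rowsP; exists (p1 / unif x), q1; split=> //.
      exact: vge1_div.
    by rewrite scalerA divfK // unif_neq0.
  by rewrite Ec0 Ec1; apply: bundleDv => //; apply: bundleZ => //; exact: hr.
have := congr1 (fun D => D x) (hnb_ddet bS hS').
rewrite -[ddet S' x]/(- ord_det S' x) -[(ddet S - _) x]/(- ord_det S x - (x == x)%:R) eqxx -[1%:R]/(1 : int).
by move: dm; lia.
Qed.

Lemma lattice_incl_ord v (B C : 'M[F]_2) : B \in unitmx -> C \in unitmx ->
  lattice v C `<=` lattice v B -> ord v (\det B) <= ord v (\det C).
Proof.
move=> uB uC sub; have dB : \det B != 0 by move: uB; rewrite unitmxE unitfE.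
have dC : \det C != 0 by move: uC; rewrite unitmxE unitfE.
have hK i j : vge v 0 ((C *m invmx B) i j).
  have /sub[c hc Ec] : lattice v C (row i C).
    exists (delta_mx 0 i); [|by rewrite -rowE].
    by move=> l; rewrite mxE regularE; case: (_ && _); [right; rewrite ord_one|left].
  have : row i C *m invmx B = c by rewrite -Ec mulmxK.
  by rewrite -row_mul => /rowP/(_ j); rewrite mxE => ->; rewrite -regularE; exact: hc.
have := vge_det hK; rewrite det_mulmx det_inv vge_ord ?mulf_neq0 ?invr_neq0 // ordM ?invr_neq0 // ordV.
by rewrite subr_ge0.
Qed.

Lemma entries_bound v (A : 'M[F]_2) : exists n : nat, forall f, vge v n%:Z f -> forall i j, vge v 0 (f * A i j).
Proof.
pose n := (\sum_i \sum_j `|ord v (A i j)|)%N; exists n => f hf i j.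
have le : (`|ord v (A i j)| <= n)%N.
  by rewrite /n (bigD1 i) //= (bigD1 j) //= -!addnA leq_addr.
have -> : 0 = n%:Z + - n%:Z by rewrite subrr.
by apply: vgeM => //; right; lia.
Qed.

(** Twisting T by a large negative multiple of x does not change its class and moves its stalk at x
    into that of S. *)
Lemma differ_conn S T : bundle 2 S -> bundle 2 T -> (forall v, v != x -> T v = S v) ->
  conn G (pclass S) (pclass T).
Proof.
move=> bS bT eq; have [B uB EB] := bundle_lattice x bS; have [C uC EC] := bundle_lattice x bT.
have [n hn] := entries_bound x (C *m invmx B).
pose E := - (Defs.point x *+ n); have dE : divisor X E by apply/divisorN/divisorMn/divisor_point.
have Ev v : E v = - ((v == x)%:R *+ n) by rewrite /E -[LHS]/(- ((Defs.point x *+ n) v)) natmul_fctE.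
pose T' : sheaf X 2 := fun v => [set u | T v (unif v ^ E v *: u)].
have hT : pew E 1%:M T T'.
  move=> v u; rewrite /T' /= mulmx1 scalerA -expfzDr ?unif_neq0 //.
  by rewrite addrN expr0z scale1r.
have bT' := pew_bundle dE (unitmx1 _ 2) hT bT.
have -> : pclass T = pclass T' by apply/pclassP => //; exists E, 1%:M; split; [|exact: unitmx1|].
have EC' := latticeZ_pew (unitmx1 _ 2) hT EC; rewrite mulmx1 Ev eqxx opprK in EC'.
have uz : unif x ^ (1%:R *+ n : int) \is a GRing.unit by rewrite unitfE unifz_neq0.
have sub : T' x `<=` S x.
  rewrite EC' EB; apply: lattice_sub => // i j; rewrite regularE -scalemxAl mxE; apply: hn.
  by right; rewrite ord_unifz -mulr_natl mulr1 natz.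
apply: (@sub_conn `|ord_det T' x - ord_det S x|%N) => // [v vx|].
  by rewrite -eq // /T'; apply/funext => u /=; rewrite Ev (negPf vx) mul0rn oppr0 expr0z scale1r.
rewrite (ord_detE uB EB) (ord_detE _ EC') ?unitmxZ //.
have := @lattice_incl_ord x B (unif x ^ (1%:R *+ n : int) *: C) uB; rewrite unitmxZ // => /(_ uC).
by rewrite -EB -EC' => /(_ sub) h; rewrite gez0_abs ?subr_ge0.
Qed.

(** In adelic terms, the inverse of A acts on S at y only. *)
Definition locmod S y (A : 'M[F]_2) : sheaf X 2 := fun v => if v == y then [set u | S y (u *m A)] else S v.

Lemma locmod_bundle S y A : A \in unitmx -> bundle 2 S -> bundle 2 (locmod S y A).
Proof.
move=> uA /bundleP[hS fS]; apply/bundleP; split=> [v|].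
  rewrite /locmod; case: eqVneq => [->|_]; last exact: hS.
  have [B uB EB] := hS y; exists (B *m invmx A); first by rewrite unitmx_mul uB unitmx_inv.
  apply/seteqP; split=> u /=; rewrite EB => -[c hc Ec]; exists c => //.
    by rewrite mulmxA Ec mulmxK.
  by rewrite -Ec mulmxA mulmxKV.
apply: (@sub_finite_set _ _ ([set v | S v <> lattice v 1%:M] `|` [set y])); last by rewrite finite_setU.
by move=> v /=; rewrite /locmod; case: eqVneq => [->|_]; [right|left].
Qed.

Lemma approx_at y C (a : F) : divisor X C -> y != x ->
  exists f, forall v, v != x -> vge v (C v) ((if v == y then a else 0) - f).
Proof.
(* With this n the degree of D is larger than 2g, so [hdim_vanish] applies; the price is a pole at
   x. *)
move=> dC yx; pose n := absz (2 * (genus X)%:Z + div_deg C + 1).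
pose D := - C + Defs.point x *+ n.
have dx := divisorMn n (divisor_point x); have dD : divisor X D by apply: divisorD => //; exact: divisorN.
have [f hf] : exists f, forall v, vge v (- D v) ((if v == y then a else 0) - f).
  apply: (strong_approx dD) => [|].
    apply: hdim_vanish => //; rewrite div_degD ?div_degN ?div_pointMn //; last exact: divisorN.
    by have := pdeg_gt0 x; have := ldim0_gt0 X; rewrite /n; nia.
  apply: (@sub_finite_set _ _ [set y]) => // v /=; case: eqVneq => [->//|_].
  by rewrite /regular /= Defs.ord0.
exists f => v vx; have := hf v; rewrite /D -[(- C + _) v]/(- C v + (Defs.point x *+ n) v).
by rewrite natmul_fctE /Defs.point (negPf vx) mul0rn addr0 opprK.
Qed.

Lemma small_multiples S (E : 'M[F]_2) : bundle 2 S -> exists2 C, divisor X C &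
  forall v f, vge v (C v) f -> forall u, S v u -> S v (u *m (f *: E)).
Proof.
move=> /bundleP[hS fS]; pose P v (n : nat) := forall f, vge v n%:Z f -> forall u, S v u -> S v (u *m (f *: E)).
have ent v B n : B \in unitmx -> S v = lattice v B ->
    (forall f, vge v n%:Z f -> forall i j, vge v 0 (f * (B *m E *m invmx B) i j)) -> P v n.
  move=> uB EB h f hf; apply/(bend_entries _ uB EB) => i j.
  by rewrite -scalemxAr -scalemxAl mxE; exact: h.
(* The exponent 0 is taken wherever it is admissible, so that C has finite support. *)
have /choice[C hC] : forall v, exists n : nat, P v n /\ (P v 0%N -> n = 0%N).
  move=> v; have [p0|np0] := pselect (P v 0%N); first by exists 0%N.
  have [B uB EB] := hS v; have [n hn] := entries_bound v (B *m E *m invmx B).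
  by exists n; split=> //; exact: ent hn.
exists (fun v => (C v)%:Z) => [|v]; last by case: (hC v).
apply: (@sub_finite_set _ _ ([set v | S v <> lattice v 1%:M] `|`
    \bigcup_(i in [set: 'I_2 * 'I_2]) [set v | ~ regular v (E i.1 i.2)])); last first.
  by rewrite finite_setU; split=> //; apply: bigcup_finite => // i _; exact: finite_nonregular.
move=> v /= /eqP Cv; apply: contrapT => /not_orP[/contrapT S1 hE]; apply: Cv; case: (hC v) => _ -> //.
apply: (ent v 1%:M) => //; first exact: unitmx1.
move=> f hf i j; rewrite invmx1 mulmx1 mul1mx -[0]addr0; apply: vgeM => //.
by rewrite -regularE; apply: contrapT => nr; apply: hE; exists (i, j).
Qed.

(** Since E^2 = 0, the map s -> 1 + s E is additive. Choose a global f close to a at y and close to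
    0 at all other places except x. Then 1 + f E is an automorphism of the generic stalk that
    reproduces the modification at y and preserves S elsewhere off x, and [differ_conn] deals with
    x. *)
Lemma elementary_conn S y (E : 'M[F]_2) (a : F) : bundle 2 S -> y != x -> E *m E = 0 ->
  conn G (pclass S) (pclass (locmod S y (1%:M + a *: E))).
Proof.
move=> bS yx E2; have [C dC hC] := small_multiples E bS.
have mE (s t : F) : (1%:M + s *: E) *m (1%:M + t *: E) = 1%:M + (s + t) *: E.
  rewrite mulmxDl !mulmxDr mulmx1 !mul1mx -!scalemxAl -!scalemxAr E2 !scaler0 addr0 scalerDl mulmx1.
  by rewrite -addrA [t *: E + _]addrC.
have uE (s : F) : 1%:M + s *: E \in unitmx.
  suff /mulmx1_unit[] : (1%:M + s *: E) *m (1%:M + (- s) *: E) = 1%:M by [].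
  by rewrite mE addrN scale0r addr0.
have [f hf] := approx_at a dC yx.
have pres v (s : F) u : vge v (C v) s -> S v u <-> S v (u *m (1%:M + s *: E)).
  have p1 z (t : F) : vge v (C v) t -> S v z -> S v (z *m (1%:M + t *: E)).
    by move=> ht hz; rewrite mulmxDr mulmx1; apply: bundleDv => //; exact: hC.
  move=> hs; split; first exact: p1.
  move=> /(p1 _ (- s)); rewrite -mulmxA mE addrN scale0r addr0 mulmx1; apply.
  by apply/vgeN.
pose S' : sheaf X 2 := fun v => [set u | S v (u *m (1%:M + f *: E))].
have pS : pew 0 (1%:M + (- f) *: E) S S'.
  by move=> v u; rewrite /S' /= oppr0 expr0z scale1r -mulmxA mE addNr scale0r addr0 mulmx1.
have bS' := pew_bundle (divisor0 X) (uE (- f)) pS bS.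
have -> : pclass S = pclass S'.
  by apply/pclassP => //; exists 0, (1%:M + (- f) *: E); split=> //; exact: divisor0.
apply: differ_conn => //; first exact: locmod_bundle.
move=> v vx; have := hf v vx; rewrite /locmod; case: eqVneq => [->|_] hv; apply/funext => u; apply/propext.
  by rewrite /S' /= (pres y (a - f) (u *m (1%:M + f *: E)) hv) -mulmxA mE [f + _]addrC subrK.
by rewrite /S' /= -(pres v f) //; apply/vgeN; rewrite -sub0r.
Qed.

Lemma cvert_adj D : divisor X D -> adj G (cvert D) (cvert (D + Defs.point x)).
Proof.
move=> dD; have d0 := divisor0 X; have dx := divisor_point x.
rewrite cvertE; have -> : cvert (D + Defs.point x) = pclass (Ext D (0 - Defs.point x) 0).
  by rewrite Ext_cvert ?opprB ?subr0 //; exact: divisorB.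
apply: adj_hnb; first exact: bundle_c.
apply: hnb_Ext2 => //; exact: adele0.
Qed.

Lemma cvert_step D : divisor X D -> conn G (cvert D) (cvert (D + Defs.point x)).
Proof. by move=> dD; have a := cvert_adj dD; have [v1 v2] := adj_vert a; exact: conn_adj. Qed.

Lemma cvert_xconn D (n : int) : divisor X D -> conn G (cvert D) (cvert (D + Defs.point x *~ n)).
Proof.
move=> dD; have dx := divisor_point x.
have pos D' (m : nat) : divisor X D' -> conn G (cvert D') (cvert (D' + Defs.point x *+ m)).
  move=> dD'; elim: m => [|m IH].
    by rewrite mulr0n addr0; apply: conn_refl; rewrite cvertE; apply: vert_pclass; exact: bundle_c.
  rewrite mulrS [Defs.point x + _]addrC addrA; apply: conn_trans IH _.
  by apply: cvert_step; apply: divisorD => //; exact: divisorMn.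
case: n => n; first exact: pos.
apply: conn_sym; have d1 : divisor X (D + Defs.point x *~ Negz n) by apply: divisorD => //; exact: divisorMz.
by have := pos _ n.+1 d1; rewrite NegzE mulrNz -pmulrn subrK.
Qed.

(* Whitehead's lemma: diag(t, 1/t) is a product of elementary matrices, and each of them can
   be approximated by a global one with poles at x only. *)
Lemma cvert_double D y : divisor X D -> conn G (cvert D) (cvert (D + Defs.point y *+ 2)).
Proof.
move=> dD; have [->|yx] := eqVneq y x; first exact: (@cvert_xconn D 2 dD).
have dy := divisor_point y; have d0 := divisor0 X; pose t := unif y; have t0 : t != 0 by exact: unif_neq0.
pose E12 : 'M[F]_2 := mx2 0 1 0 0; pose E21 : 'M[F]_2 := mx2 0 0 1 0.
have sq12 : E12 *m E12 = 0 by rewrite mx2_mul [RHS]mx2E !mxE; congr mx2; ring.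
have sq21 : E21 *m E21 = 0 by rewrite mx2_mul [RHS]mx2E !mxE; congr mx2; ring.
have e12 a : 1%:M + a *: E12 = mx2 1 a 0 1.
  by rewrite mx2_1 [LHS]mx2E !mxE /=; congr mx2; ring.
have e21 a : 1%:M + a *: E21 = mx2 1 0 a 1.
  by rewrite mx2_1 [LHS]mx2E !mxE /=; congr mx2; ring.
have u12 a : 1%:M + a *: E12 \in unitmx by rewrite e12 unit_mx2 mulr1 mulr0 subr0 oner_eq0.
have u21 a : 1%:M + a *: E21 \in unitmx by rewrite e21 unit_mx2 mulr1 mul0r subr0 oner_eq0.
have comp S A B : locmod (locmod S y A) y B = locmod S y (B *m A).
  by apply/funext => v; rewrite /locmod; case: eqVneq => [_|//]; rewrite eqxx; apply/funext => u /=; rewrite mulmxA.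
have b0 := bundle_c dD.
(* With w(s) = e12(s) e21(-1/s) e12(s), the six factors make up w(t) w(-1) = diag(t, 1/t). *)
have b1 := locmod_bundle y (u12 (-1)) b0; have c1 := elementary_conn (-1) b0 yx sq12.
have b2 := locmod_bundle y (u21 1) b1; have c2 := elementary_conn 1 b1 yx sq21.
have b3 := locmod_bundle y (u12 (-1)) b2; have c3 := elementary_conn (-1) b2 yx sq12.
have b4 := locmod_bundle y (u12 t) b3; have c4 := elementary_conn t b3 yx sq12.
have b5 := locmod_bundle y (u21 (- t^-1)) b4; have c5 := elementary_conn (- t^-1) b4 yx sq21.
have c6 := elementary_conn t b5 yx sq12.
have := conn_trans (conn_trans (conn_trans c1 c2) (conn_trans c3 c4)) (conn_trans c5 c6).
rewrite cvertE !comp !e12 !e21 !mx2_mul.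
have -> : cvert (D + Defs.point y *+ 2) = pclass (Ext (D + Defs.point y) (0 - Defs.point y) 0).
  rewrite Ext_cvert //; [|exact: divisorD|exact: divisorB].
  by congr cvert; rewrite sub0r opprK mulr2n addrA.
congr (conn _ _ (pclass _)); apply/funext => v; rewrite /locmod; case: eqVneq => [->|vy]; last first.
  by rewrite /Ext -[(D + _) v]/(D v + (v == y)%:R) -[(0 - _) v]/(0 - (v == y)%:R) (negPf vy) addr0 subr0.
apply/funext => u; apply/propext; rewrite [u]vecE.
set h := mx2 _ _ _ _; have -> : h = mx2 t 0 0 t^-1 by rewrite /h; congr mx2; field.
rewrite /= vec_mul !mulr0 addr0 add0r !ExtzE ![_ * t]mulrC ![_ * t^-1]mulrC !vgeMl ?invr_neq0 // ordV.
rewrite -[(D + _) y]/(D y + (y == y)%:R) -[(0 - _) y]/(0 - (y == y)%:R) eqxx /t ord_unif.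
by rewrite -[(0 : place -> int) y]/(0 : int) -[1%:R]/(1 : int) opprD oppr0 !sub0r.
Qed.

Lemma cvert_conn D E f (n : int) : divisor X D -> divisor X E -> f != 0 ->
  conn G (cvert D) (cvert (D + E *+ 2 + principal f + Defs.point x *~ n)).
Proof.
move=> dD dE f0; have dbl D' : divisor X D' -> conn G (cvert D') (cvert (D' + E *+ 2)).
  move: E dE D'; apply: div_ind => [D' dD'|E y dE IH D' dD'|E y dE IH D' dD'].
  - by rewrite mul0rn addr0; apply: conn_refl; rewrite cvertE; apply: vert_pclass; exact: bundle_c.
  - rewrite mulrnDl addrA; apply: conn_trans (IH _ dD') _; apply: cvert_double.
    by apply: divisorD => //; exact: divisorMn.
  - have d2 := divisorB dD' (divisorMn 2 (divisor_point y)).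
    rewrite mulrnBl addrA addrAC; apply: conn_trans (IH _ d2); apply: conn_sym.
    by have := cvert_double y d2; rewrite subrK.
have d2 := divisorD dD (divisorMn 2 dE).
apply: conn_trans (dbl _ dD) _; rewrite -(cvert_equiv d2 f0); apply: cvert_xconn.
by apply: divisorD => //; exact: divisor_principal.
Qed.
End Connect.

(** * Nucleus and cusps *)

(** Both images are the quotient of A by the same equivalence relation. *)
Lemma card_image_eq (T : choiceType) (U V : Type) (A : set T) (f : T -> U) (g : T -> V) (t0 : T) :
  (forall a b, A a -> A b -> f a = f b <-> g a = g b) -> (f @` A #= g @` A)%card.
Proof.
move=> h; pose s u := xget t0 [set a | A a /\ f a = u].
have hs a : A a -> A (s (f a)) /\ f (s (f a)) = f a.
  by move=> Aa; rewrite /s; case: xgetP => [b -> []//|/(_ a)[]].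
have -> : g @` A = (g \o s) @` (f @` A).
  apply/seteqP; split=> v.
    by move=> [a Aa <-]; exists (f a); [exists a|have [? ?] := hs a Aa; apply/h].
  by move=> [_ [a Aa <-] <-]; exists (s (f a)) => //; case: (hs a Aa).
apply/card_esym/inj_card_eq => _ _ /[!inE] -[a Aa <-] [b Ab <-] /= E.
have [sa ea] := hs a Aa; have [sb eb] := hs b Ab; rewrite -ea -eb; exact/h.
Qed.

Lemma cardfs_prod (T U : choiceType) (A : {fset T}) (B : {fset U}) :
  #|` (A `*` B)%fset| = (#|` A| * #|` B|)%N.
Proof.
rewrite -(size_allpairs pair); apply/perm_size/uniq_perm; first exact: fset_uniq.
  by apply: allpairs_uniq => [||[? ?] [? ?] _ _ []->->//]; exact: fset_uniq.
move=> [a b]; rewrite in_fsetM /=; apply/andP/allpairsP => [[ha hb]|[[a' b'] [/= ha hb [-> ->]]]//].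
by exists (a, b).
Qed.

Section Cusps.
Variables (k : finFieldType) (X : curve k) (Y : geometric_fibre X) (x : place X).
Local Notation F := (funfield X).
Local Notation place := (place X).
Local Notation G := (hecke_graph x).
Local Notation N := (nucleus x).
Local Notation d := ((pdeg x)%:Z).
Local Notation m := (mX X).
Local Notation pt := (Defs.point x).
Implicit Types (f : F) (D E : place -> int) (M : sheaf X 2) (C : set (place -> int)).

Lemma mX_ge : 0 <= m /\ 2 * (genus X)%:Z - 2 <= m.
Proof. by rewrite /mX; split; lia. Qed.

Lemma pdegx_gt0 : 0 < d. Proof. by rewrite ltz_nat pdeg_gt0. Qed.

Lemma divisor_pt : divisor X pt. Proof. exact: divisor_point. Qed.
Lemma divisor_ptn (n : int) : divisor X (pt *~ n). Proof. exact/divisorMz/divisor_pt. Qed.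

Lemma deg_ptn D (n : int) : divisor X D -> div_deg (D + pt *~ n) = div_deg D + d * n.
Proof. by move=> dD; rewrite div_degD ?div_degMz ?div_deg_point //; [exact: divisor_pt|exact: divisor_ptn]. Qed.

Lemma hdim_mX D : divisor X D -> m < div_deg D -> hdim D = 0%N.
Proof. by move=> dD h; apply: hdim_vanish => //; rewrite (ldim0 Y); have := mX_ge; lia. Qed.

(** If O(D) is the subbundle through e, the quotient has divisor [ddet M] - D up to linear
    equivalence. So the vertex can be read off from D and the determinant alone. *)
Lemma split_vec M e D : bundle 2 M -> e != 0 -> has_div M e D ->
  m < div_deg (D *+ 2 - ddet M) -> pclass M = cvert (D *+ 2 - ddet M).
Proof.
move=> bM e0 hD hd; have [A [D1 [D' [r [[uA eA dD1 dD' Ar] h]]]]] := norm_ext bM e0.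
have ED : D = D1.
  apply: has_div_uniq (@has_div_Ext _ X D1 D' r); rewrite -[D]addr0 -eA; exact: has_div_pew h hD.
rewrite {D hD}ED in hd *.
have dA : \det A != 0 by move: uA; rewrite unitmxE unitfE.
have := ddet_pew bM uA h; rewrite ddet_Ext mul0rn addr0 => Edet.
have dp := divisor_principal dA; have dM := divisor_ddet bM; have d2 := divisorMn 2 dD1.
have ED : D1 - D' = (D1 *+ 2 - ddet M) + principal (\det A).
  have -> : D' = ddet M - principal (\det A) - D1 by rewrite -Edet addrC addKr.
  by rewrite mulr2n !opprB; apply/funext => v; rewrite !fctE; lia.
have dDD := divisorB dD1 dD'.
rewrite -(cvert_equiv (divisorB d2 dM) dA) -ED -Ext_cvert //; apply/pclassP => //; first exact: Extz_bundle.
apply: pe_trans (_ : pe (Ext D1 D' r) _); first by exists 0, A; split=> //; exact: divisor0.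
apply: Ext_split => //; apply: hdim_mX => //.
by rewrite ED div_degD ?div_deg_principal ?addr0 //; exact: divisorB.
Qed.

Lemma adj_cvert D w : divisor X D -> m + d < div_deg D -> adj G (cvert D) w ->
  w = cvert (D + pt) \/ w = cvert (D - pt).
Proof.
move=> dD hd; rewrite cvertE => /(adj_at (bundle_c dD))[M hM ->]; have [bM _] := hM.
have e10 : vec 1 0 != 0 :> 'rV[F]_2 by rewrite vec_eq0 oner_eq0.
have [D1 dD1 hD1] := has_div_ex bM e10.
have Edet : ddet M = D - pt by rewrite (hnb_ddet (bundle_c dD) hM) ddet_Ext addr0.
have dpt := divisor_pt; have d0 := pdegx_gt0.
case: (hnb_div (bundle_c dD) hM (@has_div_Ext _ X D 0 0) hD1) => ED1; [left|right].
  have E : D1 *+ 2 - ddet M = D + pt.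
    by rewrite Edet ED1 mulr2n; apply/funext => v; rewrite !fctE; lia.
  by rewrite (split_vec bM e10 hD1) E // div_degD // div_deg_point; lia.
have E : D1 *+ 2 - ddet M = D - pt.
  by rewrite Edet ED1 mulr2n; apply/funext => v; rewrite !fctE; lia.
by rewrite (split_vec bM e10 hD1) E // div_degB // div_deg_point; lia.
Qed.

Lemma vert_c D : divisor X D -> vert G (cvert D).
Proof. by move=> dD; rewrite cvertE; apply: vert_pclass; exact: bundle_c. Qed.

Lemma nucP M : bundle 2 M -> vert N (pclass M) <-> delta M <= m + d.
Proof.
move=> bM; split=> [[_ [M' [bM' dM'] /esym/pclassP h]]|h].
  by rewrite (delta_pe bM (h bM bM')).
by split; [exact: vert_pclass|exists M].
Qed.

Lemma nuc_c D : divisor X D -> 0 <= div_deg D -> vert N (cvert D) <-> div_deg D <= m + d.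
Proof. by move=> dD D0; rewrite cvertE (nucP (bundle_c dD)) delta_c // ger0_norm. Qed.

Lemma cuspP C v : vert (cusp x C) v <-> exists D, [/\ divisor X D, C D, m < div_deg D & v = cvert D].
Proof.
split=> [[_ [D [dD CD hD] <-]]|[D [dD CD hD ->]]]; first by exists D.
by split; [exact: vert_c|exists D].
Qed.

Lemma not_nuc v : vert G v -> ~ vert N v -> exists D, [/\ divisor X D, m + d < div_deg D & v = cvert D].
Proof.
move=> /vertP[M bM ->] /(nucP bM)/negP; rewrite -ltNge => hd; have := mX_ge; have := pdegx_gt0 => d0 mg.
have [|D [dD E dE]] := large_delta bM (ldim0 Y); first by lia.
by exists D; rewrite dE.
Qed.

Lemma xclass_refl D : xclass x D D.
Proof. by exists 1, 0; rewrite oner_neq0 principal1 mulr0z !addr0. Qed.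

Lemma xclass_eq D D' : xclass x D D' -> xclass x D' = xclass x D.
Proof.
move=> [f [n [f0 ->]]]; apply/seteqP; split=> E [h [j [h0 ->]]].
  exists (f * h), (n + j); split; first exact: mulf_neq0.
  by rewrite principalM // mulrzDr; apply/funext => v; rewrite !fctE; lia.
exists (f^-1 * h), (j - n); split; first by rewrite mulf_neq0 ?invr_neq0.
rewrite principalM ?invr_neq0 // principalV mulrzBr.
by apply/funext => v; rewrite !fctE; lia.
Qed.

Lemma ClO_xclass C D : ClO x C -> C D -> C = xclass x D.
Proof. by move=> [D0 dD0 <-] /xclass_eq. Qed.

Lemma ClO_divisor C D : ClO x C -> C D -> divisor X D.
Proof.
move=> [D0 dD0 <-] [f [n [f0 ->]]]; apply: divisorD; last exact: divisor_ptn.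
by apply: divisorD => //; exact: divisor_principal.
Qed.

Lemma window_n (a : int) : exists n : int, m < a + d * n <= m + d.
Proof.
exists ((m + d - a) %/ d)%Z; have d0 := pdegx_gt0.
have := divz_eq (m + d - a) d; have := @modz_ge0 (m + d - a) d; have := @ltz_pmod (m + d - a) d.
by move=> /(_ d0) h1 /(_ (lt0r_neq0 d0)) h2 h3; apply/andP; split; lia.
Qed.

Lemma window C : ClO x C -> exists D, [/\ divisor X D, C = xclass x D & m < div_deg D <= m + d].
Proof.
move=> hC; have [D0 dD0 E] := hC; have [n hn] := window_n (div_deg D0).
have dD : divisor X (D0 + pt *~ n) by apply: divisorD => //; exact: divisor_ptn.
exists (D0 + pt *~ n); split=> //; last by rewrite deg_ptn.
by rewrite -E; apply/esym/xclass_eq; exists 1, n; rewrite oner_neq0 principal1 addr0.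
Qed.

Lemma cusp_cvert C D D' : ClO x C -> C D -> C D' -> m < div_deg D -> m < div_deg D' ->
  div_deg D = div_deg D' -> cvert D = cvert D'.
Proof.
move=> hC hD; rewrite {1}(ClO_xclass hC hD) => -[f [n [f0 E]]] _ _.
have dD := ClO_divisor hC hD; have df := divisor_principal f0.
rewrite E deg_ptn; last exact: divisorD.
rewrite div_degD // div_deg_principal // addr0 => h; have d0 := pdegx_gt0.
have -> : n = 0 by nia.
by rewrite mulr0z addr0 cvert_equiv.
Qed.

Lemma cusp_disjoint C C' v : ClO x C -> ClO x C' -> vert (cusp x C) v -> vert (cusp x C') v -> C = C'.
Proof.
move=> hC hC' /cuspP[D [dD CD gD ->]] /cuspP[D' [dD' CD' gD' E]]; have := mX_ge => mg.
have [||f f0 ED] := cvert_inj dD dD' _ _ E; try by lia.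
rewrite (ClO_xclass hC CD) (ClO_xclass hC' CD'); apply/esym/xclass_eq; exists f, 0; by rewrite mulr0z addr0.
Qed.

Lemma vert_decomposition : vert G = vert N `|` \bigcup_(C in ClO x) vert (cusp x C).
Proof.
apply/seteqP; split=> v; last by case=> [[]//|[C _ []]].
move=> gv; have [nv|nv] := pselect (vert N v); [by left|right].
have [D [dD hD ->]] := not_nuc gv nv; have d0 := pdegx_gt0.
by exists (xclass x D); [exists D|apply/cuspP; exists D; split=> //; [exact: xclass_refl|lia]].
Qed.

(** An edge not inside the nucleus has an end c_D with deg D > m + d, and both possible neighbours
    of c_D lie in the cusp of D. *)
Lemma far_edge v w mm : edge G (v, w, mm) -> ~ (vert N v /\ vert N w) ->
  exists2 C, ClO x C & vert (cusp x C) v /\ vert (cusp x C) w.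
Proof.
move=> e; have [gv gw] := edge_vert e; have d0 := pdegx_gt0.
have key u z : vert G u -> ~ vert N u -> adj G u z -> exists2 C, ClO x C & vert (cusp x C) u /\ vert (cusp x C) z.
  move=> gu nu; have [D [dD hD ->]] := not_nuc gu nu => az; exists (xclass x D); first by exists D.
  have in_c (n : int) : m < div_deg D + d * n -> vert (cusp x (xclass x D)) (cvert (D + pt *~ n)).
    move=> h; apply/cuspP; exists (D + pt *~ n); split=> //; last by rewrite deg_ptn.
      by apply: divisorD => //; exact: divisor_ptn.
    by exists 1, n; rewrite oner_neq0 principal1 addr0.
  split; first by have := in_c 0; rewrite mulr0z addr0; apply; lia.
  case: (adj_cvert dD hD az) => ->; first by have := in_c 1; rewrite mulr1z; apply; lia.
  by have := in_c (-1); rewrite mulrN1z; apply; lia.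
move=> /not_andP[nv|nw].
  by apply: key => //; exists mm; left.
have [|C hC [h1 h2]] := key w v gw nw; first by exists mm; right.
by exists C.
Qed.

Lemma edge_decomposition : edge G = edge N `|` \bigcup_(C in ClO x) edge (cusp x C).
Proof.
apply/seteqP; split=> -[[v w] mm]; last by case=> [[]//|[C _ []]].
move=> e; have [nvw|nvw] := pselect (vert N v /\ vert N w).
  by left; split=> //=; case: nvw => -[_ ?] [_ ?].
by right; have [C hC [[_ h1] [_ h2]]] := far_edge e nvw; exists C.
Qed.

Lemma nuc_cusp D : divisor X D -> m < div_deg D <= m + d ->
  vert N `&` vert (cusp x (xclass x D)) = [set cvert D].
Proof.
move=> dD /andP[h1 h2]; have := mX_ge => mg; have d0 := pdegx_gt0.
have hC : ClO x (xclass x D) by exists D.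
apply/seteqP; split=> v.
  move=> [nv /cuspP[D' [dD' CD' h3 E]]]; rewrite E /=.
  have h4 : div_deg D' <= m + d by apply/(nuc_c dD'); [lia|rewrite -E].
  apply: (@cusp_cvert (xclass x D)) => //; first exact: xclass_refl.
  have [f [n [f0 ED]]] := CD'; have df := divisor_principal f0.
  move: h3 h4; rewrite ED deg_ptn; last exact: divisorD.
  rewrite div_degD // div_deg_principal // addr0 => h3 h4.
  have n0 : n = 0 by nia.
  by rewrite n0 mulr0 addr0.
move=> -> /=; split; first by apply/nuc_c => //; lia.
by apply/cuspP; exists D; split=> //; exact: xclass_refl.
Qed.

Lemma cvert_dec C : vert (cusp x C) `<=` PBun2_dec X.
Proof.
move=> v /cuspP[D [dD _ _ ->]]; rewrite cvertE; exists (Ext D 0 0) => //; split; first exact: bundle_c.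
apply/decomposableP; exists 1%:M, D, 0; split=> //; [exact: unitmx1|exact: divisor0|exact: pew_refl].
Qed.

Lemma dec_delta : PBun2_dec X `<=` PBun2_where (fun M => 0 <= delta M).
Proof.
move=> _ [M [bM /decomposableP[A [D [D' [uA dD dD' h]]]]] <-]; exists M => //; split=> //.
have pM : pe (Ext D D' 0) M by exists 0, A; split=> //; exact: divisor0.
by rewrite -(delta_pe (Extz_bundle dD dD') pM) delta_split // normr_ge0.
Qed.

Lemma gi_delta : PBun2_gi X `<=` PBun2_where (fun M => delta M <= 2 * (genus X)%:Z - 2).
Proof.
move=> _ [M [bM gi] <-]; exists M => //; split=> //; rewrite leNgt; apply/negP => hd.
have [D [dD E _]] := large_delta bM (ldim0 Y) hd; apply: (gi Y); apply: decomposable_pullback.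
move: E; rewrite cvertE => /pclassP-/(_ bM (bundle_c dD)) h; apply: decomposable_pe h _.
apply/decomposableP; exists 1%:M, D, 0; split=> //; [exact: unitmx1|exact: divisor0|exact: pew_refl].
Qed.

Lemma tr_delta_even : PBun2_tr X `<=` PBun2_where (fun M => delta M < 0 /\ (2 %| delta M)%Z).
Proof.
move=> _ [M [bM [nd /existsNP[Y' /contrapT dY]]] <-]; exists M => //; split=> //.
exact: (tr_delta bM nd dY).
Qed.

(** * Number of cusps, finiteness and components *)

Section Counting.
Variables (D1 : place -> int) (dD1 : divisor X D1) (deg1 : div_deg D1 = 1).

Definition crep (c : set (place -> int)) : place -> int := xget 0 [set D | [/\ divisor X D, div_deg D = 0 & c = lin_class D]].

Lemma crepP c : Cl0 (X := X) c -> [/\ divisor X (crep c), div_deg (crep c) = 0 & c = lin_class (crep c)].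
Proof.
move=> [D [dD D0] <-]; rewrite /crep; case: xgetP => [_ -> //|/(_ D)]; by case.
Qed.

Lemma deg_shift D (n : int) : divisor X D -> div_deg (D + D1 *~ n) = div_deg D + n.
Proof. by move=> dD; rewrite div_degD ?div_degMz ?deg1 ?mul1r //; exact: divisorMz. Qed.

Lemma crep_ex D (n : int) : divisor X D -> div_deg D = n ->
  exists c f, [/\ Cl0 (X := X) c, f != 0 & crep c + D1 *~ n = D + principal f].
Proof.
move=> dD dn; have dE : divisor X (D - D1 *~ n) by apply: divisorB => //; exact: divisorMz.
have E0 : div_deg (D - D1 *~ n) = 0 by rewrite -mulrNz deg_shift // dn subrr.
have hc : Cl0 (X := X) (lin_class (D - D1 *~ n)) by exists (D - D1 *~ n).
have [dr r0 /lin_classP[f f0 Ef]] := crepP hc; exists (lin_class (D - D1 *~ n)), f; split=> //.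
by rewrite Ef addrAC subrK.
Qed.

(** The divisor D1 splits the degree map, so a class modulo x is given by a class of degree 0 and a
    degree modulo deg x. A cusp determines its class, because a vertex c_D of positive degree
    determines D up to linear equivalence. *)
Lemma card_cusps : (cusps x #= `I_(class_number X * pdeg x)%N)%card.
Proof.
pose S := Cl0 (X := X) `*` `I_(pdeg x).
pose phi (p : set (place -> int) * nat) := xclass x (crep p.1 + D1 *~ p.2%:Z).
have dphi p : S p -> divisor X (crep p.1 + D1 *~ p.2%:Z).
  by move=> [/crepP[dr _ _] _]; apply: divisorD => //; exact: divisorMz.
have ES : cusps x = (fun p => cusp x (phi p)) @` S.
  apply/seteqP; split=> z; last by move=> [p Sp <-]; exists (phi p) => //; exists (crep p.1 + D1 *~ p.2%:Z) => //; exact: dphi.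
  move=> [C [D dD <-] <-]; have d0 := pdegx_gt0.
  pose n := (div_deg D %/ d)%Z; pose j := absz (div_deg D %% d)%Z.
  have Ej : j%:Z = (div_deg D %% d)%Z by rewrite gez0_abs // modz_ge0 // lt0r_neq0.
  have dE : divisor X (D + pt *~ (- n)) by apply: divisorD => //; exact: divisor_ptn.
  have degE : div_deg (D + pt *~ (- n)) = j%:Z.
    by rewrite deg_ptn // Ej; have := divz_eq (div_deg D) d; rewrite -/n; lia.
  have [c [f [hc f0 Ec]]] := crep_ex dE degE; exists (c, j); first split=> //=.
    by rewrite -ltz_nat Ej ltz_pmod.
  congr cusp; apply: xclass_eq; exists f, (- n); split=> //=.
  by rewrite Ec addrAC.
have inj : {in S &, injective (fun p => cusp x (phi p))}.
  move=> [c j] [c' j'] /[!inE] hS hS' /(congr1 (@vert _)) E.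
  have hC p : S p -> ClO x (phi p) by move=> hp; exists (crep p.1 + D1 *~ p.2%:Z) => //; exact: dphi.
  have Ephi : phi (c, j) = phi (c', j').
    have [D [dD ED hD]] := window (hC _ hS); have dc := dphi _ hS.
    apply: (@cusp_disjoint _ _ (cvert D)); [exact: hC|exact: hC| |rewrite -E];
    by apply/cuspP; exists D; split=> //; [rewrite ED; exact: xclass_refl|lia].
  have : phi (c', j') (crep c + D1 *~ j%:Z) by rewrite -Ephi; exact: xclass_refl.
  move=> [f [n [f0 /= Ef]]]; case: hS hS' => /= hc hj [/= hc' hj'].
  have [dr r0 Ec] := crepP hc; have [dr' r0' Ec'] := crepP hc'; have df := divisor_principal f0.
  have dd' : divisor X (crep c' + D1 *~ j'%:Z) by apply: divisorD => //; exact: divisorMz.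
  have := congr1 (@div_deg _ X) Ef; rewrite deg_shift // r0 deg_ptn; last exact: divisorD.
  rewrite div_degD // div_deg_principal // addr0 deg_shift // r0' !add0r => ej.
  have hj1 : (j < pdeg x)%N := hj; have hj2 : (j' < pdeg x)%N := hj'.
  have d0 := pdegx_gt0; rewrite /= in ej; have n0 : n = 0 by nia.
  have jj : j = j' by move: ej; rewrite n0 mulr0 addr0 => -[].
  congr pair => //; rewrite Ec Ec'; apply/esym/lin_classP; exists f => //.
  move: Ef; rewrite n0 jj mulr0z addr0 => /(congr1 (fun D => D - D1 *~ j'%:Z)).
  by rewrite addrK addrAC addrK.
have fS : finite_set S by apply: finite_setX; [exact: Cl0_finite|exact: finite_II].
rewrite ES; apply: card_eq_trans (inj_card_eq inj) _.
rewrite -(fset_setK fS); apply/card_eq_fsetP.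
rewrite fset_setX ?cardfs_prod; [|exact: Cl0_finite|exact: finite_II].
by rewrite (card_fset_set (card_eqxx `I_(pdeg x))).
Qed.

Lemma finite_cvert (a b : int) : finite_set [set v | exists D, [/\ divisor X D, a <= div_deg D <= b & v = cvert D]].
Proof.
apply: (@sub_finite_set _ _ ((fun p : set (place -> int) * nat => cvert (crep p.1 + D1 *~ (a + p.2%:Z))) @`
   (Cl0 (X := X) `*` `I_(absz (b - a)).+1))); last first.
  by apply: finite_image; apply: finite_setX; [exact: Cl0_finite|exact: finite_II].
move=> _ [D [dD hD ->]]; have [c [f [hc f0 Ec]]] := crep_ex dD erefl.
exists (c, absz (div_deg D - a)) => /=; first by split=> //=; lia.
have -> : a + (absz (div_deg D - a))%:Z = div_deg D by lia.
by rewrite Ec cvert_equiv.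
Qed.

Lemma walk_Ext D D' r j : divisor X D -> divisor X D' -> adele r ->
  walk G j (pclass (Ext D D' r)) (pclass (Ext D (D' - pt *+ j) r)).
Proof.
move=> dD dD' Ar; elim: j D' dD' => [|j IH] D' dD'.
  by rewrite mulr0n subr0; apply/walk0/vert_pclass; exact: Ext_bundle.
have dD'' := divisorB dD' divisor_pt.
have := IH _ dD''; rewrite mulrS opprD addrA; apply: walk_cons; first by apply: vert_pclass; exact: Ext_bundle.
by apply: adj_hnb; [exact: Ext_bundle|exact: hnb_Ext2].
Qed.

(** Each step lowers D' by x and raises deg D - deg D' by d; once it exceeds m the extension splits.
    The bound delta >= -2g limits the number j of steps. The last clause makes a walk that starts in
    the nucleus end at the base vertex of a cusp. *)
Lemma to_cusp M : bundle 2 M -> exists n D, [/\ divisor X D, m < div_deg D,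
  walk G n (pclass M) (cvert D), d * n%:Z <= 2 * (genus X)%:Z + m + d & delta M <= m + d -> div_deg D <= m + d].
Proof.
move=> bM; have [e [E [[e0 hE dE dlE] _]]] := deltaP bM.
have [A [D [D' [r [[uA eA dD dD' Ar] h]]]]] := norm_ext bM e0.
have EG : E = D.
  apply: has_div_uniq (@has_div_Ext _ X D D' r); rewrite -[E]addr0 -eA; exact: has_div_pew h hE.
have dl : delta M = div_deg D - div_deg D'.
  have : deg M = div_deg D + div_deg D'.
    by rewrite -(deg_Ext dD dD' Ar) (deg_pew bM (divisor0 X) uA h) div_deg0 mulr0 addr0.
  by rewrite dlE EG; lia.
have ge := delta_ge bM (ex_intro _ D1 (conj dD1 deg1)) (ldim0 Y); have d0 := pdegx_gt0; have := mX_ge => mg.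
have [j [hj1 hj2 hj3]] : exists j : nat, [/\ m < delta M + d * j%:Z, d * j%:Z <= 2 * (genus X)%:Z + m + d &
   delta M <= m + d -> delta M + d * j%:Z <= m + d].
  have [hd|hd] := ltP m (delta M); first by exists 0%N; rewrite mulr0 addr0; split=> //; lia.
  have [n hn] := window_n (delta M); have n0 : 0 <= n by nia.
  by exists (absz n); rewrite gez0_abs //; split; lia.
have dDj : divisor X (D' - pt *+ j) by apply: divisorB => //; exact/divisorMn/divisor_pt.
have dDD := divisorB dD dDj.
have degD : div_deg (D - (D' - pt *+ j)) = delta M + d * j%:Z.
  by rewrite !div_degB ?div_degMn ?div_deg_point ?dl //; [lia|exact: divisor_pt|exact/divisorMn/divisor_pt].
have hM : pclass M = pclass (Ext D D' r).
  by apply/pclassP => //; [exact: Ext_bundle|exists 0, A; split=> //; exact: divisor0].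
exists j, (D - (D' - pt *+ j)); rewrite degD; split=> //.
rewrite -Ext_cvert // hM.
have -> : pclass (Ext D (D' - pt *+ j) 0) = pclass (Ext D (D' - pt *+ j) r).
  apply/pclassP; [exact: Extz_bundle|exact: Ext_bundle|].
  by apply/pe_sym/Ext_split => //; apply: hdim_mX => //; rewrite degD.
exact: walk_Ext.
Qed.

Lemma nuc_near v : vert N v -> exists D n, [/\ divisor X D, m < div_deg D <= m + d,
  walk G n v (cvert D) & d * n%:Z <= 2 * (genus X)%:Z + m + d].
Proof.
move=> nv; have [/vertP[M bM Ev] _] := nv; rewrite Ev in nv *; move/(nucP bM): nv => nv.
have [n [D [dD hD hw hn hd]]] := to_cusp bM; exists D, n; split=> //; by rewrite hD hd.
Qed.

Lemma finite_nuc : finite_set (vert N).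
Proof.
pose S := [set v | exists D, [/\ divisor X D, m <= div_deg D <= m + d & v = cvert D]].
have fS : finite_set S by exact: finite_cvert.
have SV : S `<=` vert G by move=> _ [D [dD _ ->]]; exact: vert_c.
have d0 := pdegx_gt0; have := mX_ge => mg.
apply: sub_finite_set (finite_ball (absz (2 * (genus X)%:Z + m + d)) fS SV) => v /nuc_near[D [n [dD hD hw hn]]].
exists (cvert D), n; split; [by exists D; split=> //; lia|by nia|exact: walk_rev].
Qed.

Lemma finite_nuc_edge : finite_set (edge N).
Proof.
have [B hB] := hecke_edgeP x; have fN := finite_nuc.
apply: (@sub_finite_set _ _ ((vert N `*` vert N) `*` `I_B.+1)); last first.
  by apply: finite_setX; [exact: finite_setX|exact: finite_II].
move=> [[v w] mm] [e [/= nv nw]]; have [gv gw] := edge_vert e.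
split=> /=; first by split.
by have [M [M' [_ _ _ _ h]]] := hB _ _ _ e; rewrite ltnS.
Qed.

Lemma nuc_adj v w : vert N v -> vert N w -> adj G v w -> adj N v w.
Proof. by move=> [_ nv] [_ nw] [j [h|h]]; exists j; [left|right]; split. Qed.

(** A walk in the whole graph is retracted to the nucleus by replacing each vertex of a cusp with
    the base vertex of that cusp. The second clause follows a walk that currently is at c_D in a
    cusp, with D0 the base divisor. *)
Lemma retract_conn n v w : walk G n v w -> vert N w -> (vert N v -> conn N v w) /\
  forall D D0 (j : int), v = cvert D -> divisor X D -> m < div_deg D -> D0 = D + pt *~ j ->
    m < div_deg D0 <= m + d -> conn N (cvert D0) w.
Proof.
have d0 := pdegx_gt0; have := mX_ge => mg.
have inN D : divisor X D -> 0 <= div_deg D <= m + d -> vert N (cvert D).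
  by move=> dD hD; apply/nuc_c => //; lia.
elim: n v => [|n IH] v.
  move=> [p [<- <- _ _]] nv; split=> [_|D D0 j Ev dD hD -> hD0]; first exact: conn_refl.
  have : div_deg D <= m + d by apply/nuc_c => //; [lia|rewrite -Ev].
  move: hD0; rewrite deg_ptn // => ? ?; have -> : j = 0 by nia.
  by rewrite mulr0z addr0 -Ev; exact: conn_refl.
move=> hw nw; have [z [gv az hz]] := walk_consP hw; have [IH1 IH2] := IH _ hz nw; have [gz _] := walk_vert hz.
have c1 : vert N v -> conn N v w.
  move=> nv; have [nz|nz] := pselect (vert N z).
    by apply: conn_trans (IH1 nz); apply: conn_adj => //; exact: nuc_adj.
  (* The walk leaves the nucleus from v. Of the two neighbours of z = c_D only c_{D - x} can lie in
     the nucleus, so v is the base of the cusp. *)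
  have [D [dD hD Ez]] := not_nuc gz nz.
  have : v = cvert (D + pt *~ 1) \/ v = cvert (D + pt *~ (-1)).
    by rewrite mulr1z mulrN1z; apply: (adj_cvert dD hD); rewrite -Ez; exact: adjC.
  have dj j : divisor X (D + pt *~ j) by apply: divisorD => //; exact: divisor_ptn.
  have hN (i : int) : v = cvert (D + pt *~ i) -> 0 <= div_deg D + d * i -> div_deg D + d * i <= m + d.
    by move=> Ev h; rewrite -deg_ptn //; apply/(nuc_c (dj i)); rewrite ?deg_ptn // -Ev.
  case=> Ev; have := hN _ Ev; first by lia.
  move=> h; rewrite Ev; apply: (IH2 D _ (-1) Ez) => //; rewrite ?deg_ptn //; lia.
split=> // D D0 j Ev dD hD ED0 hD0.
have [h|h] := leP (div_deg D) (m + d).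
  have nv : vert N v by rewrite Ev; apply: inN => //; lia.
  move: hD0; rewrite ED0 deg_ptn // => ?; have -> : j = 0 by nia.
  by rewrite mulr0z addr0 -Ev; exact: c1.
rewrite Ev in az; case: (adj_cvert dD h az) => Ez.
  apply: (IH2 (D + pt) D0 (j - 1) Ez) => //; first by apply: divisorD => //; exact: divisor_pt.
    by rewrite div_degD ?div_deg_point //; [lia|exact: divisor_pt].
  by rewrite ED0 mulrzBr mulr1z; apply/funext => u; rewrite !fctE; lia.
apply: (IH2 (D - pt) D0 (j + 1) Ez) => //; first by apply: divisorB => //; exact: divisor_pt.
  by rewrite div_degB ?div_deg_point //; [lia|exact: divisor_pt].
by rewrite ED0 mulrzDr mulr1z; apply/funext => u; rewrite !fctE; lia.
Qed.

Lemma xclass2_eq D E f (n : int) : divisor X E -> f != 0 ->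
  xclass2 x (D + E *+ 2 + principal f + pt *~ n) = xclass2 x D.
Proof.
move=> dE f0; apply/seteqP; split=> D' [E' dE' [h [j [h0 ->]]]].
  exists (E + E'); first exact: divisorD.
  exists (f * h), (n + j); split; first exact: mulf_neq0.
  by rewrite principalM // mulrzDr !mulr2n; apply/funext => u; rewrite !fctE; lia.
exists (E' - E); first exact: divisorB.
exists (f^-1 * h), (j - n); split; first by rewrite mulf_neq0 ?invr_neq0.
rewrite principalM ?invr_neq0 // principalV mulrzBr !mulr2n.
by apply/funext => v; rewrite !fctE; lia.
Qed.

Lemma conn_xclass2 n M M' : bundle 2 M -> bundle 2 M' -> walk G n (pclass M) (pclass M') ->
  xclass2 x (ddet M) = xclass2 x (ddet M').
Proof.
have hpe M1 M2 : bundle 2 M1 -> pe M1 M2 -> xclass2 x (ddet M2) = xclass2 x (ddet M1).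
  move=> bM1 [E [A [dE uA h]]]; rewrite (ddet_pew bM1 uA h).
  have dA : \det A != 0 by move: uA; rewrite unitmxE unitfE.
  by rewrite -(@xclass2_eq (ddet M1) E (\det A)^-1 0) ?invr_neq0 // principalV mulr0z addr0.
move=> + bM'; elim: n M => [|n IH] M bM.
  move=> [p [p0 pn _ _]]; rewrite (hpe M M') //; apply/pclassP => //; by rewrite -p0 -pn.
move=> hw; have [z [_ /(adj_at bM)[M1 hM1 Ez] h]] := walk_consP hw; rewrite Ez in h; have [bM1 _] := hM1.
rewrite -(IH _ bM1 h) (hnb_ddet bM hM1).
have := @xclass2_eq (ddet M) 0 1 (-1) (divisor0 X) (oner_neq0 _).
by rewrite mul0rn addr0 principal1 addr0 mulrN1z.
Qed.

Lemma xclass2_conn M M' : bundle 2 M -> bundle 2 M' -> xclass2 x (ddet M) = xclass2 x (ddet M') ->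
  conn G (pclass M) (pclass M').
Proof.
move=> bM bM' E; have [n [D [dD _ h _ _]]] := to_cusp bM; have [n' [D' [dD' _ h' _ _]]] := to_cusp bM'.
apply: conn_trans (ex_intro _ n h) _; apply: conn_trans (conn_sym (ex_intro _ n' h')).
have := h; have := h'; rewrite !cvertE => /(conn_xclass2 bM' (bundle_c dD')) e' /(conn_xclass2 bM (bundle_c dD)) e.
move: E; rewrite e e' !ddet_Ext !addr0 => E.
have : xclass2 x D D'.
  by rewrite E; exists 0; [exact: divisor0|rewrite mul0rn addr0; exact: xclass_refl].
by move=> [E0 dE0 [f [j [f0 ->]]]]; rewrite -!cvertE; exact: cvert_conn.
Qed.
Lemma card_components : (components N #= ClO_mod2 x)%card.
Proof.
pose rep (v : set (sheaf X 2)) : sheaf X 2 := xget (Ext 0 0 0) [set M | bundle 2 M /\ v = pclass M].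
have repP v : vert N v -> bundle 2 (rep v) /\ v = pclass (rep v).
  move=> [/vertP[M bM E] _]; rewrite /rep; case: xgetP => [M' -> //|/(_ M)]; by case.
have -> : ClO_mod2 x = (fun v => xclass2 x (ddet (rep v))) @` vert N.
  apply/seteqP; split=> z; last first.
    by move=> [v /repP[bM _] <-]; exists (ddet (rep v)) => //; exact: divisor_ddet.
  move=> [D dD <-]; have [n hn] := window_n (div_deg D); have mg := mX_ge.
  have dDn : divisor X (D + pt *~ n) by apply: divisorD => //; exact: divisor_ptn.
  have nv : vert N (cvert (D + pt *~ n)) by apply/nuc_c => //; rewrite deg_ptn //; lia.
  exists (cvert (D + pt *~ n)) => //; have [bM E] := repP _ nv.
  have gv : vert G (cvert (D + pt *~ n)) by case: nv.
  have w0 := walk0 gv; rewrite {1}cvertE E in w0.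
  rewrite -(conn_xclass2 (bundle_c dDn) bM w0) ddet_Ext addr0.
  have := @xclass2_eq D 0 1 n (divisor0 X) (oner_neq0 _).
  by rewrite mul0rn addr0 principal1 addr0.
apply: (card_image_eq (cvert 0)) => v w nv nw.
have [bv Ev] := repP v nv; have [bw Ew] := repP w nw.
rewrite component_eq //; split=> [[n h]|h].
  apply: (@conn_xclass2 n) => //; rewrite -Ev -Ew.
  move: h => [p [p0 pn vp ap]]; exists p; split=> // i hi; first by case: (vp i hi).
  by have [j [[]|[]]] := ap i hi; exists j; [left|right].
by have [n hw] := xclass2_conn bv bw h; rewrite -Ev -Ew in hw; have [+ _] := retract_conn hw nw; apply.
Qed.

Lemma nuc_distance v : vert N v -> exists C w n, [/\ ClO x C, vert (cusp x C) w, walk G n v w &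
  (n%:R : rat) <= (2 * (genus X)%:R + m%:~R + (pdeg x)%:R) / (pdeg x)%:R].
Proof.
move=> /nuc_near[D [n [dD /andP[hD _] hw hn]]]; exists (xclass x D), (cvert D), n; split=> //.
- by exists D.
- by apply/cuspP; exists D; split=> //; exact: xclass_refl.
have d0 := pdegx_gt0; rewrite ler_pdivlMr ?ltr0n ?pdeg_gt0 //.
have : ((d * n%:Z)%:~R : rat) <= (2 * (genus X)%:Z + m + d)%:~R by rewrite ler_int.
by rewrite !rmorphD !rmorphM /= mulrC.
Qed.
End Counting.

End Cusps.

(** * Retraction of rays *)

Section Segments.
Variables (R : realType) (T : Type) (G : graph T).
Local Notation real := (realization R G).
Implicit Types (c : cell G) (u t : R) (U : set real).

(** The CW topology in metric terms on each closed cell; this is the form in which every continuity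
    check below is made. *)
Definition eps_open U := forall c u, 0 <= u <= 1 -> U (attach c u) ->
  exists2 e, 0 < e & forall u', 0 <= u' <= 1 -> `|u' - u| < e -> U (attach c u').

Lemma realization_openP U : realization_open U <-> eps_open U.
Proof.
split=> h.
  move=> c u hu Uu; have /open_subspaceP[V oV EV] := h c.
  have [Vu _] : (V `&` `[0%R, 1%R]) u by rewrite EV; split=> //=; rewrite in_itv.
  have /nbhs_ballP[e /= e0 he] := open_nbhs_nbhs (conj oV Vu).
  exists e => // u' hu' du; have : (V `&` `[0%R, 1%R]) u'.
    by split; [apply: he; rewrite /ball /= distrC|rewrite /= in_itv].
  by rewrite EV => -[].
move=> c; apply/open_subspaceP.
exists [set u | exists u0 e, [/\ 0 <= u0 <= 1, 0 < e, `|u - u0| < e &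
   forall u', 0 <= u' <= 1 -> `|u' - u0| < e -> U (attach c u')]]; last first.
  apply/seteqP; split=> u /= [].
    by move=> [u0 [e [h0 e0 hu hU]]] hu1; split=> //; apply: hU => //; move: hu1; rewrite in_itv.
  move=> Uu; rewrite in_itv /= => hu; split=> //; have [e e0 he] := h c u hu Uu.
  by exists u, e; rewrite subrr normr0.
rewrite openE => u /= [u0 [e [h0 e0 hu hU]]]; apply/nbhs_ballP; exists (e - `|u - u0|); first by rewrite /= subr_gt0.
move=> u' /=; rewrite /ball /= => du; exists u0, e; split=> //.
have -> : u' - u0 = (u - u0) - (u - u') by ring.
apply: le_lt_trans (ler_normB _ _) _; lra.
Qed.

Lemma vert_adj (v w : vertex G) : adj G (sval v) (sval w) ->
  exists v' w', adj G (sval v') (sval w') /\ [set v; w] = [set v'; w'] :> set (vertex G).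
Proof. by move=> a; exists v, w. Qed.

Definition the_cell (v w : vertex G) (a : adj G (sval v) (sval w)) : cell G := exist _ [set v; w] (vert_adj a).

Lemma cell_eq c c' : sval c = sval c' -> c = c'.
Proof. by case: c c' => [e h] [e' h'] /= E; subst e'; congr exist; exact: Prop_irrelevance. Qed.

Lemma cell_endsP c : adj G (sval (source c)) (sval (target c)) /\ sval c = [set source c; target c].
Proof. exact: (projT2 (cid (projT2 (cid (svalP c))))). Qed.

Lemma cell_ends c v w : sval c = [set v; w] ->
  (source c = v /\ target c = w) \/ (source c <> v /\ source c = w /\ target c = v).
Proof.
have [_ ->] := cell_endsP c => E.
have h z : (z = source c \/ z = target c) <-> (z = v \/ z = w).
  have : [set source c; target c] z <-> [set v; w] z by rewrite E.
  by [].
have [hs|hs] := pselect (source c = v); [left|right].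
  split=> //; have [_ /(_ (or_intror erefl))[Ew|//]] := h w.
  by have [/(_ (or_intror erefl))[->|//] _] := h (target c); rewrite -hs.
split=> //; have [/(_ (or_introl erefl))[//|-> _]] := h (source c).
by split=> //; have [_ /(_ (or_introl erefl))[Ev|//]] := h v; case: hs.
Qed.

Lemma attach0 c : attach c (0 : R) = inl (source c).
Proof. by rewrite /attach; case: pselect => [h|_]; [exfalso; move: h; rewrite ltxx|rewrite lexx]. Qed.

Lemma attach1 c : attach c (1 : R) = inl (target c).
Proof. by rewrite /attach; case: pselect => [h|_]; [exfalso; move: h; rewrite ltxx andbF|rewrite ler10]. Qed.

Lemma attach_in c u (h : 0 < u < 1) : attach c u = inr (c, exist _ u h).
Proof. by rewrite /attach; case: pselect => [h'|//]; congr (inr (c, exist _ u _)); exact: Prop_irrelevance. Qed.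

Lemma attach_inj c c' u u' : 0 < u < 1 -> 0 < u' < 1 -> attach c u = attach c' u' -> c = c' /\ u = u'.
Proof. by move=> h h'; rewrite !attach_in => -[-> ->]. Qed.

(** The ends of a cell are chosen as an unordered pair, so its characteristic map may run either
    way; [seg] always runs from v to w. *)
Definition seg (v w : vertex G) (a : adj G (sval v) (sval w)) u : real :=
  if pselect (source (the_cell a) = v) then attach (the_cell a) u else attach (the_cell a) (1 - u).

Section Seg.
Variables (v w : vertex G) (a : adj G (sval v) (sval w)).

Lemma seg_attach : (forall u, seg a u = attach (the_cell a) u) \/ (forall u, seg a u = attach (the_cell a) (1 - u)).
Proof. by rewrite /seg; case: pselect; [left|right]. Qed.

Lemma attach_seg : (forall u, attach (the_cell a) u = seg a u) \/ (forall u, attach (the_cell a) u = seg a (1 - u)).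
Proof. by case: seg_attach => h; [left|right] => u; rewrite h // opprB addrC subrK. Qed.

Lemma seg0 : seg a 0 = inl v.
Proof.
rewrite /seg; case: pselect => /= h; first by rewrite attach0 h.
by rewrite subr0 attach1; case: (@cell_ends (the_cell a) v w erefl) => [[]//|[_ [_ ->]]].
Qed.

Lemma seg1 : seg a 1 = inl w.
Proof.
rewrite /seg subrr; case: pselect => /= h; rewrite ?attach0 ?attach1; congr inl;
by case: (@cell_ends (the_cell a) v w erefl) => [[? ?]|[? [? ?]]].
Qed.

Lemma seg_in u : 0 < u < 1 -> exists h, seg a u = inr (the_cell a, h).
Proof.
move=> h; case: seg_attach => ->; first by rewrite attach_in; eexists.
have h' : 0 < 1 - u < 1 by lra.
by rewrite attach_in; eexists.
Qed.

Lemma seg_inj u u' : 0 < u < 1 -> 0 < u' < 1 -> seg a u = seg a u' -> u = u'.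
Proof.
move=> h h'; case: seg_attach => E; rewrite !E => /attach_inj[] //; [lra|lra|].
by move=> _ /(congr1 (fun z => 1 - z)); rewrite !opprB ![1 + _]addrC !subrK.
Qed.

Lemma seg_open U : realization_open U -> forall u, 0 <= u <= 1 -> U (seg a u) ->
  exists2 e, 0 < e & forall u', 0 <= u' <= 1 -> `|u' - u| < e -> U (seg a u').
Proof.
move=> /realization_openP oU u hu; case: seg_attach => E; rewrite E.
  by move=> /oU[//|e e0 he]; exists e => // u' hu' du; rewrite E; exact: he.
move=> /oU[|e e0 he]; first lra.
exists e => // u' hu' du; rewrite E; apply: he; first lra.
rewrite distrC; have -> : 1 - u - (1 - u') = u' - u by ring.
exact: du.
Qed.
End Seg.

Lemma real_cases (z : real) : (exists v, z = inl v) \/ (exists c u, 0 < u < 1 /\ z = attach c u).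
Proof.
case: z => [v|[c [u h]]]; first by left; exists v.
by right; exists c, u; split=> //; rewrite attach_in.
Qed.
End Segments.

Arguments seg_attach {R T G v w} a.
Arguments attach_seg {R T G v w} a.
Arguments seg_in {R T G v w} a {u}.

Section Rays.
Variables (R : realType) (T : Type) (G : graph T) (V : set T) (I : Type) (p : I -> nat -> T).
Local Notation N := (full_subgraph G V).
Local Notation RG := (realization R G).
Local Notation RN := (realization R N).
Hypothesis p_vert : forall i n, vert G (p i n).
Hypothesis p_base : forall i, V (p i 0%N).
Hypothesis p_out : forall i n, ~ V (p i n.+1).
Hypothesis out_p : forall v, vert G v -> ~ V v -> exists i n, v = p i n.+1.
Hypothesis p_inj : forall i j n m, p i n.+1 = p j m.+1 -> i = j /\ n = m.
Hypothesis p_adj : forall i n, adj G (p i n) (p i n.+1).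
Hypothesis adj_p : forall i n w, adj G (p i n.+1) w -> w = p i n \/ w = p i n.+2.

Definition vx v (h : vert G v) : vertex G := exist _ v h.
Let P i n : vertex G := vx (p_vert i n).

Lemma vx_eq (v w : vertex G) : sval v = sval w -> v = w.
Proof. by case: v w => [v h] [w h'] /= E; subst w; congr exist; exact: Prop_irrelevance. Qed.

Lemma vxN_eq (v w : vertex N) : sval v = sval w -> v = w.
Proof. by case: v w => [v h] [w h'] /= E; subst w; congr exist; exact: Prop_irrelevance. Qed.

Definition rseg i n : R -> RG := @seg R T G (P i n) (P i n.+1) (p_adj i n).

(** The i-th ray parametrized by the half-line, with [p i n] at the integer n. *)
Definition ray i (s : R) : RG := rseg i (Num.truncn s) (s - (Num.truncn s)%:R).

Lemma rayE i n u : 0 <= u <= 1 -> ray i (n%:R + u) = rseg i n u.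
Proof.
move=> /andP[u0]; rewrite le_eqVlt => /predU1P[->|u1].
  rewrite natr1 /ray; have -> : Num.truncn (n.+1%:R : R) = n.+1.
    by apply: truncn_def; rewrite lexx ltr_nat ltnSn.
  by rewrite subrr /rseg seg0 seg1.
have -> : ray i (n%:R + u) = rseg i n (n%:R + u - n%:R).
  rewrite /ray; suff -> : Num.truncn (n%:R + u) = n by [].
  by apply: truncn_def; rewrite -natr1; lra.
by have -> : n%:R + u - n%:R = u by ring.
Qed.

Lemma ray_split (s : R) : 0 <= s -> exists n u, 0 <= u < 1 /\ s = n%:R + u.
Proof.
move=> s0; have /andP[h1 h2] := truncn_itv s0; exists (Num.truncn s), (s - (Num.truncn s)%:R).
by rewrite -natr1 in h2; split; [lra|rewrite addrC subrK].
Qed.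

Lemma ray0 i : ray i 0 = inl (P i 0).
Proof. by have := @rayE i 0 0; rewrite addr0 mulr0n => ->; rewrite ?lexx ?ler01 // /rseg seg0. Qed.

Lemma ray_open i U : realization_open U -> forall s0, 0 <= s0 -> U (ray i s0) ->
  exists2 e, 0 < e & forall s, 0 <= s -> `|s - s0| < e -> U (ray i s).
Proof.
move=> oU s0 /ray_split[n [u [hu ->]]]; have hu' : 0 <= u <= 1 by lra.
rewrite rayE // => Uu.
have [e e0 he] := seg_open oU hu' Uu.
have right s : n%:R <= s -> `|s - (n%:R + u)| < Num.min e (1 - u) -> U (ray i s).
  rewrite lt_min => ns /andP[h1 h2]; have -> : s = n%:R + (s - n%:R) by ring.
  move: h2; rewrite ltr_norml => h2; rewrite rayE; last by lra.
  by apply: he; [lra|have -> : s - n%:R - u = s - (n%:R + u) by ring].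
case: n => [|n] in right Uu he *.
  exists (Num.min e (1 - u)); first by rewrite lt_min e0; lra.
  by move=> s hs h; apply: right h.
(* An inner vertex of the ray needs the preceding cell as well, for parameters to its left. *)
have [u0|u0] := eqVneq u 0; last first.
  have up : 0 < u by lra.
  exists (Num.min u (Num.min e (1 - u))); first by rewrite !lt_min up e0; lra.
  move=> s hs h; apply: right; last by apply: lt_le_trans h _; rewrite ge_min lexx orbT.
  by move: h; rewrite lt_min => /andP[+ _]; rewrite ltr_norml; lra.
have U1 : U (rseg i n 1) by move: Uu; rewrite u0 /rseg seg0 seg1.
have [|e' e'0 he'] := seg_open oU _ U1; first by rewrite ler01 lexx.
exists (Num.min (Num.min e' 1) (Num.min e (1 - u))); first by rewrite !lt_min e'0 e0; lra.
move=> s hs h; have [le|lt] := leP n.+1%:R s.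
  by apply: right => //; apply: lt_le_trans h _; rewrite ge_min lexx orbT.
move: h lt; rewrite !lt_min u0 addr0 -natr1 => /andP[/andP[h1 h2] _] lt.
move: h2; rewrite ltr_norml => h2; have -> : s = n%:R + (s - n%:R) by ring.
rewrite rayE; last by lra.
by apply: he'; [lra|have -> : s - n%:R - 1 = s - (n%:R + 1) by ring].
Qed.

Lemma cell_rays c : (exists v w : vertex G, [/\ V (sval v), V (sval w), adj G (sval v) (sval w) & sval c = [set v; w]]) \/
  exists i n, the_cell (p_adj i n : adj G (sval (P i n)) (sval (P i n.+1))) = c.
Proof.
have [a Ec] := cell_endsP c; set v := source c in a Ec *; set w := target c in a Ec *.
have key (v0 w0 : vertex G) : adj G (sval v0) (sval w0) -> sval c = [set v0; w0] -> ~ V (sval v0) ->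
    exists i n, the_cell (p_adj i n : adj G (sval (P i n)) (sval (P i n.+1))) = c.
  move=> a0 Ec0 nv; have [i [n Ev]] := out_p (svalP v0) nv.
  rewrite Ev in a0; have Evv : v0 = P i n.+1 by apply: vx_eq.
  case: (adj_p a0) => Ew.
    by exists i, n; apply: cell_eq; rewrite Ec0 /= Evv (_ : w0 = P i n) 1?setUC //; exact: vx_eq.
  by exists i, n.+1; apply: cell_eq; rewrite Ec0 /= Evv (_ : w0 = P i n.+2) //; exact: vx_eq.
have [Vv|nv] := pselect (V (sval v)); last by right; exact: key a Ec nv.
have [Vw|nw] := pselect (V (sval w)); last first.
  by right; apply: (key w v) => //; [case: a => j [h|h]; exists j; [right|left]|rewrite setUC].
by left; exists v, w.
Qed.

Lemma adjN_G v w : adj N v w -> adj G v w.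
Proof. by move=> [j [[h _]|[h _]]]; exists j; [left|right]. Qed.

Definition inc_v (v : vertex N) : vertex G := vx (svalP v).1.

Lemma inc_adj (c : cell N) : adj G (sval (inc_v (source c))) (sval (inc_v (target c))).
Proof. exact: adjN_G (cell_endsP c).1. Qed.

(** The ends of a cell of N and of the same cell of G are chosen independently, so the inclusion is
    defined by [seg], which fixes the direction. *)
Definition inc (z : RN) : RG := match z with
  | inl v => inl (inc_v v)
  | inr (c, t) => @seg R T G (inc_v (source c)) (inc_v (target c)) (inc_adj c) (sval t)
  end.

Definition inc_c (c : cell N) : cell G :=
  @the_cell T G (inc_v (source c)) (inc_v (target c)) (inc_adj c).

Lemma inc_attach c u : 0 <= u <= 1 ->
  inc (attach c u) = @seg R T G (inc_v (source c)) (inc_v (target c)) (inc_adj c) u.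
Proof.
move=> /andP[]; rewrite le_eqVlt => /predU1P[<- _|u0]; first by rewrite attach0 seg0.
rewrite le_eqVlt => /predU1P[->|u1]; first by rewrite attach1 seg1.
have h : 0 < u < 1 by rewrite u0.
by rewrite (attach_in c h).
Qed.

Lemma cell_N (c : cell G) (v w : vertex G) : V (sval v) -> V (sval w) -> adj G (sval v) (sval w) ->
  sval c = [set v; w] -> exists c', inc_c c' = c.
Proof.
move=> Vv Vw a Ec; pose v' : vertex N := exist _ (sval v) (conj (svalP v) Vv).
pose w' : vertex N := exist _ (sval w) (conj (svalP w) Vw).
have a' : adj N (sval v') (sval w') by case: a => j [h|h]; exists j; [left|right]; split.
exists (the_cell a'); apply: cell_eq; rewrite Ec.
have Ev : inc_v v' = v by exact: vx_eq.
have Ew : inc_v w' = w by exact: vx_eq.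
rewrite /inc_c /=; case: (@cell_ends _ _ (the_cell a') v' w' erefl) => [[-> ->]|[_ [-> ->]]].
  by rewrite Ev Ew.
by rewrite Ev Ew setUC.
Qed.

Lemma inc_v_inj v w : inc_v v = inc_v w -> v = w.
Proof. by move=> /(congr1 sval) /= E; exact: vxN_eq. Qed.

Lemma inc_c_inj c c' : inc_c c = inc_c c' -> c = c'.
Proof.
move=> /(congr1 sval) /= E; apply: cell_eq; have [_ ->] := cell_endsP c; have [_ ->] := cell_endsP c'.
apply/seteqP; split=> z /= hz.
  have : [set inc_v (source c); inc_v (target c)] (inc_v z) by case: hz => ->; [left|right].
  by rewrite E => -[] /inc_v_inj ->; [left|right].
have : [set inc_v (source c'); inc_v (target c')] (inc_v z) by case: hz => ->; [left|right].
by rewrite -E => -[] /inc_v_inj ->; [left|right].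
Qed.

Lemma inc_inj : injective inc.
Proof.
move=> [v|[c [t ht]]] [v'|[c' [t' ht']]] /=.
- by move=> [E]; congr inl; exact: vxN_eq.
- by have [h ->] := seg_in (inc_adj c') ht'.
- by have [h ->] := seg_in (inc_adj c) ht.
move=> E; have Ec : c = c'.
  have [h E1] := seg_in (inc_adj c) ht; have [h' E2] := seg_in (inc_adj c') ht'.
  by move: E; rewrite E1 E2 => -[Ec _]; apply: inc_c_inj; exact: cell_eq.
subst c'; have tt := seg_inj ht ht' E; subst t'.
by congr (inr (c, exist _ t _)); exact: Prop_irrelevance.
Qed.

Lemma inc_open U : realization_open U -> realization_open (inc @^-1` U).
Proof.
move=> oU; apply/realization_openP => c u hu; rewrite /preimage /= inc_attach // => /(seg_open oU hu)[e e0 he].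
by exists e => // u' hu' du; rewrite /preimage /= inc_attach //; exact: he.
Qed.

Lemma inc_ray y i s : 0 < s -> inc y <> ray i s.
Proof.
move=> s0; have [n [u [hu Es]]] := ray_split (ltW s0); rewrite Es rayE; last by lra.
have [u0|u0] := eqVneq u 0.
  rewrite u0 /rseg seg0; case: n Es => [|n] Es; first by move: s0; rewrite Es u0 addr0 ltxx.
  case: y => [v [Ev]|[c [t ht]] /=].
    by apply: (p_out (i := i) (n := n)); rewrite -Ev; case: (svalP v).
  by have [h ->] := seg_in (inc_adj c) ht.
have [|h E] := seg_in (p_adj i n : adj G (sval (P i n)) (sval (P i n.+1))) (u := u); first by lra.
rewrite /rseg E; case: y => [//|[c [t ht]] /=].
have [h' ->] := seg_in (inc_adj c) ht => -[Ec _].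
have : [set inc_v (source c); inc_v (target c)] (P i n.+1) by rewrite Ec; right.
have VN (v : vertex N) : V (sval v) by case: (svalP v).
by move=> [] /(congr1 sval) /= Ev; apply: (p_out (i := i) (n := n)); rewrite Ev; exact: VN.
Qed.

Lemma ray_inj i j s s' : 0 < s -> 0 < s' -> ray i s = ray j s' -> i = j /\ s = s'.
Proof.
move=> s0 s0'; have [n [u [hu Es]]] := ray_split (ltW s0); have [n' [u' [hu' Es']]] := ray_split (ltW s0').
rewrite Es Es' !rayE; try lra.
have nn m w : 0 < m%:R + w -> w = 0 :> R -> exists m', m = m'.+1.
  by move=> h w0; case: m h => [|m]; [rewrite w0 addr0 ltxx|exists m].
have [u0|u0] := eqVneq u 0; have [u0'|u0'] := eqVneq u' 0.
- rewrite u0 u0' /rseg !seg0; rewrite {}Es u0 in s0 *; rewrite {}Es' u0' in s0' *.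
  have [m Em] := nn _ _ s0 erefl; have [m' Em'] := nn _ _ s0' erefl; subst n n' => -[E].
  by have [-> ->] := p_inj E.
- have [|h E] := seg_in (p_adj j n' : adj G (sval (P j n')) (sval (P j n'.+1))) (u := u'); first by lra.
  by rewrite u0 /rseg seg0 E.
- have [|h E] := seg_in (p_adj i n : adj G (sval (P i n)) (sval (P i n.+1))) (u := u); first by lra.
  by rewrite u0' /rseg seg0 E.
have [|h E] := seg_in (p_adj i n : adj G (sval (P i n)) (sval (P i n.+1))) (u := u); first by lra.
have [|h' E'] := seg_in (p_adj j n' : adj G (sval (P j n')) (sval (P j n'.+1))) (u := u'); first by lra.
move=> Eseg; suff [ij nn'] : i = j /\ n = n'.
  subst j n'; split=> //; congr (_ + _); apply: seg_inj Eseg; lra.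
move: Eseg; rewrite /rseg E E' => -[Ec _].
have : [set P j n'; P j n'.+1] (P i n.+1) by rewrite -Ec; right.
case=> [/(congr1 (@sval _ _)) /= Ep|/(congr1 (@sval _ _)) /= /p_inj[-> ->]//].
have : [set P i n; P i n.+1] (P j n'.+1) by rewrite Ec; right.
case: n' {Es' hu' h' E' Ec nn} Ep => [|m] Ep; first by case: (p_out (i := i) (n := n)); rewrite Ep.
have [ij nm] := p_inj Ep; subst j m.
case=> /(congr1 (@sval _ _)) /=; last by move=> /p_inj[_ h0]; exfalso; lia.
case: n {Es hu h E Ep} => [|n] Ep; first by case: (p_out (i := i) (n := 1)); rewrite Ep.
by have [_ h0] := p_inj Ep; exfalso; lia.
Qed.

Lemma ray_vert i n : ray i n%:R = inl (P i n).
Proof. by have := @rayE i n 0; rewrite addr0 => ->; rewrite ?lexx ?ler01 // /rseg seg0. Qed.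

Lemma inc_base i : exists y, inc y = ray i 0.
Proof.
have h : vert N (p i 0%N) by [].
by exists (inl (exist _ (p i 0%N) h)); rewrite ray0 /=; congr inl; exact: vx_eq.
Qed.

(** The isometry phi is u or 1 - u, depending on how the chosen ends of the cell are ordered. *)
Lemma cell_form (c : cell G) : exists phi : R -> R,
  [/\ forall u, 0 <= u <= 1 -> 0 <= phi u <= 1, forall u u', `|phi u - phi u'| = `|u - u'| &
   (exists c', forall u, 0 <= u <= 1 -> attach c u = inc (attach c' (phi u))) \/
   (exists i n, forall u, 0 <= u <= 1 -> attach c u = ray i (n%:R + phi u))].
Proof.
have flip u u' : `|1 - u - (1 - u')| = `|u - u'| :> R.
  by rewrite distrC; have -> : 1 - u' - (1 - u) = u - u' by ring.
case: (cell_rays c) => [[v [w [Vv Vw a Ec]]]|[i [n <-]]].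
  have [c' <-] := cell_N Vv Vw a Ec.
  case: (attach_seg (R := R) (inc_adj c')) => E.
    exists id; split=> //; left; exists c' => u hu; rewrite inc_attach //; exact: E.
  exists (fun u => 1 - u); split=> [u|//|]; first by lra.
  left; exists c' => u hu; rewrite inc_attach; [exact: E|lra].
case: (attach_seg (R := R) (p_adj i n : adj G (sval (P i n)) (sval (P i n.+1)))) => E.
  by exists id; split=> //; right; exists i, n => u hu; rewrite rayE //; exact: E.
exists (fun u => 1 - u); split=> [u|//|]; first by lra.
right; exists i, n => u hu; rewrite rayE; [exact: E|lra].
Qed.

Lemma RG_cases z : (exists y, z = inc y) \/ (exists i s, 0 < s /\ z = ray i s).
Proof.
case: (real_cases z) => [[v ->]|[c [u [hu ->]]]].
  have [Vv|nv] := pselect (V (sval v)).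
    by left; exists (inl (exist _ (sval v) (conj (svalP v) Vv))) => /=; congr inl; exact: vx_eq.
  have [i [n Ev]] := out_p (svalP v) nv; right; exists i, n.+1%:R; rewrite ltr0n ray_vert; split=> //.
  by congr inl; exact: vx_eq.
have hu' : 0 <= u <= 1 by lra.
have [phi [h1 _ [[c' E]|[i [n E]]]]] := cell_form c; rewrite E //; first by left; eexists.
have := h1 _ hu'; have := ler0n R n => n0 /andP[p0 _].
have : 0 <= n%:R + phi u by lra.
rewrite le_eqVlt => /predU1P[<-|pos]; last by right; exists i, (n%:R + phi u).
by have [y <-] := inc_base i; left; exists y.
Qed.

(** Each ray is contracted to its base by scaling its parameter with t, and N stays fixed. The
    coordinates (i, s) picked here are unique for s > 0 by [ray_inj]. *)
Definition hty (z : R * RG) : RG :=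
  match pselect (exists q : I * R, 0 < q.2 /\ z.2 = ray q.1 q.2) with
  | left h => ray (projT1 (cid h)).1 (z.1 * (projT1 (cid h)).2)
  | right _ => z.2
  end.

Lemma hty_inc t y : hty (t, inc y) = inc y.
Proof. by rewrite /hty; case: pselect => // -[[i s] /= [s0 E]]; case: (inc_ray s0 E). Qed.

Lemma hty_ray t i s : 0 <= s -> hty (t, ray i s) = ray i (t * s).
Proof.
rewrite le_eqVlt => /predU1P[<-|s0]; first by have [y Ey] := inc_base i; rewrite mulr0 -Ey hty_inc.
rewrite /hty; case: pselect => [h|[]]; last by exists (i, s).
by case: (cid h) => -[j s'] /= [s'0 /(ray_inj s0 s'0)[-> ->]].
Qed.

Lemma ret_ex z : exists y, inc y = hty (0, z).
Proof.
case: (RG_cases z) => [[y ->]|[i [s [s0 ->]]]]; first by exists y; rewrite hty_inc.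
by rewrite hty_ray ?ltW // mul0r; exact: inc_base.
Qed.

Definition ret z : RN := projT1 (cid (ret_ex z)).

Lemma retP z : inc (ret z) = hty (0, z). Proof. exact: (projT2 (cid (ret_ex z))). Qed.

Lemma inc_ret y : ret (inc y) = y.
Proof. by apply: inc_inj; rewrite retP hty_inc. Qed.

Lemma ret_open U : realization_open U -> realization_open (ret @^-1` U).
Proof.
move=> /realization_openP oU; apply/realization_openP => c u hu.
have [phi [h1 h2 [[c' E]|[i [n E]]]]] := cell_form c.
  rewrite /preimage /= E // inc_ret => /(oU _ _ (h1 _ hu))[e e0 he].
  by exists e => // u' hu' du; rewrite /preimage /= E // inc_ret; apply: he; rewrite ?h2 //; exact: h1.
have cst u' : 0 <= u' <= 1 -> ret (attach c u') = ret (ray i 0).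
  move=> hu'; apply: inc_inj; rewrite !retP E // !hty_ray // ?mul0r //.
  by have := h1 _ hu'; have := ler0n R n; lra.
by rewrite /preimage /= cst // => Uu; exists 1 => // u' hu' _; rewrite /preimage /= cst.
Qed.

Lemma ray_nbhd i s0 d : d <= s0 -> realization_open [set z | exists2 s, `|s - s0| < d & z = ray i s].
Proof.
move=> ds; apply/realization_openP => c u hu /= [s hs].
have sp : 0 < s by move: hs; rewrite ltr_norml; lra.
have [phi [h1 h2 [[c' E]|[j [n E]]]]] := cell_form c; rewrite E //; first by move=> /(inc_ray sp).
have pos u' : 0 <= u' <= 1 -> 0 <= n%:R + phi u' by move=> /h1; have := ler0n R n; lra.
have := pos _ hu; rewrite le_eqVlt => /predU1P[<-|p0 /(ray_inj p0 sp)[ji Es]].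
  by have [y <-] := inc_base j => /(inc_ray sp).
subst j; exists (d - `|s - s0|); first by rewrite subr_gt0.
move=> u' hu' du; exists (n%:R + phi u'); last exact: E.
have -> : n%:R + phi u' - s0 = (phi u' - phi u) + (s - s0) by rewrite -Es; ring.
apply: le_lt_trans (ler_normD _ _) _; rewrite h2; lra.
Qed.

(** The set of points whose whole track lies in U. At a point of N, where the homotopy is
    stationary, this set times the whole interval is the required neighbourhood, whatever the number
    of rays attached there. *)
Lemma core_open U : realization_open U -> realization_open [set z | forall t, 0 <= t <= 1 -> U (hty (t, z))].
Proof.
move=> oU; apply/realization_openP => c u hu /=.
have [phi [h1 h2 [[c' E]|[i [n E]]]]] := cell_form c; rewrite E // => hU.
  have /realization_openP oU' := inc_open oU.
  have Uu : (inc @^-1` U) (attach c' (phi u)).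
    by have := hU 0; rewrite hty_inc lexx ler01; apply.
  have [e e0 he] := oU' _ _ (h1 _ hu) Uu.
  by exists e => // u' hu' du t ht; rewrite E // hty_inc; apply: he; rewrite ?h2 //; exact: h1.
have pos u' : 0 <= u' <= 1 -> 0 <= n%:R + phi u' by move=> /h1; have := ler0n R n; lra.
have p0 := pos _ hu; have Uu t : 0 <= t <= 1 -> U (ray i (t * (n%:R + phi u))).
  by move=> ht; rewrite -hty_ray //; exact: hU.
have U1 : U (ray i (n%:R + phi u)) by rewrite -[_ + _]mul1r; apply: Uu; rewrite ler01 lexx.
have [e e0 he] := ray_open oU p0 U1.
exists e => // u' hu' du t ht; rewrite E // hty_ray ?pos //; have p0' := pos _ hu'.
set s := n%:R + phi u in p0 Uu U1 he *; set s' := n%:R + phi u' in p0' *.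
have ds : `|s' - s| < e by rewrite /s /s' opprD addrACA subrr add0r h2.
have ts0 : 0 <= t * s' by apply: mulr_ge0 => //; lra.
have ts1 : t * s' <= s' by rewrite -[leRHS]mul1r; apply: ler_wpM2r => //; lra.
(* A point of the track of s' either lies between s and s', within e of s, or lies on the track of s
   itself. *)
have [le|lt] := leP (t * s') s; last first.
  by apply: he => //; move: ds; rewrite !ltr_norml; lra.
move: p0; rewrite le_eqVlt => /predU1P[s0|sp].
  by have -> : t * s' = 0 * s; [lra|apply: Uu; rewrite lexx ler01].
have -> : t * s' = (t * s' / s) * s by rewrite divfK // gt_eqF.
by apply: Uu; apply/andP; split; [apply: divr_ge0 => //; exact: ltW|rewrite ler_pdivrMr // mul1r].
Qed.

Lemma hty_continuous : {within [set z | `[0%R, 1%R]%classic z.1], continuous hty}.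
Proof.
apply/subspace_continuousP => -[t0 z0] /=; rewrite in_itv /= => ht0 W; rewrite nbhsE => -[U [oU Uz] UW].
change (nbhs (t0, z0) (fun z : R * RG => `[0%R, 1%R]%classic z.1 -> W (hty z))).
apply: (filterS (P := fun z => `[0%R, 1%R]%classic z.1 -> U (hty z))) => [z hz h1|]; first by apply: UW; exact: hz.
have oU' : realization_open U by exact: oU.
case: (RG_cases z0) => [[y Ez]|[i [s0 [sp Ez]]]]; rewrite {}Ez in Uz *.
  exists (setT, [set z | forall t, 0 <= t <= 1 -> U (hty (t, z))]) => /=; last first.
    by move=> [t z] /= [_ hz]; rewrite in_itv /=; exact: hz.
  split; first exact: filterT.
  rewrite nbhsE /=; exists [set z | forall t, 0 <= t <= 1 -> U (hty (t, z))] => //; split; first exact: core_open.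
  by move=> t ht; rewrite hty_inc -(hty_inc t0).
have {}Uz : U (ray i (t0 * s0)) by rewrite -hty_ray ?ltW.
have t0p : 0 <= t0 * s0 by apply: mulr_ge0; [lra|exact: ltW].
have [e e0 he] := ray_open oU' t0p Uz.
(* The bound d <= s0 keeps the neighbourhood away from the base, and d (1 + s0) < e controls t s -
   t0 s0 = t (s - s0) - s0 (t0 - t). *)
pose d := Num.min s0 (e / (2 * (1 + s0))).
have s1 : 0 < 1 + s0 by lra.
have d0 : 0 < d by rewrite lt_min sp /=; apply: divr_gt0 => //; lra.
have de : d * (1 + s0) < e.
  apply: (@le_lt_trans _ _ (e / 2)); last by lra.
  have -> : e / 2 = e / (2 * (1 + s0)) * (1 + s0) by field; rewrite gt_eqF.
  by apply: ler_wpM2r; [exact: ltW|rewrite ge_min lexx orbT].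
exists ([set t | `|t0 - t| < d], [set z | exists2 s, `|s - s0| < d & z = ray i s]) => /=.
  split; first by apply/nbhs_ballP; exists d.
  rewrite nbhsE /=; exists [set z | exists2 s, `|s - s0| < d & z = ray i s] => //; split.
    by apply: ray_nbhd; rewrite ge_min lexx.
  by exists s0 => //; rewrite subrr normr0.
move=> [t z] /= [dt [s ds ->]]; rewrite in_itv /= => ht.
have sp' : 0 <= s.
  have : d <= s0 by rewrite ge_min lexx.
  by move: ds; rewrite ltr_norml; lra.
rewrite hty_ray //; apply: he; first by apply: mulr_ge0 => //; lra.
have -> : t * s - t0 * s0 = t * (s - s0) - s0 * (t0 - t) by ring.
apply: le_lt_trans (ler_normB _ _) _; rewrite !normrM (ger0_norm (ltW sp)) (ger0_norm (_ : 0 <= t)); last by lra.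
apply: le_lt_trans _ de; rewrite mulrDr mulr1 [d * s0]mulrC; apply: lerD.
  by rewrite -[leRHS]mul1r; apply: ler_pM => //; [lra|lra|exact: ltW].
by apply: ler_wpM2l; exact: ltW.
Qed.

Lemma rays_homotopy_equivalent : homotopy_equivalent R RN RG.
Proof.
exists inc, ret; split.
- by apply/continuousP => U oU; exact: inc_open.
- by apply/continuousP => U oU; exact: ret_open.
- exists snd; split=> [|y|//]; last by rewrite /= inc_ret.
  by apply: continuous_subspaceT => z; exact: cvg_snd.
- exists hty; split=> [|z|z]; first exact: hty_continuous.
    by rewrite /= retP.
  by case: (RG_cases z) => [[y ->]|[i [s [s0 ->]]]]; rewrite ?hty_inc ?hty_ray ?mul1r ?ltW.
Qed.
End Rays.

(** * The cusps as rays attached to the nucleus *)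

Section Homotopy.
Variables (R : realType) (k : finFieldType) (X : curve k) (Y : geometric_fibre X) (x : place X).
Local Notation G := (hecke_graph x).
Local Notation N := (nucleus x).
Local Notation d := ((pdeg x)%:Z).
Local Notation m := (mX X).
Local Notation pt := (Defs.point x).

(** The ray of a class starts at c_D for the representative with m < deg D <= m + d and continues
    through the c_{D + n x}. That rays do not meet outside the nucleus rests on [cvert_inj]. *)
Lemma nucleus_homotopy : homotopy_equivalent R (realization R N) (realization R G).
Proof.
have d0 := pdegx_gt0 x; have mg := mX_ge X.
pose I := {C : set (place X -> int) | ClO x C}.
have /choice[D hD] : forall i : I, exists D, [/\ divisor X D, sval i = xclass x D & m < div_deg D <= m + d].
  by move=> i; exact: (window (svalP i)).
have dDn i (n : int) : divisor X (D i + pt *~ n).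
  by apply: divisorD; [case: (hD i)|exact: divisor_ptn].
have degD i (n : int) : div_deg (D i + pt *~ n) = div_deg (D i) + d * n.
  by apply: deg_ptn; case: (hD i).
have hdeg i : m < div_deg (D i) <= m + d by case: (hD i).
pose p i (n : nat) := cvert (D i + pt *~ n%:Z).
have step i (n : nat) : D i + pt *~ n.+1 = D i + pt *~ n + pt by rewrite intS mulrzDr mulr1z addrCA [RHS]addrC.
have degS i (n : nat) : m + d < div_deg (D i + pt *~ n.+1) by rewrite degD; have := hdeg i; nia.
apply: (@rays_homotopy_equivalent R _ G _ I p).
- by move=> i n; exact: vert_c.
- move=> i; have [h1 h2] := andP (hdeg i); have h : vert N (p i 0%N); last by case: h.
  by apply/nuc_c => //; rewrite degD mulr0 addr0; lia.
- move=> i n Vp; have nv : vert N (p i n.+1) by split=> //; exact: vert_c.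
  have gS := degS i n; have [|h _] := @nuc_c _ _ x (D i + pt *~ n.+1) (dDn i n.+1) _; first by lia.
  by have := h nv; lia.
- move=> v gv nV; have [|E [dE hE ->]] := not_nuc Y gv (v := v); first by case.
  have hC : ClO x (xclass x E) by exists E.
  pose i : I := exist _ _ hC; have [dDi Ei _] := hD i.
  have : xclass x (D i) E by rewrite -Ei; exact: xclass_refl.
  move=> [f [j [f0 EE]]]; have df := divisor_principal f0.
  have degE : div_deg E = div_deg (D i) + d * j.
    by rewrite EE deg_ptn ?div_degD ?div_deg_principal ?addr0 //; exact: divisorD.
  have [h1 h2] := andP (hdeg i); have j0 : 0 < j by nia.
  exists i, (absz j).-1; rewrite /p prednK ?absz_gt0 ?gt_eqF // gtz0_abs //.
  by rewrite EE addrAC cvert_equiv.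
- move=> i j n n' E; have gi := degS i n; have gj := degS j n'.
  have [||f f0 Ef] := cvert_inj (dDn i n.+1) (dDn j n'.+1) _ _ E; try by lia.
  have df := divisor_principal f0.
  have ij : i = j.
    have Ec : sval i = sval j.
      have [_ -> _] := hD i; have [_ -> _] := hD j.
      have xs l (q : int) : xclass x (D l + pt *~ q) = xclass x (D l).
        by apply: xclass_eq; exists 1, q; rewrite oner_neq0 principal1 addr0.
      rewrite -(xs i n.+1) -(xs j n'.+1) Ef; apply/esym/xclass_eq; exists f, 0.
      by rewrite mulr0z addr0.
    by case: i j Ec {E gi gj Ef} => [C hC] [C' hC'] /= EC; subst C'; congr exist; exact: Prop_irrelevance.
  subst j; split=> //; have := congr1 (@div_deg _ X) Ef.
  by rewrite degD div_degD // div_deg_principal // addr0 degD; nia.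
- by move=> i n; rewrite /p step; exact: cvert_adj.
- move=> i n w /(adj_cvert Y (dDn i n.+1) (degS i n)) [->|->]; [right|left].
    by rewrite /p [in RHS]step.
  by rewrite /p step addrK.
Qed.
End Homotopy.

Theorem theorem8p8 (R : realType) (k : finFieldType) (X : curve k)
    (hX : geometrically_irreducible X) (x : place X) :
  (* (1) *)
  [/\ cusps x #= `I_(class_number X * pdeg x)%N,
      vert (hecke_graph x) =
        vert (nucleus x) `|` \bigcup_(C in ClO x) vert (cusp x C) /\
      edge (hecke_graph x) =
        edge (nucleus x) `|` \bigcup_(C in ClO x) edge (cusp x C),
      forall D : place X -> int, divisor X D ->
        mX X < div_deg D <= mX X + (pdeg x)%:Z ->
        vert (nucleus x) `&` vert (cusp x (xclass x D)) = [set cvert D],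
      forall C, ClO x C ->
        edge (nucleus x) `&` edge (cusp x C) `<=` [set e | e.1.1 = e.1.2] &
      trivIset (ClO x) (fun C => vert (cusp x C)) /\
      trivIset (ClO x) (fun C => edge (cusp x C))]
  /\
  (* (2) *)
  [/\ finite_set (vert (nucleus x)) /\ finite_set (edge (nucleus x)),
      components (nucleus x) #= ClO_mod2 x,
      forall v, vert (nucleus x) v ->
        exists C w n, [/\ ClO x C, vert (cusp x C) w,
          walk (hecke_graph x) n v w &
          (n%:R : rat) <= (2 * (genus X)%:R + (mX X)%:~R + (pdeg x)%:R) / (pdeg x)%:R] &
      homotopy_equivalent R (realization R (nucleus x))
                            (realization R (hecke_graph x))]
  /\
  (* (3) *)
  [/\ forall C, ClO x C -> vert (cusp x C) `<=` PBun2_dec X,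
      PBun2_dec X `<=` PBun2_where (fun M => 0 <= delta M),
      PBun2_gi X `<=` PBun2_where (fun M => delta M <= 2 * (genus X)%:Z - 2) &
      PBun2_tr X `<=` PBun2_where (fun M => delta M < 0 /\ (2 %| delta M)%Z)].
Proof.
case: hX => Y; have [D1 [dD1 deg1]] := exists_divisor1 Y.
split; [|split].
- split.
  + exact: card_cusps deg1.
  + split; [exact: vert_decomposition|exact: edge_decomposition].
  + exact: nuc_cusp.
  (* Both ends of a common edge are the only common vertex, so it is a loop; a loop there belongs to
     both full subgraphs. *)
  + move=> C hC [[v w] mm] [[_ [nv nw]] [e [cv cw]]] /=.
    have [D [dD EC hD]] := window hC; have [gv gw] := edge_vert e.
    have h z : vert (hecke_graph x) z -> vert (nucleus x) z -> vert (cusp x C) z -> z = cvert D.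
      move=> gz nz cz; have : (vert (nucleus x) `&` vert (cusp x (xclass x D))) z by rewrite -EC.
      by rewrite (nuc_cusp dD hD).
    exact: etrans (h v gv (conj gv nv) (conj gv cv)) (esym (h w gw (conj gw nw) (conj gw cw))).
  + split=> C C' hC hC' [z [h h']]; first exact: cusp_disjoint h h'.
    case: z h h' => [[v w] mm] [e [cv _]] [_ [cv' _]]; have [gv _] := edge_vert e.
    exact: (@cusp_disjoint _ _ x C C' v).
- split.
  + split; [exact: finite_nuc deg1|exact: finite_nuc_edge deg1].
  + exact: card_components deg1.
  + exact: nuc_distance deg1.
  + exact: nucleus_homotopy.
- split; [move=> C _; exact: cvert_dec|exact: dec_delta|exact: gi_delta|exact: tr_delta_even].
Qed.
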